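(* Let $G$ be a locally compact group and let $E$ be a large ideal of $B(G)$. Then the assignment $(A,\delta)\mapsto(A^E,\delta^E)$, with quotient maps $Q^E_A:A\to A^E$, is a decreasing coaction functor (denoted $\tau_E$).
   Context: **Conventions.** $G$ is a locally compact group; ideals of $C^*$-algebras are closed and two-sided; homomorphisms are $*$-homomorphisms; $\otimes$ is the minimal tensor product; $\mathcal K=\mathcal K(L^2(G))$. For $C^*$-algebras $A,C$ put $\widetilde M(A\otimes C)=\{m\in M(A\otimes C): m(1\otimes C)\cup(1\otimes C)m\subset A\otimes C\}$; a homomorphism $\phi:A\to B$ has a canonical extension $\overline{\phi\otimes\mathrm{id}}:\widetilde M(A\otimes C)\to\widetilde M(B\otimes C)$ with $\overline{\phi\otimes\mathrm{id}}(m)(1\otimes c)=(\phi\otimes\mathrm{id})(m(1\otimes c))$. Let $\delta_G:C^*(G)\to M(C^*(G)\otimes C^*(G))$ be the comultiplication, $\delta_G(s)=s\otimes s$ for $s\in G$. **Coactions.** A coaction $(A,\delta)$ of $G$ is a $C^*$-algebra $A$ with an injective nondegenerate homomorphism $\delta:A\to \widetilde M(A\otimes C^*(G))\subset M(A\otimes C^*(G))$ such that $(\delta\otimes\mathrm{id})\circ\delta=(\mathrm{id}\otimes\delta_G)\circ\delta$ and $\overline{\mathrm{span}}\,\delta(A)(1\otimes C^*(G))=A\otimes C^*(G)$. The category $\mathbf{Coact}$ has coactions of $G$ as objects; a morphism $\phi:(A,\delta)\to(B,\epsilon)$ is a homomorphism $\phi:A\to B$ (not into multipliers) with $\epsilon\circ\phi=\overline{\phi\otimes\mathrm{id}}\circ\delta$.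 **Crossed products.** Let $w_G\in M(C_0(G)\otimes C^*(G))$ be the unitary function $w_G(s)=s$. $(A\rtimes_\delta G,j_A,j_G)$ is the crossed product, universal for pairs of nondegenerate homomorphisms $\pi:A\to M(C)$, $\mu:C_0(G)\to M(C)$ satisfying $(\pi\otimes\mathrm{id})\circ\delta(a)=\mathrm{Ad}\,(\mu\otimes\mathrm{id})(w_G)(\pi(a)\otimes1)$; it carries the dual action $\widehat\delta$ of $G$ (fixing $j_A(A)$ and acting by right translation on $j_G(C_0(G))$). It is functorial on $\mathbf{Coact}$, $\phi\mapsto\phi\rtimes G$. With $\lambda,\rho$ the left and right regular representations and $M$ the multiplication representation of $C_0(G)$ on $L^2(G)$, there is a canonical surjection $\Phi=\big((\mathrm{id}\otimes\lambda)\circ\delta\times(1\otimes M)\big)\times(1\otimes\rho):A\rtimes_\delta G\rtimes_{\widehat\delta}G\to A\otimes\mathcal K$. The coaction is maximal if $\Phi$ is an isomorphism, and normal if $\Phi$ factors through an isomorphism $A\rtimes_\delta G\rtimes_{\widehat\delta,r}G\cong A\otimes\mathcal K$. **Maximalization and normalization.** Every coaction $(A,\delta)$ has a maximalization: a maximal coaction $(A^m,\delta^m)$ and a surjective morphism $q^m_A:(A^m,\delta^m)\to(A,\delta)$ with $q^m_A\rtimes G$ an isomorphism; and a normalization: a normal coaction $(A^n,\delta^n)$ and a surjective morphism $\Lambda_A:(A,\delta)\to(A^n,\delta^n)$ with $\Lambda_A\rtimes G$ an isomorphism. Both are unique up to isomorphism and, after choices, functors on $\mathbf{Coact}$ with $q^m$,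 $\Lambda$ natural. One has $\ker\Lambda_A=\ker j_A$. One identifies $A^{mn}=A^n$, so $\Lambda_{A^m}=\Lambda_A\circ q^m_A:A^m\to A^n$. **Coaction functors.** A coaction functor is a functor $\tau:(A,\delta)\mapsto(A^\tau,\delta^\tau)$ on $\mathbf{Coact}$ together with a natural transformation $q^\tau$ from maximalization to $\tau$ such that for every $(A,\delta)$ the map $q^\tau_A:A^m\to A^\tau$ is surjective and $\ker q^\tau_A\subset\ker\Lambda_{A^m}$. **Decreasing coaction functors.** Suppose that for each coaction $(A,\delta)$ there are a coaction $(A^\tau,\delta^\tau)$ and a $\delta-\delta^\tau$ equivariant surjection $Q^\tau_A:A\to A^\tau$ such that $\ker Q^\tau_A\subset\ker(Q^\tau_B\circ\phi)$ for each morphism $\phi:(A,\delta)\to(B,\epsilon)$ in $\mathbf{Coact}$; then there is a unique morphism $\phi^\tau$ with $\phi^\tau\circ Q^\tau_A=Q^\tau_B\circ\phi$, and $\tau$ is a functor. It is called decreasing if $\ker Q^\tau_A\subset\ker\Lambda_A$ for every $(A,\delta)$; as a coaction functor it has $q^\tau_A:=Q^\tau_A\circ q^m_A$. **Large ideals.** $B(G)=C^*(G)^*$ is the Fourier–Stieltjes algebra. For a coaction $(A,\delta)$, $f\in B(G)$, $a\in A$ put $f\cdot a=(\mathrm{id}\otimes f)(\delta(a))\in A$. A large ideal $E$ of $B(G)$ is an ideal that is nonzero, $G$-invariant (under left and right translation), and weak* closed (such an ideal contains the reduced Fourier–Stieltjes algebra $B_r(G)=C^*_r(G)^*$). Let ${}^\perp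 E\subset C^*(G)$ be its preannihilator and $q_E:C^*(G)\to C^*_E(G)=C^*(G)/{}^\perp E$ the quotient map. For a coaction $(A,\delta)$, $A_E:=\{a\in A:E\cdot a=\{0\}\}=\ker(\mathrm{id}\otimes q_E)\circ\delta$ is an ideal of $A$, $A^E:=A/A_E$, $Q^E_A:A\to A^E$ is the quotient map, and $\delta^E$ is the unique coaction on $A^E$ for which $Q^E_A$ is $\delta-\delta^E$ equivariant. *)

(* Defs.v *)
From HB Require Import structures.
From mathcomp Require Import all_boot all_order all_algebra.
From mathcomp Require Import complex.
From mathcomp Require Import all_classical all_reals all_analysis.
Set Implicit Arguments.
Unset Strict Implicit.
Unset Printing Implicit Defensive.
Import Order.TTheory GRing.Theory Num.Theory.
Import numFieldNormedType.Exports.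
Local Open Scope classical_set_scope.
Local Open Scope ring_scope.

(* Objects that are determined only up to isomorphism (minimal tensor         *)
(* products, C*(G), C_0(G), L^2(G), K(L^2(G)), crossed products, maximal-     *)
(* izations, normalizations) are records collecting a carrier together with   *)
(* its defining property: an element of the record is a choice of a model.    *)

(* [the x0 P] is a definite description: the x with P x.  On the arguments    *)
(* to which the definitions below are applied, that x exists and is unique,   *)
(* so the default x0 is irrelevant.                                           *)
Definition the (T : Type) (x0 : T) (P : T -> Prop) : T :=
  if pselect (exists x, P x) is left h then projT1 (cid h) else x0.

HB.mixin Record isLCGroup G of Group G & Topological G := {
  mulg_cts : continuous (fun x : G * G => (x.1 * x.2)%g);
  invg_cts : continuous (fun x : G => (x^-1)%g);
  lcg_hausdorff : hausdorff_space G;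
  lcg_locally_compact : locally_compact [set: G]
}.
#[short(type="lcGroupType")]
HB.structure Definition LCGroup := {G of isLCGroup G & Group G & Topological G}.

Reserved Notation "a ** b" (at level 40, left associativity).

Record cstarAlg (R : realType) := CstarAlg {
  ccar :> completeNormedModType R[i];
  cmul : ccar -> ccar -> ccar where "a ** b" := (cmul a b);
  star : ccar -> ccar;
  cmulA : forall a b c, a ** (b ** c) = (a ** b) ** c;
  cmulDl : forall (k : R[i]) a b c, (k *: a + b) ** c = k *: (a ** c) + b ** c;
  cmulDr : forall (k : R[i]) a b c, c ** (k *: a + b) = k *: (c ** a) + c ** b;
  cmul_norm : forall a b, `|a ** b| <= `|a| * `|b|;
  starK : forall a, star (star a) = a;
  starD : forall (k : R[i]) a b, star (k *: a + b) = k^* *: star a + star b;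
  starM : forall a b, star (a ** b) = star b ** star a;
  cstar_id : forall a, `|star a ** a| = `|a| ^+ 2
}.
Arguments cmul {R c} : rename.
Arguments star {R c} : rename.
Notation "a ** b" := (cmul a b).

Section Multipliers.
Context {R : realType}.
Implicit Types A B C : cstarAlg R.

Definition cspan (V : normedModType R[i]) (S : set V) : set V :=
  closure [set x | exists (n : nat) (k : 'I_n -> R[i]) (v : 'I_n -> V),
    (forall i, S (v i)) /\ x = \sum_(i < n) k i *: v i].

Definition islin (U V : lmodType R[i]) (f : U -> V) :=
  forall k a b, f (k *: a + b) = k *: f a + f b.

Definition ishom A B (h : A -> B) :=
  [/\ islin h, (forall a b, h (a ** b) = h a ** h b)
    & (forall a, h (star a) = star (h a))].

(* M(A), realised as the adjointable operators of the Hilbert A-module A.     *)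
(* Linearity, A-linearity and boundedness are automatic.                      *)
Record mult A := Mult {
  mact :> A -> A;
  madj : A -> A;
  multP : forall a b, star (mact a) ** b = star a ** madj b
}.

Lemma multP' A (m : mult A) a b : star (madj m a) ** b = star a ** m b.
Proof. by rewrite -[RHS]starK starM starK multP starM !starK. Qed.

Definition mone A : mult A := @Mult A id id (fun _ _ => erefl).
Definition mstar A (m : mult A) : mult A := Mult (multP' m).
Lemma mmul_subproof A (m n : mult A) a b :
  star (m (n a)) ** b = star a ** madj n (madj m b).
Proof. by rewrite !multP. Qed.
Definition mmul A (m n : mult A) : mult A := Mult (mmul_subproof m n).
Lemma emb_subproof A (x a b : A) : star (x ** a) ** b = star a ** (star x ** b).
Proof. by rewrite starM cmulA. Qed.
Definition emb A (x : A) : mult A := Mult (emb_subproof x).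

Definition ismhom A B (h : A -> mult B) :=
  [/\ (forall b, islin (fun a => h a b)),
      (forall a b, h (a ** b) = mmul (h a) (h b))
    & (forall a, h (star a) = mstar (h a))].

Definition nondeg A B (h : A -> mult B) :=
  ismhom h /\ cspan [set y | exists a b, y = h a b] = setT.

(* the extension M(A) -> M(B) of a nondegenerate homomorphism                 *)
Definition mext A B (h : A -> mult B) (m : mult A) : mult B :=
  the (mone B) (fun n => forall a b, n (h a b) = h (m a) b).

(* strictly continuous unitary homomorphisms G -> UM(B)                       *)
Definition unitary_rep (G : lcGroupType) B (u : G -> mult B) :=
  [/\ u 1%g = mone B, (forall s t, u (s * t)%g = mmul (u s) (u t)),
      (forall s, u (s^-1)%g = mstar (u s))
    & (forall b, continuous (fun s => u s b))].

Definition bounded_functional A (f : A -> R[i]^o) := islin f /\ continuous f.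

(* The strict extension to M(A) of a bounded functional f; by Cohen           *)
(* factorization, f has the form x |-> g (x ** c).                            *)
Definition fext A (f : A -> R[i]^o) (m : mult A) : R[i] :=
  the 0 (fun z => exists g c, [/\ bounded_functional g,
    (forall x, f x = g (x ** c)) & z = g (m c)]).

Definition posfun A (f : A -> R[i]^o) :=
  islin f /\ forall a, 0 <= f (star a ** a).

(* The norm is the spatial one.  For x, y in the algebraic tensor product     *)
(* (sequences of elementary tensors) and positive functionals f, g, the sums  *)
(* below are |pi(x) xi|^2 and |xi|^2, where pi is the tensor product of the   *)
(* GNS representations of f and g, and xi is the class of y.                  *)
Definition is_min_tensor (A C T : cstarAlg R) (t : A -> C -> T) :=
  [/\ (forall c, islin (fun a => t a c)) /\ (forall a, islin (t a)),
      (forall a a' c c', t a c ** t a' c' = t (a ** a') (c ** c')),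
      (forall a c, star (t a c) = t (star a) (star c)),
      cspan [set x | exists a c, x = t a c] = setT
    & (forall (x : seq (A * C)) (r : R[i]), 0 <= r ->
       (`|\sum_(p <- x) t p.1 p.2| <= r <->
        forall f g, posfun f -> posfun g -> forall y : seq (A * C),
          \sum_(q <- y) \sum_(p <- x) \sum_(p' <- x) \sum_(q' <- y)
            (f (star (p.1 ** q.1) ** (p'.1 ** q'.1)) *
             g (star (p.2 ** q.2) ** (p'.2 ** q'.2)) : R[i])
          <= r ^+ 2 * \sum_(q <- y) \sum_(q' <- y)
            (f (star q.1 ** q'.1) * g (star q.2 ** q'.2) : R[i])))].

Record tensorProducts := TensorProducts {
  tp : cstarAlg R -> cstarAlg R -> cstarAlg R;
  tens : forall A C, A -> C -> tp A C;
  tensP : forall A C, is_min_tensor (@tens A C)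
}.

End Multipliers.
Arguments tensorProducts : clear implicits.
Arguments tens {R t A C}.

Section GroupModels.
Context (R : realType) (G : lcGroupType).

(* C*(G)                                                                      *)
Record groupAlg := GroupAlg {
  gcar :> cstarAlg R;
  gin : G -> mult gcar;
  gin_rep : unitary_rep gin;
  gin_univ : forall (B : cstarAlg R) (u : G -> mult B), unitary_rep u ->
    exists! h : gcar -> mult B, nondeg h /\ forall s, mext h (gin s) = u s
}.

Definition Cc (f : G -> R[i]^o) :=
  continuous f /\ exists2 K : set G, compact K & forall s, ~ K s -> f s = 0.

Definition C0 (f : G -> R[i]^o) :=
  continuous f /\ forall e : R[i], 0 < e ->
    exists2 K : set G, compact K & forall s, ~ K s -> `|f s| < e.

(* C_0(G), with the evaluations                                               *)
Record c0Alg := C0Alg {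
  zcar :> cstarAlg R;
  zev : zcar -> G -> R[i]^o;
  zev_inj : injective zev;
  zev_range : range zev = C0;
  zev_lin : forall s, islin (fun d => zev d s);
  zevM : forall d e s, zev (d ** e) s = zev d s * zev e s :> R[i];
  zev_star : forall d s, zev (star d) s = (zev d s : R[i])^*
}.

Record hilbert := Hilbert {
  hcar :> completeNormedModType R[i];
  hdot : hcar -> hcar -> R[i];
  hdot_lin : forall y : hcar, islin (fun x => hdot x y : R[i]^o);
  hdotC : forall x y, hdot y x = (hdot x y)^*;
  hdot_norm : forall x, `|x| ^+ 2 = hdot x x
}.

(* a left Haar integral, as a functional on C_c(G), and its modular function  *)
Definition is_haar (I : (G -> R[i]^o) -> R[i]^o) (Delta : G -> R) :=
  [/\ (forall (k : R[i]) f g, Cc f -> Cc g ->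
        I (fun s => k *: f s + g s) = k *: I f + I g),
      (forall f, Cc f -> (forall s, 0 <= f s) -> 0 <= I f),
      (exists2 f, Cc f & I f <> 0),
      (forall f s, Cc f -> I (fun t => f (s * t)%g) = I f)
    & (forall s, 0 < Delta s /\
        forall f, Cc f -> I (fun t => f (t * s)%g) = (Delta s)^-1%:C%C * I f)].

(* L^2(G) as the completion of C_c(G)                                         *)
Record l2Space := L2Space {
  haar : (G -> R[i]^o) -> R[i]^o;
  modular : G -> R;
  haarP : is_haar haar modular;
  l2car :> hilbert;
  l2in : (G -> R[i]^o) -> l2car;
  l2in_lin : forall (k : R[i]) f g, Cc f -> Cc g ->
    l2in (fun s => k *: f s + g s) = k *: l2in f + l2in g;
  l2in_dot : forall f g, Cc f -> Cc g ->
    hdot (l2in f) (l2in g) = haar (fun s => f s * (g s : R[i])^*);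
  l2in_dense : closure (l2in @` Cc) = setT
}.

(* K(H), with its action on H                                                 *)
Record compactAlg (H : hilbert) := CompactAlg {
  kcar :> cstarAlg R;
  kact : kcar -> H -> H;
  kact_linl : forall x, islin (fun k => kact k x);
  kact_linr : forall k, islin (kact k);
  kactM : forall k l x, kact (k ** l) x = kact k (kact l x);
  kact_star : forall k x y, hdot (kact k x) y = hdot x (kact (star k) y);
  kact_inj : injective kact;
  kact_rank1 : forall x y, exists k, forall z, kact k z = hdot z y *: x;
  kact_dense :
    cspan [set k | exists x y, forall z, kact k z = hdot z y *: x] = setT
}.

Record groupData := GroupData {
  gdT :> tensorProducts R;
  gdA : groupAlg;
  gdZ : c0Alg;
  gdL : l2Space;
  gdK : compactAlg gdL
}.

End GroupModels.
Arguments gin {R G g}.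
Arguments zev {R G c}.
Arguments l2in {R G l}.
Arguments kact {R H c}.

Section Coactions.
Context {R : realType} {G : lcGroupType} {D : groupData R G}.
Implicit Types A B C : cstarAlg R.
Local Notation CG := (gdA D).
Local Notation CZ := (gdZ D).
Local Notation L2 := (gdL D).
Local Notation K := (gdK D).
Local Notation "A \ox C" := (tp D A C) (at level 40, left associativity).

Definition tensm A C (m : mult A) (n : mult C) : mult (A \ox C) :=
  the (mone _) (fun x => forall a c, x (tens a c) = tens (m a) (n c)).

(* for f : A -> M(A') and g : C -> M(C'), the map A \ox C -> M(A' \ox C')     *)
Definition tensmh A C A' C' (f : A -> mult A') (g : C -> mult C') :
    A \ox C -> mult (A' \ox C') :=
  the (fun=> mone _)
    (fun h => ismhom h /\ forall a c, h (tens a c) = tensm (f a) (g c)).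

Definition tensid A B C (f : A -> B) : A \ox C -> B \ox C :=
  the (fun=> 0)
    (fun h => ishom h /\ forall a c, h (tens a c) = tens (f a) c).
Arguments tensid {A B} C f.

Definition tassoc A B C : (A \ox B) \ox C -> A \ox (B \ox C) :=
  the (fun=> 0) (fun h => ishom h /\
    forall a b c, h (tens (tens a b) c) = tens a (tens b c)).

(* the slice maps f \ox id and id \ox f                                       *)
Definition slicel A C (f : A -> R[i]^o) : A \ox C -> C :=
  the (fun=> 0) (fun h => [/\ islin h, continuous h
    & forall a c, h (tens a c) = f a *: c]).
Definition slicer A C (f : C -> R[i]^o) : A \ox C -> A :=
  the (fun=> 0) (fun h => [/\ islin h, continuous h
    & forall a c, h (tens a c) = f c *: a]).

Definition tildeM A C (m : mult (A \ox C)) :=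
  forall c, (exists t, mmul m (tensm (mone A) (emb c)) = emb t) /\
            (exists t, mmul (tensm (mone A) (emb c)) m = emb t).

(* the extension of f \ox id to the tilde multiplier algebras                 *)
Definition tbar A B C (f : A -> B) (m : mult (A \ox C)) : mult (B \ox C) :=
  the (mone _) (fun n => tildeM n /\
    forall c t, mmul m (tensm (mone A) (emb c)) = emb t ->
                mmul n (tensm (mone B) (emb c)) = emb (tensid C f t)).

(* (id \ox f)(m) for m in tildeM; see [fext]                                  *)
Definition tslicer A C (f : C -> R[i]^o) (m : mult (A \ox C)) : A :=
  the 0 (fun a => exists g c t, [/\ bounded_functional g,
    (forall x, f x = g (x ** c)),
    mmul m (tensm (mone A) (emb c)) = emb t & a = slicer g t]).

(* the integrated form of a strictly continuous unitary homomorphism          *)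
Definition integrated B (u : G -> mult B) : CG -> mult B :=
  the (fun=> mone _) (fun h => nondeg h /\ forall s, mext h (gin s) = u s).

Definition deltaG : CG -> mult (CG \ox CG) :=
  integrated (fun s => tensm (gin s) (gin s)).

(* w_G in M(C_0(G) \ox C*(G)), the function s |-> s                           *)
Definition wG : mult (CZ \ox CG) :=
  the (mone _) (fun w => forall s x,
    slicel (fun d => zev d s) (w x) = gin s (slicel (fun d => zev d s) x)).

(* --- coactions --- *)

Record coaction := Coaction {
  coalg :> cstarAlg R;
  codelta : coalg -> mult (coalg \ox CG);
  codelta_inj : injective codelta;
  codelta_nondeg : nondeg codelta;
  codelta_tilde : forall a, tildeM (codelta a);
  codelta_id : forall a,
    mext (fun x => emb (@tassoc _ _ _ x))
         (mext (tensmh codelta (@emb _ CG)) (codelta a))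
    = mext (tensmh (@emb _ coalg) deltaG) (codelta a);
  codelta_span :
    cspan [set t | exists a c,
      emb t = mmul (codelta a) (tensm (mone coalg) (emb c))] = setT
}.
Implicit Types S T : coaction.

Record comor S T := Comor {
  cofun :> S -> T;
  cofun_hom : ishom cofun;
  cofun_equiv : forall a, codelta (cofun a) = tbar cofun (codelta a)
}.

(* --- representations on L^2(G), with values in M(K) --- *)

Definition l2op (u : (G -> R[i]^o) -> (G -> R[i]^o)) : L2 -> L2 :=
  the (fun=> 0) (fun v => [/\ islin v, continuous v
    & forall f, Cc f -> v (l2in f) = l2in (u f)]).

Definition opmult (v : L2 -> L2) : mult K :=
  the (mone _) (fun m => forall (k : K) x, kact (m k) x = v (kact k x)).

Definition lamG (s : G) : mult K := opmult (l2op (fun f t => f (s^-1 * t)%g)).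
Definition rhoG (s : G) : mult K :=
  opmult (l2op (fun f t => (Num.sqrt (modular L2 s))%:C%C *: f (t * s)%g)).
Definition lam : CG -> mult K := integrated lamG.
Definition Mrep (d : CZ) : mult K := opmult (l2op (fun f t => zev d t * f t)).

(* --- crossed products --- *)

Definition covariant S B (p : S -> mult B) (q : CZ -> mult B) :=
  [/\ nondeg p, nondeg q
    & forall a, let W := mext (tensmh q (@emb _ CG)) wG in
      mext (tensmh p (@emb _ CG)) (codelta a)
      = mmul (mmul W (tensm (p a) (mone CG))) (mstar W)].

Record cocrossed S := Cocrossed {
  xcar :> cstarAlg R;
  jA : S -> mult xcar;
  jG : CZ -> mult xcar;
  jcov : covariant jA jG;
  juniv : forall B (p : S -> mult B) (q : CZ -> mult B), covariant p q ->
    exists! h : xcar -> mult B, [/\ nondeg h,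
      (forall a, mext h (jA a) = p a) & (forall d, mext h (jG d) = q d)]
}.

(* the integrated form p x q of a covariant pair                              *)
Definition cointegrated S (X : cocrossed S) B (p : S -> mult B)
    (q : CZ -> mult B) : X -> mult B :=
  the (fun=> mone _) (fun h => [/\ nondeg h,
      (forall a, mext h (jA X a) = p a) & (forall d, mext h (jG X d) = q d)]).

Definition rtrans (s : G) (d e : CZ) := forall t, zev e t = zev d (t * s)%g.

Definition dual_action S (X : cocrossed S) (s : G) : X -> X :=
  the id (fun h => [/\ ishom h, bijective h,
      (forall a, mext (fun x => emb (h x)) (jA X a) = jA X a)
    & (forall d e, rtrans s d e ->
        mext (fun x => emb (h x)) (jG X d) = jG X e)]).

Definition act_covariant A (al : G -> A -> A) B
    (p : A -> mult B) (u : G -> mult B) :=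
  [/\ nondeg p, unitary_rep u
    & forall s a, p (al s a) = mmul (mmul (u s) (p a)) (mstar (u s))].

(* the full crossed product by an action                                      *)
Record actcrossed A (al : G -> A -> A) := Actcrossed {
  ycar :> cstarAlg R;
  iA : A -> mult ycar;
  iG : G -> mult ycar;
  icov : act_covariant al iA iG;
  iuniv : forall B (p : A -> mult B) (u : G -> mult B), act_covariant al p u ->
    exists! h : ycar -> mult B, [/\ nondeg h,
      (forall a, mext h (iA a) = p a) & (forall s, mext h (iG s) = u s)]
}.

Definition actintegrated A (al : G -> A -> A) (Y : actcrossed al) B
    (p : A -> mult B) (u : G -> mult B) : Y -> mult B :=
  the (fun=> mone _) (fun h => [/\ nondeg h,
      (forall a, mext h (iA Y a) = p a) & (forall s, mext h (iG Y s) = u s)]).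

(* the function s |-> al_{s^-1}(a) in M(A \ox C_0(G))                         *)
Definition actfun A (al : G -> A -> A) (a : A) : mult (A \ox CZ) :=
  the (mone _) (fun m => forall s x,
    slicer (fun d => zev d s) (m x)
    = al (s^-1)%g a ** slicer (fun d => zev d s) x).

Arguments actintegrated {A al} Y {B} p u.
Arguments cointegrated {S} X {B} p q.

(* The regular representation, into M(A \ox K(L^2(G))); its range is the      *)
(* reduced crossed product.                                                   *)
Definition regular A (al : G -> A -> A) (Y : actcrossed al) :
    Y -> mult (A \ox K) :=
  actintegrated Y (fun a => mext (tensmh (@emb _ A) Mrep) (actfun al a))
                  (fun s => tensm (mone A) (lamG s)).

End Coactions.
Arguments coaction {R G} D.
Arguments tensmh {R G D A C} {A' C'} f g.
Arguments jA {R G D S}.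
Arguments jG {R G D S}.
Arguments cointegrated {R G D S} X {B} p q.
Arguments actintegrated {R G A al} Y {B} p u.

Section Functors.
Context {R : realType} {G : lcGroupType} {D : groupData R G}.
Local Notation CG := (gdA D).
Local Notation CZ := (gdZ D).
Local Notation K := (gdK D).

(* a choice of A x_delta G and A x_delta G x_deltahat G for all coactions     *)
Record crossedProducts := CrossedProducts {
  cox :> forall S : coaction D, cocrossed S;
  coxx : forall S : coaction D, actcrossed (dual_action (X := cox S))
}.
Context {X : crossedProducts}.
Implicit Types S T : coaction D.

Definition Phi S : coxx X S -> mult (tp D S K) :=
  actintegrated (coxx X S)
    (cointegrated (cox X S)
       (fun a => mext (tensmh (@emb _ S) lam) (codelta a))
       (fun d => tensm (mone S) (Mrep d)))
    (fun s => tensm (mone S) (rhoG s)).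

Definition maximal_coaction S :=
  exists2 F : coxx X S -> tp D S K,
    bijective F & forall x, Phi x = emb (F x).

(* Phi factors through an isomorphism of the reduced crossed product          *)
Definition normal_coaction S :=
  exists2 F : mult (tp D (X S) K) -> tp D S K,
    set_bij (range (regular (Y := coxx X S))) setT F
    & forall x : coxx X S, Phi x = emb (F (regular x)).

(* h is phi x G; note that jA(a) jG(d) lies in A x G                          *)
Definition is_crossed_mor S T (phi : comor S T) (h : X S -> X T) :=
  ishom h /\ forall a d x, emb x = mmul (jA (X S) a) (jG (X S) d) ->
    emb (h x) = mmul (jA (X T) (phi a)) (jG (X T) d).

Definition crossed_iso S T (phi : comor S T) :=
  exists2 h, is_crossed_mor phi h & bijective h.

Definition surj (U V : Type) (f : U -> V) := forall y, exists x, f x = y.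

Definition is_functor (F : coaction D -> coaction D)
    (Fm : forall S T, comor S T -> comor (F S) (F T)) :=
  (forall S (i : comor S S), i =1 id -> Fm _ _ i =1 id) /\
  (forall S T U (f : comor S T) (g : comor T U) (h : comor S U),
     h =1 g \o f -> Fm _ _ h =1 Fm _ _ g \o Fm _ _ f).

Record maximalization := Maximalization {
  mobj :> coaction D -> coaction D;
  mmor : forall S T, comor S T -> comor (mobj S) (mobj T);
  mmorP : is_functor mmor;
  qm : forall S, comor (mobj S) S;
  qm_nat : forall S T (f : comor S T), qm T \o mmor f =1 f \o qm S;
  qm_max : forall S, maximal_coaction (mobj S);
  qm_surj : forall S, surj (qm S);
  qm_iso : forall S, crossed_iso (qm S)
}.

Record normalization := Normalization {
  nobj :> coaction D -> coaction D;
  nmor : forall S T, comor S T -> comor (nobj S) (nobj T);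
  nmorP : is_functor nmor;
  Lam : forall S, comor S (nobj S);
  Lam_nat : forall S T (f : comor S T), Lam T \o f =1 nmor f \o Lam S;
  Lam_normal : forall S, normal_coaction (nobj S);
  Lam_surj : forall S, surj (Lam S);
  Lam_iso : forall S, crossed_iso (Lam S)
}.

Context (Mx : maximalization) (Nm : normalization).

Definition ker (A : Type) (B : zmodType) (f : A -> B) : set A :=
  [set x | f x = 0].

Definition is_coaction_functor (F : coaction D -> coaction D)
    (Fm : forall S T, comor S T -> comor (F S) (F T))
    (q : forall S, comor (Mx S) (F S)) :=
  [/\ is_functor Fm,
      (forall S T (f : comor S T), q T \o mmor Mx f =1 Fm _ _ f \o q S),
      (forall S, surj (q S))
    & (forall S, ker (q S) `<=` ker (Lam Nm (Mx S)))].

Definition is_decreasing_coaction_functor (F : coaction D -> coaction D)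
    (Q : forall S, comor S (F S)) :=
  [/\ (forall S, surj (Q S)),
      (forall S T (f : comor S T), ker (Q S) `<=` ker (Q T \o f)),
      (forall S, ker (Q S) `<=` ker (Lam Nm S))
    & exists (Fm : forall S T, comor S T -> comor (F S) (F T))
             (q : forall S, comor (Mx S) (F S)),
        [/\ (forall S T (f : comor S T), Fm _ _ f \o Q S =1 Q T \o f),
            (forall S, q S =1 Q S \o qm Mx S)
          & is_coaction_functor Fm q]].

(* --- large ideals --- *)

(* B(G) = C*(G)^*; fext f (gin s) is the value at s of the function f         *)
Definition BG : set (CG -> R[i]^o) := @bounded_functional R CG.
Definition BGval (f : CG -> R[i]^o) (s : G) : R[i] := fext f (gin s).

Definition large_ideal (E : set (CG -> R[i]^o)) :=
  [/\ E `<=` BG,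
      E (fun=> 0) /\
      (forall (k : R[i]) f g, E f -> E g -> E (fun x => k *: f x + g x)),
      (forall e f h, E e -> BG f -> BG h ->
        (forall s, BGval h s = BGval e s * BGval f s) -> E h),
      (exists2 e, E e & exists x, e x <> 0)
    & (forall e h t, E e -> BG h ->
        (forall s, BGval h s = BGval e (t * s)%g) \/
        (forall s, BGval h s = BGval e (s * t)%g) -> E h) /\
      (exists2 F : set {ptws CG -> R[i]^o}, closed F & E = BG `&` F)].

(* A_E                                                                        *)
Definition idealE (E : set (CG -> R[i]^o)) S : set S :=
  [set a | forall f, E f -> tslicer f (codelta a) = 0].

(* (A^E, delta^E) with the quotient map Q^E, for all coactions (A, delta):    *)
(* the quotient A/A_E is given by a surjection with kernel A_E.               *)
Definition is_quotientE (E : set (CG -> R[i]^o)) (F : coaction D -> coaction D)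
    (Q : forall S, comor S (F S)) :=
  forall S, surj (Q S) /\ ker (Q S) = idealE E (S := S).

End Functors.
Arguments crossedProducts {R G} D.
Arguments maximalization {R G D} X.
Arguments normalization {R G D} X.
Arguments is_decreasing_coaction_functor {R G D X} Mx Nm F Q.
Arguments large_ideal {R G D} E.
Arguments is_quotientE {R G D} E F Q.

(* Main.v *)
Require Import Defs.
From HB Require Import structures.
From mathcomp Require Import all_boot all_order all_algebra.
From mathcomp Require Import complex ring lra.
From mathcomp Require Import all_classical all_reals all_analysis.
Set Implicit Arguments.
Unset Strict Implicit.
Unset Printing Implicit Defensive.
Import Order.TTheory GRing.Theory Num.Theory.
Import numFieldNormedType.Exports.
Local Open Scope classical_set_scope.
Local Open Scope ring_scope.

(* Let a lie in A_E. By the covariance identity (j_A x id)(delta(a)) = W (j_A(a) x 1) W^*,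
   slicing by e(c1 . c2) with e in E gives j_A(a) = 0. This uses that E contains the functionals
   e(c1 . c2): a functional e with e(s c) = 0 for all s in G
   satisfies e(x c) = 0 for all x, so e(c1 . c2) can be interpolated on finite sets by combinations
   of translates of e, and E is translation invariant and weak* closed.

   For a normal coaction j_A is injective. Put W_lambda = (j_G x lambda)(w_G) and let U be the
   unitary f |-> Delta^(-1/2) f(. ^-1) of L^2(G). With V = (1 x U) W_lambda^*, the regular
   representation of the double crossed product is y |-> V ((j_A x id)(Phi(y))) V^*, as one checks
   on generators. If j_A(b) = 0 and Phi(y) = b x k, the regular representation kills y, and since
   Phi factors through it, b x k = 0.

   Slices commute with morphisms, so A_E is mapped into B_E, which gives the functor; and
   Lambda_A maps A_E into (A^n)_E, which is contained in ker j_(A^n) = 0. For the maximalization,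
   A x G is the closed span of j_A(A) j_G(C_0(G)), so that the isomorphisms q^m x G and Lambda x G
   transport the kernels of the maps j_A. *)

(** Two features of the setting shape the proof. Tensor products, C*(G) and crossed products are
    known only by their characterizing properties, and many maps between them are definite
    descriptions with a default value. Existence is therefore established before use: norm bounds
    come from the positive functionals in the definition of the tensor norm, with crude constants,
    since only kernels and closed spans matter in the end. Where existence cannot be established
    directly, the default itself is computed with: it would be 1 both for an element and for its
    double, which forces the algebra to be zero.

    A universal property says nothing directly about generation. Twice a closed subalgebra P of M(X)
    is formed, for X = C*(G) and for X a crossed product, and the universal property is applied to
    P. The resulting map from X to M(P), followed by the extended inclusion into M(X), is the
    embedding of X. This yields the vanishing criterion [dens] for C*(G) and the description
    [emb_range_crossed] of the crossed product as a closed span. *)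

(* A reflexive decision procedure for linear identities in abelian groups, to which [ring] does not apply. *)
Inductive zexpr := ZVar of nat | ZAdd of zexpr & zexpr | ZOpp of zexpr | ZZero.

Fixpoint zeval (V : zmodType) (env : seq V) (e : zexpr) : V :=
  match e with
  | ZVar n => nth 0 env n
  | ZAdd a b => zeval env a + zeval env b
  | ZOpp a => - zeval env a
  | ZZero => 0
  end.

Fixpoint zcoef (n : nat) (e : zexpr) : int :=
  match e with
  | ZVar m => if m == n then 1 else 0
  | ZAdd a b => zcoef n a + zcoef n b
  | ZOpp a => - zcoef n a
  | ZZero => 0
  end.

Fixpoint zvars (e : zexpr) : nat :=
  match e with
  | ZVar n => n.+1
  | ZAdd a b => maxn (zvars a) (zvars b)
  | ZOpp a => zvars a
  | ZZero => 0
  end.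

(** Any range that covers the variables will do, so the two sides of an identity can be summed over
    the same one. *)
Lemma zevalE (V : zmodType) (env : seq V) e n : (zvars e <= n)%N ->
  zeval env e = \sum_(i < n) nth 0 env i *~ zcoef i e.
Proof.
elim: e => [m|a IHa b IHb|a IHa|] /=.
- move=> mn; rewrite (bigD1 (Ordinal mn))//= eqxx mulr1z big1 ?addr0// => i im.
  by rewrite ifN ?mulr0z//; apply: contra im => /eqP h; apply/eqP/val_inj.
- rewrite geq_max => /andP[/IHa-> /IHb->]; rewrite -big_split/=.
  by apply: eq_bigr => i _; rewrite mulrzDr.
- by move=> /IHa->; rewrite -sumrN; apply: eq_bigr => i _; rewrite mulrNz.
- by move=> _; rewrite big1// => i _; rewrite mulr0z.
Qed.

Definition zcheck e1 e2 : bool :=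
  all (fun i => zcoef i e1 == zcoef i e2) (iota 0 (maxn (zvars e1) (zvars e2))).

Lemma zcheckP (V : zmodType) (env : seq V) e1 e2 :
  zcheck e1 e2 -> zeval env e1 = zeval env e2.
Proof.
move=> /allP h; rewrite (zevalE env (leq_maxl (zvars e1) (zvars e2))).
rewrite (zevalE env (leq_maxr (zvars e1) (zvars e2))).
by apply: eq_bigr => i _; rewrite (eqP (h i _))// mem_iota leq0n add0n ltn_ord.
Qed.

(* Atoms are compared modulo the structure instances inside the operations. *)
Ltac zm_same x y :=
  first [ constr_eq x y
        | lazymatch x with
          | ?a * ?b => lazymatch y with ?c * ?d => zm_same a c; zm_same b d end
          | ?a *: ?b => lazymatch y with ?c *: ?d => zm_same a c; zm_same b d end
          | ?a + ?b => lazymatch y with ?c + ?d => zm_same a c; zm_same b d end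
          | - ?a => lazymatch y with - ?c => zm_same a c end
          | ?a ^+ ?n => lazymatch y with ?c ^+ ?m => constr_eq n m; zm_same a c end
          | ?a *+ ?n => lazymatch y with ?c *+ ?m => constr_eq n m; zm_same a c end
          | ?a^-1 => lazymatch y with ?c^-1 => zm_same a c end
          | @real_complex_def _ _ ?a =>
              lazymatch y with @real_complex_def _ _ ?c => zm_same a c end
          | 1 => lazymatch y with 1 => idtac end
          | 0 => lazymatch y with 0 => idtac end
          | ?f ?a => lazymatch y with ?g ?c => constr_eq f g; zm_same a c end
          end ].
Ltac zm_index x l :=
  match l with
  | ?y :: _ => let _ := match goal with _ => zm_same x y end in constr:(0%N)
  | _ :: ?l' => let n := zm_index x l' in constr:(S n)
  end.
Ltac zm_in x l :=
  match l with
  | ?y :: _ => let _ := match goal with _ => zm_same x y end in constr:(true)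
  | _ :: ?l' => zm_in x l'
  | _ => constr:(false)
  end.
Ltac zm_atoms e l :=
  lazymatch e with
  | (?a + ?b) => let l1 := zm_atoms a l in zm_atoms b l1
  | (- ?a) => zm_atoms a l
  | 0 => l
  | _ => let t := zm_in e l in
         lazymatch t with true => l | false => constr:(e :: l) end
  end.
Ltac zm_reify e l :=
  lazymatch e with
  | (?a + ?b) => let x := zm_reify a l in let y := zm_reify b l in constr:(ZAdd x y)
  | (- ?a) => let x := zm_reify a l in constr:(ZOpp x)
  | 0 => constr:(ZZero)
  | _ => let n := zm_index e l in constr:(ZVar n)
  end.
Ltac zmod :=
  lazymatch goal with
  | |- @eq ?T ?a ?b =>
    let l0 := constr:(@nil T) in
    let l1 := zm_atoms a l0 in
    let l := zm_atoms b l1 in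
    let x := zm_reify a l in
    let y := zm_reify b l in
    exact: (@zcheckP _ l x y isT)
  end.
Ltac nring := rewrite ?(mulrDl, mulrDr, mulNr, mulrN, opprK, mulr1, mul1r, mulrA, mulr0, mul0r); zmod.

(** * Real norms and bounded linear maps *)

Section RealNorm.
Context {R : realType}.
Local Notation C := R[i].
Implicit Types V W : normedModType C.

(* The library norm takes its values in R[i]; [nm] is the same norm, read in R. *)
Definition nm V (x : V) : R := complex.Re `|x|.
Definition cabs (k : C) : R := complex.Re `|k|.

Lemma nmE V (x : V) : `|x| = (nm x)%:C%C.
Proof. by rewrite /nm RRe_real// normr_real. Qed.

Lemma cabsE (k : C) : `|k| = (cabs k)%:C%C.
Proof. by rewrite /cabs RRe_real// normr_real. Qed.

Lemma lecR' (x y : R) : (x%:C%C <= y%:C%C :> C) = (x <= y).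
Proof. by rewrite lecR. Qed.

Lemma ltcR' (x y : R) : (x%:C%C < y%:C%C :> C) = (x < y).
Proof. by rewrite ltcR. Qed.

Lemma nm_ge0 V (x : V) : 0 <= nm x.
Proof. by rewrite -lecR' -nmE; exact: normr_ge0. Qed.

Lemma cabs_ge0 (k : C) : 0 <= cabs k.
Proof. by rewrite -lecR' -cabsE; exact: normr_ge0. Qed.

Lemma nm0 V : nm (0 : V) = 0.
Proof. by rewrite /nm normr0. Qed.

Lemma nm_eq0 V (x : V) : nm x = 0 -> x = 0.
Proof. by move=> h; apply/normr0_eq0; rewrite nmE h. Qed.

Lemma nm_le0 V (x : V) : nm x <= 0 -> x = 0.
Proof. by move=> h; apply: nm_eq0; apply/eqP; rewrite eq_le h nm_ge0. Qed.

Lemma nmN V (x : V) : nm (- x) = nm x.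
Proof. by rewrite /nm normrN. Qed.

Lemma nmBC V (x y : V) : nm (x - y) = nm (y - x).
Proof. by rewrite -nmN opprB. Qed.

Lemma nmD V (x y : V) : nm (x + y) <= nm x + nm y.
Proof. by rewrite -lecR' rmorphD/= -!nmE ler_normD. Qed.

Lemma nmB V (x y : V) : nm (x - y) <= nm x + nm y.
Proof. by rewrite -(nmN y) nmD. Qed.

Lemma nm_tri V (z x y : V) : nm (x - y) <= nm (x - z) + nm (z - y).
Proof. by rewrite (le_trans _ (nmD _ _))// addrA subrK. Qed.

Lemma nmZ V (k : C) (x : V) : nm (k *: x) = cabs k * nm x.
Proof. by apply: (@complexI R); rewrite rmorphM/= -!nmE -cabsE normrZ. Qed.

Lemma cabsM (k l : C) : cabs (k * l) = cabs k * cabs l.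
Proof. by apply: (@complexI R); rewrite rmorphM/= -!cabsE normrM. Qed.

Lemma cabs_real (x : R) : cabs x%:C%C = `|x|.
Proof. by rewrite /cabs normc_def/= expr0n/= addr0 sqrtr_sqr. Qed.

Lemma cabs_i : cabs 'i%C = 1 :> R.
Proof. by rewrite /cabs normc_def/= expr0n expr1n/= add0r sqrtr1. Qed.

Lemma cabsC (k : C) : cabs k^*%C = cabs k.
Proof. by rewrite /cabs normcJ. Qed.

Lemma cabsV (k : C) : cabs k^-1 = (cabs k)^-1.
Proof. by apply: (@complexI R); rewrite fmorphV/= -!cabsE normfV. Qed.

Lemma cabsN (k : C) : cabs (- k) = cabs k.
Proof. by rewrite /cabs normrN. Qed.

Lemma cabs0 : cabs 0 = 0.
Proof. by rewrite /cabs normr0. Qed.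

Lemma cabsD (k l : C) : cabs (k + l) <= cabs k + cabs l.
Proof. exact: (@nmD C^o). Qed.

Lemma cabs_eq0 (k : C) : cabs k = 0 -> k = 0.
Proof. exact: (@nm_eq0 C^o). Qed.

Lemma Re_le_cabs (k : C) : `|complex.Re k| <= cabs k.
Proof. by have := normc_ge_Re k; rewrite cabsE lecR. Qed.

Lemma cabs_sqr (k : C) : (cabs k ^+ 2)%:C%C = k * k^*%C.
Proof. by rewrite -sqr_normc cabsE rmorphXn. Qed.

Lemma nm_sum V (I : Type) (r : seq I) (P : pred I) (F : I -> V) :
  nm (\sum_(i <- r | P i) F i) <= \sum_(i <- r | P i) nm (F i).
Proof.
elim/big_rec2: _ => [|i y x _ h]; first by rewrite nm0.
by rewrite (le_trans (nmD _ _))// lerD2l.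
Qed.

(** The usual way to prove an equality below: the error is at most a fixed multiple of every
    positive e. Nothing is assumed about the sign of K, whence [|K| + 1] in the denominator. *)
Lemma nm_eps V (x : V) (K : R) :
  (forall e, 0 < e -> nm x <= K * e) -> x = 0.
Proof.
move=> h; apply: nm_le0; apply/ler_addgt0Pr => e e0; rewrite add0r.
have K1 : 0 < `|K| + 1 by rewrite ltr_wpDl.
apply: le_trans (h (e / (`|K| + 1)) (divr_gt0 e0 K1)) _.
rewrite mulrA ler_pdivrMr// [leRHS]mulrC ler_pM2r//.
by rewrite (le_trans (ler_norm _))// lerDl.
Qed.

Lemma nbhs_nmP V (x : V) (P : set V) :
  nbhs x P <-> exists2 e : R, 0 < e & forall y, nm (x - y) < e -> P y.
Proof.
split=> [/nbhs_normP[e e0 h]|[e e0 h]].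
- exists (complex.Re e); first by move: e0; rewrite /= ltcE => /andP[].
  move=> y yx; apply: h => /=.
  by rewrite nmE -[e]RRe_real ?ltcR//= gtr0_real.
- apply/nbhs_normP; exists e%:C%C; first by rewrite /= ltcR.
  by move=> y /=; rewrite nmE ltcR => /h.
Qed.

Lemma closure_nmP V (S : set V) (x : V) :
  closure S x <-> forall e : R, 0 < e -> exists2 y, S y & nm (x - y) < e.
Proof.
split=> [h e e0|h B /nbhs_nmP[e e0 eB]].
- have /h[y [Sy xy]] : nbhs x [set y | nm (x - y) < e] by apply/nbhs_nmP; exists e.
  by exists y.
- by have [y Sy xy] := h e e0; exists y; split=> //; exact: eB.
Qed.

Lemma continuous_nmP V W (f : V -> W) :
  continuous f <-> forall x (e : R), 0 < e -> exists2 d : R, 0 < d &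
    forall y, nm (x - y) < d -> nm (f x - f y) < e.
Proof.
split=> [h x e e0|h x B /nbhs_nmP[e e0 eB]].
- have /nbhs_nmP[d d0 hd] : nbhs x (f @^-1` [set z | nm (f x - z) < e]).
    by apply: (h x); apply/nbhs_nmP; exists e.
  by exists d.
- have [d d0 hd] := h x e e0; apply/nbhs_nmP; exists d => // y /hd; exact: eB.
Qed.

Section Linear.
Context (V W : lmodType C) (f : V -> W) (fl : islin f).
Lemma islin0 : f 0 = 0.
Proof. by have := fl (-1) 0 0; rewrite scaler0 addr0 scaleN1r addNr. Qed.
Lemma islinD x y : f (x + y) = f x + f y.
Proof. by have := fl 1 x y; rewrite !scale1r. Qed.
Lemma islinZ k x : f (k *: x) = k *: f x.
Proof. by have := fl k x 0; rewrite addr0 islin0 addr0. Qed.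
Lemma islinN x : f (- x) = - f x.
Proof. by rewrite -scaleN1r islinZ scaleN1r. Qed.
Lemma islinB x y : f (x - y) = f x - f y.
Proof. by rewrite islinD islinN. Qed.
Lemma islin_sum (I : Type) (r : seq I) (P : pred I) (F : I -> V) :
  f (\sum_(i <- r | P i) F i) = \sum_(i <- r | P i) f (F i).
Proof. by elim/big_rec2: _ => [|i y x _ <-]; rewrite ?islin0 ?islinD. Qed.
End Linear.

Definition bdlin V W (f : V -> W) :=
  islin f /\ exists2 K : R, 0 <= K & forall x, nm (f x) <= K * nm x.

Lemma bdlinP V W (f : V -> W) : islin f -> (continuous f <-> bdlin f).
Proof.
move=> fl; split=> [/continuous_nmP h|[_ [K K0 hK]]]; last first.
  apply/continuous_nmP => x e e0; exists (e / (K + 1)).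
    by rewrite divr_gt0// ltr_wpDl.
  move=> y; rewrite ltr_pdivlMr ?ltr_wpDl// => xy.
  rewrite -islinB// (le_lt_trans (hK _))// (le_lt_trans _ xy)//.
  by rewrite mulrC ler_wpM2l ?nm_ge0// lerDl.
split=> //; have [d d0 hd] := h 0 1 ltr01.
exists (2 / d); first by rewrite divr_ge0// ltW.
move=> x; have [x0|x0] := eqVneq (nm x) 0.
  by rewrite (nm_eq0 x0) islin0// !nm0 mulr0.
have nx : 0 < nm x by rewrite lt_neqAle eq_sym x0 nm_ge0.
pose k := (d / 2 / nm x)%:C%C.
have k0 : 0 < d / 2 / nm x by rewrite !divr_gt0.
have : nm (0 - k *: x) < d.
  rewrite sub0r nmN nmZ cabs_real gtr0_norm// divfK//.
  by rewrite ltr_pdivrMr// ltr_pMr// ltr1n.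
move=> /hd; rewrite (islin0 fl) sub0r nmN islinZ// nmZ cabs_real gtr0_norm//.
move=> h1; apply/ltW; rewrite -(ltr_pM2l k0); apply: lt_le_trans h1 _.
rewrite [_ * (_ * _)]mulrACA.
have -> : d / 2 * (2 / d) * ((nm x)^-1 * nm x) = 1.
  by field; rewrite x0 (gt_eqF d0).
by [].
Qed.

Lemma bdlin_cont V W (f : V -> W) : bdlin f -> continuous f.
Proof. by move=> h; apply/bdlinP => //; case: h. Qed.

Lemma bdlin_comp (U V W : normedModType C) (f : U -> V) (g : V -> W) :
  bdlin f -> bdlin g -> bdlin (g \o f).
Proof.
move=> [fl [K K0 hK]] [gl [L L0 hL]]; split=> [k a b|]; first by rewrite /= fl gl.
exists (L * K); first exact: mulr_ge0.
by move=> x; rewrite -mulrA (le_trans (hL _))// ler_wpM2l.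
Qed.

Definition slim V (u : nat -> V) (l : V) :=
  forall e : R, 0 < e -> exists N, forall n, (N <= n)%N -> nm (u n - l) < e.

Lemma complete_seq (V : completeNormedModType C) (u : nat -> V) :
  (forall e : R, 0 < e -> exists N, forall n m, (N <= n)%N -> (N <= m)%N ->
    nm (u n - u m) < e) -> exists l, slim u l.
Proof.
move=> h; have /cauchy_cvg/cvg_ex[l ul] : cauchy (u @ \oo).
  apply: cauchy_exP => e e0; have e0' : 0 < complex.Re e.
    by move: e0; rewrite ltcE => /andP[].
  have [N hN] := h _ e0'; exists (u N); exists N => //= n Nn.
  by rewrite /= -ball_normE /ball_/= nmE -[e]RRe_real ?ltcR ?hN ?gtr0_real.
exists l => e e0.
have : nbhs l [set y | nm (l - y) < e] by apply/nbhs_nmP; exists e.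
by move=> /ul[N _ hN]; exists N => n /hN/=; rewrite nmBC.
Qed.

Lemma slim_nm_le V (u : nat -> V) l (x : V) (K : R) N : slim u l ->
  (forall n, (N <= n)%N -> nm (u n - x) <= K) -> nm (l - x) <= K.
Proof.
move=> ul h; apply/ler_addgt0Pr => e e0; have [M hM] := ul e e0.
rewrite (le_trans (nm_tri (u (maxn M N)) _ _))// addrC lerD//.
  by rewrite h// leq_maxr.
by rewrite nmBC ltW// hM// leq_maxl.
Qed.

Lemma expr_lt_eps (K r e : R) : 0 <= K -> 0 <= r -> r < 1 -> 0 < e ->
  exists N, forall n, (N <= n)%N -> K * r ^+ n < e.
Proof.
move=> K0 r0 r1 e0; have e2 : 0 < e / (K + 1) by rewrite divr_gt0// ltr_wpDl.
have /cvgrPdist_lt/(_ _ e2)[N _ hN] : (fun n => r ^+ n) @ \oo --> (0 : R).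
  by apply: cvg_expr; rewrite ger0_norm.
exists N => n /hN/=; rewrite sub0r normrN normrX ger0_norm// => hr.
apply: le_lt_trans (_ : (K + 1) * r ^+ n < _).
  by rewrite ler_wpM2r ?exprn_ge0// lerDl.
by move: hr; rewrite ltr_pdivlMr ?ltr_wpDl// mulrC.
Qed.

(** Besides the limit it gives the tail estimate of the geometric series, which the gliding hump
    argument for multipliers needs. *)
Lemma geo_complete (V : completeNormedModType C) (u : nat -> V) (K r : R) :
  0 <= r -> r < 1 -> (forall n, nm (u n.+1 - u n) <= K * r ^+ n) ->
  exists2 l, slim u l & forall n, nm (l - u n) <= K * r ^+ n / (1 - r).
Proof.
move=> r0 r1 h.
have K0 : 0 <= K by have := h 0%N; rewrite expr0 mulr1; apply: le_trans (nm_ge0 _).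
have d0 : 0 < 1 - r by rewrite subr_gt0.
have bnd n p : nm (u (n + p)%N - u n) <= K * r ^+ n / (1 - r).
  suff : nm (u (n + p)%N - u n) <= K * r ^+ n * (1 - r ^+ p) / (1 - r).
    move=> /le_trans; apply; rewrite ler_pM2r ?invr_gt0// ler_piMr ?mulr_ge0 ?exprn_ge0//.
    by rewrite lerBlDr lerDl exprn_ge0.
  elim: p => [|p IH]; first by rewrite addn0 subrr nm0 expr0 subrr mulr0 mul0r.
  rewrite addnS (le_trans (nm_tri (u (n + p)%N) _ _))// (le_trans (lerD (h _) IH))//.
  rewrite le_eqVlt; apply/orP; left; apply/eqP.
  by rewrite exprD exprS; field; rewrite gt_eqF.
have [l ul] : exists l, slim u l.
  apply: complete_seq => e e0.
  have [N hN] : exists N, K * r ^+ N / (1 - r) < e / 2.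
    have [|N hN] := @expr_lt_eps K r (e / 2 * (1 - r)) K0 r0 r1.
      by rewrite !mulr_gt0.
    by exists N; rewrite ltr_pdivrMr// hN.
  exists N => n m Nn Nm; rewrite (splitr e).
  have f k : (N <= k)%N -> nm (u k - u N) < e / 2.
    by move=> Nk; rewrite -(subnKC Nk) (le_lt_trans (bnd _ _)).
  by rewrite (le_lt_trans (nm_tri (u N) _ _))// ltrD ?f// nmBC f.
exists l => // n; apply: (slim_nm_le (N := n) ul) => k nk.
by rewrite -(subnKC nk) bnd.
Qed.

Lemma cspan_nmP V I (S : set V) (v : I -> V) x :
  (forall y, S y <-> exists i, y = v i) ->
  (cspan S x <-> forall e : R, 0 < e -> exists s : seq (C * I),
     nm (x - \sum_(p <- s) p.1 *: v p.2) < e).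
Proof.
move=> hS; split=> [/closure_nmP h e e0|h].
  have [_ [n [k [w [Sw ->]]]] xy] := h e e0.
  have /choice[g gE] : forall i, exists j, w i = v j by move=> i; exact/hS.
  exists [seq (k i, g i) | i <- enum 'I_n]; rewrite big_map/= big_enum/=.
  by under [X in x - X]eq_bigr do rewrite -gE.
apply/closure_nmP => e e0; have [s hs] := h e e0.
exists (\sum_(p <- s) p.1 *: v p.2) => //.
case: s hs => [|p0 s] _.
  by exists 0%N, (fun=> 0), (fun=> 0); split=> [[]//|]; rewrite big_nil big_ord0.
exists (size (p0 :: s)), (fun i => (nth p0 (p0 :: s) i).1),
  (fun i => v (nth p0 (p0 :: s) i).2); split; first by move=> i; apply/hS; eexists.
by rewrite (big_nth p0) big_mkord.
Qed.

Lemma dense_bdlin_eq V W (S : set V) (f g : V -> W) : cspan S = setT ->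
  bdlin f -> bdlin g -> (forall x, S x -> f x = g x) -> f =1 g.
Proof.
move=> dS [fl [K K0 hK]] [gl [L L0 hL]] h x; apply/eqP; rewrite -subr_eq0.
apply/eqP; apply: (@nm_eps _ _ (K + L)) => e e0.
have /closure_nmP/(_ e e0)[_ [n [k [v [Sv ->]]]] xy] : cspan S x by rewrite dS.
set y := \sum_(i < n) _ in xy *.
have fg : f y = g y.
  by rewrite (islin_sum fl) (islin_sum gl); apply: eq_bigr => i _; rewrite (islinZ fl) (islinZ gl) h.
have -> : f x - g x = f (x - y) - g (x - y).
  by rewrite (islinB fl) (islinB gl) fg opprB addrA subrK.
rewrite mulrDl (le_trans (nmB _ _))// lerD//.
  by rewrite (le_trans (hK _))// ler_wpM2l// ltW.
by rewrite (le_trans (hL _))// ler_wpM2l// ltW.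
Qed.

(** The map is obtained as the closure P of its graph on finite combinations. The norm bound makes P
    single-valued, which includes well-definedness on the span, and completeness of W makes it
    total. *)
Lemma ext_total V (W : completeNormedModType C) I (v : I -> V) (w : I -> W)
    (S : set V) (K : R) : 0 <= K ->
  (forall y, S y <-> exists i, y = v i) -> cspan S = setT ->
  (forall s : seq (C * I), nm (\sum_(p <- s) p.1 *: w p.2) <=
                           K * nm (\sum_(p <- s) p.1 *: v p.2)) ->
  exists f : V -> W, [/\ islin f, forall x, nm (f x) <= K * nm x
    & forall i, f (v i) = w i].
Proof.
move=> K0 hS dS hK.
pose sv (s : seq (C * I)) := \sum_(p <- s) p.1 *: v p.2.
pose sw (s : seq (C * I)) := \sum_(p <- s) p.1 *: w p.2.
pose P x y := forall e : R, 0 < e ->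
  exists s, nm (x - sv s) < e /\ nm (y - sw s) < e.
have dx x (e : R) : 0 < e -> exists s, nm (x - sv s) < e.
  by apply: (iffLR (cspan_nmP x hS)); rewrite dS.
pose sc k s : seq (C * I) := [seq (k * p.1, p.2) | p <- s].
have svc k s s' : sv (sc k s ++ s') = k *: sv s + sv s'.
  rewrite /sv big_cat/= big_map scaler_sumr; congr (_ + _).
  by apply: eq_bigr => p _; rewrite scalerA.
have swc k s s' : sw (sc k s ++ s') = k *: sw s + sw s'.
  rewrite /sw big_cat/= big_map scaler_sumr; congr (_ + _).
  by apply: eq_bigr => p _; rewrite scalerA.
have hK' s s' : nm (sw s - sw s') <= K * nm (sv s - sv s').
  have := hK (sc (-1) s' ++ s); rewrite -/(sv _) -/(sw _) svc swc !scaleN1r.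
  by rewrite ![- _ + _]addrC.
have Plin k x y x' y' : P x y -> P x' y' -> P (k *: x + x') (k *: y + y').
  move=> h h' e e0; have c0 : 0 < cabs k + 1 by rewrite ltr_wpDl ?cabs_ge0.
  have e1 : 0 < e / 2 / (cabs k + 1) by rewrite !divr_gt0.
  have [s [s1 s2]] := h _ e1; have [|s' [s'1 s'2]] := h' (e / 2).
    by rewrite divr_gt0.
  have f (U : normedModType C) (a a' b b' : U) : nm (a - b) < e / 2 / (cabs k + 1) ->
      nm (a' - b') < e / 2 -> nm (k *: a + a' - (k *: b + b')) < e.
    move=> ab a'b'; rewrite opprD addrACA -scalerBr (splitr e).
    rewrite (le_lt_trans (nmD _ _))// ltr_leD ?(ltW a'b')// nmZ.
    rewrite ltr_pdivlMr// in ab; apply: le_lt_trans ab.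
    by rewrite mulrC ler_wpM2l ?nm_ge0// lerDl.
  by exists (sc k s ++ s'); rewrite svc swc; split; apply: f.
have Pbd x y : P x y -> nm y <= K * nm x.
  move=> h; apply/ler_addgt0Pr => e e0.
  have e1 : 0 < e / (K + 1) by rewrite divr_gt0// ltr_wpDl.
  have [s [s1 s2]] := h _ e1.
  have y1 : nm y <= nm (y - sw s) + nm (sw s) by rewrite -{1}(subrK (sw s) y) nmD.
  have y2 : nm (sv s) <= nm (x - sv s) + nm x.
    by rewrite nmBC -{1}(subrK x (sv s)) nmD.
  rewrite (le_trans y1)// (le_trans (lerD (ltW s2) (hK s)))//.
  have : K * nm (sv s) <= K * (e / (K + 1) + nm x).
    by rewrite ler_wpM2l// (le_trans y2)// lerD2r ltW.
  move=> /(lerD (lexx (e / (K + 1))))/le_trans; apply.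
  by rewrite mulrDr addrA -[X in X + _ + _]mul1r -mulrDl addrC lerD2l addrC mulrC divfK// gt_eqF// ltr_wpDl.
have Puniq x y y' : P x y -> P x y' -> y = y'.
  move=> h h'; apply/eqP; rewrite -subr_eq0; apply/eqP/nm_le0.
  have := Plin (-1) _ _ _ _ h' h; rewrite !scaleN1r addNr addrC => /Pbd.
  by rewrite nm0 mulr0.
have Pex x : exists y, P x y.
  have h2 n : 0 < (2^-1 : R) ^+ n by rewrite exprn_gt0.
  have /choice[u hu] : forall n, exists s, nm (x - sv s) < 2^-1 ^+ n.
    by move=> n; exact: dx.
  have r1 : (2^-1 : R) < 1 by rewrite invf_lt1// ltr1n.
  have [|//|n|l ul _] := @geo_complete W (fun n => sw (u n)) (K * 2) 2^-1.
  - by rewrite invr_ge0.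
  - rewrite (le_trans (hK' _ _))// -mulrA ler_wpM2l//.
    rewrite (le_trans (nm_tri x _ _))// nmBC mulr2n mulrDl mul1r lerD//; last exact: ltW.
    by rewrite (le_trans (ltW (hu _)))// exprS ler_piMl// ?ltW.
  exists l => e e0; have [N1 hN1] := ul e e0.
  have [|N2 hN2] := @expr_lt_eps 1 2^-1 e ler01 _ r1 e0; first by rewrite invr_ge0.
  exists (u (maxn N1 N2)); split; last by rewrite nmBC hN1// leq_maxl.
  by rewrite (lt_trans (hu _))// -[X in X < _]mul1r hN2// leq_maxr.
have [f hf] := choice Pex; exists f; split.
- by move=> k a b; apply: Puniq (hf _) _; exact: Plin.
- by move=> x; exact: Pbd.
- move=> i; apply: Puniq (hf _) _ => e e0; exists [:: (1, i)].
  by rewrite /sv /sw !big_seq1/= !scale1r !subrr !nm0.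
Qed.

Lemma half_addv (V : lmodType C) (x : V) : 2^-1 *: (x + x) = x.
Proof.
rewrite -[X in _ *: (X + X)]scale1r -scalerDl scalerA mulVf ?scale1r//.
Qed.

Lemma cabs_nat n : cabs n%:R = n%:R.
Proof. by rewrite -(rmorph_nat (@real_complex R)) cabs_real ger0_norm. Qed.

End RealNorm.
Arguments nm {R V} x.
Arguments nm_eps {R V x} K.

(** * C*-algebras and their multipliers *)

Section CstarBasics.
Context {R : realType}.
Local Notation C := R[i].
Implicit Types A B : cstarAlg R.

Lemma cmull_lin A (c : A) : islin (fun a => a ** c).
Proof. by move=> k a b; exact: cmulDl. Qed.
Lemma cmulr_lin A (c : A) : islin (fun a => c ** a).
Proof. by move=> k a b; exact: cmulDr. Qed.
Lemma cmulDl1 A (a b c : A) : (a + b) ** c = a ** c + b ** c.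
Proof. exact: (islinD (cmull_lin c)). Qed.
Lemma cmulDr1 A (a b c : A) : c ** (a + b) = c ** a + c ** b.
Proof. exact: (islinD (cmulr_lin c)). Qed.
Lemma cmulBl A (a b c : A) : (a - b) ** c = a ** c - b ** c.
Proof. exact: (islinB (cmull_lin c)). Qed.
Lemma cmulBr A (a b c : A) : c ** (a - b) = c ** a - c ** b.
Proof. exact: (islinB (cmulr_lin c)). Qed.
Lemma cmulZl A k (a c : A) : (k *: a) ** c = k *: (a ** c).
Proof. exact: (islinZ (cmull_lin c)). Qed.
Lemma cmulZr A k (a c : A) : c ** (k *: a) = k *: (c ** a).
Proof. exact: (islinZ (cmulr_lin c)). Qed.
Lemma cmul0l A (c : A) : 0 ** c = 0.
Proof. exact: (islin0 (cmull_lin c)). Qed.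
Lemma cmul0r A (c : A) : c ** 0 = 0.
Proof. exact: (islin0 (cmulr_lin c)). Qed.
Lemma cmul_suml A (I : Type) (r : seq I) (P : pred I) (F : I -> A) c :
  (\sum_(i <- r | P i) F i) ** c = \sum_(i <- r | P i) F i ** c.
Proof. exact: (islin_sum (cmull_lin c)). Qed.
Lemma cmul_sumr A (I : Type) (r : seq I) (P : pred I) (F : I -> A) c :
  c ** (\sum_(i <- r | P i) F i) = \sum_(i <- r | P i) c ** F i.
Proof. exact: (islin_sum (cmulr_lin c)). Qed.

Lemma star0 A : star (0 : A) = 0.
Proof.
have := starD (-1) (0 : A) 0; rewrite scaler0 addr0 rmorphN1 scaleN1r.
by rewrite addNr.
Qed.
Lemma starDD A (a b : A) : star (a + b) = star a + star b.
Proof. by have := starD 1 a b; rewrite rmorph1 !scale1r. Qed.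
Lemma starZ A k (a : A) : star (k *: a) = k^* *: star a.
Proof. by have := starD k a 0; rewrite star0 !addr0. Qed.
Lemma starN A (a : A) : star (- a) = - star a.
Proof. by rewrite -scaleN1r starZ rmorphN1 scaleN1r. Qed.
Lemma starB A (a b : A) : star (a - b) = star a - star b.
Proof. by rewrite starDD starN. Qed.
Lemma star_sum A (I : Type) (r : seq I) (P : pred I) (F : I -> A) :
  star (\sum_(i <- r | P i) F i) = \sum_(i <- r | P i) star (F i).
Proof. by elim/big_rec2: _ => [|i y x _ <-]; rewrite ?star0 ?starDD. Qed.

Lemma nm_mul A (a b : A) : nm (a ** b) <= nm a * nm b.
Proof. by rewrite -lecR' rmorphM/= -!nmE cmul_norm. Qed.
Lemma nm_starmul A (a : A) : nm (star a ** a) = nm a ^+ 2.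
Proof. by apply: (@complexI R); rewrite rmorphXn/= -!nmE cstar_id. Qed.
Lemma nm_star A (a : A) : nm (star a) = nm a.
Proof.
suff h (b : A) : nm b <= nm (star b).
  by apply/eqP; rewrite eq_le -{2}(starK a) !h.
have [/eqP/nm_eq0->|b0] := boolP (nm b == 0); first by rewrite nm0 nm_ge0.
have nb : 0 < nm b by rewrite lt_neqAle eq_sym b0 nm_ge0.
by rewrite -(ler_pM2r nb) -expr2 -nm_starmul nm_mul.
Qed.
Lemma nm_mulstar A (a : A) : nm (a ** star a) = nm a ^+ 2.
Proof. by rewrite -{1}(starK a) nm_starmul nm_star. Qed.
Lemma starmul_eq0 A (a : A) : star a ** a = 0 -> a = 0.
Proof.
move=> h; apply: nm_eq0; apply/eqP; rewrite -sqrf_eq0; apply/eqP.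
by rewrite -nm_starmul h nm0.
Qed.
Lemma cmul_nondeg A (a b : A) : (forall x, star x ** a = star x ** b) -> a = b.
Proof.
move=> h; apply/eqP; rewrite -subr_eq0; apply/eqP/starmul_eq0.
by rewrite cmulBr h subrr.
Qed.

Lemma cmull_bd A (c : A) : bdlin (fun a => a ** c).
Proof.
split; [exact: cmull_lin|exists (nm c); first exact: nm_ge0].
by move=> x; rewrite mulrC nm_mul.
Qed.
Lemma cmulr_bd A (c : A) : bdlin (fun a => c ** a).
Proof.
by split; [exact: cmulr_lin|exists (nm c) => [|x]; rewrite ?nm_ge0 ?nm_mul].
Qed.

Section Mult.
Context {A : cstarAlg R}.
Implicit Types m n : mult A.

Lemma mult_ext m n : (forall x, m x = n x) -> m = n.
Proof.
case: m n => [f f' fP] [g g' gP]/= h.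
have e1 : f = g by exact/funext.
have e2 : f' = g'.
  by apply/funext => b; apply: cmul_nondeg => a; rewrite -fP -gP h.
by subst g g'; congr Mult; exact: Prop_irrelevance.
Qed.

Lemma star_inj : injective (@star R A).
Proof. exact: can_inj (@starK R A). Qed.

Lemma cmul_nondegr (a b : A) : (forall x, a ** x = b ** x) -> a = b.
Proof.
move=> h; apply: star_inj; apply: cmul_nondeg => x; apply: star_inj.
by rewrite !starM !starK h.
Qed.

Lemma mult_lin m : islin m.
Proof.
move=> k a b; apply: star_inj; apply: cmul_nondegr => y.
by rewrite multP !starD cmulDl1 cmulZl cmulDl1 cmulZl !multP.
Qed.

Lemma multM m a b : m (a ** b) = m a ** b.
Proof.
apply: star_inj; apply: cmul_nondegr => y.
by rewrite multP !starM -!cmulA multP.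
Qed.

Lemma emb_inj : injective (@emb R A).
Proof. by move=> x y h; apply: cmul_nondegr => z; rewrite -![_ ** z]/(emb _ z) h. Qed.

(* Gliding hump: a total family of vectors [m a_n] on which [m] is unbounded  *)
(* would make the image of sum +- 3^-n m a_n / |m a_n| under the adjoint      *)
(* infinite.                                                                  *)
Lemma mult_bdlin m : bdlin m.
Proof.
split; first exact: mult_lin.
have [[K hK]|nK] := pselect (exists K : R, forall x, nm (m x) <= K * nm x).
  by exists `|K| => // x; rewrite (le_trans (hK x))// ler_wpM2r ?nm_ge0// ler_norm.
exfalso; have /choice[a ha] : forall n : nat, exists a, nm a <= 1 /\ 4 ^+ n < nm (m a).
  move=> n; have [x hx] : exists x, 4 ^+ n * nm x < nm (m x).
    apply/not_existsP => h; apply: nK; exists (4 ^+ n) => x.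
    by rewrite leNgt; apply/negP/h.
  have x0 : 0 < nm x.
    rewrite lt_neqAle nm_ge0 andbT eq_sym; apply/eqP => /nm_eq0 x0.
    by move: hx; rewrite x0 (islin0 (mult_lin m)) nm0 mulr0 ltxx.
  exists ((nm x)^-1%:C%C *: x); rewrite (islinZ (mult_lin m)) !nmZ cabs_real.
  by rewrite gtr0_norm ?invr_gt0// mulVf ?gt_eqF// mulrC ltr_pdivlMr.
pose b (n : nat) := m (a n).
have b0 (n : nat) : 0 < nm (b n).
  by have [_] := ha n; apply: lt_trans; rewrite exprn_gt0.
pose e (n : nat) := (3^-1 ^+ n / nm (b n))%:C%C *: b n.
have e3 (n : nat) : nm (e n) = 3^-1 ^+ n.
  by rewrite nmZ cabs_real ger0_norm ?divfK ?gt_eqF// divr_ge0 ?nm_ge0.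
pose good (n : nat) y := 3^-1 ^+ n * nm (b n) <= nm (star (b n) ** y).
pose x := fix x (n : nat) := if n is k.+1 then
  (if `[< good k (x k + e k) >] then x k + e k else x k - e k) else 0.
have xS (n : nat) : x n.+1 = if `[< good n (x n + e n) >] then x n + e n else x n - e n.
  by [].
(* One of the two signs is good: [star (b n) ** e n] is half the difference of the products with
   [x n + e n] and [x n - e n], and its norm is [3^-1 ^+ n * nm (b n)]. *)
have xgood (n : nat) : good n (x n.+1).
  rewrite xS; case: asboolP => // /negP; rewrite -ltNge => h1.
  rewrite /good leNgt; apply/negP => h2.
  have : star (b n) ** e n = 2^-1 *: (star (b n) ** (x n + e n) - star (b n) ** (x n - e n)).
    by rewrite -cmulBr opprB [x n + _]addrC addrACA subrr addr0 cmulDr1 half_addv.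
  move=> /(congr1 (@nm R A)); rewrite cmulZr nmZ cabs_real nm_starmul ger0_norm; last first.
    by rewrite divr_ge0 ?nm_ge0.
  rewrite nmZ cabsV cabs_nat.
  rewrite expr2 mulrA divfK ?gt_eqF// => h3.
  have := le_lt_trans (nmB _ _) (ltrD h1 h2).
  by rewrite -[X in X < _](mulVKf (_ : 2 != 0)) ?pnatr_eq0// -h3; lra.
have r1 : (3^-1 : R) < 1 by rewrite invf_lt1// ltr1n.
have [|n|l _ xl] := @geo_complete R A x 1 3^-1 _ r1.
- by rewrite invr_ge0.
- by rewrite xS; case: ifP => _; rewrite addrC addrA addNr add0r ?nmN e3 mul1r.
(* After step n + 1 the tail of the series is at most half of [3^-1 ^+ n], so half of the bound in
   [good] survives in the limit l. *)
have low (n : nat) : 2^-1 * (3^-1 ^+ n * nm (b n)) <= nm (madj m l).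
  have h1 : nm (star (b n) ** l) <= nm (madj m l).
    rewrite multP (le_trans (nm_mul _ _))// nm_star ler_piMl ?nm_ge0//.
    by case: (ha n).
  apply: le_trans h1.
  have := xl n.+1; rewrite mul1r => h2.
  have h3 : nm (star (b n) ** x n.+1) <= nm (star (b n) ** l) + nm (b n) * (3^-1 ^+ n.+1 / (1 - 3^-1)).
    have -> : star (b n) ** x n.+1 = star (b n) ** l - star (b n) ** (l - x n.+1).
      by rewrite cmulBr opprB addrC subrK.
    rewrite (le_trans (nmB _ _))// lerD2l (le_trans (nm_mul _ _))// nm_star.
    by rewrite ler_wpM2l ?nm_ge0.
  have := le_trans (xgood n) h3; rewrite exprS.
  have -> : nm (b n) * (3^-1 * 3^-1 ^+ n / (1 - 3^-1)) = 2^-1 * (3^-1 ^+ n * nm (b n)).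
    by field.
  by lra.
(* With [nm (b N) > 4 ^+ N], the bound [low] makes (4/3)^N at most twice [nm (madj m l)] for every
   N. *)
have r2 : (3 / 4 : R) < 1 by lra.
have r3 : (0 <= 3 / 4 :> R) by lra.
have [|N hN] := @expr_lt_eps R (2 * nm (madj m l)) (3 / 4) 1 _ r3 r2 ltr01.
  by rewrite mulr_ge0 ?nm_ge0.
have := hN N (leqnn N); rewrite ltNge => /negP; apply.
have h4 : 1 <= 4^-1 ^+ N * nm (b N).
  rewrite exprVn mulrC ler_pdivlMr ?exprn_gt0// mul1r ltW//.
  by case: (ha N).
have := low N; rewrite expr_div_n.
have -> : 3 ^+ N / 4 ^+ N = 3 ^+ N * 4^-1 ^+ N :> R by rewrite exprVn.
move=> h5.
have : (3 ^+ N * 4^-1 ^+ N) * (2^-1 * (3^-1 ^+ N * nm (b N))) <= (3 ^+ N * 4^-1 ^+ N) * nm (madj m l).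
  by rewrite ler_wpM2l// mulr_ge0 ?exprn_ge0 ?invr_ge0.
have -> : (3 ^+ N * 4^-1 ^+ N) * (2^-1 * (3^-1 ^+ N * nm (b N))) = 2^-1 * (4^-1 ^+ N * nm (b N)).
  by rewrite !exprVn; field; rewrite !expf_neq0.
by lra.
Qed.

End Mult.
End CstarBasics.

Lemma half_gt0 (R : realType) (e : R) : 0 < e -> 0 < e / 2.
Proof. by move=> e0; rewrite divr_gt0. Qed.

(** A Cauchy filter contains balls of radius 2^-n with centres u n. Two such balls meet, which gives
    the factor 2, and the limit of the centres is the limit of the filter. *)
Lemma seq_complete (R : realType) (V : normedModType R[i]) :
  (forall u : nat -> V, (forall n m, (n <= m)%N -> nm (u n - u m) <= 2 * 2^-1 ^+ n) ->
    exists l, slim u l) ->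
  forall F : set_system V, ProperFilter F -> cauchy F -> cvg F.
Proof.
move=> h F PF /cauchy_ballP cF.
have e0 n : 0 < 2^-1 ^+ n :> R by rewrite exprn_gt0.
have cF' : cauchy_ex F by apply/cauchyP/cauchy_ballP.
have /choice[u hu] : forall n, exists x, F [set y | nm (x - y) < 2^-1 ^+ n].
  move=> n; have [|x hx] := cF' (2^-1 ^+ n)%:C%C; first by rewrite ltcR.
  exists x; apply: filterS hx => y; rewrite -ball_normE /ball_/= nmE ltcR.
  by [].
have [n m nm'|l ul] := h u.
  have [y [/= y1 y2]] := filter_ex (filterI (hu n) (hu m)).
  rewrite (le_trans (nm_tri y _ _))// mulr2n mulrDl mul1r lerD ?(ltW y1)//.
  rewrite nmBC (le_trans (ltW y2))// -(subnKC nm') exprD ler_piMr ?(ltW (e0 n))//.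
  by rewrite exprn_ile1// ?invr_ge0// invf_le1// ler1n.
apply/cvg_ex; exists l; move=> B /nbhs_nmP[e epos eB].
have [N hN] := ul _ (half_gt0 epos).
have r1 : (2^-1 : R) < 1 by rewrite invf_lt1// ltr1n.
have [|M hM] := @expr_lt_eps R 1 2^-1 (e / 2) ler01 _ r1 (half_gt0 epos).
  by rewrite invr_ge0.
apply: filterS (hu (maxn N M)) => y /= hy; apply: eB.
rewrite (le_lt_trans (nm_tri (u (maxn N M)) _ _))// (splitr e) ltrD//.
  by rewrite nmBC hN// leq_maxl.
by rewrite (lt_trans hy)// -[X in X < _]mul1r hM// leq_maxr.
Qed.

Section MultAlgebra.
Context {R : realType} {A : cstarAlg R}.
Implicit Types m n : mult A.

Definition mbound m := [set K : R | 0 <= K /\ forall x, nm (m x) <= K * nm x].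
Definition opn m : R := inf (mbound m).

Lemma mbound_inf m : has_inf (mbound m).
Proof.
split; last by exists 0 => K [].
by have [_ [K K0 hK]] := mult_bdlin m; exists K.
Qed.

Lemma opn_ge0 m : 0 <= opn m.
Proof. by apply: lb_le_inf; [case: (mbound_inf m)|move=> K []]. Qed.

Lemma opn_le m K : 0 <= K -> (forall x, nm (m x) <= K * nm x) -> opn m <= K.
Proof. by move=> K0 hK; apply: ge_inf => //; case: (mbound_inf m). Qed.

Lemma opnP m x : nm (m x) <= opn m * nm x.
Proof.
have [/eqP/nm_eq0->|x0] := boolP (nm x == 0).
  by rewrite (islin0 (mult_lin m)) !nm0 mulr0.
have nx : 0 < nm x by rewrite lt_neqAle eq_sym x0 nm_ge0.
rewrite -ler_pdivrMr//; apply: lb_le_inf; first by case: (mbound_inf m).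
by move=> K [_ hK]; rewrite ler_pdivrMr.
Qed.

Lemma madd_subproof m n a b :
  star (m a + n a) ** b = star a ** (madj m b + madj n b).
Proof. by rewrite starDD cmulDl1 cmulDr1 !multP. Qed.
Definition madd m n : mult A := Mult (@madd_subproof m n).
Lemma mscale_subproof (k : R[i]) m a b :
  star (k *: m a) ** b = star a ** (k^* *: madj m b).
Proof. by rewrite starZ cmulZl cmulZr multP. Qed.
Definition mscale (k : R[i]) m : mult A := Mult (@mscale_subproof k m).
Lemma mzero_subproof (a b : A) : star (0 : A) ** b = star a ** 0.
Proof. by rewrite star0 cmul0l cmul0r. Qed.
Definition mzero : mult A := Mult mzero_subproof.

HB.instance Definition _ := gen_eqMixin (mult A).
HB.instance Definition _ := gen_choiceMixin (mult A).

Lemma maddA : associative madd.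
Proof. by move=> m n p; apply: mult_ext => x /=; rewrite addrA. Qed.
Lemma maddC : commutative madd.
Proof. by move=> m n; apply: mult_ext => x /=; rewrite addrC. Qed.
Lemma madd0 : left_id mzero madd.
Proof. by move=> m; apply: mult_ext => x /=; rewrite add0r. Qed.
Lemma maddN : left_inverse mzero (mscale (-1)) madd.
Proof. by move=> m; apply: mult_ext => x /=; rewrite scaleN1r addNr. Qed.
HB.instance Definition _ := GRing.isZmodule.Build (mult A) maddA maddC madd0 maddN.

Lemma mscaleA k l m : mscale k (mscale l m) = mscale (k * l) m.
Proof. by apply: mult_ext => x /=; rewrite scalerA. Qed.
Lemma mscale1 : left_id 1 mscale.
Proof. by move=> m; apply: mult_ext => x /=; rewrite scale1r. Qed.
Lemma mscaleDr : right_distributive mscale +%R.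
Proof. by move=> k m n; apply: mult_ext => x /=; rewrite scalerDr. Qed.
Lemma mscaleDl m : {morph mscale^~ m : k l / k + l}.
Proof. by move=> k l; apply: mult_ext => x /=; rewrite scalerDl. Qed.
HB.instance Definition _ := GRing.Zmodule_isLmodule.Build R[i] (mult A)
  mscaleA mscale1 mscaleDr mscaleDl.

Lemma multDE m n x : (m + n) x = m x + n x. Proof. by []. Qed.
Lemma multZE k m x : (k *: m) x = k *: m x. Proof. by []. Qed.
Lemma multNE m x : (- m) x = - m x. Proof. by rewrite -[RHS]scaleN1r. Qed.
Lemma multBE m n x : (m - n) x = m x - n x. Proof. by rewrite -multNE. Qed.
Lemma mult0E x : (0 : mult A) x = 0. Proof. by []. Qed.

Definition mnorm m : R[i] := (opn m)%:C%C.
Lemma opnD m n : opn (m + n) <= opn m + opn n.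
Proof.
apply: opn_le => [|x]; first by rewrite addr_ge0 ?opn_ge0.
by rewrite mulrDl (le_trans (nmD _ _))// lerD ?opnP.
Qed.
Lemma mnormD m n : mnorm (m + n) <= mnorm m + mnorm n.
Proof. by rewrite -rmorphD lecR opnD. Qed.
Lemma opnZ k m : opn (k *: m) = cabs k * opn m.
Proof.
have le (l : R[i]) n : opn (l *: n) <= cabs l * opn n.
  apply: opn_le => [|x]; first by rewrite mulr_ge0 ?opn_ge0 ?cabs_ge0.
  by rewrite nmZ -mulrA ler_wpM2l ?cabs_ge0 ?opnP.
apply/eqP; rewrite eq_le le/=; have [->|k0] := eqVneq k 0.
  by rewrite cabs0 mul0r opn_ge0.
have ck : 0 < cabs k by rewrite lt_neqAle cabs_ge0 andbT eq_sym; apply/eqP => /cabs_eq0/eqP; rewrite (negbTE k0).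
rewrite mulrC -ler_pdivlMr// mulrC -cabsV.
by have := le k^-1 (k *: m); rewrite scalerA mulVf// scale1r.
Qed.
Lemma mnormZ k m : mnorm (k *: m) = `|k| * mnorm m.
Proof. by rewrite cabsE -rmorphM /mnorm opnZ. Qed.
Lemma opn_eq0 m : opn m = 0 -> m = 0.
Proof.
move=> h; apply: mult_ext => x; apply: nm_le0.
by rewrite (le_trans (opnP _ _))// h mul0r.
Qed.
Lemma mnorm0_eq0 m : mnorm m = 0 -> m = 0.
Proof. by move=> /complexI/opn_eq0. Qed.
HB.instance Definition _ :=
  Lmodule_isNormed.Build R[i] (mult A) mnormD mnormZ mnorm0_eq0.

Lemma nm_mult m : nm m = opn m.
Proof. by []. Qed.

Lemma opn_star m : opn (mstar m) = opn m.
Proof.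
suff h n : opn (mstar n) <= opn n.
  apply/eqP; rewrite eq_le h/=; have -> : m = mstar (mstar m) by exact: mult_ext.
  exact: h.
apply: opn_le => [|x]; first exact: opn_ge0.
have [/eqP->|y0] := boolP (nm (mstar n x) == 0); first by rewrite mulr_ge0 ?opn_ge0 ?nm_ge0.
have y1 : 0 < nm (mstar n x) by rewrite lt_neqAle eq_sym y0 nm_ge0.
rewrite -(ler_pM2r y1) -expr2 -nm_starmul -[star _ ** _]/(star (mstar n x) ** mstar n x) multP.
rewrite (le_trans (nm_mul _ _))// nm_star [opn n * _]mulrC -mulrA ler_wpM2l ?nm_ge0//.
exact: opnP.
Qed.

(** A multiplier carries its adjoint, so the pointwise limits of the adjoints are constructed as
    well; [opn_star] gives them the same Cauchy estimate. *)
Lemma mult_complete (F : set_system (mult A)) : ProperFilter F -> cauchy F -> cvg F.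
Proof.
apply: seq_complete => u hu.
have r1 : (2^-1 : R) < 1 by rewrite invf_lt1// ltr1n.
have pw (v : nat -> mult A) x : (forall i j : nat, (i <= j)%N ->
    nm (v i - v j) <= 2 * 2^-1 ^+ i) -> exists l, slim (fun i => v i x) l.
  move=> hv; have [|//|n|l ul _] := @geo_complete R A (fun i : nat => v i x) (2 * nm x) 2^-1.
  - by rewrite invr_ge0.
  - rewrite nmBC -multBE (le_trans (opnP (v n - v n.+1) x))// mulrAC ler_wpM2r ?nm_ge0//.
    exact: hv.
  by exists l.
have /choice[l hl] x := pw u x hu.
have /choice[l' hl'] x : exists l, slim (fun i => mstar (u i) x) l.
  apply: pw => i j ij; rewrite nm_mult.
  have -> : mstar (u i) - mstar (u j) = mstar (u i - u j).
    by apply: mult_ext => y /=; rewrite rmorphN1.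
  by rewrite opn_star; exact: hu.
have lP a b : star (l a) ** b = star a ** l' b.
  apply/eqP; rewrite -subr_eq0; apply/eqP; apply: (@nm_eps _ _ _ (nm b + nm a)) => e e0.
  have [N hN] := hl a e e0; have [M hM] := hl' b e e0.
  pose k := maxn N M.
  have -> : star (l a) ** b - star a ** l' b =
      star (l a - u k a) ** b - star a ** (l' b - mstar (u k) b).
    by rewrite starB cmulBl cmulBr multP opprB addrA subrK.
  rewrite mulrDl (le_trans (nmB _ _))// lerD// (le_trans (nm_mul _ _))// nm_star.
    by rewrite mulrC ler_wpM2l ?nm_ge0// ltW// nmBC hN// leq_maxl.
  by rewrite ler_wpM2l ?nm_ge0// ltW// nmBC hM// leq_maxr.
exists (Mult lP) => e e0.
have [|N hN] := @expr_lt_eps R 2 2^-1 (e / 2) (ler0n R 2) _ r1 (half_gt0 e0).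
  by rewrite invr_ge0.
exists N => n Nn; apply: le_lt_trans (_ : e / 2 < e); last first.
  by rewrite ltr_pdivrMr// ltr_pMr// ltr1n.
apply: opn_le => [|x]; first by rewrite divr_ge0// ltW.
rewrite multBE nmBC; apply: (slim_nm_le (N := n) (hl x)) => k nk.
rewrite nmBC -multBE (le_trans (opnP (u n - u k) x))// ler_wpM2r ?nm_ge0//.
by rewrite (le_trans (hu _ _ nk))// ltW// hN.
Qed.
HB.instance Definition _ := Uniform_isComplete.Build (mult A) mult_complete.

Lemma opn_mul m n : opn (mmul m n) <= opn m * opn n.
Proof.
apply: opn_le => [|x]; first by rewrite mulr_ge0 ?opn_ge0.
by rewrite (le_trans (opnP m (n x)))// -mulrA ler_wpM2l ?opn_ge0 ?opnP.
Qed.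

Lemma opn_starmul m : opn (mmul (mstar m) m) = opn m ^+ 2.
Proof.
apply/eqP; rewrite eq_le; apply/andP; split.
  by rewrite (le_trans (opn_mul _ _))// opn_star expr2.
have h : 0 <= opn (mmul (mstar m) m) by exact: opn_ge0.
rewrite -[leRHS]sqr_sqrtr// lerXn2r ?nnegrE ?opn_ge0 ?sqrtr_ge0//.
apply: opn_le => [|x]; first exact: sqrtr_ge0.
rewrite -(@ler_pXn2r _ 2) ?nnegrE ?mulr_ge0 ?sqrtr_ge0 ?nm_ge0//.
rewrite -nm_starmul multP.
rewrite (le_trans (nm_mul _ _))// nm_star exprMn sqr_sqrtr// mulrC expr2 mulrA.
by rewrite ler_wpM2r ?nm_ge0//; exact: (opnP (mmul (mstar m) m)).
Qed.

Lemma multalg_mulA m n p : mmul m (mmul n p) = mmul (mmul m n) p.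
Proof. exact: mult_ext. Qed.
Lemma multalg_mulDl (k : R[i]) m n p :
  mmul (k *: m + n) p = k *: mmul m p + mmul n p.
Proof. exact: mult_ext. Qed.
Lemma multalg_mulDr (k : R[i]) m n p :
  mmul p (k *: m + n) = k *: mmul p m + mmul p n.
Proof. by apply: mult_ext => x /=; rewrite mult_lin. Qed.
Lemma multalg_norm m n : `|mmul m n| <= `|m| * `|n|.
Proof. by rewrite !nmE -rmorphM lecR opn_mul. Qed.
Lemma multalg_starK m : mstar (mstar m) = m.
Proof. exact: mult_ext. Qed.
Lemma multalg_starD (k : R[i]) m n :
  mstar (k *: m + n) = k^* *: mstar m + mstar n.
Proof. exact: mult_ext. Qed.
Lemma multalg_starM m n : mstar (mmul m n) = mmul (mstar n) (mstar m).
Proof. exact: mult_ext. Qed.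
Lemma multalg_cstar m : `|mmul (mstar m) m| = `|m| ^+ 2.
Proof. by rewrite !nmE -rmorphXn; congr (_%:C%C); exact: opn_starmul. Qed.

(** M(A) as a C*-algebra in its own right, so that the results on homomorphisms and on closed
    subalgebras apply to it too. *)
Definition multalg : cstarAlg R := CstarAlg multalg_mulA multalg_mulDl
  multalg_mulDr multalg_norm multalg_starK multalg_starD multalg_starM multalg_cstar.

Lemma opn_emb (a : A) : opn (emb a) = nm a.
Proof.
apply/eqP; rewrite eq_le opn_le ?nm_ge0//=; last by move=> x; rewrite nm_mul.
have [/eqP->|a0] := boolP (nm a == 0); first exact: opn_ge0.
have a1 : 0 < nm a by rewrite lt_neqAle eq_sym a0 nm_ge0.
rewrite -(ler_pM2r a1) -expr2 -nm_mulstar -[X in _ <= _ * X](nm_star a).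
exact: (opnP (emb a)).
Qed.
End MultAlgebra.
Arguments multalg {R} A.

Section MultRing.
Context {R : realType} {A : cstarAlg R}.
Local Notation M := (mult A).
Implicit Types m x y g h p t : M.

Lemma mring_mul1 : left_id (mone A) (@mmul R A).
Proof. by move=> m; exact: mult_ext. Qed.
Lemma mring_mulr1 : right_id (mone A) (@mmul R A).
Proof. by move=> m; exact: mult_ext. Qed.
Lemma mring_mulDl : left_distributive (@mmul R A) +%R.
Proof. by move=> m n p; exact: mult_ext. Qed.
Lemma mring_mulDr : right_distributive (@mmul R A) +%R.
Proof. by move=> m n p; apply: mult_ext => x /=; rewrite (islinD (mult_lin m)). Qed.
HB.instance Definition _ := GRing.Zmodule_isPzRing.Build M
  (@multalg_mulA R A) mring_mul1 mring_mulr1 mring_mulDl mring_mulDr.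

Lemma mscAl (k : R[i]) m (n : M) : (k *: m) * n = k *: (m * n).
Proof. exact: mult_ext. Qed.
Lemma mscAr (k : R[i]) m (n : M) : m * (k *: n) = k *: (m * n).
Proof. by apply: mult_ext => x /=; rewrite (islinZ (mult_lin m)). Qed.
Lemma mstarM m (n : M) : mstar (m * n) = mstar n * mstar m.
Proof. exact: mult_ext. Qed.
Lemma mstarK m : mstar (mstar m) = m.
Proof. exact: mult_ext. Qed.
Lemma mstarD m (n : M) : mstar (m + n) = mstar m + mstar n.
Proof. exact: mult_ext. Qed.
Lemma mstarZ (k : R[i]) m : mstar (k *: m) = k^* *: mstar m.
Proof. exact: mult_ext. Qed.
Lemma mstarN m : mstar (- m) = - mstar m.
Proof. by rewrite -scaleN1r mstarZ rmorphN1 scaleN1r. Qed.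
Lemma mstarB m (n : M) : mstar (m - n) = mstar m - mstar n.
Proof. by rewrite mstarD mstarN. Qed.
Lemma mstar1 : mstar (1 : M) = 1.
Proof. exact: mult_ext. Qed.
Lemma mstar0 : mstar (0 : M) = 0.
Proof. exact: mult_ext. Qed.
Lemma mstarX m k : mstar (m ^+ k) = mstar m ^+ k.
Proof. by elim: k => [|k IH]; rewrite ?expr0 ?mstar1// exprS mstarM IH -exprSr. Qed.
Lemma mstar_sum (I : Type) (r : seq I) (F : I -> M) :
  mstar (\sum_(i <- r) F i) = \sum_(i <- r) mstar (F i).
Proof. by elim/big_rec2: _ => [|i y x _ <-]; rewrite ?mstar0 ?mstarD. Qed.

Lemma nmM m (n : M) : nm (m * n) <= nm m * nm n. Proof. exact: opn_mul. Qed.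
Lemma nm_mstar m : nm (mstar m) = nm m. Proof. exact: opn_star. Qed.
Lemma nm_mstarM m : nm (mstar m * m) = nm m ^+ 2. Proof. exact: opn_starmul. Qed.
Lemma nm_Mmstar m : nm (m * mstar m) = nm m ^+ 2.
Proof. by rewrite -{1}(mstarK m) nm_mstarM nm_mstar. Qed.
Lemma nm1_le : nm (1 : M) <= 1.
Proof. by apply: opn_le => // x; rewrite mul1r. Qed.
Lemma nmMl K m (n : M) : nm m <= K -> nm (m * n) <= K * nm n.
Proof. by move=> h; rewrite (le_trans (nmM _ _))// ler_wpM2r ?nm_ge0. Qed.
Lemma nm_mstarM1 u : mstar u * u = 1 -> nm u <= 1.
Proof.
move=> h; rewrite -(@ler_pXn2r _ 2) ?nnegrE ?nm_ge0// expr1n -nm_mstarM h.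
exact: nm1_le.
Qed.
Lemma nmX_le1 m k : nm m <= 1 -> nm (m ^+ k) <= 1.
Proof.
move=> h; elim: k => [|k IH]; first by rewrite expr0 nm1_le.
by rewrite exprS (le_trans (nmMl _ h))// mul1r.
Qed.

Lemma nm_rsc (e : R) m : nm (e%:C%C *: m) = `|e| * nm m.
Proof. by rewrite nmZ cabs_real. Qed.
Lemma mstar_rsc (e : R) m : mstar (e%:C%C *: m) = e%:C%C *: mstar m.
Proof. by rewrite mstarZ; congr (_ *: _); exact: conjc_real. Qed.

(* The Newton-type iteration s <- (x + s^2)/2 solves (1 - s)^2 = 1 - x.       *)
Lemma msqrt g (r : R) : mstar g = g -> nm (1 - g) <= r -> r < 1 ->
  exists v, [/\ mstar v = v, v * v = g, forall y, y * g = g * y -> y * v = v * y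
    & forall P : M -> Prop, (forall u l, (forall n : nat, P (u n)) -> slim u l -> P l) ->
      P 0 -> (forall y, P y -> P (2^-1 *: ((1 - g) + y * y))) -> P (1 - v)].
Proof.
move=> gs gr r1; pose x := 1 - g; have xr : nm x <= r by [].
have r0 : 0 <= r by exact: le_trans (nm_ge0 _) xr.
pose u := fix u (n : nat) : M := if n is k.+1 then 2^-1 *: (x + u k * u k) else 0.
have c2 : cabs (2^-1 : R[i]) = 2^-1 by rewrite cabsV cabs_nat.
have ub n : nm (u n) <= r.
  elim: n => [|n IH]; first by rewrite nm0.
  rewrite /= nmZ c2 mulrC ler_pdivrMr// mulr_natr mulr2n.
  rewrite (le_trans (nmD _ _))// lerD// (le_trans (nmMl _ IH))//.
  by rewrite -[leRHS]mulr1 ler_wpM2l// (le_trans IH)// ltW.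
have [|//|n|s us _] := @geo_complete R M u r r; first exact: r0.
- elim: n => [|n IH].
    rewrite subr0 /= mulr0 addr0 expr0 mulr1 nmZ c2.
    by rewrite (le_trans _ xr)// ler_piMl ?nm_ge0// invf_le1// ler1n.
  rewrite [u n.+2]/= [X in _ - X]/= -scalerBr opprD addrACA subrr add0r nmZ c2.
  have -> : u n.+1 * u n.+1 - u n * u n = u n.+1 * (u n.+1 - u n) + (u n.+1 - u n) * u n.
    by rewrite mulrBr mulrBl addrA subrK.
  rewrite mulrC ler_pdivrMr// mulr_natr mulr2n exprS mulrCA.
  rewrite (le_trans (nmD _ _))// lerD// (le_trans (nmM _ _))//.
    by rewrite ler_pM ?nm_ge0.
  by rewrite mulrC ler_pM ?nm_ge0.
have lim_eq (F G : M -> M) : bdlin F -> bdlin G -> (forall n, F (u n) = G (u n)) -> F s = G s.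
  move=> [Fl [K K0 hK]] [Gl [L L0 hL]] h; apply/eqP; rewrite -subr_eq0; apply/eqP.
  apply: (@nm_eps _ _ _ (K + L)) => e e0; have [N /(_ N (leqnn N)) hN] := us e e0.
  have -> : F s - G s = F (s - u N) - G (s - u N).
    by rewrite (islinB Fl) (islinB Gl) h opprB addrA subrK.
  rewrite mulrDl (le_trans (nmB _ _))// lerD//.
    by rewrite (le_trans (hK _))// ler_wpM2l// ltW// nmBC.
  by rewrite (le_trans (hL _))// ler_wpM2l// ltW// nmBC.
have sE : s = 2^-1 *: (x + s * s).
  apply/eqP; rewrite -subr_eq0; apply/eqP; apply: (@nm_eps _ _ _ (1 + (nm s + r))) => e e0.
  have [N hN] := us e e0; have h1 := hN N.+1 (leqnSn N); have h0 := hN N (leqnn N).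
  have -> : s - 2^-1 *: (x + s * s) = - (u N.+1 - s) + 2^-1 *: (u N * u N - s * s).
    rewrite scalerBr scalerDr (_ : u N.+1 = 2^-1 *: x + 2^-1 *: (u N * u N)); last first.
      by rewrite -scalerDr.
    by rewrite opprB !opprD -!addrA addKr.
  rewrite mulrDl mul1r (le_trans (nmD _ _))// nmN lerD ?(ltW h1)//.
  rewrite nmZ c2 (@le_trans _ _ (nm (u N * u N - s * s)))//.
    by rewrite ler_piMl ?nm_ge0// invf_le1// ler1n.
  have -> : u N * u N - s * s = s * (u N - s) + (u N - s) * u N.
    by rewrite mulrBr mulrBl [RHS]addrC addrA subrK.
  rewrite [leRHS]mulrDl (le_trans (nmD _ _))// lerD// (le_trans (nmM _ _))//.
    by rewrite ler_wpM2l ?nm_ge0// ltW.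
  by rewrite mulrC ler_pM ?nm_ge0// ltW.
exists (1 - s); split.
- rewrite mstarB mstar1; congr (1 - _).
  apply/eqP; rewrite -subr_eq0; apply/eqP; apply: (@nm_eps _ _ _ (1 + 1)) => e e0.
  have us' n : mstar (u n) = u n.
    by elim: n => [|n IH]/=; rewrite ?mstar0// mstarZ mstarD mstarM IH mstarB mstar1 gs fmorphV rmorph_nat.
  have [N /(_ N (leqnn N)) hN] := us e e0.
  have -> : mstar s - s = (u N - s) - mstar (u N - s) by rewrite mstarB us' opprB [RHS]addrC addrA subrK.
  rewrite (le_trans (nmB _ _))// nm_mstar mulrDl mul1r lerD ?ltW//.
- rewrite mulrBl mul1r mulrBr mulr1 opprB addrA.
  have -> : s * s = s + s - x.
    by rewrite {3 4}sE -scalerDr half_addv addrC addKr.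
  rewrite /x opprB -!addrA addKr [s + (g + _)]addrCA [1 + _]addrCA.
  by rewrite [s + (_ + _)]addrCA !subrr addr0 subrr addr0.
- move=> y yg; rewrite mulrBr mulrBl mulr1 mul1r; congr (_ - _).
  apply: (lim_eq (fun z => y * z) (fun z => z * y)).
  + exact: (@cmulr_bd R (multalg A) y).
  + exact: (@cmull_bd R (multalg A) y).
  + elim=> [|n IH] /=; first by rewrite mulr0 mul0r.
    rewrite mscAr mscAl mulrDr mulrDl mulrA IH -mulrA IH mulrA; congr (_ *: (_ + _)).
    by rewrite mulrBr mulrBl mulr1 mul1r yg.
(* A closed property that the iteration preserves passes to the limit. In [asqrt] this keeps 1 - v
   inside A although v is only a multiplier. *)
- move=> P Pl P0 PS; rewrite opprB addrC subrK; apply: Pl us.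
  by elim=> [|n IH] //; exact: PS.
Qed.
End MultRing.

(** * Positivity, states and approximate units *)

Section Positivity.
Context {R : realType} {A : cstarAlg R}.
Local Notation M := (mult A).
Implicit Types m x y g h p t c : M.
Local Notation rsc e m := (e%:C%C *: (m : M)).

(* For bounded [h = h^*], positivity means [|1 - e h| <= 1] for all small [e >= 0]. *)
Definition pos1 h := mstar h = h /\ exists2 e0 : R, 0 < e0 &
  forall e : R, 0 <= e -> e <= e0 -> nm (1 - rsc e h) <= 1.

Lemma rscA (e d : R) m : rsc e (rsc d m) = rsc (e * d) m.
Proof. by rewrite scalerA -rmorphM. Qed.
Lemma rsc1 m : rsc 1 m = m. Proof. by rewrite rmorph1 scale1r. Qed.
Lemma rscDl (e d : R) m : rsc (e + d) m = rsc e m + rsc d m.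
Proof. by rewrite rmorphD scalerDl. Qed.
Lemma rscNl (e : R) m : rsc (- e) m = - rsc e m.
Proof. by rewrite rmorphN scaleNr. Qed.
Lemma rsc_half : (2^-1 : R)%:C%C = 2^-1 :> R[i].
Proof. by rewrite fmorphV rmorph_nat. Qed.
Lemma i_sqr : 'i%C * 'i%C = -1 :> R[i].
Proof. by rewrite -expr2 sqr_i. Qed.
Lemma conj_i : ('i%C : R[i])^* = - 'i%C.
Proof. by apply/eqP; rewrite eq_complex/= oppr0 !eqxx. Qed.

Lemma nm_half m n : nm (2^-1 *: (m + n)) <= 2^-1 * (nm m + nm n).
Proof. by rewrite nmZ cabsV cabs_nat ler_wpM2l ?invr_ge0// nmD. Qed.

(** With q the square root of 1 + p^2, which commutes with p, the element u = q + p is unitary: p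
    plays the role of i sin and q that of cos. This replaces functional calculus. *)
Lemma unitary_skew p : mstar p = - p -> nm (p * p) < 1 ->
  exists u, [/\ mstar u * u = 1, u * mstar u = 1, u - mstar u = p + p
    & u * u + mstar u * mstar u = (1 + (p * p + p * p)) + (1 + (p * p + p * p))].
Proof.
move=> ps pl.
have gs : mstar (1 + p * p) = 1 + p * p by rewrite mstarD mstar1 mstarM ps mulrNN.
have g1 : nm (1 - (1 + p * p)) <= nm (p * p) by rewrite opprD addrA subrr sub0r nmN.
have [q [qs qq qc _]] := msqrt gs g1 pl.
have qp : p * q = q * p by apply: qc; nring.
exists (q + p); rewrite mstarD qs ps; split.
- by rewrite mulrBl !mulrDr qq qp; zmod.
- by rewrite mulrDl !mulrBr qq qp; zmod.
- zmod.
- by rewrite ?(mulrDl, mulrDr, mulNr, mulrN, opprK) qq qp; zmod.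
Qed.

(** The identity cos 2x = 1 - 2 (sin x)^2: for p = i (e/2)^(1/2) r the element 1 - e r^2 is the mean
    of u^2 and its adjoint, with u unitary, and so has norm at most 1. *)
Lemma pos1_sqr r : mstar r = r -> pos1 (r * r).
Proof.
move=> rs; split; first by rewrite mstarM rs.
have K0 : 0 < nm (r * r) + 1 by rewrite ltr_wpDl ?nm_ge0.
exists (nm (r * r) + 1)^-1 => [|e e0 e1]; first by rewrite invr_gt0.
pose p := ('i%C * (Num.sqrt (e / 2))%:C%C) *: r.
have pp : p * p = - rsc (e / 2) (r * r).
  rewrite /p mscAl mscAr scalerA -scaleNr; congr (_ *: _).
  rewrite mulrACA i_sqr mulN1r -rmorphM -expr2 sqr_sqrtr// divr_ge0//.
have ps : mstar p = - p.
  rewrite /p mstarZ rs -scaleNr; congr (_ *: _).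
  by rewrite rmorphM/= conj_i mulNr; congr (- (_ * _)); exact: conjc_real.
have [|u [u1 u2 _ u3]] := unitary_skew ps.
  rewrite pp nmN nm_rsc ger0_norm ?divr_ge0// mulrAC ltr_pdivrMr// mul1r.
  apply: le_lt_trans (_ : 1 < 2); last by rewrite ltr1n.
  rewrite (le_trans (ler_wpM2r (nm_ge0 _) e1))// mulrC ler_pdivrMr// mul1r.
  by rewrite lerDl.
have -> : 1 - rsc e (r * r) = 2^-1 *: (u * u + mstar u * mstar u).
  rewrite u3 half_addv pp [in LHS](splitr e) rscDl; zmod.
have nu : nm u <= 1 by exact: nm_mstarM1.
have nus : nm (mstar u) <= 1 by rewrite nm_mstar.
rewrite (le_trans (nm_half _ _))// mulrC ler_pdivrMr// mul1r -[2]/(1 + 1).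
by apply: lerD; rewrite (le_trans (nmM _ _))// mulr_ile1 ?nm_ge0.
Qed.

Lemma pos1D h k : pos1 h -> pos1 k -> pos1 (h + k).
Proof.
move=> [hs [e1 e10 h1]] [ks [e2 e20 h2]]; split; first by rewrite mstarD hs ks.
exists (Num.min e1 e2 / 2) => [|e e0]; first by rewrite divr_gt0// lt_min e10.
rewrite ler_pdivlMr// le_min => /andP[ee1 ee2].
have -> : 1 - rsc e (h + k) = 2^-1 *: ((1 - rsc (e * 2) h) + (1 - rsc (e * 2) k)).
  rewrite -[LHS]half_addv; congr (_ *: _); rewrite mulr_natr mulr2n !rscDl scalerDr; zmod.
rewrite (le_trans (nm_half _ _))// mulrC ler_pdivrMr// mul1r -[2]/(1 + 1).
by apply: lerD; [apply: h1|apply: h2]; rewrite ?mulr_ge0.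
Qed.

Lemma pos1_0 : pos1 0.
Proof.
split; [exact: mstar0|exists 1 => // e _ _].
by rewrite scaler0 subr0 nm1_le.
Qed.

Lemma pos1Z (s : R) h : 0 <= s -> pos1 h -> pos1 (rsc s h).
Proof.
rewrite le_eqVlt => /orP[/eqP<- _|s0]; first by rewrite scale0r; exact: pos1_0.
move=> [hs [e1 e10 h1]]; split; first by rewrite mstar_rsc hs.
exists (e1 / s) => [|e e0]; first by rewrite divr_gt0.
by rewrite ler_pdivlMr// rscA => ee; apply: h1 => //; rewrite mulr_ge0// ltW.
Qed.

Lemma pos1Mn h k : pos1 h -> pos1 (h *+ k).
Proof.
by move=> hp; elim: k => [|k IH]; rewrite ?mulr0n ?mulrS; [exact: pos1_0|exact: pos1D].
Qed.

Lemma pos1_sum (I : Type) (r : seq I) (F : I -> M) :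
  (forall i, pos1 (F i)) -> pos1 (\sum_(i <- r) F i).
Proof. by move=> hF; elim/big_ind: _ => //; [exact: pos1_0|exact: pos1D]. Qed.

(** The shift by d brings a small multiple of h + d within distance less than 1 of the identity, as
    [msqrt] requires. *)
Lemma pos1_sqrt h (d : R) : 0 < d -> pos1 h ->
  exists v, [/\ mstar v = v, v * v = h + rsc d 1 & forall y, y * h = h * y -> y * v = v * y].
Proof.
(* Since e d is at most 1/2 and e at most e1/2, the rescaled parameter e / (1 - e d) is still at
   most e1, where positivity of h is known. *)
move=> d0 [hs [e1 e10 h1]]; pose e := Num.min (e1 / 2) (2 * d)^-1.
have e0 : 0 < e by rewrite lt_min divr_gt0//= invr_gt0 mulr_gt0.
have ed : e * d <= 2^-1.
  have : e <= (2 * d)^-1 by rewrite ge_min lexx orbT.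
  rewrite (_ : 2^-1 = (2 * d)^-1 * d) ?ler_pM2r//.
  by field; rewrite gt_eqF.
have ee1 : e * 2 <= e1 by rewrite -ler_pdivlMr// ge_min lexx.
have r0 : 0 < 1 - e * d by lra.
have r1 : 1 - e * d < 1 by rewrite ltrBlDr ltrDl mulr_gt0.
pose g := rsc e (h + rsc d 1).
have gs : mstar g = g by rewrite /g mstar_rsc mstarD hs mstar_rsc mstar1.
have g1 : nm (1 - g) <= 1 - e * d.
  have -> : 1 - g = rsc (1 - e * d) (1 - rsc (e / (1 - e * d)) h).
    rewrite [RHS]scalerBr rscA mulrCA divff ?gt_eqF// mulr1 rscDl rsc1 /g scalerDr rscA.
    by rewrite rscNl; zmod.
  rewrite nm_rsc (ger0_norm (ltW r0)) ler_piMr ?(ltW r0)//; apply: h1.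
    by rewrite divr_ge0 ?(ltW e0) ?(ltW r0).
  rewrite ler_pdivrMr// (le_trans _ (_ : (e * 2) * 2^-1 <= _))//.
    by rewrite -mulrA mulfV ?mulr1// pnatr_eq0.
  by rewrite ler_pM// ?mulr_ge0// ?(ltW e0)//; lra.
have [w [ws ww wc _]] := msqrt gs g1 r1.
exists (rsc (Num.sqrt e)^-1 w); split.
- by rewrite mstar_rsc ws.
- rewrite mscAl mscAr rscA ww /g rscA -invfM -expr2 sqr_sqrtr ?ltW// mulVf ?gt_eqF//.
  by rewrite rsc1.
- move=> y yh; rewrite mscAr mscAl wc// /g mscAr mscAl; congr (_ *: _).
  by rewrite mulrDr mulrDl yh mscAr mscAl mulr1 mul1r.
Qed.

(** The roots v of h + d and w of k - h + d commute, so z = v + i w satisfies z^* z = k + 2 d. As v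
    is the real part of z, the norm of h + d = v^2 is at most k + 2 d. *)
Lemma pos1_le h (k : R) : 0 <= k -> pos1 h -> pos1 (rsc k 1 - h) -> nm h <= k.
Proof.
move=> k0 hp kp; apply/ler_addgt0Pr => e e0.
pose d := e / 3; have d0 : 0 < d by rewrite divr_gt0.
have [v [vs vv vc]] := pos1_sqrt d0 hp; have [w [ws ww wc]] := pos1_sqrt d0 kp.
have vh : h * v = v * h by exact: vc.
have vw : v * w = w * v by apply: wc; rewrite mulrBr mulrBl vh mscAr mscAl mulr1 mul1r.
pose z := v + 'i%C *: w.
have zs : mstar z = v - 'i%C *: w by rewrite mstarD vs mstarZ ws conj_i scaleNr.
have zz : mstar z * z = rsc (k + d + d) 1.
  rewrite zs mulrBl !mulrDr !mscAl !mscAr scalerA i_sqr vw vv ww scaleN1r !rscDl; zmod.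
have kd : 0 <= k + d + d by rewrite !addr_ge0// ltW.
have nz : nm z ^+ 2 <= k + d + d.
  by rewrite -nm_mstarM zz nm_rsc ger0_norm// ler_piMr// nm1_le.
have nv : nm v <= nm z.
  have -> : v = 2^-1 *: (z + mstar z) by rewrite zs -[LHS]half_addv /z; congr (_ *: _); zmod.
  by rewrite (le_trans (nm_half _ _))// nm_mstar; lra.
have nh : nm (h + rsc d 1) <= k + d + d.
  by rewrite -vv (le_trans (nmM _ _))// (le_trans _ nz)// -expr2 lerXn2r ?nnegrE ?nm_ge0.
have -> : h = (h + rsc d 1) - rsc d 1 by zmod.
rewrite (le_trans (nmB _ _))//.
have n1 : nm (rsc d (1 : M)) <= d by rewrite nm_rsc gtr0_norm// ler_piMr ?(ltW d0)// nm1_le.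
by apply: le_trans (lerD nh n1) _; rewrite /d; lra.
Qed.

Lemma pos1_scalar h (k : R) : mstar h = h -> nm h <= k -> pos1 (rsc k 1 - h).
Proof.
move=> hs hk; split; first by rewrite mstarB mstar_rsc mstar1 hs.
have k1 : 0 < k + 1 by rewrite ltr_wpDl// (le_trans (nm_ge0 h)).
have k0 : 0 <= k by exact: le_trans (nm_ge0 h) hk.
exists (k + 1)^-1 => [|e e0 e1]; first by rewrite invr_gt0.
have ek : e * k <= 1.
  by rewrite (le_trans (ler_wpM2r k0 e1))// mulrC ler_pdivrMr// mul1r lerDl.
have -> : 1 - rsc e (rsc k 1 - h) = rsc (1 - e * k) 1 + rsc e h.
  by rewrite scalerBr rscA rscDl rsc1 rscNl; zmod.
rewrite (le_trans (nmD _ _))// !nm_rsc !ger0_norm ?subr_ge0//.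
have h1 : (1 - e * k) * nm (1 : M) <= 1 - e * k by rewrite ler_piMr ?subr_ge0// nm1_le.
have h2 : e * nm h <= e * k by rewrite ler_wpM2l.
by lra.
Qed.

Lemma pos1_mono h k : pos1 h -> pos1 (k - h) -> nm h <= nm k.
Proof.
move=> hp kp; apply: (pos1_le (nm_ge0 _) hp).
have ks : mstar k = k.
  by have [] := pos1D hp kp; rewrite addrC subrK.
have -> : rsc (nm k) 1 - h = (rsc (nm k) 1 - k) + (k - h) by zmod.
by apply: pos1D => //; exact: pos1_scalar.
Qed.

Lemma nm_pow2 g (m : nat) : mstar g = g -> nm (g ^+ (2 ^ m)) = nm g ^+ (2 ^ m).
Proof.
move=> gs; elim: m => [|m IH]; first by rewrite expn0 !expr1.
by rewrite expnS mulnC !exprM expr2 -{1}(_ : mstar (g ^+ (2 ^ m)) = g ^+ (2 ^ m)) ?nm_mstarM ?IH// mstarX gs.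
Qed.

(** For a selfadjoint g the C*-identity gives [nm (g ^+ n) = nm g ^+ n] when n is a power of 2. If
    the norm is 1 + d, Bernoulli's inequality makes the 2n-th power at least (n d)^2, which outgrows
    the linear bound. *)
Lemma pow_growth g (K : R) : 0 <= K -> mstar g = g ->
  (forall n : nat, nm (g ^+ n) <= 1 + n%:R * K) -> nm g <= 1.
Proof.
move=> K0 gs h; rewrite leNgt; apply/negP => g1.
pose d := nm g - 1; have d0 : 0 < d by rewrite subr_gt0.
have bern n : 1 + n%:R * d <= nm g ^+ n.
  elim: n => [|n IH]; first by rewrite mul0r addr0 expr0.
  have gE : nm g = 1 + d by rewrite /d addrC subrK.
  have g0 : 0 <= 1 + d by lra.
  rewrite exprS {1}gE; apply: le_trans (ler_wpM2l g0 IH).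
  have : 0 <= d * (n%:R * d) by rewrite !mulr_ge0// ltW.
  by rewrite -natr1; move: (n%:R) => N; lra.
have key (m : nat) : (2 ^ m)%:R * d ^+ 2 <= 1 + 2 * K.
  set n := (2 ^ m)%N; have n0 : 0 < n%:R :> R by rewrite ltr0n expn_gt0.
  have n1 : 1 <= n%:R :> R by rewrite ler1n expn_gt0.
  have h1 : (n%:R * d) ^+ 2 <= 1 + (n * 2)%:R * K.
    apply: le_trans (h (n * 2)%N); rewrite /n mulnC -expnS nm_pow2// expnS mulnC exprM.
    rewrite lerXn2r ?nnegrE ?mulr_ge0 ?exprn_ge0 ?nm_ge0// ?(ltW d0)//.
    by rewrite (le_trans _ (bern _))// lerDr.
  rewrite -(ler_pM2l n0); have -> : n%:R * (n%:R * d ^+ 2) = (n%:R * d) ^+ 2 by ring.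
  by apply: le_trans h1 _; rewrite natrM [leRHS]mulrDr mulr1 -mulrA lerD2r.
have [m hm] : exists m : nat, (1 + 2 * K) / d ^+ 2 < (2 ^ m)%:R.
  exists (Num.truncn ((1 + 2 * K) / d ^+ 2)).+1; apply: lt_trans (truncnS_gt _) _.
  by rewrite ltr_nat ltn_expl.
have := key m; rewrite -ler_pdivlMr ?exprn_gt0//.
by rewrite leNgt hm.
Qed.
End Positivity.

Section Fukamiya.
Context {R : realType} {A : cstarAlg R}.
Local Notation M := (mult A).
Local Notation rsc e m := (e%:C%C *: (m : M)).

(* Put [h = c^* c] and [T = 1 - h = S^2].  For [t = c S^n] one has            *)
(* [t^* t = T^n - T^(n+1) <= 1/n], hence [t t^* >= -1/n] and then             *)
(* [t^* t >= -1/n]; so [T^n] grows at most linearly.                          *)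
Lemma nm_1sub_starmul (c : M) : nm (mstar c * c) <= 2^-1 -> nm (1 - mstar c * c) <= 1.
Proof.
set h := mstar c * c => h2; pose T := 1 - h.
have hs : mstar h = h by rewrite /h mstarM mstarK.
have Ts : mstar T = T by rewrite /T mstarB mstar1 hs.
have T1 : nm (1 - T) <= 2^-1 by rewrite /T opprB addrC subrK.
have r1 : (2^-1 : R) < 1 by rewrite invf_lt1// ltr1n.
have [S [Ss SS _ _]] := msqrt Ts T1 r1.
have ST : GRing.comm S T by rewrite /GRing.comm -SS mulrA.
have SnSn n : S ^+ n * S ^+ n = T ^+ n by rewrite -SS exprMn_comm.
have Sns n : mstar (S ^+ n) = S ^+ n by rewrite mstarX Ss.
(* This says n (T^n - T^(n+1)) <= 1 - T^n. The difference of consecutive instances is n + 1 times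
   the square of the selfadjoint D = (T - 1) S^n. *)
have bpos n : pos1 ((T ^+ n.+1 - T ^+ n) *+ n - (T ^+ n - 1)).
  elim: n => [|n IH]; first by rewrite mulr0n expr0 subrr subrr; exact: pos1_0.
  pose D := (T - 1) * S ^+ n.
  have cD : S ^+ n * (T - 1) = (T - 1) * S ^+ n.
    apply/esym; apply: commrX; rewrite /GRing.comm mulrBl mulrBr mulr1 mul1r.
    by rewrite ST.
  have Ds : mstar D = D by rewrite /D mstarM Sns mstarB mstar1 Ts cD.
  have DD : D * D = (T ^+ n.+2 - T ^+ n.+1) - (T ^+ n.+1 - T ^+ n).
    rewrite /D mulrA -[_ * _ * (T - 1)]mulrA cD mulrA -mulrA SnSn.
    by rewrite !exprS; nring.
  have -> : (T ^+ n.+2 - T ^+ n.+1) *+ n.+1 - (T ^+ n.+1 - 1) =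
      ((T ^+ n.+1 - T ^+ n) *+ n - (T ^+ n - 1)) + (D * D) *+ n.+1.
    have zz (X Y a b o : M) : X - (a - o) = Y - (b - o) + (X - (Y + (a - b))) by zmod.
    by rewrite DD [X in _ = _ + X]mulrnBl (mulrSr (T ^+ n.+1 - T ^+ n)); exact: zz.
  by apply: pos1D => //; apply: pos1Mn; exact: pos1_sqr.
have step n : nm (T ^+ n.+1 - T ^+ n) <= 3.
  case: n => [|n].
    by rewrite expr1 expr0 nmBC (le_trans T1)//; lra.
  pose t := c * S ^+ n.+1; pose y := mstar t * t; pose z := t * mstar t.
  have yE : y = T ^+ n.+1 - T ^+ n.+2.
    rewrite /y /t mstarM Sns mulrA -[_ * mstar c * c]mulrA -/h.
    have -> : S ^+ n.+1 * h = h * S ^+ n.+1.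
      have -> : h = 1 - T by rewrite /T opprB addrC subrK.
      rewrite mulrBr mulrBl mulr1 mul1r; congr (_ - _).
      by apply/esym; exact: commrX.
    rewrite -mulrA SnSn; have -> : h = 1 - T by rewrite /T opprB addrC subrK.
    by rewrite mulrBl mul1r -exprS.
  have p1 : pos1 (1 - y *+ n.+1).
    have -> : 1 - y *+ n.+1 =
        ((T ^+ n.+2 - T ^+ n.+1) *+ n.+1 - (T ^+ n.+1 - 1)) + S ^+ n.+1 * S ^+ n.+1.
      by rewrite SnSn yE -mulNrn opprB; zmod.
    by apply: pos1D => //; exact: pos1_sqr.
  have p2 : pos1 (y + z).
    pose a := t + mstar t; pose b := 'i%C *: (t - mstar t).
    have -> : y + z = rsc 2^-1 (a * a + b * b).
      rewrite rsc_half -[LHS]half_addv; congr (_ *: _); rewrite /b mscAl mscAr scalerA.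
      rewrite i_sqr scaleN1r /a /y /z.
      by rewrite ?(mulrDl, mulrDr, mulNr, mulrN, opprK); zmod.
    apply: pos1Z; first by rewrite invr_ge0.
    apply: pos1D; apply: pos1_sqr; first by rewrite /a mstarD mstarK addrC.
    by rewrite /b mstarZ mstarB mstarK conj_i scaleNr -scalerN opprB.
  have p3 : pos1 (1 + z *+ n.+1).
    have -> : 1 + z *+ n.+1 = (y + z) *+ n.+1 + (1 - y *+ n.+1).
      by rewrite mulrnDl; zmod.
    by apply: pos1D => //; exact: pos1Mn.
  have ys : mstar y = y by rewrite /y mstarM mstarK.
  (* Positivity moves from t t^* to t^* t by intertwining: t^* G'^k = G^k t^*, where G' has norm at
     most 1. Hence the powers of G grow at most linearly and [pow_growth] applies. *)
  have p4 : pos1 (1 + y *+ n.+1).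
    have ysn : mstar (y *+ n.+1) = y *+ n.+1.
      by rewrite -scaler_nat mstarZ ys rmorph_nat.
    split; first by rewrite mstarD mstar1 ysn.
    have [_ [e1 e10 he]] := p3; exists (Num.min e1 1); first by rewrite lt_min e10/=.
    move=> e e0; rewrite le_min => /andP[ee1 ee2].
    set G := 1 - _; pose G' := 1 - rsc e (1 + z *+ n.+1).
    have G'1 : nm G' <= 1 by exact: he.
    have GG' : mstar t * G' = G * mstar t.
      rewrite /G /G' mulrBr mulrBl mulr1 mul1r mscAr mscAl mulrDr mulrDl mulr1 mul1r.
      by rewrite mulrnAr mulrnAl /z /y !mulrA.
    have GGk k : mstar t * G' ^+ k = G ^+ k * mstar t.
      elim: k => [|k IH]; first by rewrite !expr0 mulr1 mul1r.
      by rewrite exprSr mulrA IH -mulrA GG' mulrA -exprSr.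
    apply: (@pow_growth _ _ _ (n.+1%:R * nm t ^+ 2)).
    - by rewrite mulr_ge0// exprn_ge0// nm_ge0.
    - by rewrite /G mstarB mstar1 mstar_rsc mstarD mstar1 ysn.
    elim=> [|k IH]; first by rewrite expr0 mul0r addr0 nm1_le.
    have Gy : nm (G ^+ k * y) <= nm t ^+ 2.
      rewrite /y mulrA -GGk (le_trans (nmM _ _))// expr2 ler_wpM2r ?nm_ge0//.
      rewrite (le_trans (nmM _ _))// nm_mstar ler_piMr ?nm_ge0//.
      exact: nmX_le1.
    have -> : G ^+ k.+1 = rsc (1 - e) (G ^+ k) - rsc (e * n.+1%:R) (G ^+ k * y).
      rewrite exprSr {2}/G mulrBr mulr1 mscAr mulrDr mulr1 scalerDr mulrnAr -scaler_nat.
      rewrite [in RHS]rscDl rsc1 rscNl -rscA rmorph_nat.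
      by zmod.
    rewrite (le_trans (nmB _ _))// !nm_rsc !ger0_norm ?subr_ge0 ?mulr_ge0//.
    have h1 : (1 - e) * nm (G ^+ k) <= nm (G ^+ k).
      by rewrite ler_piMl ?nm_ge0// gerBl.
    have h3 : e * n.+1%:R * nm (G ^+ k * y) <= n.+1%:R * nm t ^+ 2.
      by rewrite -[leRHS]mul1r -mulrA ler_pM ?mulr_ge0 ?nm_ge0// ler_wpM2l.
    have -> : k.+1%:R = k%:R + 1 :> R by rewrite natr1.
    by rewrite mulrDl mul1r; lra.
  have p5 : nm (1 + y *+ n.+1) <= 2.
    apply: pos1_le => //; have -> : rsc 2 1 - (1 + y *+ n.+1) = 1 - y *+ n.+1.
      by rewrite -[2]/(1 + 1) rscDl rsc1; zmod.
    by [].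
  have p6 : nm (y *+ n.+1) <= 3.
    have -> : y *+ n.+1 = (1 + y *+ n.+1) - 1 by zmod.
    by rewrite (le_trans (nmB _ _))//; have := @nm1_le R A; lra.
  move: p6; rewrite -scaler_nat nmZ cabs_nat => p6.
  rewrite nmBC -yE (le_trans _ p6)// ler_peMl ?nm_ge0//.
  by rewrite ler1n.
(* The increments of the powers of T are bounded by 3 uniformly in n, so T^n grows at most
   linearly. *)
apply: (@pow_growth _ _ _ 3) => // n.
elim: n => [|n IH]; first by rewrite expr0 mul0r addr0 nm1_le.
have -> : T ^+ n.+1 = (T ^+ n.+1 - T ^+ n) + T ^+ n by zmod.
rewrite (le_trans (nmD _ _))// -natr1.
by have := step n; lra.
Qed.

Lemma pos1_starmul (c : M) : pos1 (mstar c * c).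
Proof.
split; first by rewrite mstarM mstarK.
have K0 : 0 < 2 * nm (mstar c * c) + 1 by rewrite ltr_wpDl ?mulr_ge0 ?nm_ge0.
exists (2 * nm (mstar c * c) + 1)^-1 => [|e e0 e1]; first by rewrite invr_gt0.
have -> : rsc e (mstar c * c) = mstar (rsc (Num.sqrt e) c) * rsc (Num.sqrt e) c.
  by rewrite mstar_rsc mscAl mscAr rscA -expr2 sqr_sqrtr.
apply: nm_1sub_starmul; rewrite mstar_rsc mscAl mscAr rscA -expr2 sqr_sqrtr//.
rewrite nm_rsc ger0_norm//.
have := nm_ge0 (mstar c * c); move: e1; set N := nm _ => e1 N0.
have : e * (2 * N + 1) <= 1 by rewrite -ler_pdivlMr ?mul1r.
by lra.
Qed.
End Fukamiya.

Section HahnBanach.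
Context {R : realType} {V : lmodType R[i]}.
Implicit Types (p q : V -> R) (x y : V).

Definition sublin p := (forall x y, p (x + y) <= p x + p y) /\
  (forall (r : R) x, 0 <= r -> p (r%:C%C *: x) = r * p x).

Lemma sublin0 p : sublin p -> p 0 = 0.
Proof. by move=> [_ h]; have := h 0 0 (lexx 0); rewrite scaler0 mul0r. Qed.

Lemma sublin_opp p x : sublin p -> - p (- x) <= p x.
Proof.
move=> ps; have := sublin0 ps; have [h _] := ps.
by have := h x (- x); rewrite subrr => h1 h0; lra.
Qed.

(** The infimum over t >= 0 of p(x + t x0) - t p(x0) is sublinear, lies below p, and is at most
    -p(x0) at -x0. A minimal sublinear p agrees with all these functionals and is therefore
    additive. *)
Definition shiftset p x0 x := [set p (x + t%:C%C *: x0) - t * p x0 | t in [set t : R | 0 <= t]].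
Definition shift p x0 x := inf (shiftset p x0 x).

Lemma shift_lb p x0 x : sublin p -> lbound (shiftset p x0 x) (- p (- x)).
Proof.
move=> [h1 h2] _ [t /= t0 <-]; have := h1 (- x) (x + t%:C%C *: x0).
by rewrite addrA addNr add0r h2//; lra.
Qed.

Lemma shift_le p x0 x t : sublin p -> 0 <= t ->
  shift p x0 x <= p (x + t%:C%C *: x0) - t * p x0.
Proof.
move=> ps t0; apply: ge_inf; last by exists t.
by exists (- p (- x)); exact: shift_lb.
Qed.

Lemma le_shift p x0 x c :
  (forall t, 0 <= t -> c <= p (x + t%:C%C *: x0) - t * p x0) -> c <= shift p x0 x.
Proof.
move=> h; apply: lb_le_inf; first by exists (p (x + 0%:C%C *: x0) - 0 * p x0), 0 => //=.
by move=> _ [t /= t0 <-]; exact: h.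
Qed.

Lemma shift_sublin p x0 : sublin p -> sublin (shift p x0).
Proof.
move=> ps; have [h1 h2] := ps; split.
- move=> x y; rewrite -lerBlDr; apply: le_shift => t t0; rewrite lerBlDl -lerBlDr.
  apply: le_shift => s s0; rewrite lerBlDl.
  rewrite (le_trans (shift_le x0 (x + y) ps (addr_ge0 t0 s0)))// mulrDl.
  have := h1 (x + t%:C%C *: x0) (y + s%:C%C *: x0).
  by rewrite addrACA -scalerDl -rmorphD; lra.
- move=> r x; rewrite le_eqVlt => /orP[/eqP<-|r0].
    rewrite mul0r scale0r; apply/eqP; rewrite eq_le; apply/andP; split.
      by have := shift_le x0 0 ps (lexx 0); rewrite scale0r addr0 (sublin0 ps) mul0r subr0.
    by apply: le_shift => t t0; rewrite add0r h2// subrr.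
  have scal t : p (r%:C%C *: x + t%:C%C *: x0) - t * p x0 =
      r * (p (x + (t / r)%:C%C *: x0) - (t / r) * p x0).
    rewrite mulrBr mulrA [r * (t / r)]mulrC divfK ?gt_eqF//.
    rewrite -(h2 r _ (ltW r0)).
    by rewrite scalerDr scalerA -rmorphM [r * (t / r)]mulrC divfK ?gt_eqF.
  apply/eqP; rewrite eq_le; apply/andP; split.
    rewrite -(ler_pdivrMl _ _ r0); apply: le_shift => t t0; rewrite (ler_pdivrMl _ _ r0).
    have := shift_le x0 (r%:C%C *: x) ps (mulr_ge0 t0 (ltW r0)).
    by rewrite scal mulfK ?gt_eqF.
  apply: le_shift => t t0; rewrite scal ler_pM2l//; apply: shift_le => //.
  by rewrite divr_ge0// ltW.
Qed.

Lemma shift_le_id p x0 x : sublin p -> shift p x0 x <= p x.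
Proof.
by move=> ps; have := shift_le x0 x ps (lexx 0); rewrite scale0r addr0 mul0r subr0.
Qed.

(* Minimal sublinear functionals are linear. *)
Lemma hahn_banach q x0 : sublin q -> exists f : V -> R,
  [/\ forall x y, f (x + y) = f x + f y,
      forall (r : R) x, f (r%:C%C *: x) = r * f x,
      forall x, f x <= q x & q x0 <= f x0].
Proof.
(* The search for a minimal functional starts below the shift of q, not below q: its value at -x0 is
   at most -q(x0), which gives [q x0 <= f x0] for the linear f found below it. *)
move=> qs; pose q0 := shift q x0; have q0s : sublin q0 by exact: shift_sublin.
pose T := {p : V -> R | sublin p /\ forall x, p x <= q0 x}.
(* The order is reversed, so that a maximal element for [Zorn] is a minimal functional. *)
pose le (p p' : T) := `[< forall x, sval p' x <= sval p x >].
have q0T : T := exist _ q0 (conj q0s (fun x => lexx (q0 x))).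
have [||||p pmin] := @Zorn T le.
- by move=> p; apply/asboolP.
- move=> p p' p'' /asboolP h1 /asboolP h2; apply/asboolP => x.
  exact: le_trans (h2 x) (h1 x).
- move=> [p hp] [p' hp'] /asboolP h1 /asboolP h2.
  have e : p = p' by apply/funext => x; apply/eqP; rewrite eq_le h2 h1.
  by subst p'; congr exist; exact: Prop_irrelevance.
- move=> C Ctot; have [[s0 Cs0]|C0] := pselect (exists s, C s); last first.
    by exists q0T => s Cs; case: C0; exists s.
  pose S x := [set sval s x | s in C]; pose m x := inf (S x).
  have lb (s : T) x : - q0 (- x) <= sval s x.
    case: s => [p [ps pq]] /=; rewrite (le_trans _ (sublin_opp x ps))//.
    by rewrite lerN2.
  have mle s x : C s -> m x <= sval s x.
    by move=> Cs; apply: ge_inf; [exists (- q0 (- x)) => _ [t _ <-]|exists s].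
  have lem c x : (forall s, C s -> c <= sval s x) -> c <= m x.
    move=> h; apply: lb_le_inf; first by exists (sval s0 x), s0.
    by move=> _ [t Ct <-]; exact: h.
  have ms : sublin m.
    split=> [x y|r x].
    - suff : m (x + y) - m y <= m x by lra.
      apply: (lem _ _) => s Cs; suff : m (x + y) - sval s x <= m y by lra.
      apply: (lem _ _) => s' Cs'; suff : m (x + y) <= sval s x + sval s' y by lra.
      have [/asboolP h|/asboolP h] := Ctot s s' Cs Cs'.
      + rewrite (le_trans (mle s' _ Cs'))//.
        by case: (svalP s') => [[h1 _] _]; rewrite (le_trans (h1 _ _))// lerD2r.
      + rewrite (le_trans (mle s _ Cs))//.
        by case: (svalP s) => [[h1 _] _]; rewrite (le_trans (h1 _ _))// lerD2l.
    - rewrite le_eqVlt => /orP[/eqP<-|r0].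
        rewrite mul0r scale0r; apply/eqP; rewrite eq_le; apply/andP; split.
          by rewrite (le_trans (mle s0 _ Cs0))//; case: (svalP s0) => [h _]; rewrite sublin0.
        by apply: (lem _ _) => s _; case: (svalP s) => [h _]; rewrite sublin0.
      apply/eqP; rewrite eq_le; apply/andP; split.
        rewrite -(ler_pdivrMl _ _ r0); apply: (lem _ _) => s Cs; rewrite (ler_pdivrMl _ _ r0).
        rewrite (le_trans (mle s _ Cs))//; case: (svalP s) => [[_ h2] _].
        by rewrite h2// ltW.
      apply: (lem _ _) => s Cs; case: (svalP s) => [[_ h2] _].
      by rewrite h2 ?(ltW r0)// ler_pM2l// mle.
  have mq x : m x <= q0 x by rewrite (le_trans (mle s0 x Cs0))//; case: (svalP s0).
  by exists (exist _ m (conj ms mq)) => s Cs; apply/asboolP => x /=; exact: mle.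
- case: p pmin => [p [ps pq]] pmin.
  have psup x y : p x + p y <= p (x + y).
    have s1 := shift_sublin y ps.
    have s2 z : shift p y z <= q0 z by exact: le_trans (shift_le_id y z ps) (pq z).
    have s3 : le (exist _ p (conj ps pq)) (exist _ (shift p y) (conj s1 s2)).
      by apply/asboolP => z /=; exact: shift_le_id.
    have /(congr1 sval)/= e := pmin _ s3.
    have := shift_le y x ps ler01; rewrite e.
    by rewrite rmorph1 scale1r mul1r; lra.
  have pD x y : p (x + y) = p x + p y.
    by apply/eqP; rewrite eq_le psup andbT; case: (ps) => h _; exact: h.
  have pN x : p (- x) = - p x.
    by have := pD (- x) x; rewrite addNr sublin0//; lra.
  exists p; split=> //.
  + move=> r x; have [r0|r0] := leP 0 r; first by case: (ps) => _ ->.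
    have -> : r%:C%C *: x = - ((- r)%:C%C *: x) by rewrite rmorphN scaleNr opprK.
    by rewrite pN; case: (ps) => _ -> //; rewrite ?oppr_ge0 ?(ltW r0)// mulNr opprK.
  + by move=> x; rewrite (le_trans (pq x))//; exact: shift_le_id.
  + have := pq (- x0); have := shift_le x0 (- x0) qs ler01.
    rewrite rmorph1 scale1r addNr sublin0// mul1r pN -/q0.
    by rewrite /q0; lra.
Qed.
End HahnBanach.

Section States.
Context {R : realType} {A : cstarAlg R}.
Local Notation M := (mult A).
Local Notation rsc e m := (e%:C%C *: (m : M)).
Implicit Types (a b c x : A).

Lemma emb_lin : islin (@emb R A).
Proof. by move=> k a b; apply: mult_ext => x /=; rewrite cmulDl. Qed.
Lemma embM a b : emb (a ** b) = emb a * emb b.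
Proof. by apply: mult_ext => x /=; rewrite cmulA. Qed.
Lemma emb_star a : emb (star a) = mstar (emb a).
Proof. exact: mult_ext. Qed.
Lemma emb_mact (m : M) a : emb (m a) = m * emb a.
Proof. by apply: mult_ext => x /=; rewrite multM. Qed.
Lemma nm_emb a : nm (emb a) = nm a.
Proof. exact: opn_emb. Qed.
Lemma nm_mact (m : M) a : nm (m a) <= nm m * nm a.
Proof. exact: opnP. Qed.
Lemma mactM (m n : M) a : (m * n) a = m (n a). Proof. by []. Qed.
Lemma mact1 a : (1 : M) a = a. Proof. by []. Qed.

Definition hpart (m : M) : M := 2^-1 *: (m + mstar m).
(** [qfun m] is the distance of the real part of m to the negatives of positive elements. A
    real-linear functional below it is contractive, nonnegative on positive elements and zero on
    skew-adjoint ones. *)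
Definition qset (m : M) := [set nm (hpart m + p) | p in @pos1 R A].
Definition qfun (m : M) : R := inf (qset m).

Lemma qfun_le m p : pos1 p -> qfun m <= nm (hpart m + p).
Proof.
move=> pp; apply: ge_inf; last by exists p.
by exists 0 => _ [r _ <-]; exact: nm_ge0.
Qed.

Lemma le_qfun m (k : R) : (forall p, pos1 p -> k <= nm (hpart m + p)) -> k <= qfun m.
Proof.
move=> h; apply: lb_le_inf; first by exists (nm (hpart m + 0)), 0 => //; exact: pos1_0.
by move=> _ [p pp <-]; exact: h.
Qed.

Lemma hpartD m n : hpart (m + n) = hpart m + hpart n.
Proof. by rewrite /hpart mstarD addrACA scalerDr. Qed.
Lemma hpartZ (r : R) m : hpart (rsc r m) = rsc r (hpart m).
Proof. by rewrite /hpart mstar_rsc -scalerDr !scalerA mulrC. Qed.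
Lemma hpart_sa m : mstar m = m -> hpart m = m.
Proof. by rewrite /hpart => ->; rewrite half_addv. Qed.
Lemma hpart_skew m : mstar m = - m -> hpart m = 0.
Proof. by rewrite /hpart => ->; rewrite subrr scaler0. Qed.
Lemma nm_hpart m : nm (hpart m) <= nm m.
Proof. by rewrite (le_trans (nm_half _ _))// nm_mstar; lra. Qed.

Lemma qfun_sublin : sublin (qfun : M -> R).
Proof.
split=> [m n|r m].
- suff : qfun (m + n) - qfun n <= qfun m by lra.
  apply: le_qfun => p pp; suff : qfun (m + n) - nm (hpart m + p) <= qfun n by lra.
  apply: le_qfun => q qp; have := qfun_le (m + n) (pos1D pp qp).
  have := nmD (hpart m + p) (hpart n + q).
  by rewrite hpartD [hpart m + p + _]addrACA; lra.
- rewrite le_eqVlt => /orP[/eqP<-|r0].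
    rewrite mul0r scale0r; apply/eqP; rewrite eq_le; apply/andP; split.
      have := qfun_le 0 (@pos1_0 R A).
      by rewrite hpart_sa ?mstar0// addr0 nm0.
    by apply: le_qfun => p _; exact: nm_ge0.
  apply/eqP; rewrite eq_le; apply/andP; split.
    rewrite -(ler_pdivrMl _ _ r0); apply: le_qfun => p pp; rewrite (ler_pdivrMl _ _ r0).
    rewrite (le_trans (qfun_le _ (pos1Z (ltW r0) pp)))// hpartZ -scalerDr nm_rsc.
    by rewrite gtr0_norm.
  apply: le_qfun => p pp; have r1 : 0 <= r^-1 by rewrite invr_ge0 ltW.
  have -> : hpart (rsc r m) + p = rsc r (hpart m + rsc r^-1 p).
    by rewrite scalerDr rscA mulfV ?gt_eqF// rsc1 hpartZ.
  by rewrite nm_rsc gtr0_norm// ler_pM2l//; apply: qfun_le; exact: pos1Z.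
Qed.

(** Hahn-Banach below [qfun] at c^* c: by monotonicity of the norm on positive elements, [qfun]
    takes there at least the value of the norm. The constant 2 comes from bounding the real and the
    imaginary part of the complexified functional separately. *)
Lemma exists_state c : exists f : A -> R[i]^o, [/\ posfun f,
  forall x, cabs (f x) <= 2 * nm x & nm c ^+ 2 <= complex.Re (f (star c ** c))].
Proof.
pose h0 : M := emb (star c ** c).
have h0E : h0 = mstar (emb c) * emb c by rewrite /h0 embM emb_star.
have [f [fD fZ fq f0]] := hahn_banach h0 qfun_sublin.
have fN m : f (- m) = - f m by have := fZ (-1) m; rewrite rscNl rsc1 mulN1r.
have fn m : f m <= nm m.
  rewrite (le_trans (fq m))// (le_trans (qfun_le m (@pos1_0 R A)))// addr0.
  exact: nm_hpart.
have fabs m : `|f m| <= nm m.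
  by rewrite ler_norml fn andbT lerNl -fN (le_trans (fn _))// nmN.
have fpos m : 0 <= f (mstar m * m).
  rewrite -oppr_le0 -fN (le_trans (fq _))//.
  rewrite (le_trans (qfun_le _ (pos1_starmul m)))//.
  by rewrite hpart_sa ?addNr ?nm0// mstarN mstarM mstarK.
have fskew m : mstar m = - m -> f m = 0.
  move=> ms; have h n : mstar n = - n -> f n <= 0.
    move=> ns; rewrite (le_trans (fq n))// (le_trans (qfun_le n (@pos1_0 R A)))//.
    by rewrite hpart_skew// addr0 nm0.
  apply/eqP; rewrite eq_le h//= -oppr_le0 -fN h//.
  by rewrite mstarN ms.
have f0' : nm c ^+ 2 <= f h0.
  rewrite (le_trans _ f0)//; apply: le_qfun => p pp.
  have h0s : mstar h0 = h0 by rewrite h0E mstarM mstarK.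
  rewrite hpart_sa// -nm_emb -nm_mstarM -h0E; apply: pos1_mono.
    by rewrite h0E; exact: pos1_starmul.
  by rewrite addrC addKr.
pose F m : R[i]^o := (f m +i* (- f ('i%C *: m)))%C.
have Flin : islin F.
  move=> k m n; case: k => a b.
  have kE : (a +i* b)%C = a%:C%C + 'i%C * b%:C%C :> R[i].
    by apply/eqP; rewrite eq_complex/= ?(mul0r, mulr0, mul1r, addr0, add0r, subr0, subrr) !eqxx.
  have e1 : f ((a +i* b)%C *: m) = a * f m + b * f ('i%C *: m).
    by rewrite kE scalerDl fD fZ ['i%C * _]mulrC -scalerA fZ.
  have e2 : f ('i%C *: ((a +i* b)%C *: m)) = a * f ('i%C *: m) - b * f m.
    rewrite scalerA kE mulrDr mulrA i_sqr scalerDl fD mulN1r scaleNr fN fZ.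
    by rewrite ['i%C * _]mulrC -scalerA fZ.
  apply/eqP; rewrite eq_complex /F/= scalerDr !fD e1 e2.
  by apply/andP; split; apply/eqP; ring.
exists (fun x => F (emb x)); split.
- split=> [k a b|a]; first by rewrite emb_lin Flin.
  rewrite embM emb_star lecE /F/= fpos andbT fskew ?oppr0//.
  by rewrite mstarZ mstarM mstarK conj_i scaleNr.
- move=> x; rewrite /F -lecR' -cabsE normc_def lecR.
  have h1 := fabs (emb x); have h2 := fabs ('i%C *: emb x).
  move: h1 h2; rewrite nmZ cabs_i mul1r nm_emb => h1 h2.
  rewrite -[leRHS]ger0_norm ?mulr_ge0 ?nm_ge0// -sqrtr_sqr ler_wsqrtr//= sqrrN exprMn.
  have : f (emb x) ^+ 2 <= nm x ^+ 2 by rewrite -real_normK ?num_real// lerXn2r ?nnegrE ?nm_ge0.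
  have : f ('i%C *: emb x) ^+ 2 <= nm x ^+ 2 by rewrite -real_normK ?num_real// lerXn2r ?nnegrE ?nm_ge0.
  have : 0 <= nm x ^+ 2 by rewrite exprn_ge0 ?nm_ge0.
  by lra.
- by rewrite /F/=.
Qed.

Section PosFun.
Variables (f : A -> R[i]^o) (fp : posfun f).
Definition psq a : R := complex.Re (f (star a ** a)).

Lemma posfunE a : f (star a ** a) = (psq a)%:C%C.
Proof. by case: fp => _ /(_ a) h; rewrite /psq RRe_real// ger0_real. Qed.

Lemma psq_ge0 a : 0 <= psq a.
Proof. by case: fp => _ /(_ a); rewrite posfunE lecR. Qed.

Lemma psq_bound (m : M) a : psq (m a) <= nm m ^+ 2 * psq a.
Proof.
have fl : islin f by case: fp.
apply/ler_addgt0Pr => e e0; pose d := e / (psq a + 1).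
have a1 : 0 < psq a + 1 by rewrite ltr_wpDl ?psq_ge0.
have d0 : 0 < d by rewrite divr_gt0.
have K0 : pos1 (rsc (nm m ^+ 2) 1 - mstar m * m).
  by apply: pos1_scalar; rewrite ?nm_mstarM// mstarM mstarK.
have [v [vs vv _]] := pos1_sqrt d0 K0.
have : psq (v a) = (nm m ^+ 2 + d) * psq a - psq (m a).
  rewrite /psq -[star (v a) ** v a]/(star (v a) ** v a) multP -[madj v (v a)]/((mstar v * v) a).
  rewrite vs vv multDE multBE multZE multZE mact1 cmulDr1 cmulBr !cmulZr.
  rewrite -[(mstar m * m) a]/(madj m (m a)) -multP.
  rewrite (islinD fl) (islinB fl) !(islinZ fl) !posfunE.
  by rewrite /= ?(mul0r, mulr0, subr0, addr0); ring.
have := psq_ge0 (v a); have : d * psq a <= e.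
  by rewrite /d mulrAC ler_pdivrMr// ler_wpM2l ?(ltW e0)// lerDl.
by lra.
Qed.
End PosFun.

(** Let H be the sum of all a a^* + a^* a and T = 1 - d H, of norm at most 1. The mean F of the
    first powers of T satisfies H F = (1 - T^N) / (d N) by telescoping, so F H F is small and F
    nearly kills every a and its adjoint. The approximate unit is 1 - F, of norm at most 1 + 1. *)
Lemma approx_unit (s : seq A) (e : R) : 0 < e ->
  exists d : A, [/\ star d = d, nm d <= 2
    & forall a, a \in s -> nm (a - d ** a) <= e /\ nm (a - a ** d) <= e].
Proof.
move=> e0; pose t a := emb a * mstar (emb a) + mstar (emb a) * emb a.
pose H : M := \sum_(a <- s) t a.
have tp a : pos1 (t a).
  apply: pos1D; last exact: pos1_starmul.
  by rewrite -{1}(mstarK (emb a)); exact: pos1_starmul.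
have Hp : pos1 H by exact: pos1_sum.
have [Hs [d d0 /(_ d (ltW d0) (lexx d)) T1]] := Hp.
set T := 1 - rsc d H in T1.
have Ts : mstar T = T by rewrite mstarB mstar1 mstar_rsc Hs.
have [N hN] : exists N : nat, 2 / (d * N.+1%:R) < e ^+ 2.
  exists (Num.truncn (2 / (d * e ^+ 2))).
  rewrite ltr_pdivrMr ?mulr_gt0// [ltRHS]mulrA -ltr_pdivrMl ?mulr_gt0 ?exprn_gt0//.
  rewrite mulrC [e ^+ 2 * d]mulrC; exact: truncnS_gt.
pose F := rsc N.+1%:R^-1 (\sum_(j < N.+1) T ^+ j).
have Fs : mstar F = F.
  by rewrite mstar_rsc mstar_sum; congr (_ *: _); apply: eq_bigr => j _; rewrite mstarX Ts.
have F1 : nm F <= 1.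
  rewrite nm_rsc ger0_norm ?invr_ge0// mulrC ler_pdivrMr// mul1r.
  rewrite (le_trans (nm_sum _ _ _))//.
  apply: le_trans (_ : \sum_(j < N.+1) (1 : R) <= _).
    by apply: ler_sum => j _; exact: nmX_le1.
  by rewrite sumr_const card_ord.
have FH : nm (F * H * F) <= e ^+ 2.
  have HE : H = rsc d^-1 (1 - T) by rewrite /T opprB addrC subrK rscA mulVf ?gt_eqF// rsc1.
  have FHE : H * F = rsc (d * N.+1%:R)^-1 (1 - T ^+ N.+1).
    rewrite HE /F mscAl mscAr rscA; congr (_%:C%C *: _); first by rewrite invfM.
    by rewrite -[LHS]opprK -mulNr opprB -subrX1 opprB.
  rewrite -mulrA (le_trans (nmM _ _))// (le_trans (ler_wpM2r (nm_ge0 _) F1))// mul1r.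
  rewrite FHE nm_rsc ger0_norm ?invr_ge0 ?mulr_ge0 ?(ltW d0)//.
  rewrite (le_trans _ (ltW hN))// mulrC ler_wpM2r ?invr_ge0 ?mulr_ge0 ?(ltW d0)//.
  rewrite (le_trans (nmB _ _))// -[2]/(1 + 1) lerD ?nm1_le//.
  exact: nmX_le1.
(* Neither 1 nor T lies in A, but each 1 - T^j does, by a recursion in j. *)
have [x Fx] : exists x : A, 1 - F = emb x.
  have [g hg] : exists g : nat -> A, forall j, 1 - T ^+ j = emb (g j).
    have [h hh] : exists h : A, rsc d H = emb h.
      exists (d%:C%C *: \sum_(a <- s) (a ** star a + star a ** a)).
      rewrite (islinZ emb_lin) (islin_sum emb_lin); congr (_ *: _).
      by apply: eq_bigr => a _; rewrite (islinD emb_lin) !embM emb_star.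
    pose g := fix g (n : nat) := if n is k.+1 then g k + h - h ** g k else 0.
    exists g; elim=> [|n IH]; first by rewrite expr0 subrr (islin0 emb_lin).
    rewrite /= (islinB emb_lin) (islinD emb_lin) embM -IH -hh exprS /T.
    by rewrite ?(mulrDl, mulrDr, mulNr, mulrN, opprK) !mul1r !mulr1; zmod.
  exists (N.+1%:R^-1%:C%C *: \sum_(j < N.+1) g j).
  rewrite (islinZ emb_lin) (islin_sum emb_lin) /F.
  have -> : \sum_(j < N.+1) emb (g j) = \sum_(j < N.+1) (1 : M) - \sum_(j < N.+1) T ^+ j.
    by rewrite -sumrB; apply: eq_bigr => j _; rewrite hg.
  have -> : \sum_(j < N.+1) (1 : M) = rsc N.+1%:R 1.
    by rewrite sumr_const card_ord -[LHS]scaler_nat rmorph_nat.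
  by rewrite scalerBr rscA mulVf ?pnatr_eq0// rsc1.
have small a : a \in s -> (forall b, b = a \/ b = star a -> nm (F b) <= e).
  move=> sa b hb; rewrite -(@ler_pXn2r _ 2) ?nnegrE ?nm_ge0 ?(ltW e0)//.
  rewrite (le_trans _ FH)// -nm_emb -nm_Mmstar emb_mact mstarM Fs.
  have [q [qp qE]] : exists q, pos1 (F * q * F) /\ H = emb b * mstar (emb b) + q.
    rewrite /H (big_rem a sa)/=; set G := \sum_(_ <- _) _.
    have conj p : pos1 (F * (p * mstar p) * F).
      have -> : F * (p * mstar p) * F = mstar (mstar p * F) * (mstar p * F).
        by rewrite mstarM mstarK Fs !mulrA.
      exact: pos1_starmul.
    have Gp : pos1 (F * G * F).
      rewrite /G mulr_sumr mulr_suml; apply: pos1_sum => c.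
      rewrite mulrDr mulrDl; apply: pos1D; first exact: conj.
      by rewrite -{2}(mstarK (emb c)); exact: conj.
    case: hb => ->; last rewrite emb_star mstarK.
      exists (mstar (emb a) * emb a + G); split; last by rewrite /t addrA.
      rewrite mulrDr mulrDl; apply: pos1D => //.
      by rewrite -{2}(mstarK (emb a)); exact: conj.
    exists (emb a * mstar (emb a) + G); split; last by rewrite /t addrA [_ + mstar _ * _]addrC.
    by rewrite mulrDr mulrDl; apply: pos1D.
  have -> : F * emb b * (mstar (emb b) * F) = F * (emb b * mstar (emb b)) * F by rewrite !mulrA.
  apply: pos1_mono.
    have -> : F * (emb b * mstar (emb b)) * F = mstar (mstar (emb b) * F) * (mstar (emb b) * F).
      by rewrite mstarM mstarK Fs !mulrA.
    exact: pos1_starmul.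
  by rewrite qE mulrDr mulrDl addrC addKr.
have xs : star x = x by apply: emb_inj; rewrite emb_star -Fx mstarB mstar1 Fs.
have Fa a : a - x ** a = F a.
  rewrite -[x ** a]/(emb x a) -Fx multBE mact1 opprB addrC subrK//.
exists x; split => //.
- rewrite -nm_emb -Fx (le_trans (nmB _ _))// -[2]/(1 + 1) lerD// nm1_le//.
- move=> a sa; split; first by rewrite Fa; apply: (small a sa); left.
  rewrite -nm_star starB starM xs Fa; apply: (small a sa); right.
  by [].
Qed.
End States.

Lemma the_spec (T : Type) (x0 : T) (P : T -> Prop) : (exists x, P x) -> P (the x0 P).
Proof. by move=> h; rewrite /the; case: pselect => // h'; exact: (projT2 (cid h')). Qed.

(** The default carries information: where existence is not known in advance, the void case is
    refuted by computing with it. *)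
Lemma the_none (T : Type) (x0 : T) (P : T -> Prop) : ~ (exists x, P x) -> the x0 P = x0.
Proof. by move=> h; rewrite /the; case: pselect. Qed.

(** * Homomorphisms and their extensions to multipliers *)

Section Homs.
Context {R : realType}.
Implicit Types A B D : cstarAlg R.

(** Here s = 1 - (1 - a)^(1/2), and the equation means (1 - s)^2 = 1 - a. In this form it mentions
    no unit and is preserved by homomorphisms. *)
Lemma asqrt A (a : A) : star a = a -> nm a <= 2^-1 ->
  exists2 s : A, star s = s & s + s - s ** s = a.
Proof.
move=> sa a1; have gs : mstar (1 - emb a) = 1 - emb a.
  by rewrite mstarB mstar1 -emb_star sa.
have g1 : nm (1 - (1 - emb a)) <= 2^-1 by rewrite opprB addrC subrK nm_emb.
have r1 : (2^-1 : R) < 1 by rewrite invf_lt1// ltr1n.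
have [v [vs vv _ vP]] := msqrt gs g1 r1.
have [|||s sE] := vP (fun m => exists x : A, m = emb x).
- move=> u l /choice[x ux] ul; have [|y yx] := @complete_seq R A x.
    move=> e e0; have e20 : 0 < e / 2 by rewrite divr_gt0.
    have [N hN] := ul _ e20; exists N => n m Nn Nm.
    rewrite -nm_emb (islinB (@emb_lin R A)) -!ux (splitr e).
    by rewrite (le_lt_trans (nm_tri l _ _))// ltrD ?hN// nmBC hN.
  exists y; apply/eqP; rewrite -subr_eq0; apply/eqP; apply: (@nm_eps _ _ _ 2) => e e0.
  have [N hN] := ul _ e0; have [N' hN'] := yx _ e0; pose k := maxn N N'.
  rewrite (le_trans (nm_tri (u k) _ _))// mulrDl mul1r lerD//.
    by rewrite nmBC ltW// hN// leq_maxl.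
  by rewrite ux -(islinB (@emb_lin R A)) nm_emb ltW// hN'// leq_maxr.
- by exists 0; rewrite (islin0 (@emb_lin R A)).
- move=> _ [x ->]; exists (2^-1 *: (a + x ** x)).
  by rewrite (islinZ (@emb_lin R A)) (islinD (@emb_lin R A)) embM opprB (addrC 1) subrK.
have vE : v = 1 - emb s by rewrite -sE opprB addrC subrK.
exists s; apply: emb_inj.
  by rewrite emb_star -sE mstarB mstar1 vs.
rewrite (islinB (@emb_lin R A)) (islinD (@emb_lin R A)) embM.
have -> : emb a = 1 - v * v by rewrite vv opprB addrC subrK.
by rewrite vE; nring.
Qed.

Lemma ismhom_lin A B (p : A -> mult B) : ismhom p -> islin p.
Proof. by move=> [h _ _] k a b; apply: mult_ext => x; exact: h. Qed.

Lemma ismhomM A B (p : A -> mult B) a b : ismhom p -> p (a ** b) = p a * p b.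
Proof. by move=> [_ h _]; exact: h. Qed.
Lemma ismhomS A B (p : A -> mult B) a : ismhom p -> p (star a) = mstar (p a).
Proof. by move=> [_ _ h]; exact: h. Qed.

Lemma ismhom_emb A B (h : A -> B) : ishom h -> ismhom (fun a => emb (h a)).
Proof.
move=> [hl hm hs]; split=> [b k x y|a b|a] /=.
- by rewrite hl cmulDl.
- by rewrite hm embM.
- by rewrite hs emb_star.
Qed.

Lemma ismhom_id A : ismhom (@emb R A).
Proof. by apply: (@ismhom_emb A A id); split. Qed.

(** For s with s + s - s^2 = a^* a, the difference of the two sides is the value of [psq f] at (1 -
    p(s)) x. *)
Lemma mhom_psq_half A B (p : A -> mult B) (f : B -> R[i]^o) a x :
  ismhom p -> posfun f -> nm (star a ** a) <= 2^-1 -> psq f (p a x) <= psq f x.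
Proof.
move=> ph fp a1; have fl : islin f by case: fp.
have [|s ss sE] := @asqrt A (star a ** a) _ a1; first by rewrite starM starK.
have := psq_ge0 fp ((1 - p s) x); suff -> : psq f ((1 - p s) x) = psq f x - psq f (p a x) by lra.
have star_act (m n : mult B) y : star (m y) ** n y = star y ** (mstar m * n) y.
  by rewrite multP.
have ps : mstar (1 - p s) * (1 - p s) = 1 - mstar (p a) * p a.
  rewrite mstarB mstar1 -(ismhomS _ ph) ss -(ismhomS _ ph) -(ismhomM _ _ ph) -sE.
  have pl := ismhom_lin ph; rewrite (islinB pl) (islinD pl) (ismhomM _ _ ph); nring.
rewrite /psq star_act ps multBE mact1 cmulBr (islinB fl) raddfB/=.
by rewrite -star_act.
Qed.

Lemma psqZ B (f : B -> R[i]^o) (r : R) x : posfun f -> psq f (r%:C%C *: x) = r ^+ 2 * psq f x.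
Proof.
move=> [fl _]; rewrite /psq starZ cmulZl cmulZr scalerA (islinZ fl).
have -> : (r%:C%C^* * r%:C%C : R[i]) = (r ^+ 2)%:C%C.
  by rewrite expr2 rmorphM; congr (_ * _); exact: conjc_real.
by case: (f _) => u v /=; rewrite mul0r subr0.
Qed.

Lemma mhom_psq A B (p : A -> mult B) (f : B -> R[i]^o) a x :
  ismhom p -> posfun f -> psq f (p a x) <= 2 * nm a ^+ 2 * psq f x.
Proof.
move=> ph fp; have pl := ismhom_lin ph.
have [/eqP/nm_eq0->|a0] := boolP (nm a == 0).
  rewrite (islin0 pl) mult0E /psq cmul0r (islin0 (proj1 fp)) nm0 expr0n/= mulr0 mul0r.
  exact: lexx.
have a1 : 0 < nm a by rewrite lt_neqAle eq_sym a0 nm_ge0.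
pose r := (Num.sqrt 2 * nm a)^-1.
have s2 : 0 < Num.sqrt 2 :> R by rewrite sqrtr_gt0.
have r0 : 0 < r by rewrite invr_gt0 mulr_gt0.
have r2 : r ^+ 2 * (2 * nm a ^+ 2) = 1.
  by rewrite exprVn exprMn sqr_sqrtr// mulVf// gt_eqF// mulr_gt0// exprn_gt0.
have h : nm (star (r%:C%C *: a) ** (r%:C%C *: a)) <= 2^-1.
  rewrite nm_starmul nmZ cabs_real gtr0_norm// exprMn.
  have h : 2 * (r ^+ 2 * nm a ^+ 2) = 1 by rewrite mulrCA.
  by lra.
have := mhom_psq_half x ph fp h; rewrite (islinZ pl) multZE psqZ// => h1.
have r2p : 0 < r ^+ 2 by rewrite exprn_gt0.
by rewrite -(ler_pM2l r2p) [leRHS]mulrA r2 mul1r.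
Qed.

Lemma psq_le_nm B (f : B -> R[i]^o) (K : R) x : posfun f ->
  (forall y, cabs (f y) <= K * nm y) -> 0 <= K -> psq f x <= K * nm x ^+ 2.
Proof.
move=> fp fK K0; rewrite /psq (le_trans (ler_norm _))// (le_trans (Re_le_cabs _))//.
by rewrite (le_trans (fK _))// nm_starmul.
Qed.

(** Homomorphisms are automatically bounded. In squared norms, one factor 2 comes from scaling a
    into the range of [asqrt] and one from the bound on the norming functional. *)
Lemma mhom_bound A B (p : A -> mult B) a : ismhom p -> nm (p a) <= 2 * nm a.
Proof.
move=> ph; apply: opn_le => [|x]; first by rewrite mulr_ge0 ?nm_ge0.
have [f [fp fK fx]] := exists_state (p a x).
rewrite -(@ler_pXn2r _ 2) ?nnegrE ?mulr_ge0 ?nm_ge0// (le_trans fx)//.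
rewrite (le_trans (mhom_psq a x ph fp))//.
have h2 := psq_le_nm x fp fK (ler0n R 2).
apply: le_trans (ler_wpM2l _ h2) _; first by rewrite mulr_ge0// exprn_ge0 ?nm_ge0.
by rewrite !exprMn; lra.
Qed.

Lemma mhom_bdlin A B (p : A -> mult B) : ismhom p -> bdlin p.
Proof. by move=> ph; split; [exact: ismhom_lin|exists 2 => // x; exact: mhom_bound]. Qed.

Lemma hom_bdlin A B (h : A -> B) : ishom h -> bdlin h.
Proof.
move=> hh; split; first by case: hh.
by exists 2 => // x; rewrite -nm_emb; apply: (mhom_bound x (ismhom_emb hh)).
Qed.

Lemma mact_bdlin B (m : mult B) : bdlin m.
Proof. by split; [exact: mult_lin|exists (nm m) => [|x]; [exact: nm_ge0|exact: opnP]]. Qed.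

Lemma ev_bdlin B (x : B) : bdlin (fun m : mult B => m x).
Proof.
by split=> //; exists (nm x) => [|m]; [exact: nm_ge0|rewrite mulrC; exact: opnP].
Qed.

Lemma mult_eq_total B (S : set B) (m n : mult B) : cspan S = setT ->
  (forall x, S x -> m x = n x) -> m = n.
Proof.
move=> dS h; apply: mult_ext.
exact: dense_bdlin_eq dS (mact_bdlin m) (mact_bdlin n) h.
Qed.

Lemma adj_total B (S : set B) (n n' : B -> B) : cspan S = setT -> bdlin n -> bdlin n' ->
  (forall x y, S x -> S y -> star (n x) ** y = star x ** n' y) ->
  exists m : mult B, mact m = n.
Proof.
move=> dS nb n'b h.
have h1 x : S x -> forall y, star (n x) ** y = star x ** n' y.
  move=> Sx; apply: (dense_bdlin_eq dS (cmulr_bd _) (bdlin_comp n'b (cmulr_bd _))).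
  by move=> y Sy /=; exact: h.
have h2 x y : star (n x) ** y = star x ** n' y.
  apply: star_inj; rewrite !starM !starK; move: x.
  apply: (dense_bdlin_eq dS (bdlin_comp nb (cmulr_bd _)) (cmulr_bd _)) => x Sx /=.
  by apply: star_inj; rewrite !starM !starK h1.
by exists (Mult h2).
Qed.

Lemma opn_le_total B I (S : set B) (v : I -> B) (m : mult B) (K : R) : 0 <= K ->
  (forall y, S y <-> exists i, y = v i) -> cspan S = setT ->
  (forall s : seq (R[i] * I), nm (m (\sum_(p <- s) p.1 *: v p.2)) <=
                              K * nm (\sum_(p <- s) p.1 *: v p.2)) ->
  nm m <= K.
Proof.
move=> K0 hS dS h; apply: opn_le => // x; apply/ler_addgt0Pr => e e0.
have k0 : 0 < K + nm m + 1 by rewrite ltr_wpDl// addr_ge0// nm_ge0.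
have [s hs] : exists s : seq (R[i] * I), nm (x - \sum_(p <- s) p.1 *: v p.2) < e / (K + nm m + 1).
  by apply: (iffLR (cspan_nmP x hS)); rewrite ?dS// divr_gt0.
set y := \sum_(p <- s) _ in hs; have hy := h s.
have h1 : nm (m x) <= nm (m (x - y)) + nm (m y).
  by rewrite (islinB (mult_lin m)) -{1}(subrK (m y) (m x)) nmD.
have h2 : nm (m (x - y)) <= nm m * nm (x - y) by exact: opnP.
have h3 : nm y <= nm (x - y) + nm x by rewrite nmBC -{1}(subrK x y) nmD.
have h4 : K * nm y <= K * (nm (x - y) + nm x) by rewrite ler_wpM2l.
have h5 : (K + nm m) * nm (x - y) <= e.
  move: hs; rewrite ltr_pdivlMr// => hs.
  by have := nm_ge0 (x - y); move: hs; rewrite -/y; nra.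
by rewrite -/y in hy; lra.
Qed.

Section Mext.
Context {A B : cstarAlg R} (p : A -> mult B) (pn : nondeg p).
Let ph : ismhom p. Proof. by case: pn. Qed.
Let dS : cspan [set y | exists a b, y = p a b] = setT. Proof. by case: pn. Qed.
Let hS y : [set y | exists a b, y = p a b] y <-> exists i : A * B, y = p i.1 i.2.
Proof. by split=> [[a [b ->]]|[[a b] ->]]; [exists (a, b)|exists a, b]. Qed.

(** For an approximate unit d of the finitely many first components, p(m a) b is close to p(m d)
    p(a) b, and m d lies in A. The constant is 2 for p times 2 for the norm of d. *)
Lemma mext_bound (m : mult A) (s : seq (R[i] * (A * B))) :
  nm (\sum_(q <- s) q.1 *: p (m q.2.1) q.2.2) <=
  4 * nm m * nm (\sum_(q <- s) q.1 *: p q.2.1 q.2.2).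
Proof.
have pl := ismhom_lin ph; set w := \sum_(q <- s) _ *: p q.2.1 _.
pose K := \sum_(q <- s) cabs q.1 * (2 * nm m * nm q.2.2).
have K0 : 0 <= K by rewrite sumr_ge0// => q _; rewrite !mulr_ge0 ?nm_ge0 ?cabs_ge0.
apply/ler_addgt0Pr => e e0; have e1 : 0 < e / (K + 1) by rewrite divr_gt0// ltr_wpDl.
have [d [_ d2 hd]] := approx_unit [seq q.2.1 | q <- s] e1.
have -> : \sum_(q <- s) q.1 *: p (m q.2.1) q.2.2 =
    \sum_(q <- s) q.1 *: p (m (q.2.1 - d ** q.2.1)) q.2.2 + p (m d) w.
  rewrite /w (islin_sum (mult_lin _)) -big_split/=; apply: eq_bigr => q _.
  rewrite (islinZ (mult_lin _)) -scalerDr (islinB (mult_lin m)) multM (islinB pl).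
  by rewrite (ismhomM _ _ ph) multBE subrK.
rewrite (le_trans (nmD _ _))// addrC lerD//.
  rewrite (le_trans (opnP _ _))// ler_wpM2r ?nm_ge0// (le_trans (mhom_bound _ ph))//.
  by have := nm_mact m d; have := nm_ge0 m; nra.
rewrite (le_trans (nm_sum _ _ _))//; apply: le_trans (_ : K * (e / (K + 1)) <= _).
  rewrite /K mulr_suml big_seq [leRHS]big_seq; apply: ler_sum => q qs.
  rewrite nmZ -mulrA ler_wpM2l ?cabs_ge0// (le_trans (opnP _ _))// mulrAC.
  rewrite ler_wpM2r ?nm_ge0// (le_trans (mhom_bound _ ph))// -!mulrA ler_wpM2l//.
  have [|h _] := hd q.2.1; first exact: map_f.
  by apply: le_trans (nm_mact m _) _; rewrite ler_wpM2l// nm_ge0.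
by rewrite mulrCA ler_piMr ?(ltW e0)// ler_pdivrMr ?mul1r ?lerDl// ltr_wpDl.
Qed.

Lemma mext_exists (m : mult A) : exists n : mult B, forall a b, n (p a b) = p (m a) b.
Proof.
have ex (k : mult A) : exists f : B -> B, [/\ islin f, forall x, nm (f x) <= 4 * nm k * nm x
    & forall i : A * B, f (p i.1 i.2) = p (k i.1) i.2].
  apply: (@ext_total _ _ _ _ (fun i : A * B => p i.1 i.2)
    (fun i : A * B => p (k i.1) i.2) _ _ _ hS dS (mext_bound k)).
  by rewrite mulr_ge0 ?nm_ge0.
have [n [nl nb nE]] := ex m; have [n' [n'l n'b n'E]] := ex (mstar m).
have nbd (k : mult A) f : islin f -> (forall x, nm (f x) <= 4 * nm k * nm x) -> bdlin (f : B -> B).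
  by move=> fl fb; split=> //; exists (4 * nm k) => //; rewrite mulr_ge0 ?nm_ge0.
have [|N NE] := adj_total dS (nbd m n nl nb) (nbd _ _ n'l n'b).
  move=> _ _ [a [b ->]] [a' [b' ->]].
  rewrite (nE (a, b)) (n'E (a', b'))/= !multP -![madj (p _) _]/(mstar (p _) _).
  by rewrite -!(ismhomS _ ph) -![p _ (p _ _)]/((p _ * p _) _) -!(ismhomM _ _ ph) multP.
by exists N => a b; rewrite NE (nE (a, b)).
Qed.

Lemma mextP (m : mult A) a b : mext p m (p a b) = p (m a) b.
Proof. by move: a b; exact: (the_spec _ (mext_exists m)). Qed.

Lemma mext_uniq (m : mult A) (n : mult B) :
  (forall a b, n (p a b) = p (m a) b) -> mext p m = n.
Proof.
by move=> h; apply: (mult_eq_total dS) => _ [a [b ->]]; rewrite mextP h.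
Qed.

Lemma mextM m n : mext p (m * n) = mext p m * mext p n.
Proof. by apply: mext_uniq => a b; rewrite mactM !mextP. Qed.
Lemma mext1 : mext p 1 = 1.
Proof. exact: mext_uniq. Qed.
Lemma mext_lin : islin (mext p).
Proof.
move=> k m n; apply: mext_uniq => a b.
by rewrite multDE multZE !mextP (ismhom_lin ph).
Qed.
Lemma mext_emb a : mext p (emb a) = p a.
Proof. by apply: mext_uniq => x b; rewrite /= (ismhomM _ _ ph). Qed.
Lemma mext_star m : mext p (mstar m) = mstar (mext p m).
Proof.
apply: (mult_eq_total dS) => _ [a [b ->]]; rewrite mextP.
apply: cmul_nondeg; move=> x; rewrite -multP; move: x.
have h : (fun x : B => star x ** p (mstar m a) b) = (fun x => star (mext p m x) ** p a b).
  apply/funext => x; apply: star_inj; rewrite !starM !starK; move: x.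
  apply: (dense_bdlin_eq dS (cmulr_bd _) (bdlin_comp (mact_bdlin _) (cmulr_bd _))).
  move=> _ [a' [b' ->]] /=; rewrite mextP !multP -![madj (p _) _]/(mstar (p _) _).
  rewrite -!(ismhomS _ ph) -![p _ (p _ _)]/((p _ * p _) _) -!(ismhomM _ _ ph).
  by rewrite multP'.
by move=> x; rewrite -[LHS]/((fun x : B => star x ** p (mstar m a) b) x) h.
Qed.
End Mext.

Lemma mext_id A (m : mult A) : nondeg (@emb R A) -> mext (@emb R A) m = m.
Proof. by move=> h; apply: (mext_uniq h) => a b /=; rewrite multM. Qed.

Lemma nondeg_emb A : nondeg (@emb R A).
Proof.
split; first exact: ismhom_id.
rewrite -subTset => x _; apply/closure_nmP => e e0.
have [|d [_ _ hd]] := @approx_unit R A [:: x] (e / 2); first by rewrite divr_gt0.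
exists (d ** x); last first.
  have [|h _] := hd x; first by rewrite mem_seq1.
  by rewrite (le_lt_trans h)// ltr_pdivrMr// ltr_pMr// ltr1n.
exists 1%N, (fun=> 1), (fun=> d ** x); split; first by move=> _; exists d, x.
by rewrite big_ord1 scale1r.
Qed.

Lemma mext_emb_id A (m : mult A) : mext (@emb R A) m = m.
Proof. exact: mext_id (@nondeg_emb A). Qed.

End Homs.

(** Cauchy-Schwarz for a form whose Hermitian symmetry is not known: that b' is the conjugate of b
    is forced by k = 1 and k = i. *)
Lemma cs_abs (R : realType) (a b b' c : R[i]) : 0 <= a -> 0 <= c ->
  (forall k : R[i], 0 <= a + k * b + k^* * b' + k^* * k * c) ->
  cabs b ^+ 2 <= complex.Re a * complex.Re c.
Proof.
case: a => ar ai; case: c => cr ci; rewrite !lecE /= => /andP[/eqP-> a0] /andP[/eqP-> c0] h.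
have h1 := h 1; have h2 := h ('i)%C.
have bb' : b' = b^*%C.
  move: h1 h2; case: b {h} => br bi; case: b' => br' bi'; rewrite !lecE /= => /andP[/eqP e1 _] /andP[/eqP e2 _].
  by congr (_ +i* _)%C; lra.
pose be := cabs b ^+ 2.
have hs (s : R) : 0 <= ar - 2 * s * be + s ^+ 2 * be * cr.
  have := h (- s%:C%C * b^*%C); rewrite bb' -lecR' /be.
  have -> : (- s%:C%C * b^*%C)^* = - s%:C%C * b.
    by case: (b) => u v; rewrite /Num.conj /=; congr (_ +i* _)%C; ring.
  have -> : (ar - 2 * s * cabs b ^+ 2 + s ^+ 2 * cabs b ^+ 2 * cr)%:C%C =
    ar%:C%C - (s%:C%C * (cabs b ^+ 2)%:C%C + s%:C%C * (cabs b ^+ 2)%:C%C) + s%:C%C ^+ 2 * (cabs b ^+ 2)%:C%C * cr%:C%C.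
    rewrite !expr2; apply/eqP; rewrite eq_complex /=; apply/andP.
    by split; apply/eqP; ring.
  rewrite cabs_sqr -[(ar +i* 0)%C]/(ar%:C%C) -[(cr +i* 0)%C]/(cr%:C%C) => H.
  apply: le_trans H _; rewrite le_eqVlt; apply/orP; left; apply/eqP; ring.
have be0 : 0 <= be by rewrite exprn_ge0 ?cabs_ge0.
(* If c = 0, the expression is affine in s and takes the value -1 at s = (a + 1) / (2 be), unless be
   = 0. Otherwise s = 1/c is its minimum. *)
rewrite -/be; have [c00|cn] := eqVneq cr 0.
  rewrite c00 in hs *; rewrite mulr0; have [//|bp] := leP be 0.
  have bn : be != 0 by rewrite gt_eqF.
  have := hs ((ar + 1) / (2 * be)); have -> : 2 * ((ar + 1) / (2 * be)) * be = ar + 1 by field.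
  by lra.
have cp : 0 < cr by rewrite lt_neqAle eq_sym cn.
have := hs cr^-1; have -> : ar - 2 * cr^-1 * be + cr^-1 ^+ 2 * be * cr = ar - be / cr by field.
by rewrite subr_ge0 ler_pdivrMr.
Qed.

(** * Minimal tensor products *)

Section MinTensor.
Context {R : realType}.
Implicit Types A C T : cstarAlg R.

Section Forms.
Variables (A C : cstarAlg R) (f : A -> R[i]^o) (g : C -> R[i]^o).
(** The inner product of y and x in the tensor product of the GNS spaces of f and g. *)
Definition tform (y x : seq (A * C)) : R[i] :=
  \sum_(q <- y) \sum_(p <- x) (f (star q.1 ** p.1) * g (star q.2 ** p.2) : R[i]).

Lemma tform_catl y y' x : tform (y ++ y') x = tform y x + tform y' x.
Proof. by rewrite /tform big_cat. Qed.

Lemma tform_catr y x x' : tform y (x ++ x') = tform y x + tform y x'.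
Proof. by rewrite /tform -big_split/=; apply: eq_bigr => q _; rewrite big_cat. Qed.

Definition tscale (k : R[i]) (x : seq (A * C)) := [seq (k *: p.1, p.2) | p <- x].

Lemma tform_scaler k y x : islin f -> tform y (tscale k x) = k * tform y x.
Proof.
move=> fl; rewrite /tform big_distrr/=; apply: eq_bigr => q _.
rewrite big_map big_distrr/=; apply: eq_bigr => p _.
by rewrite /= cmulZr (islinZ fl) mulrA.
Qed.

Lemma tform_scalel k y x : islin f -> tform (tscale k y) x = k^* * tform y x.
Proof.
move=> fl; rewrite /tform big_distrr/= big_map; apply: eq_bigr => q _.
rewrite big_distrr/=; apply: eq_bigr => p _.
by rewrite /= starZ cmulZl (islinZ fl) mulrA.
Qed.
End Forms.

Definition tlmul A C (x y : seq (A * C)) := [seq (p.1 ** q.1, p.2 ** q.2) | p <- x, q <- y].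

Section Tensor.
Variables (A C T : cstarAlg R) (t : A -> C -> T).
Definition zt (x : seq (A * C)) : T := \sum_(p <- x) t p.1 p.2.
Hypothesis ht : is_min_tensor t.

Lemma tens_linl c : islin (fun a => t a c). Proof. by case: ht => -[]. Qed.
Lemma tens_linr a : islin (t a). Proof. by case: ht => -[]. Qed.
Lemma tensM a a' c c' : t a c ** t a' c' = t (a ** a') (c ** c').
Proof. by case: ht => _ ->. Qed.
Lemma tens_star a c : star (t a c) = t (star a) (star c).
Proof. by case: ht => _ _ ->. Qed.
Lemma tens_total : cspan [set x | exists a c, x = t a c] = setT.
Proof. by case: ht. Qed.

Lemma zt_mul x y : zt (tlmul x y) = zt x ** zt y.
Proof.
rewrite /zt big_allpairs_dep/= cmul_suml; apply: eq_bigr => p _.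
by rewrite cmul_sumr; apply: eq_bigr => q _; rewrite tensM.
Qed.
Lemma zt_cat x y : zt (x ++ y) = zt x + zt y. Proof. by rewrite /zt big_cat. Qed.
Lemma zt_scale k x : zt (tscale k x) = k *: zt x.
Proof.
by rewrite /zt big_map scaler_sumr; apply: eq_bigr => p _; rewrite (islinZ (tens_linl _)).
Qed.
Lemma zt_dense (z : T) (e : R) : 0 < e -> exists x, nm (z - zt x) < e.
Proof.
move=> e0; have hS y : [set x | exists a c, x = t a c] y <-> exists i : A * C, y = t i.1 i.2.
  by split=> [[a [b ->]]|[[a b] ->]]; [exists (a, b)|exists a, b].
have [s zs] : exists s : seq (R[i] * (A * C)), nm (z - \sum_(p <- s) p.1 *: t p.2.1 p.2.2) < e.
  by apply: (iffLR (cspan_nmP z hS)); rewrite ?tens_total.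
exists [seq (p.1 *: p.2.1, p.2.2) | p <- s]; rewrite /zt big_map.
by under eq_bigr => p _ do rewrite (islinZ (tens_linl _)).
Qed.

Lemma tform_norm x (r : R) : 0 <= r -> (nm (zt x) <= r <->
  forall f g, posfun f -> posfun g -> forall y,
   tform f g (tlmul x y) (tlmul x y) <= (r ^+ 2)%:C%C * tform f g y y).
Proof.
move=> r0; have [_ _ _ _ h] := ht.
have r0' : 0 <= r%:C%C by rewrite lecR.
have := h x _ r0'; rewrite -/(zt x) nmE lecR => ->.
have E f g y : \sum_(q <- y) \sum_(p <- x) \sum_(p' <- x) \sum_(q' <- y)
    (f (star (p.1 ** q.1) ** (p'.1 ** q'.1)) *
     g (star (p.2 ** q.2) ** (p'.2 ** q'.2)) : R[i]) = tform f g (tlmul x y) (tlmul x y).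
  rewrite /tform big_allpairs_dep/= exchange_big/=; apply: eq_bigr => q _.
  by apply: eq_bigr => p _; rewrite big_allpairs_dep.
by split=> H f g fp gp y; have := H f g fp gp y; rewrite E rmorphXn.
Qed.

(** Positivity of the product form is read off from the norm condition itself, applied to the empty
    sum with r = 1. *)
Lemma tform_ge0 f g (y : seq (A * C)) : posfun f -> posfun g -> 0 <= tform f g y y.
Proof.
move=> fp gp; have : nm (zt [::]) <= 1 by rewrite /zt big_nil nm0.
move=> /(tform_norm _ ler01)/(_ f g fp gp y); rewrite /tlmul/=.
by rewrite {1}/tform big_nil expr1n mul1r.
Qed.

Lemma tform_cs f g (y x : seq (A * C)) : posfun f -> posfun g ->
  cabs (tform f g y x) ^+ 2 <= complex.Re (tform f g y y) * complex.Re (tform f g x x).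
Proof.
move=> fp gp; apply: (cs_abs (b' := tform f g x y)); [exact: tform_ge0..|] => k.
have := tform_ge0 (y ++ tscale k x) fp gp; have fl : islin f by case: fp.
by rewrite tform_catl !tform_catr !(tform_scaler, tform_scalel)// !addrA !mulrA [k * _^*]mulrC.
Qed.

(** With v^2 = |m|^2 + eta - m^* m, the form at v y is nonnegative, and its real part is |m|^2 + eta
    times that at y minus that at m y. *)
Lemma tform_mact f g (m : mult A) (y : seq (A * C)) : posfun f -> posfun g ->
  complex.Re (tform f g [seq (m q.1, q.2) | q <- y] [seq (m q.1, q.2) | q <- y])
  <= nm m ^+ 2 * complex.Re (tform f g y y).
Proof.
move=> fp gp; have fl : islin f by case: fp.
apply/ler_addgt0Pr => e e0; set N := nm m ^+ 2.
set q0 := complex.Re (tform f g y y).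
have q00 : 0 <= q0 by have := tform_ge0 y fp gp; rewrite lecE/= => /andP[].
have d0 : 0 < e / (q0 + 1) by rewrite divr_gt0// ltr_wpDl.
have ms : mstar (mstar m * m) = mstar m * m by rewrite mstarM mstarK.
have [|v [vs vv _]] := pos1_sqrt d0 (pos1_scalar (k := N) ms _).
  by rewrite nm_mstarM.
have E (w : mult A) : complex.Re (tform f g [seq (w q.1, q.2) | q <- y] [seq (w q.1, q.2) | q <- y]) =
   \sum_(q <- y) \sum_(p <- y) complex.Re (f (star q.1 ** (mstar w * w) p.1) * g (star q.2 ** p.2) : R[i]).
  rewrite /tform big_map raddf_sum; apply: eq_bigr => q _.
  by rewrite big_map raddf_sum; apply: eq_bigr => p _; rewrite /= multP.
have := tform_ge0 [seq (v q.1, q.2) | q <- y] fp gp; rewrite lecE/= => /andP[_]; rewrite !E.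
rewrite vs vv; set eta := e / _; set s := (X in 0 <= X); set s' := (X in _ -> X <= _).
have -> : s = (N + eta) * q0 - s'.
  rewrite /q0 /tform raddf_sum mulr_sumr -sumrB; apply: eq_bigr => q _.
  rewrite raddf_sum mulr_sumr -sumrB; apply: eq_bigr => p _ /=.
  rewrite !(cmulDr1, cmulZr) !(islinD fl) !(islinZ fl).
  case: (f _) => a b; case: (f _) => a' b'; case: (g _) => c d /=.
  by ring.
move=> h; have : eta * q0 <= e by rewrite /eta mulrAC ler_pdivrMr ?ltr_wpDl// ler_pM2l// lerDl.
by rewrite mulrDl in h; lra.
Qed.

Lemma tens_mact_bound (m : mult A) x :
  nm (zt [seq (m q.1, q.2) | q <- x]) <= nm m * nm (zt x).
Proof.
have := nm_ge0 m; have := nm_ge0 (zt x) => x0 m0.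
apply/tform_norm; first exact: mulr_ge0.
move=> f g fp gp y.
have -> : tlmul [seq (m q.1, q.2) | q <- x] y = [seq (m q.1, q.2) | q <- tlmul x y].
  rewrite /tlmul map_allpairs allpairs_mapl; apply: eq_allpairs => p q /=.
  by rewrite multM.
have /tform_norm/(_ f g fp gp y) := lexx (nm (zt x)); move=> /(_ x0).
have h0 := tform_ge0 [seq (m q.1, q.2) | q <- tlmul x y] fp gp.
have h1 := tform_ge0 y fp gp; have h2 := tform_ge0 (tlmul x y) fp gp.
have := tform_mact m (tlmul x y) fp gp.
move: h0 h1 h2; case: (tform _ _ _ _) => a b; case: (tform _ _ _ _) => a' b'; case: (tform _ _ _ _) => a'' b''.
rewrite !lecE/= => /andP[/eqP-> a0] /andP[/eqP-> a0'] /andP[/eqP-> a0''] h /andP[_ h'].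
rewrite !mulr0 !mul0r addr0 eqxx/= subr0.
rewrite mul0r subr0 in h'.
by rewrite exprMn -mulrA (le_trans h)// ler_wpM2l// exprn_ge0.
Qed.
End Tensor.
End MinTensor.

Section MinTensor.
Context {R : realType}.
Implicit Types A C T : cstarAlg R.

(** The norm condition is symmetric in the two factors, so statements about the first leg also serve
    for the second. *)
Lemma tens_flip A C T (t : A -> C -> T) : is_min_tensor t ->
  is_min_tensor (fun c a => t a c).
Proof.
move=> [[h1 h2] h3 h4 h5 h6]; split=> [||||x r r0].
- by [].
- by move=> c c' a a'; exact: h3.
- by move=> c a; exact: h4.
- rewrite -h5; congr (cspan _); apply/seteqP; split=> z [a [c ->]]; first by exists c, a.
  by exists c, a.
- have := h6 [seq (p.2, p.1) | p <- x] r r0; rewrite big_map /= => ->.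
  have L1 f g (y : seq (A * C)) :
      \sum_(q <- [seq (p.2, p.1) | p <- y]) \sum_(p <- x) \sum_(p' <- x)
        \sum_(q' <- [seq (p.2, p.1) | p <- y]) (g (star (p.1 ** q.1) ** (p'.1 ** q'.1)) *
          f (star (p.2 ** q.2) ** (p'.2 ** q'.2)) : R[i]) =
      \sum_(q <- y) \sum_(p <- [seq (p.2, p.1) | p <- x]) \sum_(p' <- [seq (p.2, p.1) | p <- x])
        \sum_(q' <- y) (f (star (p.1 ** q.1) ** (p'.1 ** q'.1)) *
          g (star (p.2 ** q.2) ** (p'.2 ** q'.2)) : R[i]).
    rewrite big_map; apply: eq_bigr => q _; rewrite [RHS]big_map; apply: eq_bigr => p _.
    rewrite [RHS]big_map; apply: eq_bigr => p' _; rewrite big_map; apply: eq_bigr => q' _.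
    by rewrite mulrC.
  have L2 f g (y : seq (A * C)) :
      \sum_(q <- [seq (p.2, p.1) | p <- y]) \sum_(q' <- [seq (p.2, p.1) | p <- y])
        (g (star q.1 ** q'.1) * f (star q.2 ** q'.2) : R[i]) =
      \sum_(q <- y) \sum_(q' <- y) (f (star q.1 ** q'.1) * g (star q.2 ** q'.2) : R[i]).
    rewrite big_map; apply: eq_bigr => q _; rewrite big_map; apply: eq_bigr => q' _.
    by rewrite mulrC.
  split=> H f g fp gp y.
    have := H g f gp fp [seq (p.2, p.1) | p <- y]; rewrite -L1 -L2.
    suff -> : [seq (p.2, p.1) | p <- [seq (p.2, p.1) | p <- y]] = y by [].
    by rewrite -map_comp -[RHS]map_id; apply: eq_map => -[].
  by have := H g f gp fp [seq (p.2, p.1) | p <- y]; rewrite L1 L2.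
Qed.

Section Tensor.
Variables (A C T : cstarAlg R) (t : A -> C -> T).
Hypothesis ht : is_min_tensor t.

Lemma tens_tot_ind y : [set x | exists a c, x = t a c] y <-> exists i : A * C, y = t i.1 i.2.
Proof. by split=> [[a [b ->]]|[[a b] ->]]; [exists (a, b)|exists a, b]. Qed.

Lemma zt_lsum (s : seq (R[i] * (A * C))) :
  \sum_(p <- s) p.1 *: t p.2.1 p.2.2 = zt t [seq (p.1 *: p.2.1, p.2.2) | p <- s].
Proof.
by rewrite /zt big_map; apply: eq_bigr => p _; rewrite (islinZ (tens_linl ht _)).
Qed.

Lemma tensm_left (m : mult A) : exists2 x : mult T, nm x <= nm m &
  forall a c, x (t a c) = t (m a) c.
Proof.
have ex (k : mult A) : exists f : T -> T, [/\ islin f, forall x, nm (f x) <= nm k * nm x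
    & forall i : A * C, f (t i.1 i.2) = t (k i.1) i.2].
  apply: (@ext_total _ _ _ _ _ _ _ _ (nm_ge0 k) tens_tot_ind (tens_total ht)) => s.
  rewrite zt_lsum (le_trans _ (tens_mact_bound ht _ _))// /zt !big_map le_eqVlt; apply/orP; left.
  apply/eqP; congr nm; apply: eq_bigr => p _ /=.
  by rewrite (islinZ (mult_lin _)) (islinZ (tens_linl ht _)).
have [n [nl nb nE]] := ex m; have [n' [n'l n'b n'E]] := ex (mstar m).
have nbd : bdlin n by split=> //; exists (nm m) => //; exact: nm_ge0.
have n'bd : bdlin n' by split=> //; exists (nm (mstar m)) => //; exact: nm_ge0.
have [|N NE] := adj_total (tens_total ht) nbd n'bd.
  move=> _ _ [a [c ->]] [a' [c' ->]]; rewrite (nE (a, c)) (n'E (a', c'))/=.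
  by rewrite !(tens_star ht) !(tensM ht) multP.
exists N; last by move=> a c; rewrite NE (nE (a, c)).
by rewrite nm_mult; apply: opn_le; [exact: nm_ge0|move=> x; rewrite NE].
Qed.
End Tensor.

Section Tensor2.
Variables (A C T : cstarAlg R) (t : A -> C -> T).
Hypothesis ht : is_min_tensor t.

Lemma tensm_exists (m : mult A) (n : mult C) : exists2 x : mult T, nm x <= nm m * nm n &
  forall a c, x (t a c) = t (m a) (n c).
Proof.
have [x xb xE] := tensm_left ht m; have [y yb yE] := tensm_left (tens_flip ht) n.
exists (x * y); last by move=> a c; rewrite mactM yE xE.
by rewrite (le_trans (nmM _ _))// ler_pM ?nm_ge0.
Qed.

Lemma nm_tens a c : nm (t a c) <= nm a * nm c.
Proof.
have [x xb xE] := tensm_exists (emb a) (emb c).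
rewrite -nm_emb -(nm_emb a) -(nm_emb c) (le_trans _ xb)//.
rewrite le_eqVlt; apply/orP; left; apply/eqP; congr nm.
apply: (mult_eq_total (tens_total ht)) => _ [a' [c' ->]].
by rewrite xE /= (tensM ht).
Qed.

Lemma tens_bdl c : bdlin (fun a => t a c).
Proof.
split; [exact: tens_linl|exists (nm c) => [|x]; [exact: nm_ge0|]].
by rewrite mulrC nm_tens.
Qed.
Lemma tens_bdr a : bdlin (t a).
Proof. by split; [exact: tens_linr|exists (nm a) => [|x]; [exact: nm_ge0|exact: nm_tens]]. Qed.

(** The sum is the form between a ⊗ c and x applied to the missing vector 1 ⊗ 1. Approximate units d
    ⊗ d' of norm at most 4 stand in for that vector, and Cauchy-Schwarz gives 16^2 = 4 * 64. *)
Lemma pair_bound f g a c (x : seq (A * C)) : posfun f -> posfun g ->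
  (forall a, cabs (f a) <= 2 * nm a) -> (forall c, cabs (g c) <= 2 * nm c) ->
  cabs (\sum_(p <- x) f (star a ** p.1) * g (star c ** p.2) : R[i])
    <= 16 * (nm a * nm c * nm (zt t x)).
Proof.
move=> fp gp fb gb; have fl : islin f by case: fp. have gl : islin g by case: gp.
set F := fun d d' => \sum_(p <- x) (f (star a ** (p.1 ** d)) * g (star c ** (p.2 ** d')) : R[i]).
have n0 := @nm_ge0 R.
have h1 d d' : nm d <= 2 -> nm d' <= 2 -> cabs (F d d') <= 16 * (nm a * nm c * nm (zt t x)).
  move=> d2 d'2; rewrite -(@ler_pXn2r _ 2) ?nnegrE ?mulr_ge0 ?cabs_ge0//.
  have := tform_cs ht [:: (a, c)] (tlmul x [:: (d, d')]) fp gp.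
  rewrite {1}/tform big_seq1 /tlmul big_allpairs_dep/=.
  under eq_bigr => p _ do rewrite big_seq1 /=.
  move=> h; rewrite (le_trans h)//.
  have h2 : complex.Re (tform f g [:: (a, c)] [:: (a, c)]) <= 4 * nm a ^+ 2 * nm c ^+ 2.
    rewrite /tform !big_seq1/= (le_trans (ler_norm _))// (le_trans (Re_le_cabs _))//.
    rewrite cabsM; have := fb (star a ** a); have := gb (star c ** c); rewrite !nm_starmul.
    move=> u v; apply: le_trans (ler_pM _ _ v u) _; rewrite ?cabs_ge0//.
    by rewrite le_eqVlt; apply/orP; left; apply/eqP; ring.
  have h3 : complex.Re (tform f g (tlmul x [:: (d, d')]) (tlmul x [:: (d, d')])) <= 64 * nm (zt t x) ^+ 2.
    have /(tform_norm ht x (n0 _ (zt t x)))/(_ f g fp gp [:: (d, d')]) := lexx (nm (zt t x)).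
    rewrite lecE => /andP[_] /le_trans; apply.
    set w := tform _ _ _ _; have w4 : cabs w <= 64.
      rewrite /w /tform !big_seq1/= cabsM.
      have := fb (star d ** d); have := gb (star d' ** d'); rewrite !nm_starmul => u v.
      apply: le_trans (ler_pM _ _ v u) _; rewrite ?cabs_ge0//.
      have := n0 _ d; have := n0 _ d' => d0 d'0.
      have e1 : nm d ^+ 2 <= 4 by rewrite -[4]/((2 * 2)%N%:R) natrM -expr2 ler_pXn2r ?nnegrE.
      have e2 : nm d' ^+ 2 <= 4 by rewrite -[4]/((2 * 2)%N%:R) natrM -expr2 ler_pXn2r ?nnegrE.
      have := exprn_ge0 2 d0; have := exprn_ge0 2 d'0; nra.
    have := Re_le_cabs w; case: (w) w4 => u v /= w4 /(le_trans (ler_norm _)) hu.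
    rewrite mul0r subr0 mulrC ler_wpM2r ?exprn_ge0//.
    exact: le_trans hu w4.
  apply: le_trans (_ : (4 * nm a ^+ 2 * nm c ^+ 2) * (64 * nm (zt t x) ^+ 2) <= _).
    apply: ler_pM => //.
      by have := tform_ge0 ht [:: (a, c)] fp gp; rewrite lecE => /andP[].
    by have := tform_ge0 ht (tlmul x [:: (d, d')]) fp gp; rewrite lecE => /andP[].
  by rewrite le_eqVlt; apply/orP; left; apply/eqP; ring.
apply/ler_addgt0Pr => e e0.
pose K := \sum_(p <- x) (8 * nm a * nm c * (nm p.1 + nm p.2)).
have K0 : 0 <= K by rewrite sumr_ge0// => p _; rewrite !mulr_ge0 ?addr_ge0.
have e1 : 0 < e / (K + 1) by rewrite divr_gt0// ltr_wpDl.
have [d [_ d2 hd]] := approx_unit [seq p.1 | p <- x] e1.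
have [d' [_ d'2 hd']] := approx_unit [seq p.2 | p <- x] e1.
have := h1 d d' d2 d'2.
suff hh : cabs (\sum_(p <- x) f (star a ** p.1) * g (star c ** p.2) - F d d' : R[i]) <= e.
  have := cabsD (\sum_(p <- x) f (star a ** p.1) * g (star c ** p.2) - F d d' : R[i]) (F d d').
  by rewrite subrK => u v; rewrite (le_trans u)// addrC lerD.
have Ke : K * (e / (K + 1)) <= e by rewrite mulrCA ler_piMr ?(ltW e0)// ler_pdivrMr ?mul1r ?lerDl// ltr_wpDl.
apply: le_trans Ke; rewrite /F -sumrB (le_trans (@nm_sum R R[i]^o _ _ _ _))//.
rewrite mulr_suml big_seq [leRHS]big_seq; apply: ler_sum => p px.
have [_ u1] := hd _ (map_f fst px); have [_ u2] := hd' _ (map_f snd px).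
have -> : f (star a ** p.1) * g (star c ** p.2) - f (star a ** (p.1 ** d)) * g (star c ** (p.2 ** d')) =
  f (star a ** (p.1 - p.1 ** d)) * g (star c ** p.2) +
  f (star a ** (p.1 ** d)) * g (star c ** (p.2 - p.2 ** d')) :> R[i].
  by rewrite !cmulBr (islinB fl) (islinB gl) mulrBl mulrBr addrA subrK.
rewrite (le_trans (cabsD _ _))// !cabsM.
have fb' u : cabs (f (star a ** u)) <= 2 * (nm a * nm u).
  by rewrite (le_trans (fb _))// ler_wpM2l// -(nm_star a) nm_mul.
have gb' u : cabs (g (star c ** u)) <= 2 * (nm c * nm u).
  by rewrite (le_trans (gb _))// ler_wpM2l// -(nm_star c) nm_mul.
have pd : nm (p.1 ** d) <= nm p.1 * 2 by rewrite (le_trans (nm_mul _ _))// ler_wpM2l.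
rewrite (_ : _ * (e / (K + 1)) = (2 * (nm a * (e / (K + 1)))) * (2 * (nm c * nm p.2)) +
  (2 * (nm a * (nm p.1 * 2))) * (2 * (nm c * (e / (K + 1)))) +
   4 * nm a * nm c * nm p.2 * (e / (K + 1))); last by ring.
apply: ler_wpDr; first by apply: mulr_ge0 (ltW e1); rewrite !mulr_ge0.
apply: lerD; apply: ler_pM; rewrite ?cabs_ge0//.
- by rewrite (le_trans (fb' _))// !ler_wpM2l.
- by rewrite (le_trans (fb' _))// !ler_wpM2l.
- by rewrite (le_trans (gb' _))// !ler_wpM2l.
Qed.

(** The functional om is not decomposed into positive ones. A functional g norming the slice c turns
    g(c^* c) into om(b), where b is a slice in the other leg; a functional norming b then reduces
    the estimate to [pair_bound]. *)
Lemma slice_bound (om : A -> R[i]^o) (L : R) (x : seq (A * C)) : 0 <= L -> islin om ->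
  (forall a, cabs (om a) <= L * nm a) ->
  nm (\sum_(p <- x) om p.1 *: p.2) <= 16 * L * nm (zt t x).
Proof.
move=> L0 ol ob; set c := \sum_(p <- x) _; have n0 := @nm_ge0 R.
have [g [gp gb gc]] := exists_state c; have gl : islin g by case: gp.
set b := \sum_(p <- x) g (star c ** p.2) *: p.1.
have e1 : g (star c ** c) = om b.
  rewrite /b (islin_sum ol) {2}/c cmul_sumr (islin_sum gl); apply: eq_bigr => p _.
  by rewrite cmulZr (islinZ gl) (islinZ ol) -[LHS]/(om p.1 * _ : R[i]) mulrC.
have [f [fp fb fc]] := exists_state b; have fl : islin f by case: fp.
have bb : nm b <= 16 * (nm c * nm (zt t x)).
  have [->|bn] := eqVneq (nm b) 0; first by rewrite !mulr_ge0.
  have b0 : 0 < nm b by rewrite lt_neqAle eq_sym bn n0.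
  rewrite -(ler_pM2l b0) -expr2 (le_trans fc)//.
  rewrite (le_trans (ler_norm _))// (le_trans (Re_le_cabs _))//.
  have -> : f (star b ** b) = \sum_(p <- x) f (star b ** p.1) * g (star c ** p.2) :> R[i].
    rewrite {2}/b cmul_sumr (islin_sum fl); apply: eq_bigr => p _.
    by rewrite cmulZr (islinZ fl) -[LHS]/(g _ * _ : R[i]) mulrC.
  apply: le_trans (pair_bound b c x fp gp fb gb) _.
  by rewrite le_eqVlt; apply/orP; left; apply/eqP; ring.
have [->|cn] := eqVneq (nm c) 0; first by rewrite !mulr_ge0.
have c0 : 0 < nm c by rewrite lt_neqAle eq_sym cn n0.
rewrite -(ler_pM2l c0) -expr2 (le_trans gc)//.
rewrite (le_trans (ler_norm _))// (le_trans (Re_le_cabs _))// e1 (le_trans (ob _))//.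
apply: le_trans (ler_wpM2l L0 bb) _.
by rewrite le_eqVlt; apply/orP; left; apply/eqP; ring.
Qed.

Lemma slice_exists (om : A -> R[i]^o) : bdlin om ->
  exists2 h : T -> C, bdlin h & forall a c, h (t a c) = om a *: c.
Proof.
move=> [ol [L L0 oL]]; have L1 : 0 <= 16 * L by rewrite mulr_ge0.
have [|h [hl hb hE]] := @ext_total R T C (A * C)%type (fun i => t i.1 i.2) (fun i => om i.1 *: i.2)
   _ _ L1 (tens_tot_ind t) (tens_total ht).
  move=> s; rewrite (zt_lsum ht); have := slice_bound [seq (p.1 *: p.2.1, p.2.2) | p <- s] L0 ol oL.
  rewrite big_map => /(le_trans _); apply; rewrite le_eqVlt; apply/orP; left; apply/eqP; congr nm.
  by apply: eq_bigr => p _; rewrite (islinZ ol) scalerA.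
exists h; last by move=> a c; rewrite (hE (a, c)).
by split=> //; exists (16 * L).
Qed.
End Tensor2.
End MinTensor.

Section Pos.
Context {R : realType}.
Implicit Types A C T : cstarAlg R.

Lemma bdlin_sum (V W : normedModType R[i]) I (r : seq I) (F : I -> V -> W) :
  (forall i, bdlin (F i)) -> bdlin (fun x => \sum_(i <- r) F i x).
Proof.
move=> h; elim: r => [|i r [IHl [K K0 IH]]].
  split=> [k a b|]; first by rewrite !big_nil scaler0 addr0.
  by exists 0 => // x; rewrite big_nil nm0 mul0r.
have [Fl [L L0 FL]] := h i; split=> [k a b|].
  by rewrite !big_cons Fl IHl scalerDr addrACA.
exists (L + K); first exact: addr_ge0.
by move=> x; rewrite big_cons (le_trans (nmD _ _))// mulrDl lerD.
Qed.

Lemma pos_cs A (f : A -> R[i]^o) a b : posfun f ->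
  cabs (f (star a ** b)) ^+ 2 <= psq f a * psq f b.
Proof.
move=> fp; have [fl f0] := fp.
apply: (cs_abs (b' := f (star b ** a)) (f0 a) (f0 b)) => k; have := f0 (a + k *: b).
rewrite starDD starZ !(cmulDl1, cmulDr1) !(cmulZl, cmulZr) !(islinD fl) !(islinZ fl).
rewrite -![_ *: (_ : R[i]^o)]/(_ * _ : R[i]) !addrA !mulrA.
exact.
Qed.

Lemma pos_coef_bdlin A (f : A -> R[i]^o) a b : posfun f ->
  bdlin (fun m : mult A => f (star a ** m b)).
Proof.
move=> fp; have [fl f0] := fp; split=> [k m n|].
  by rewrite multDE multZE cmulDr1 cmulZr (islinD fl) (islinZ fl).
exists (Num.sqrt (psq f a * psq f b)); first exact: sqrtr_ge0.
move=> m; have := psq_ge0 fp a; have := psq_ge0 fp b => b0 a0.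
rewrite -[nm (f _)]/(cabs (f _)) -(@ler_pXn2r _ 2) ?nnegrE ?mulr_ge0 ?cabs_ge0 ?sqrtr_ge0 ?nm_ge0//.
rewrite exprMn sqr_sqrtr ?mulr_ge0// (le_trans (pos_cs _ _ fp))// -mulrA ler_wpM2l//.
by rewrite mulrC (psq_bound fp).
Qed.

Lemma nonneg_eps (u : R[i]) :
  (forall e : R, 0 < e -> exists2 v, 0 <= v & cabs (u - v) <= e) -> 0 <= u.
Proof.
case: u => a b h; rewrite lecE /=; apply/andP; split.
  suff : (b%:C%C : R[i]^o) = 0 :> R[i]^o by move/(@complexI R) => ->.
  apply: (@nm_eps _ _ _ 1) => e e0; rewrite mul1r -[nm _]/(cabs _) cabs_real.
  have [[c d]] := h e e0; rewrite lecE/= => /andP[/eqP-> c0]; apply: le_trans.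
  have : cabs ('i%C * ((a +i* b)%C - (c +i* 0)%C)) = cabs ((a +i* b)%C - (c +i* 0)%C).
    by rewrite cabsM cabs_i mul1r.
  move=> <-; apply: le_trans (Re_le_cabs _); rewrite /= mul0r mul1r sub0r normrN.
  by rewrite subr0.
rewrite -oppr_le0; apply/ler_addgt0Pr => e e0; rewrite add0r.
have [[c d]] := h e e0; rewrite lecE/= => /andP[_ c0] /(le_trans (Re_le_cabs _))/=.
by rewrite ler_norml => /andP[]; lra.
Qed.

Lemma quad_diff A (f : A -> R[i]^o) (L : R) x y (e : R) : islin f -> 0 <= L ->
  (forall x, cabs (f x) <= L * nm x) -> nm (x - y) <= e -> e <= 1 ->
  cabs (f (star x ** x) - f (star y ** y)) <= L * (2 * nm x + 1) * e.
Proof.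
move=> fl L0 fL xy e1; rewrite -(islinB fl) (le_trans (fL _))// -mulrA ler_wpM2l//.
have -> : star x ** x - star y ** y = star (x - y) ** x + star y ** (x - y).
  by rewrite starB cmulBl cmulBr addrA subrK.
have y1 : nm y <= nm x + 1 by rewrite -(subrK x y) (le_trans (nmD _ _))// addrC lerD2l nmBC (le_trans xy).
have := nm_mul (star (x - y)) x; have := nm_mul (star y) (x - y); rewrite !nm_star => h1 h2.
have h3 : nm (x - y) * nm x <= e * nm x by rewrite ler_wpM2r ?nm_ge0.
have h4 : nm y * nm (x - y) <= (nm x + 1) * e by rewrite ler_pM ?nm_ge0.
by rewrite (le_trans (nmD _ _))//; lra.
Qed.

Lemma small_eps (e M : R) : 0 < e -> 0 <= M -> exists d, [/\ 0 < d, d <= 1 & M * d <= e].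
Proof.
move=> e0 M0; exists (Num.min 1 (e / (M + 1))).
have M1 : 0 < M + 1 by rewrite ltr_wpDl.
split; [by rewrite lt_min ltr01 divr_gt0|by rewrite ge_min lexx|].
apply: le_trans (_ : M * (e / (M + 1)) <= _); first by rewrite ler_wpM2l// ge_min lexx orbT.
by rewrite mulrCA ler_piMr ?(ltW e0)// ler_pdivrMr// mul1r lerDl.
Qed.

Lemma posfun_dense T (f : T -> R[i]^o) : bdlin f ->
  (forall x e, 0 < e -> exists2 y, nm (x - y) < e & 0 <= f (star y ** y)) -> posfun f.
Proof.
move=> [fl [L L0 fL]] h; split=> // x; apply: nonneg_eps => e e0.
have [|d [d0 d1 de]] := @small_eps e (L * (2 * nm x + 1)) e0.
  by rewrite mulr_ge0// addr_ge0// mulr_ge0 ?nm_ge0.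
have [y xy y0] := h x d d0; exists (f (star y ** y)) => //.
by apply: le_trans de; apply: quad_diff => //; exact: ltW.
Qed.

(** Up to an error, x is x d, and left multiplication by x is controlled by [psq_bound]. *)
Lemma posfun_unit_bound T (f : T -> R[i]^o) x (K : R) : bdlin f -> posfun f -> 0 <= K ->
  (forall e, 0 < e -> exists2 d, nm (x - x ** d) <= e & psq f d <= K) ->
  psq f x <= nm x ^+ 2 * K.
Proof.
move=> [fl [L L0 fL]] fp K0 h; apply/ler_addgt0Pr => e e0.
have [|r [r0 r1 re]] := @small_eps e (L * (2 * nm x + 1)) e0.
  by rewrite mulr_ge0// addr_ge0// mulr_ge0 ?nm_ge0.
have [d xd dK] := h r r0.
have := quad_diff fl L0 fL xd r1; rewrite !posfunE// -rmorphB cabs_real.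
move=> /(le_trans (ler_norm _)); rewrite lerBlDl => /le_trans; apply.
apply: lerD => //; have := psq_bound fp (emb x) d; rewrite nm_emb => /le_trans; apply.
by rewrite ler_wpM2l// exprn_ge0 ?nm_ge0.
Qed.

Lemma tform_flip A C (f : A -> R[i]^o) (g : C -> R[i]^o) (y x : seq (A * C)) :
  tform f g y x = tform g f [seq (p.2, p.1) | p <- y] [seq (p.2, p.1) | p <- x].
Proof.
rewrite /tform big_map; apply: eq_bigr => q _; rewrite big_map; apply: eq_bigr => p _.
by rewrite mulrC.
Qed.

Lemma mstar_total (B : cstarAlg R) (S : set B) (m n : mult B) : cspan S = setT ->
  (forall x y, S x -> S y -> star (m x) ** y = star x ** n y) -> mstar m = n.
Proof.
move=> dS h; have h1 x : S x -> forall y, star (m x) ** y = star x ** n y.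
  move=> Sx; apply: (dense_bdlin_eq dS (cmulr_bd _) (bdlin_comp (mact_bdlin n) (cmulr_bd _))).
  by move=> y Sy /=; exact: h.
have h2 x y : star (m x) ** y = star x ** n y.
  apply: star_inj; rewrite !starM !starK; move: x.
  apply: (dense_bdlin_eq dS (bdlin_comp (mact_bdlin m) (cmulr_bd _)) (cmulr_bd _)) => x Sx /=.
  by apply: star_inj; rewrite !starM !starK h1.
by apply: mult_ext => y; apply: cmul_nondeg => x; rewrite -h2 multP.
Qed.

Section Hom.
Variables (A C T A' T' : cstarAlg R) (t : A -> C -> T) (t' : A' -> C -> T').
Hypotheses (ht : is_min_tensor t) (ht' : is_min_tensor t').
Variable p : A -> mult A'.
Hypothesis ph : ismhom p.

Let act (x : seq (A * C)) (w : seq (A' * C)) := [seq (p i.1 j.1, i.2 ** j.2) | i <- x, j <- w].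

(** This is the boundedness of p ⊗ id, proved by pulling the vector functional at w back to T. The
    pullback is positive, so its size is governed by its values at approximate units d1 ⊗ d2; there
    p(d1) has norm at most 4 and d2 norm at most 2, whence 8. *)
Lemma tmh_form_le f g x w : posfun f -> posfun g ->
  complex.Re (tform f g (act x w) (act x w)) <=
  (8 * nm (zt t x)) ^+ 2 * complex.Re (tform f g w w).
Proof.
move=> fp gp; have fl : islin f by case: fp. have gl : islin g by case: gp.
have [h hP] : exists h : A' * A' -> T -> C, forall i, bdlin (h i) /\
    forall a c, h i (t a c) = f (star i.1 ** p a i.2) *: c.
  have [|k kP] := choice (P := fun (i : A' * A') (k : T -> C) => bdlin k /\
    forall a c, k (t a c) = f (star i.1 ** p a i.2) *: c); last by exists k.
  move=> [b b']; have [|k kb kE] := @slice_exists _ _ _ _ _ ht (fun a => f (star b ** p a b')).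
    exact: (bdlin_comp (mhom_bdlin ph) (pos_coef_bdlin b b' fp)).
  by exists k.
(* The matrix coefficient at w of the future operator (p ⊗ id)(z). It is written with slices because
   only those are available, and bounded, on all of T. *)
pose Th z : R[i]^o := \sum_(j <- w) \sum_(k <- w) g (star j.2 ** (h (j.1, k.1) z ** k.2)).
have Tb : bdlin Th.
  apply: bdlin_sum => j; apply: bdlin_sum => k; have [hb _] := hP (j.1, k.1).
  have eb : bdlin (@emb R C) by apply: mhom_bdlin; exact: ismhom_id.
  exact: (bdlin_comp hb (bdlin_comp eb (pos_coef_bdlin j.2 k.2 gp))).
have Tt a c : Th (t a c) = \sum_(j <- w) \sum_(k <- w)
    f (star j.1 ** p a k.1) * g (star j.2 ** (c ** k.2)) :> R[i].
  apply: eq_bigr => j _; apply: eq_bigr => k _; have [_ ->] := hP (j.1, k.1).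
  by rewrite cmulZl cmulZr (islinZ gl).
have Tzt y : Th (star (zt t y) ** zt t y) = tform f g (act y w) (act y w).
  rewrite /zt star_sum cmul_suml (islin_sum (proj1 Tb)) /tform big_allpairs_dep/=.
  apply: eq_bigr => i _; rewrite cmul_sumr (islin_sum (proj1 Tb)).
  under [RHS]eq_bigr => j _ do rewrite big_allpairs_dep/=.
  rewrite [RHS]exchange_big/=; apply: eq_bigr => i' _.
  rewrite (tens_star ht) (tensM ht) Tt; apply: eq_bigr => j _; apply: eq_bigr => k _.
  by rewrite multP -![madj (p _) _]/(mstar (p _) _) -(ismhomS _ ph)
    -[p _ (p _ _)]/((p _ * p _) _) -(ismhomM _ _ ph) starM !cmulA.
have Tp : posfun Th.
  apply: posfun_dense => // z e e0; have [y yz] := zt_dense ht z e0; exists (zt t y) => //.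
  by rewrite Tzt; exact: (tform_ge0 ht').
have w0 : 0 <= complex.Re (tform f g w w).
  by have := tform_ge0 ht' w fp gp; rewrite lecE => /andP[].
rewrite -Tzt -[X in X <= _]/(psq Th (zt t x)) exprMn.
rewrite [_ * nm _ ^+ 2]mulrC -mulrA; apply: posfun_unit_bound => //.
  by rewrite mulr_ge0.
move=> e e0; pose M := \sum_(q <- x) (3 * (nm q.1 + nm q.2)).
have M0 : 0 <= M by rewrite sumr_ge0// => q _; rewrite mulr_ge0// addr_ge0 ?nm_ge0.
have [r [r0 r1 re]] := small_eps e0 M0.
have [d1 [_ d12 hd1]] := approx_unit [seq q.1 | q <- x] r0.
have [d2 [_ d22 hd2]] := approx_unit [seq q.2 | q <- x] r0.
exists (t d1 d2).
  apply: le_trans re; rewrite /zt cmul_suml -sumrB (le_trans (nm_sum _ _ _))//.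
  rewrite mulr_suml big_seq [leRHS]big_seq; apply: ler_sum => q qx.
  have [_ u1] := hd1 _ (map_f fst qx); have [_ u2] := hd2 _ (map_f snd qx).
  rewrite (tensM ht) (_ : t q.1 q.2 - _ = t (q.1 - q.1 ** d1) q.2 + t (q.1 ** d1) (q.2 - q.2 ** d2)); last first.
    by rewrite (islinB (tens_linl ht _)) (islinB (tens_linr ht _)) addrA subrK.
  have v1 := nm_tens ht (q.1 - q.1 ** d1) q.2; have v2 := nm_tens ht (q.1 ** d1) (q.2 - q.2 ** d2).
  have v3 : nm (q.1 ** d1) <= nm q.1 * 2 by rewrite (le_trans (nm_mul _ _))// ler_wpM2l ?nm_ge0.
  have v4 : nm (q.1 - q.1 ** d1) * nm q.2 <= r * nm q.2 by rewrite ler_wpM2r ?nm_ge0.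
  have v5 : nm (q.1 ** d1) * nm (q.2 - q.2 ** d2) <= nm q.1 * 2 * r by rewrite ler_pM ?nm_ge0.
  have z1 : 0 <= r * nm q.1 by rewrite mulr_ge0 ?nm_ge0 ?(ltW r0).
  have z2 : 0 <= r * nm q.2 by rewrite mulr_ge0 ?nm_ge0 ?(ltW r0).
  by rewrite (le_trans (nmD _ _))//; lra.
rewrite /psq (_ : t d1 d2 = zt t [:: (d1, d2)]); last by rewrite /zt big_seq1.
rewrite Tzt /act /=.
have -> : [seq (p d1 j.1, d2 ** j.2) | j <- w] ++ [::] =
   [seq (p d1 j.1, j.2) | j <- [seq (j.1, emb d2 j.2) | j <- w]] by rewrite cats0 -map_comp.
apply: le_trans (tform_mact ht' _ _ fp gp) _.
have h1 : nm (p d1) ^+ 2 <= 16.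
  rewrite -[16]/((4 * 4)%N%:R) natrM -expr2 ler_pXn2r ?nnegrE ?nm_ge0//.
  by rewrite (le_trans (mhom_bound _ ph))// -[4]/((2 * 2)%N%:R) natrM ler_wpM2l.
have h2 : complex.Re (tform f g [seq (j.1, emb d2 j.2) | j <- w] [seq (j.1, emb d2 j.2) | j <- w])
    <= 4 * complex.Re (tform f g w w).
  rewrite tform_flip [in leRHS]tform_flip -!map_comp /comp /=.
  have -> : [seq (d2 ** x0.2, x0.1) | x0 <- w] = [seq (emb d2 j.1, j.2) | j <- [seq (q.2, q.1) | q <- w]].
    by rewrite -map_comp.
  apply: le_trans (tform_mact (tens_flip ht') _ _ gp fp) _; rewrite nm_emb ler_wpM2r//.
    by rewrite -tform_flip.
  by rewrite -[4]/((2 * 2)%N%:R) natrM -expr2 ler_pXn2r ?nnegrE ?nm_ge0.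
have h3 : 0 <= complex.Re (tform f g [seq (j.1, emb d2 j.2) | j <- w] [seq (j.1, emb d2 j.2) | j <- w]).
  by have := tform_ge0 ht' [seq (j.1, emb d2 j.2) | j <- w] fp gp; rewrite lecE => /andP[].
apply: le_trans (ler_pM _ h3 h1 h2) _; first by rewrite exprn_ge0 ?nm_ge0.
by rewrite mulrA ler_wpM2r// expr2 -!natrM ler_nat.
Qed.

Lemma tmh_exists : exists2 h : T -> mult T', ismhom h &
  forall a c a' c', h (t a c) (t' a' c') = t' (p a a') (c ** c').
Proof.
have [M MP] : exists M : A * C -> mult T', forall i, forall a' c', M i (t' a' c') = t' (p i.1 a') (i.2 ** c').
  have [|k kP] := choice (P := fun (i : A * C) (m : mult T') =>
    forall a' c', mact m (t' a' c') = t' (p i.1 a') (i.2 ** c')); last by exists k.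
  by move=> [a c]; have [x _ xE] := tensm_exists ht' (p a) (emb c); exists x.
have pl := ismhom_lin ph.
have Mact x w : (\sum_(i <- x) M i) (zt t' w) = zt t' (act x w).
  have -> : (\sum_(i <- x) M i) (zt t' w) = \sum_(i <- x) M i (zt t' w).
    by rewrite (@islin_sum R (mult T') T' (fun m => m (zt t' w))).
  rewrite /zt big_allpairs_dep/=; apply: eq_bigr => i _.
  by rewrite (islin_sum (mult_lin _)); apply: eq_bigr => j _; rewrite MP.
have bd x : nm (\sum_(i <- x) M i) <= 8 * nm (zt t x).
  have K0 : 0 <= 8 * nm (zt t x) by rewrite mulr_ge0 ?nm_ge0.
  apply: (opn_le_total K0 (tens_tot_ind t') (tens_total ht')) => s.
  rewrite (zt_lsum ht'); set w := [seq _ | _ <- s].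
  have z0 := nm_ge0 (zt t' w).
  rewrite Mact; apply/(tform_norm ht'); first exact: mulr_ge0.
  move=> f g fp gp y.
  have E F : \sum_(i <- tlmul (act x w) y) F i = \sum_(i <- act x (tlmul w y)) F i :> R[i].
    rewrite /tlmul /act !big_allpairs_dep/=; apply: eq_bigr => i _.
    rewrite !big_allpairs_dep/=; apply: eq_bigr => j _; apply: eq_bigr => k _.
    by rewrite multM cmulA.
  have -> : tform f g (tlmul (act x w) y) (tlmul (act x w) y) =
      tform f g (act x (tlmul w y)) (act x (tlmul w y)).
    by rewrite /tform E; apply: eq_bigr => i _; rewrite E.
  have h1 := tmh_form_le x (tlmul w y) fp gp.
  have /(tform_norm ht' _ z0)/(_ f g fp gp y) := lexx (nm (zt t' w)).
  have := tform_ge0 ht' (act x (tlmul w y)) fp gp.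
  have := tform_ge0 ht' y fp gp; move: h1.
  case: (tform _ _ (act _ _) _) => a b; case: (tform _ _ (tlmul _ _) _) => a' b'.
  case: (tform _ _ _ _) => c d; rewrite !lecE/= => h1 /andP[/eqP-> c0] /andP[/eqP-> a0] /andP[_].
  rewrite !mulr0 !mul0r addr0 eqxx !subr0/= => h2.
  by rewrite exprMn -mulrA (le_trans h1)// ler_wpM2l// exprn_ge0.
have K8 : (0 : R) <= 8 by [].
have [|h [hl hb hE]] := @ext_total R T (multalg T') (A * C)%type (fun i => t i.1 i.2) M
   _ 8 K8 (tens_tot_ind t) (tens_total ht).
  move=> s; rewrite (zt_lsum ht) (le_trans _ (bd _))// big_map le_eqVlt.
  apply/orP; left; apply/eqP; congr nm; apply: eq_bigr => q _.
  apply: (mult_eq_total (tens_total ht')) => _ [a [c ->]].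
  by rewrite multZE !MP /= (islinZ pl) multZE (islinZ (tens_linl ht' _)).
have hbd : bdlin (h : T -> multalg T') by split=> //; exists 8.
have hP a c a' c' : h (t a c) (t' a' c') = t' (p a a') (c ** c').
  by rewrite (hE (a, c)) MP.
exists h => //; split.
- by move=> b k x y; rewrite hl multDE multZE.
- move=> x y; move: x; have mb := @cmull_bd R (multalg T') (h y).
  apply: (dense_bdlin_eq (tens_total ht) (bdlin_comp (cmull_bd y) hbd) (bdlin_comp hbd mb)).
  move=> _ [a [c ->]] /=; move: y {mb}; have mb := @cmulr_bd R (multalg T') (h (t a c)).
  apply: (dense_bdlin_eq (tens_total ht) (bdlin_comp (cmulr_bd _) hbd) (bdlin_comp hbd mb)).
  move=> _ [a' [c' ->]] /=; rewrite (tensM ht).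
  apply: (mult_eq_total (tens_total ht')) => _ [x [y ->]].
  by rewrite /= !hP (ismhomM _ _ ph) cmulA.
- have sb : bdlin (fun x => mstar (h (star x)) : multalg T').
    split=> [k x y|]; first by rewrite starDD starZ hl mstarD mstarZ conjCK.
    by exists 8 => // x; rewrite nm_mstar (le_trans (hb _))// nm_star.
  have hs : h =1 (fun x => mstar (h (star x))).
    apply: (dense_bdlin_eq (tens_total ht) hbd sb) => _ [a [c ->]].
    apply/esym.
    apply: (mstar_total (tens_total ht')) => _ _ [x [y ->]] [x' [y' ->]].
    rewrite (tens_star ht) !hP !(tens_star ht') !(tensM ht') multP starM !cmulA.
    by rewrite -![madj (p _) _]/(mstar (p _) _) -(ismhomS _ ph) !starK.
  by move=> a; rewrite [in RHS]hs mstarK.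
Qed.
End Hom.
End Pos.

(** * Density arguments and strictly continuous representations *)

Section Total.
Context {R : realType}.
Implicit Types A B C : cstarAlg R.
Implicit Types V W : normedModType R[i].

(** Induction over a total set: K is a closed subspace, given as a predicate. *)
Lemma total_ind V (S K : set V) : cspan S = setT ->
  (forall x, (forall e : R, 0 < e -> exists2 y, K y & nm (x - y) < e) -> K x) ->
  (forall k x y, K x -> K y -> K (k *: x + y)) -> K 0 ->
  (forall x, S x -> K x) -> forall x, K x.
Proof.
move=> dS cK lK K0 SK x; apply: cK => e e0.
have /closure_nmP/(_ e e0)[_ [n [k [v [Sv ->]]]] xy] : cspan S x by rewrite dS.
exists (\sum_(i < n) k i *: v i) => //.
elim/big_ind: _ => // [a b Ka Kb|i _]; first by rewrite -[a]scale1r; exact: lK.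
by rewrite -[_ *: _]addr0; apply: lK => //; exact: SK.
Qed.

Lemma cspan_sub V (S : set V) x : S x -> cspan S x.
Proof.
move=> Sx; apply: subset_closure; exists 1%N, (fun=> 1), (fun=> x); split=> //.
by rewrite big_ord1 scale1r.
Qed.

Lemma cspan_eps V (S : set V) x :
  (forall e : R, 0 < e -> exists2 y, cspan S y & nm (x - y) < e) -> cspan S x.
Proof.
move=> h; apply/closure_nmP => e e0; have e20 : 0 < e / 2 by rewrite divr_gt0.
have [y /closure_nmP/(_ _ e20)[z Sz yz] xy] := h _ e20; exists z => //.
by rewrite (le_lt_trans (nm_tri y _ _))// (splitr e) ltrD.
Qed.

Lemma cspan_lin V (S : set V) k x y : cspan S x -> cspan S y -> cspan S (k *: x + y).
Proof.
move=> /closure_nmP hx /closure_nmP hy; apply/closure_nmP => e e0.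
have k0 : 0 < cabs k + 1 by rewrite ltr_wpDl ?cabs_ge0.
have e1 : 0 < e / 2 by rewrite divr_gt0.
have [_ [n [l [v [Sv ->]]]] xv] := hx _ (divr_gt0 e1 k0).
have [_ [n' [l' [v' [Sv' ->]]]] yv] := hy _ e1.
exists (k *: (\sum_(i < n) l i *: v i) + \sum_(i < n') l' i *: v' i).
  exists (n + n')%N, (fun i : 'I_(n + n') => match fintype.split i with inl j => k * l j | inr j => l' j end),
    (fun i : 'I_(n + n') => match fintype.split i with inl j => v j | inr j => v' j end); split.
    by move=> i; case: (fintype.split i).
  rewrite big_split_ord /= scaler_sumr; congr (_ + _); apply: eq_bigr => i _.
    by rewrite (unsplitK (inl i)) scalerA.
  by rewrite (unsplitK (inr i)).
rewrite opprD addrACA -scalerBr (le_lt_trans (nmD _ _))// (splitr e) ltrD// nmZ.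
move: xv; rewrite ltr_pdivlMr// => xv.
apply: le_lt_trans xv; rewrite mulrC ler_wpM2l ?nm_ge0// lerDl//.
Qed.

Lemma cspan0 V (S : set V) : cspan S 0.
Proof.
apply: subset_closure; exists 0%N, (fun=> 0), (fun=> 0); split; first by case.
by rewrite big_ord0.
Qed.

Lemma cspan_bdlin V W (S : set V) (T : set W) (f : V -> W) : cspan S = setT -> bdlin f ->
  (forall x, S x -> cspan T (f x)) -> forall x, cspan T (f x).
Proof.
move=> dS [fl [K K0 fK]] h; apply: (total_ind dS) => //.
- move=> x hx; apply: cspan_eps => e e0; have K1 : 0 < K + 1 by rewrite ltr_wpDl.
  have [y Ty xy] := hx _ (divr_gt0 e0 K1); exists (f y) => //.
  rewrite -(islinB fl) (le_lt_trans (fK _))//; move: xy; rewrite ltr_pdivlMr// => xy.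
  by apply: le_lt_trans xy; rewrite mulrC ler_wpM2l ?nm_ge0// lerDl.
- by move=> k x y hx hy; rewrite fl; exact: cspan_lin.
- by rewrite (islin0 fl); exact: cspan0.
Qed.

Lemma id_bdlin V : bdlin (fun x : V => x).
Proof. by split=> //; exists 1 => // x; rewrite mul1r. Qed.

Lemma cspan_total V (S T : set V) : cspan S = setT -> (forall x, S x -> cspan T x) ->
  cspan T = setT.
Proof. by move=> dS h; rewrite -subTset => x _; apply: (cspan_bdlin dS (id_bdlin V)). Qed.

Lemma tens_total2 A C (T : cstarAlg R) (t : A -> C -> T) (S1 : set A) (S2 : set C) (S : set T) : is_min_tensor t ->
  cspan S1 = setT -> cspan S2 = setT -> (forall a c, S1 a -> S2 c -> cspan S (t a c)) ->
  cspan S = setT.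
Proof.
move=> ht d1 d2 h; apply: (cspan_total (tens_total ht)) => _ [a [c ->]].
move: a; apply: (cspan_bdlin d1 (tens_bdl ht c)) => a Sa.
by move: c; apply: (cspan_bdlin d2 (tens_bdr ht a)) => c Sc; exact: h.
Qed.

Lemma cmul_total A : cspan [set x : A | exists a b, x = a ** b] = setT.
Proof. by have [_ h] := @nondeg_emb R A. Qed.

Lemma mext_mhom A B (p : A -> mult B) C (q : B -> mult C) : nondeg q -> ismhom p ->
  ismhom (fun a => mext q (p a)).
Proof.
move=> qn ph; split.
- by move=> c k a b; rewrite (ismhom_lin ph) (mext_lin qn) multDE multZE.
- by move=> a b; rewrite (ismhomM _ _ ph) (mextM qn).
- by move=> a; rewrite (ismhomS _ ph) (mext_star qn).
Qed.

Lemma evh_bdlin A B (p : A -> mult B) x : ismhom p -> bdlin (fun a => p a x).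
Proof. by move=> ph; exact: (bdlin_comp (mhom_bdlin ph) (ev_bdlin x)). Qed.

Lemma mext_nondeg A B (p : A -> mult B) C (q : B -> mult C) : nondeg q -> nondeg p ->
  nondeg (fun a => mext q (p a)).
Proof.
move=> qn pn; have [qh dq] := qn; have [ph dp] := pn.
split; first exact: mext_mhom.
apply: (cspan_total dq) => _ [b [c ->]]; move: b.
apply: (cspan_bdlin dp (evh_bdlin c qh)) => _ [a [b ->]]; apply: cspan_sub.
by exists a, (q b c); rewrite (mextP qn).
Qed.

Lemma mext_comp A B (p : A -> mult B) C (q : B -> mult C) m : nondeg q -> nondeg p ->
  mext (fun a => mext q (p a)) m = mext q (mext p m).
Proof.
move=> qn pn; apply: mext_uniq; first exact: mext_nondeg.
move=> a c; rewrite -mactM -(mextM qn); congr (mact (mext q _) c).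
by apply: mult_ext => b; rewrite mactM (mextP pn).
Qed.

Lemma mext_bound2 A B (p : A -> mult B) m : nondeg p -> nm (mext p m) <= 2 * nm m.
Proof.
move=> pn; apply: (@mhom_bound R (multalg A) B (mext p) m); split.
- by move=> b k x y; rewrite (mext_lin pn) multDE multZE.
- exact: (mextM pn).
- exact: (mext_star pn).
Qed.

Section Cont.
Variable G : topologicalType.

Lemma cts_nm V (f : G -> V) : continuous f <->
  forall s (e : R), 0 < e -> \forall s' \near s, nm (f s - f s') < e.
Proof.
split=> [h s e e0|h s B /nbhs_nmP[e e0 eB]].
  apply: (h s [set z | nm (f s - z) < e]); apply/nbhs_nmP; exists e => //.
by apply: filterS (h s e e0) => s' /eB.
Qed.

Lemma cts_bdlin V W (f : G -> V) (g : V -> W) : bdlin g -> continuous f -> continuous (g \o f).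
Proof. by move=> /bdlin_cont gc fc s; apply: continuous_comp; [exact: fc|exact: gc]. Qed.

Lemma cts_lin V (f g : G -> V) k : continuous f -> continuous g ->
  continuous (fun s => k *: f s + g s).
Proof. by move=> fc gc s; apply: cvgD; [apply: cvgZr; exact: fc|exact: gc]. Qed.

Lemma cts_unif V (f : G -> V) :
  (forall e : R, 0 < e -> exists2 g : G -> V, continuous g & forall s, nm (f s - g s) < e) ->
  continuous f.
Proof.
move=> h; apply/cts_nm => s e e0; have e3 : 0 < e / 3 by rewrite divr_gt0.
have [g /cts_nm gc fg] := h _ e3; apply: filterS (gc s _ e3) => s' gs.
have := nm_tri (g s) (f s) (f s'); have := nm_tri (g s') (g s) (f s').
by have := fg s; have := fg s'; rewrite (nmBC (f s')); lra.
Qed.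

Lemma cts_total B (S : set B) (u : G -> mult B) (K : R) : cspan S = setT -> 0 <= K ->
  (forall s, nm (u s) <= K) -> (forall x, S x -> continuous (fun s => u s x)) ->
  forall x, continuous (fun s => u s x).
Proof.
move=> dS K0 uK h; apply: (total_ind dS) => //.
- move=> x hx; apply: cts_unif => e e0; have K1 : 0 < K + 1 by rewrite ltr_wpDl.
  have [y yc xy] := hx _ (divr_gt0 e0 K1); exists (fun s => u s y) => // s.
  rewrite -(islinB (mult_lin _)) (le_lt_trans (nm_mact _ _))//.
  rewrite (le_lt_trans (ler_wpM2r _ (uK s))) ?nm_ge0//.
  move: xy; rewrite ltr_pdivlMr// => xy; apply: le_lt_trans xy.
  by rewrite mulrC ler_wpM2l ?nm_ge0// lerDl.
- move=> k x y hx hy; rewrite (_ : (fun s => _) = fun s => k *: u s x + u s y); first exact: cts_lin.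
  by apply/funext => s; rewrite (mult_lin (u s)).
- rewrite (_ : (fun s => _) = fun=> 0); first by move=> s; exact: cvg_cst.
  by apply/funext => s; rewrite (islin0 (mult_lin (u s))).
Qed.
End Cont.

Section URep.
Variable G : lcGroupType.

Lemma urep_inv B (u : G -> mult B) s : unitary_rep u -> u s * mstar (u s) = 1.
Proof. by move=> [u1 um uv _]; rewrite -uv -[LHS]um mulgV. Qed.
Lemma urep_invl B (u : G -> mult B) s : unitary_rep u -> mstar (u s) * u s = 1.
Proof. by move=> [u1 um uv _]; rewrite -uv -[LHS]um mulVg. Qed.
Lemma urep_nm B (u : G -> mult B) s : unitary_rep u -> nm (u s) <= 1.
Proof.
move=> uu; rewrite -(@ler_pXn2r _ 2) ?nnegrE ?nm_ge0// expr1n -nm_mstarM urep_invl//.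
exact: nm1_le.
Qed.

Lemma urep_mext B C (q : B -> mult C) (u : G -> mult B) : nondeg q -> unitary_rep u ->
  unitary_rep (fun s => mext q (u s)).
Proof.
move=> qn uu; have [u1 um uv uc] := uu; split.
- by rewrite u1 -[mone B]/(1 : mult B) (mext1 qn).
- by move=> s t; rewrite um -[mmul _ _]/(u s * u t) (mextM qn).
- by move=> s; rewrite uv (mext_star qn).
- apply: (cts_total (K := 2) (proj2 qn)) => //.
    move=> s; rewrite (le_trans (mext_bound2 _ qn))// ler_piMr//.
    by rewrite (le_trans (urep_nm _ uu)).
  move=> _ [b [c ->]]; rewrite (_ : (fun s => _) = (fun b => q b c) \o (fun s => u s b)).
    by apply: cts_bdlin => //; apply: evh_bdlin; case: qn.
  by apply/funext => s /=; rewrite (mextP qn).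
Qed.
End URep.
End Total.

Lemma ishom_lin (R : realType) (A B : cstarAlg R) (f : A -> B) : ishom f -> islin f.
Proof. by case. Qed.
Lemma ishomM (R : realType) (A B : cstarAlg R) (f : A -> B) a b : ishom f -> f (a ** b) = f a ** f b.
Proof. by case. Qed.
Lemma ishomS (R : realType) (A B : cstarAlg R) (f : A -> B) a : ishom f -> f (star a) = star (f a).
Proof. by case. Qed.

Lemma mext_uniq_total (R : realType) (A B : cstarAlg R) (p : A -> mult B) (S : set A) (S' : set B)
    (m : mult A) (n : mult B) : nondeg p -> cspan S = setT -> cspan S' = setT ->
  (forall a b, S a -> S' b -> n (p a b) = p (m a) b) -> mext p m = n.
Proof.
move=> pn dS dS' h; have ph : ismhom p by case: pn.
apply: mext_uniq => // a; apply: (dense_bdlin_eq dS').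
- exact: (bdlin_comp (mact_bdlin _) (mact_bdlin _)).
- exact: mact_bdlin.
move=> b Sb; move: a; apply: (dense_bdlin_eq dS).
- exact: (bdlin_comp (evh_bdlin b ph) (mact_bdlin n)).
- exact: (bdlin_comp (mact_bdlin m) (evh_bdlin b ph)).
by move=> a Sa /=; exact: h.
Qed.

Lemma mhom_total (R : realType) (A B : cstarAlg R) (S : set A) (h k : A -> mult B) :
  cspan S = setT -> ismhom h -> ismhom k -> (forall a, S a -> h a = k a) -> h = k.
Proof.
move=> dS hh kh e; apply/funext.
exact: (dense_bdlin_eq dS (mhom_bdlin hh) (mhom_bdlin kh) e).
Qed.

(** * Multipliers, homomorphisms and slices on tensor products *)

Section T.
Context {R : realType} {G : lcGroupType} {D : groupData R G}.
Implicit Types A B C : cstarAlg R.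
Local Notation "A \ox C" := (tp D A C) (at level 40, left associativity).
Local Notation ts := (@tens R D _ _).
Local Notation tot A C := (tens_total (tensP D A C)).

Lemma tensmE A C (m : mult A) (n : mult C) a c :
  tensm m n (tens a c : A \ox C) = tens (m a) (n c).
Proof.
have := @the_spec _ (mone _) (fun x : mult (A \ox C) => forall a c, x (tens a c) = tens (m a) (n c)).
by apply; have [x _ xE] := tensm_exists (tensP D A C) m n; exists x.
Qed.

Lemma tensm_eq A C (m n : mult (A \ox C)) :
  (forall a c, m (tens a c) = n (tens a c)) -> m = n.
Proof. by move=> h; apply: (mult_eq_total (tot A C)) => _ [a [c ->]]; exact: h. Qed.

Lemma tensmM A C (m m' : mult A) (n n' : mult C) :
  tensm m n * tensm m' n' = tensm (m * m') (n * n') :> mult (A \ox C).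
Proof. by apply: tensm_eq => a c; rewrite mactM !tensmE. Qed.

Lemma tensm11 A C : tensm (1 : mult A) (1 : mult C) = 1 :> mult (A \ox C).
Proof. by apply: tensm_eq => a c; rewrite tensmE. Qed.

Lemma tensm_star A C (m : mult A) (n : mult C) :
  mstar (tensm m n : mult (A \ox C)) = tensm (mstar m) (mstar n).
Proof.
apply: (mstar_total (tot A C)) => _ _ [a [c ->]] [a' [c' ->]].
by rewrite !tensmE !(tens_star (tensP D _ _)) !(tensM (tensP D _ _)) !multP.
Qed.

Lemma tensm_emb A C (a : A) (c : C) : tensm (emb a) (emb c) = emb (tens a c : A \ox C).
Proof. by apply: tensm_eq => a' c'; rewrite tensmE /= (tensM (tensP D _ _)). Qed.

Lemma tensm_linl A C (n : mult C) : islin (fun m : mult A => tensm m n : mult (A \ox C)).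
Proof.
move=> k a b; apply: tensm_eq => x c.
by rewrite multDE multZE !tensmE multDE multZE (tens_linl (tensP D _ _)).
Qed.

Lemma tensm_linr A C (m : mult A) : islin (fun n : mult C => tensm m n : mult (A \ox C)).
Proof.
move=> k a b; apply: tensm_eq => x c.
by rewrite multDE multZE !tensmE multDE multZE (tens_linr (tensP D _ _)).
Qed.

Lemma nm_tensm A C (m : mult A) (n : mult C) : nm (tensm m n : mult (A \ox C)) <= nm m * nm n.
Proof.
have [x xb xE] := tensm_exists (tensP D A C) m n; suff -> : tensm m n = x by [].
by apply: tensm_eq => a c; rewrite tensmE xE.
Qed.

Lemma tens_mhom_eq A C B (h k : A \ox C -> mult B) : ismhom h -> ismhom k ->
  (forall a c, h (tens a c) = k (tens a c)) -> h = k.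
Proof. by move=> hh kh e; apply: (mhom_total (tot A C)) => // _ [a [c ->]]. Qed.

Lemma tensmhL A C A' (p : A -> mult A') : ismhom p ->
  ismhom (tensmh p (@emb R C) : A \ox C -> mult (A' \ox C)) /\
  forall a c, tensmh p (@emb R C) (tens a c : A \ox C) = tensm (p a) (emb c) :> mult (A' \ox C).
Proof.
move=> ph; have := @the_spec _ (fun=> mone _) (fun h : A \ox C -> mult (A' \ox C) =>
   ismhom h /\ forall a c, h (tens a c) = tensm (p a) (emb c)).
apply; have [h hh hE] := tmh_exists (tensP D A C) (tensP D A' C) ph.
by exists h; split=> // a c; apply: tensm_eq => a' c'; rewrite hE tensmE.
Qed.

Lemma tensmhR A C C' (q : C -> mult C') : ismhom q ->
  ismhom (tensmh (@emb R A) q : A \ox C -> mult (A \ox C')) /\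
  forall a c, tensmh (@emb R A) q (tens a c : A \ox C) = tensm (emb a) (q c) :> mult (A \ox C').
Proof.
move=> qh; have := @the_spec _ (fun=> mone _) (fun h : A \ox C -> mult (A \ox C') =>
   ismhom h /\ forall a c, h (tens a c) = tensm (emb a) (q c)).
apply; have [h hh hE] := tmh_exists (tens_flip (tensP D A C)) (tens_flip (tensP D A C')) qh.
by exists h; split=> // a c; apply: tensm_eq => a' c'; rewrite hE tensmE.
Qed.

Section L.
Variables (A C A' : cstarAlg R) (p : A -> mult A').
Hypothesis pn : nondeg p.
Let ph : ismhom p. Proof. by case: pn. Qed.
Local Notation pC := (tensmh p (@emb R C) : A \ox C -> mult (A' \ox C)).

Lemma tensmhL_nondeg : nondeg pC.
Proof.
have [hh hE] := tensmhL C ph; split=> //.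
apply: (tens_total2 (tensP D A' C) (proj2 pn) (cmul_total C)) => _ _ [a [b ->]] [c [d ->]].
by apply: cspan_sub; exists (tens a c), (tens b d); rewrite hE tensmE.
Qed.

Lemma mext_tensmL (m : mult A) (n : mult C) : mext pC (tensm m n) = tensm (mext p m) n.
Proof.
have [hh hE] := tensmhL C ph.
apply: (mext_uniq_total tensmhL_nondeg (tot A C) (tot A' C)) => _ _ [a [c ->]] [b [d ->]].
by rewrite tensmE !hE !tensmE (mextP pn) /= multM.
Qed.
End L.

Section RR.
Variables (A C C' : cstarAlg R) (q : C -> mult C').
Hypothesis qn : nondeg q.
Let qh : ismhom q. Proof. by case: qn. Qed.
Local Notation Aq := (tensmh (@emb R A) q : A \ox C -> mult (A \ox C')).

Lemma tensmhR_nondeg : nondeg Aq.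
Proof.
have [hh hE] := tensmhR A qh; split=> //.
apply: (tens_total2 (tensP D A C') (cmul_total A) (proj2 qn)) => _ _ [a [b ->]] [c [d ->]].
by apply: cspan_sub; exists (tens a c), (tens b d); rewrite hE tensmE.
Qed.

Lemma mext_tensmR (m : mult A) (n : mult C) : mext Aq (tensm m n) = tensm m (mext q n).
Proof.
have [hh hE] := tensmhR A qh.
apply: (mext_uniq_total tensmhR_nondeg (tot A C) (tot A C')) => _ _ [a [c ->]] [b [d ->]].
by rewrite tensmE !hE !tensmE (mextP qn) /= multM.
Qed.
End RR.

(** The extension into M(B ⊗ C) exists by [tensmhL]; on elementary tensors it takes values in the
    closed subspace B ⊗ C, so a bounded map g into B ⊗ C lies beneath it. *)
Lemma tensidP A B C (f : A -> B) : ishom f ->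
  ishom (@tensid R G D _ _ C f : A \ox C -> B \ox C) /\
  forall a c, @tensid R G D _ _ C f (tens a c : A \ox C) = tens (f a) c :> B \ox C.
Proof.
move=> fh; have := @the_spec _ (fun=> 0) (fun h : A \ox C -> B \ox C =>
   ishom h /\ forall a c, h (tens a c) = tens (f a) c).
apply; have [hh hE] := tensmhL C (ismhom_emb fh); set h := tensmh _ _ in hh hE.
have hl := ismhom_lin hh.
have [|g [gl gb gE]] := @ext_total R _ (B \ox C) (A * C)%type (fun i => tens i.1 i.2 : A \ox C)
   (fun i => tens (f i.1) i.2) _ _ (ler0n R 2) (tens_tot_ind _) (tot A C).
  move=> s; rewrite -nm_emb; apply: le_trans (mhom_bound _ hh).
  rewrite (islin_sum (@emb_lin R _)) (islin_sum hl) le_eqVlt; apply/orP; left; apply/eqP; congr nm.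
  by apply: eq_bigr => i _; rewrite (islinZ (@emb_lin R _)) (islinZ hl) hE tensm_emb.
have gbd : bdlin g by split=> //; exists 2.
have eg : forall x, h x = emb (g x).
  have eb : bdlin (@emb R (B \ox C)) by apply: mhom_bdlin; exact: ismhom_id.
  apply: (dense_bdlin_eq (tot A C) (mhom_bdlin hh) (bdlin_comp gbd eb)) => _ [a [c ->]].
  by rewrite hE tensm_emb /= (gE (a, c)).
exists g; split; last by move=> a c; rewrite (gE (a, c)).
split=> // [x y|x]; apply: emb_inj.
- by rewrite embM -!eg (ismhomM _ _ hh).
- by rewrite emb_star -!eg (ismhomS _ hh).
Qed.

Lemma slicelP A C (f : A -> R[i]^o) : bdlin f ->
  bdlin (slicel f : A \ox C -> C) /\ forall a c, slicel f (tens a c : A \ox C) = f a *: c.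
Proof.
move=> fb; have [|hl hc hE] := @the_spec _ (fun=> 0) (fun h : A \ox C -> C =>
  [/\ islin h, continuous h & forall a c, h (tens a c) = f a *: c]).
  2: by split=> //; apply/bdlinP.
have [h hb hE] := slice_exists (tensP D A C) fb; exists h; split=> //; last exact: bdlin_cont.
by case: hb.
Qed.

Lemma slicerP A C (f : C -> R[i]^o) : bdlin f ->
  bdlin (slicer f : A \ox C -> A) /\ forall a c, slicer f (tens a c : A \ox C) = f c *: a.
Proof.
move=> fb; have [|hl hc hE] := @the_spec _ (fun=> 0) (fun h : A \ox C -> A =>
  [/\ islin h, continuous h & forall a c, h (tens a c) = f c *: a]).
  2: by split=> //; apply/bdlinP.
have [h hb hE] := slice_exists (tens_flip (tensP D A C)) fb; exists h; split=> //; last exact: bdlin_cont.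
by case: hb.
Qed.

Lemma slicer_bd A C (f : C -> R[i]^o) : bdlin f -> bdlin (slicer f : A \ox C -> A).
Proof. by case/(slicerP A). Qed.
Lemma slicel_bd A C (f : A -> R[i]^o) : bdlin f -> bdlin (slicel f : A \ox C -> C).
Proof. by case/(slicelP C). Qed.
Lemma slicerE A C (f : C -> R[i]^o) a c : bdlin f -> slicer f (tens a c : A \ox C) = f c *: a.
Proof. by case/(slicerP A). Qed.
Lemma slicelE A C (f : A -> R[i]^o) a c : bdlin f -> slicel f (tens a c : A \ox C) = f a *: c.
Proof. by case/(slicelP C). Qed.

Lemma slicer_tensm A C (g : C -> R[i]^o) (m : mult A) (n : mult C) x : bdlin g ->
  slicer g (tensm m n x : A \ox C) = m (slicer (fun c => g (n c)) x).
Proof.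
move=> gb; have gnb : bdlin (fun c => g (n c)) by exact: (bdlin_comp (mact_bdlin n) gb).
move: x; apply: (dense_bdlin_eq (tot A C)).
- exact: (bdlin_comp (mact_bdlin _) (slicer_bd A gb)).
- exact: (bdlin_comp (slicer_bd A gnb) (mact_bdlin m)).
by move=> _ [a [c ->]] /=; rewrite tensmE !slicerE// (islinZ (mult_lin m)).
Qed.

Lemma slicel_tensm A C (f : A -> R[i]^o) (m : mult A) (n : mult C) x : bdlin f ->
  slicel f (tensm m n x : A \ox C) = n (slicel (fun c => f (m c)) x).
Proof.
move=> fb; have fmb : bdlin (fun c => f (m c)) by exact: (bdlin_comp (mact_bdlin m) fb).
move: x; apply: (dense_bdlin_eq (tot A C)).
- exact: (bdlin_comp (mact_bdlin _) (slicel_bd C fb)).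
- exact: (bdlin_comp (slicel_bd C fmb) (mact_bdlin n)).
by move=> _ [a [c ->]] /=; rewrite tensmE !slicelE// (islinZ (mult_lin n)).
Qed.

Lemma slicer_tensid A B C (f : A -> B) (g : C -> R[i]^o) x : ishom f -> bdlin g ->
  slicer g (@tensid R G D _ _ C f x : B \ox C) = f (slicer g (x : A \ox C)).
Proof.
move=> fh gb; have [hh hE] := tensidP C fh; move: x; apply: (dense_bdlin_eq (tot A C)).
- exact: (bdlin_comp (hom_bdlin hh) (slicer_bd B gb)).
- exact: (bdlin_comp (slicer_bd A gb) (hom_bdlin fh)).
by move=> _ [a [c ->]] /=; rewrite hE !slicerE// (islinZ (ishom_lin fh)).
Qed.
End T.

(** * Slices, coactions and their morphisms *)

Section Slices.
Context {R : realType} {G : lcGroupType} {D : groupData R G}.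
Implicit Types A B C : cstarAlg R.
Local Notation CG := (gdA D).
Local Notation "A \ox C" := (tp D A C) (at level 40, left associativity).
Local Notation tot A C := (tens_total (tensP D A C)).

(** The product x m in A. A multiplier gives only a left action, and the right one is recovered
    through adjoints. *)
Definition rm A (x : A) (m : mult A) : A := star (mstar m (star x)).

Lemma rmE A (x : A) (m : mult A) : emb x * m = emb (rm x m).
Proof.
rewrite -[LHS]mstarK mstarM -emb_star -[RHS]mstarK -emb_star /rm starK; congr mstar.
by rewrite emb_mact.
Qed.

Lemma rm_bdlin A (m : mult A) : bdlin (fun x => rm x m).
Proof.
split=> [k x y|]; first by rewrite /rm starDD starZ (mult_lin (mstar m)) starDD starZ conjCK.
by exists (nm m) => [|x]; [exact: nm_ge0|rewrite nm_star (le_trans (nm_mact _ _))// nm_mstar nm_star].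
Qed.

Lemma rm_tens A C (a : A) (c : C) m n : rm (tens a c : A \ox C) (tensm m n) = tens (rm a m) (rm c n).
Proof. by rewrite /rm tensm_star !(tens_star (tensP D _ _)) tensmE (tens_star (tensP D _ _)). Qed.

Lemma slicer_rm A C (g : C -> R[i]^o) (m : mult A) (n : mult C) x : bdlin g ->
  slicer g (rm x (tensm m n) : A \ox C) = rm (slicer (fun c => g (rm c n)) x) m.
Proof.
move=> gb; have gnb : bdlin (fun c => g (rm c n)) by exact: (bdlin_comp (rm_bdlin n) gb).
move: x; apply: (dense_bdlin_eq (tot A C)).
- exact: (bdlin_comp (rm_bdlin _) (slicer_bd A gb)).
- exact: (bdlin_comp (slicer_bd A gnb) (rm_bdlin m)).
move=> _ [a [c ->]] /=; rewrite rm_tens !slicerE//.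
by rewrite (islinZ (proj1 (rm_bdlin m))).
Qed.

Lemma rm_emb A (x y : A) : rm x (emb y) = x ** y.
Proof. by rewrite /rm -emb_star /= starM !starK. Qed.
Lemma rm1 A (x : A) : rm x 1 = x. Proof. by rewrite /rm mstar1 mact1 starK. Qed.

Lemma tens_unit_r A C (s : seq (A \ox C)) (e : R) : 0 < e ->
  exists d : C, [/\ star d = d, nm d <= 2
    & forall x, x \in s -> nm (x - tensm 1 (emb d) x) <= e].
Proof.
move=> e0; have e4 : 0 < e / 4 by rewrite divr_gt0.
have [z hz] := choice (P := fun (x : A \ox C) w => nm (x - zt (@tens R D A C) w) < e / 4)
  (fun x => zt_dense (tensP D A C) x e4).
pose N := \sum_(x <- s) \sum_(p <- z x) nm p.1.
have N0 : 0 <= N by rewrite sumr_ge0// => x _; rewrite sumr_ge0// => p _; exact: nm_ge0.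
have [r [r0 _ re]] := small_eps e4 N0.
have [d [sd d2 hd]] := approx_unit [seq p.2 | p <- flatten [seq z x | x <- s]] r0.
exists d; split=> // x xs.
have h1 : nm (zt (@tens R D A C) (z x) - tensm 1 (emb d) (zt (@tens R D A C) (z x))) <= e / 4.
  apply: le_trans re; rewrite /zt (islin_sum (mult_lin _)) -sumrB (le_trans (nm_sum _ _ _))//.
  apply: (le_trans (y := \sum_(p <- z x) nm p.1 * r)).
    rewrite big_seq [leRHS]big_seq; apply: ler_sum => p px.
    rewrite tensmE -(islinB (tens_linr (tensP D _ _) _)) (le_trans (nm_tens (tensP D _ _) _ _))//.
    apply: ler_wpM2l; first exact: nm_ge0.
    by have [] := hd p.2; first (apply: map_f; apply/flatten_mapP; exists x).
  rewrite -mulr_suml ler_wpM2r ?(ltW r0)// /N (big_rem x xs)/= lerDl.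
  by apply: sumr_ge0 => y _; apply: sumr_ge0 => p _; exact: nm_ge0.
set w := zt _ _ in h1.
have h2 : nm (tensm 1 (emb d) (w - x)) <= 2 * nm (w - x).
  rewrite (le_trans (nm_mact _ _))// ler_wpM2r ?nm_ge0// (le_trans (nm_tensm _ _))//.
  by rewrite nm_emb; have := @nm1_le R A; have := nm_ge0 (1 : mult A); have := nm_ge0 d; nra.
have h3 : nm (x - w) < e / 4 by exact: hz.
have -> : x - tensm 1 (emb d) x = (x - w) + (w - tensm 1 (emb d) w) + tensm 1 (emb d) (w - x).
  by rewrite (islinB (mult_lin (tensm 1 (emb d)))) !addrA subrK subrK.
have := nmD (x - w + (w - tensm 1 (emb d) w)) (tensm 1 (emb d) (w - x)).
by have := nmD (x - w) (w - tensm 1 (emb d) w); move: h2; rewrite (nmBC w x); lra.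
Qed.

Lemma bdfunP A (g : A -> R[i]^o) : bounded_functional g <-> bdlin g.
Proof. by split=> [[gl gc]|gb]; [apply/bdlinP|split; [case: gb|exact: bdlin_cont]]. Qed.

(** The slice must not depend on how f factors as g(x c). A left factor 1 ⊗ d turns m into an
    element s of A ⊗ C, and slicing s involves only the function x -> g(x c), which is the same for
    both factorizations. *)
Lemma tslicer_wd A C (m : mult (A \ox C)) (g g' : C -> R[i]^o) c c' t t' : tildeM m ->
  bdlin g -> bdlin g' -> (forall x, g (x ** c) = g' (x ** c')) ->
  m * tensm 1 (emb c) = emb t -> m * tensm 1 (emb c') = emb t' -> slicer g t = slicer g' t'.
Proof.
move=> mt gb g'b e mt1 mt2; apply/eqP; rewrite -subr_eq0; apply/eqP.
have sb : bdlin (slicer g : A \ox C -> A) := slicer_bd A gb.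
have s'b : bdlin (slicer g' : A \ox C -> A) := slicer_bd A g'b.
have [_ [L L0 gL]] := sb; have [_ [L' L'0 g'L]] := s'b.
apply: (@nm_eps _ _ _ (L + L')) => r r0.
have [d [_ _ hd]] := tens_unit_r [:: t; t'] r0.
have key (h : C -> R[i]^o) b u : bdlin h -> m * tensm 1 (emb b) = emb u ->
    exists2 s, tensm 1 (emb d) * m = emb s & slicer h (tensm 1 (emb d) u) = slicer (fun x => h (x ** b)) s.
  move=> hb mu; have [_ [s sE]] := mt d; exists s => //.
  have -> : tensm 1 (emb d) u = rm s (tensm 1 (emb b)).
    apply: emb_inj; rewrite -rmE -[emb s]sE -[mmul _ m]/(_ * m) -mulrA mu.
    by apply: mult_ext => y; rewrite mactM /= multM.
  rewrite slicer_rm// rm1; congr (slicer _ s); apply/funext => x; by rewrite rm_emb.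
have [s sE k1] := key g c t gb mt1; have [s' s'E k2] := key g' c' t' g'b mt2.
have ss : s = s' by apply: emb_inj; rewrite -sE.
have k3 : slicer g (tensm 1 (emb d) t) = slicer g' (tensm 1 (emb d) t').
  by rewrite k1 k2 ss; congr (slicer _ s'); apply/funext.
have -> : slicer g t - slicer g' t' = slicer g (t - tensm 1 (emb d) t) - slicer g' (t' - tensm 1 (emb d) t').
  rewrite (islinB (proj1 (slicer_bd A gb))) (islinB (proj1 (slicer_bd A g'b))) k3.
  by rewrite opprB addrA subrK.
rewrite (le_trans (nmB _ _))// mulrDl lerD//.
  by rewrite (le_trans (gL _))// ler_wpM2l// hd// !inE eqxx.
by rewrite (le_trans (g'L _))// ler_wpM2l// hd// !inE eqxx orbT.
Qed.

Lemma tslicerE A C (m : mult (A \ox C)) (f g : C -> R[i]^o) c t : tildeM m -> bdlin g ->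
  (forall x, f x = g (x ** c)) -> m * tensm 1 (emb c) = emb t -> tslicer f m = slicer g t.
Proof.
move=> mt gb fg mc.
have [|g' [c' [t' [/bdfunP g'b fg' mc' e]]]] := @the_spec _ 0 (fun a : A => exists g c t,
  [/\ bounded_functional g, (forall x, f x = g (x ** c)),
    mmul m (tensm (mone A) (emb c)) = emb t & a = slicer g t]).
  by exists (slicer g t), g, c, t; split=> //; apply/bdfunP.
rewrite /tslicer e.
by apply: (tslicer_wd (m := m) (c := c') (c' := c)) => // x; rewrite -fg fg'.
Qed.

(** Together with [tslicerE] this covers every functional: either it factors, or the slice is the
    default 0. *)
Lemma tslicer0 A C (m : mult (A \ox C)) (f : C -> R[i]^o) : tildeM m ->
  ~ (exists g c, bdlin g /\ (forall x, f x = g (x ** c))) -> tslicer f m = 0.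
Proof.
move=> mt h; apply: the_none => -[a [g [c [t [/bdfunP gb fg _ _]]]]].
by apply: h; exists g, c.
Qed.

Lemma tilde_ex A C (m : mult (A \ox C)) c : tildeM m -> exists t, m * tensm 1 (emb c) = emb t.
Proof. by move=> /(_ c)[]. Qed.

Lemma tens1c_eq A C (m n : mult (A \ox C)) :
  (forall c, m * tensm 1 (emb c) = n * tensm 1 (emb c)) -> m = n.
Proof.
move=> h; have dC : cspan [set x : A \ox C | exists a c c', x = tens a (c ** c')] = setT.
  apply: (tens_total2 (tensP D A C) (S1 := setT) _ (cmul_total C)).
    by rewrite -subTset => x _; apply: cspan_sub.
  by move=> a _ _ [c [c' ->]]; apply: cspan_sub; exists a, c, c'.
apply: (mult_eq_total dC) => _ [a [c [c' ->]]].
have -> : tens a (c ** c') = tensm 1 (emb c) (tens a c' : A \ox C) by rewrite tensmE.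
by rewrite -!mactM h.
Qed.

Lemma tbar_uniq A B C (f : A -> B) (m : mult (A \ox C)) (n : mult (B \ox C)) : tildeM m -> tildeM n ->
  (forall c t, m * tensm 1 (emb c) = emb t -> n * tensm 1 (emb c) = emb (@tensid R G D _ _ C f t)) ->
  tbar f m = n.
Proof.
move=> mt nt h; have [|tt tE] := @the_spec _ (mone _) (fun n => tildeM n /\
    forall c t, mmul m (tensm (mone A) (emb c)) = emb t ->
                mmul n (tensm (mone B) (emb c)) = emb (@tensid R G D _ _ C f t)).
  by exists n.
by apply: tens1c_eq => c; have [t mc] := tilde_ex c mt; rewrite (h _ _ mc); exact: tE.
Qed.

Lemma mult_trivial A (m n : mult A) : 1 = 0 :> mult A -> m = n.
Proof. by move=> h; rewrite -[m]mul1r -[n]mul1r h !mul0r. Qed.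

Lemma tildeMZ A C k (m : mult (A \ox C)) : tildeM m -> tildeM (k *: m).
Proof.
move=> h c; have [[t ht] [t' ht']] := h c; split; [exists (k *: t)|exists (k *: t')].
  by rewrite (islinZ (@emb_lin R _)) -ht; exact: mscAl.
by rewrite (islinZ (@emb_lin R _)) -ht'; exact: mscAr.
Qed.

Implicit Types S T : coaction D.

Lemma codelta_hom S : ismhom (@codelta _ _ _ S). Proof. by case: (@codelta_nondeg _ _ _ S). Qed.

(** Equivariance is stated with the description [tbar]. If that were void at a, it would be void at
    2 a, so both values of the coaction would be the default 1; linearity gives 1 = 2, and in the
    zero algebra the identity holds anyway. *)
Lemma comor_tens S T (f : comor S T) a c t : codelta a * tensm 1 (emb c) = emb t ->
  codelta (f a) * tensm 1 (emb c) = emb (@tensid R G D _ _ CG f t).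
Proof.
move=> ac; pose P a n := tildeM n /\
    forall c t, mmul (codelta (a : S)) (tensm (mone S) (emb c)) = emb t ->
                mmul n (tensm (mone T) (emb c)) = emb (@tensid R G D _ _ CG f t).
have fh := cofun_hom f; have [th _] := tensidP (D := D) CG fh.
have [ex|nex] := pselect (exists n, P a n).
  by have [_] := the_spec (mone _) ex; rewrite -/(tbar _ _) -(cofun_equiv f a); apply.
have bad : ~ exists n, P (2 *: a) n.
  move=> [n [nt nE]]; apply: nex; exists (2^-1 *: n); split; first exact: tildeMZ.
  move=> c' t' h; rewrite [LHS]mscAl [_ * _](nE c' (2 *: t')).
    rewrite (islinZ (ishom_lin th)) (islinZ (@emb_lin R _)) scalerA mulVf ?scale1r//.
  rewrite (islinZ (ismhom_lin (codelta_hom S))) (islinZ (@emb_lin R _)) -h.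
  exact: mscAl.
have d1 : codelta (f a) = 1 by rewrite (cofun_equiv f); exact: the_none.
have d2 : codelta (f (2 *: a)) = 1 by rewrite (cofun_equiv f); exact: the_none.
apply: mult_trivial; move: d2; rewrite (islinZ (ishom_lin fh)) (islinZ (ismhom_lin (codelta_hom T))).
by rewrite d1 scaler_nat mulr2n => /(congr1 (fun x => x - 1)); rewrite addrK subrr.
Qed.

Lemma mk_comor S T (f : S -> T) : ishom f ->
  (forall a c t, codelta a * tensm 1 (emb c) = emb t ->
     codelta (f a) * tensm 1 (emb c) = emb (@tensid R G D _ _ CG f t)) ->
  exists h : comor S T, h =1 f.
Proof.
move=> fh fE; have eq a : codelta (f a) = tbar f (codelta a).
  by apply/esym/tbar_uniq; [exact: codelta_tilde..|exact: fE].
by exists (Comor fh eq).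
Qed.

Lemma ishom_comp A B C (f : A -> B) (g : B -> C) : ishom f -> ishom g -> ishom (g \o f).
Proof.
move=> [f1 f2 f3] [g1 g2 g3]; split=> [k a b|a b|a] /=.
- by rewrite f1 g1.
- by rewrite f2 g2.
- by rewrite f3 g3.
Qed.

Lemma tensid_comp A B C E (f : A -> B) (g : B -> C) (h : A -> C) x : ishom f -> ishom g -> ishom h ->
  h =1 g \o f ->
  @tensid R G D _ _ E h x = @tensid R G D _ _ E g (@tensid R G D _ _ E f x).
Proof.
move=> fh gh hh e; have [h1 e1] := tensidP (D := D) E fh; have [h2 e2] := tensidP (D := D) E gh.
have [h3 e3] := tensidP (D := D) E hh; move: x; apply: (dense_bdlin_eq (tot A E)).
- exact: hom_bdlin.
- exact: (bdlin_comp (hom_bdlin h1) (hom_bdlin h2)).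
by move=> _ [a [c ->]] /=; rewrite e1 e2 e3 e.
Qed.

Lemma comor_comp S T U (f : comor S T) (g : comor T U) : exists h : comor S U, h =1 g \o f.
Proof.
have fh := cofun_hom f; have gh := cofun_hom g; have hh := ishom_comp fh gh.
apply: mk_comor => // a c t ac.
by rewrite (comor_tens g (comor_tens f ac)) (tensid_comp _ fh gh hh).
Qed.

(** Whether e factors depends on e alone, so the two sides are both genuine slices or both the
    default 0. *)
Lemma tslicer_comor S T (f : comor S T) (e : CG -> R[i]^o) a :
  tslicer e (codelta (f a)) = f (tslicer e (codelta a)).
Proof.
have fh := cofun_hom f.
have [[g [c [gb eg]]]|h] := pselect (exists g c, bdlin g /\ forall x, e x = g (x ** c)).
  have [t ac] := tilde_ex c (@codelta_tilde _ _ _ _ a).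
  rewrite (tslicerE (@codelta_tilde _ _ _ _ a) gb eg ac).
  rewrite (tslicerE (@codelta_tilde _ _ _ _ (f a)) gb eg (comor_tens f ac)).
  exact: slicer_tensid.
rewrite (tslicer0 (@codelta_tilde _ _ _ _ a) h) (tslicer0 (@codelta_tilde _ _ _ _ (f a)) h).
by rewrite (islin0 (ishom_lin fh)).
Qed.

Lemma idealE_comor E S T (f : comor S T) a : idealE E (S := S) a -> idealE E (S := T) (f a).
Proof. by move=> h e Ee; rewrite tslicer_comor h// (islin0 (ishom_lin (cofun_hom f))). Qed.

Section Quot.
Variables (E : set (CG -> R[i]^o)) (F : coaction D -> coaction D) (Q : forall S, comor S (F S)).
Hypothesis hQ : is_quotientE E F Q.

Lemma Q_surj S y : exists x, Q S x = y. Proof. by have [h _] := hQ S. Qed.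
Lemma Q_ker S x : Q S x = 0 <-> idealE E (S := S) x.
Proof. by have [_ <-] := hQ S. Qed.

Lemma induced_comor S T (f : comor S T) : exists h : comor (F S) (F T), h \o Q S =1 Q T \o f.
Proof.
have [s sP] := choice (@Q_surj S); pose h y := Q T (f (s y)).
have Qh S' := cofun_hom (Q S'); have fh := cofun_hom f.
have hE x : h (Q S x) = Q T (f x).
  apply/eqP; rewrite -subr_eq0 /h -(islinB (ishom_lin (Qh T))) -(islinB (ishom_lin fh)); apply/eqP.
  by apply/Q_ker; apply: idealE_comor; apply/Q_ker; rewrite (islinB (ishom_lin (Qh S))) sP subrr.
have hh : ishom h.
  split=> [k y z|y z|y].
  - have [x <-] := Q_surj y; have [x' <-] := Q_surj z.
    by rewrite -(ishom_lin (Qh S)) !hE (ishom_lin fh) (ishom_lin (Qh T)).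
  - have [x <-] := Q_surj y; have [x' <-] := Q_surj z.
    by rewrite -(ishomM _ _ (Qh S)) !hE (ishomM _ _ fh) (ishomM _ _ (Qh T)).
  - by have [x <-] := Q_surj y; rewrite -(ishomS _ (Qh S)) !hE (ishomS _ fh) (ishomS _ (Qh T)).
have [|k kE] := mk_comor hh; last by exists k => x; rewrite /= kE hE.
move=> y c t; have [x <-] := Q_surj y => yc.
have [u xc] := tilde_ex c (@codelta_tilde _ _ _ _ x).
have : emb t = emb (@tensid R G D _ _ CG (Q S) u) by rewrite -yc (comor_tens (Q S) xc).
move/emb_inj => ->; rewrite hE (comor_tens (Q T) (comor_tens f xc)); congr emb.
rewrite -(tensid_comp _ fh (Qh T) (ishom_comp fh (Qh T)) (fun=> erefl)).
apply: (tensid_comp _ (Qh S) hh (ishom_comp fh (Qh T))) => z /=.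
by rewrite hE.
Qed.
End Quot.
End Slices.

(** * Subalgebras of multiplier algebras and universal properties *)

Section Sub.
Context {R : realType}.

(** A closed *-subalgebra. Through [subalg] it becomes an algebra to which the universal properties
    can be applied. *)
Record cssub (M : cstarAlg R) := CsSub {
  cs_set :> M -> Prop;
  cs_closed : forall x, (forall e : R, 0 < e -> exists2 y, cs_set y & nm (x - y) < e) -> cs_set x;
  cs_lin : forall k a b, cs_set a -> cs_set b -> cs_set (k *: a + b);
  cs_0 : cs_set 0;
  cs_mul : forall a b, cs_set a -> cs_set b -> cs_set (a ** b);
  cs_star : forall a, cs_set a -> cs_set (star a)
}.

Section Carrier.
Variables (M : cstarAlg R) (P : cssub M).
Record scar := Scar { sv : M; svP : P sv }.
Implicit Types x y z : scar.

Lemma sv_inj : injective sv.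
Proof. by move=> [x px] [y py] /= e; case: _ / e py => py; congr Scar; exact: Prop_irrelevance. Qed.

HB.instance Definition _ := gen_eqMixin scar.
HB.instance Definition _ := gen_choiceMixin scar.

Lemma scale_P k x : P (k *: sv x).
Proof. by rewrite -[_ *: _]addr0; apply: cs_lin; [exact: svP|exact: cs_0]. Qed.
Lemma add_P x y : P (sv x + sv y).
Proof. by rewrite -[sv x]scale1r; apply: cs_lin; exact: svP. Qed.
Definition sadd x y := Scar (add_P x y).
Definition sscale k x := Scar (scale_P k x).
Definition szero := Scar (cs_0 P).

Lemma saddA : associative sadd.
Proof. by move=> x y z; apply: sv_inj; exact: addrA. Qed.
Lemma saddC : commutative sadd.
Proof. by move=> x y; apply: sv_inj; exact: addrC. Qed.
Lemma sadd0 : left_id szero sadd.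
Proof. by move=> x; apply: sv_inj; exact: add0r. Qed.
Lemma saddN : left_inverse szero (sscale (-1)) sadd.
Proof. by move=> x; apply: sv_inj; rewrite /= scaleN1r addNr. Qed.
HB.instance Definition _ := GRing.isZmodule.Build scar saddA saddC sadd0 saddN.

Lemma sscaleA k l x : sscale k (sscale l x) = sscale (k * l) x.
Proof. by apply: sv_inj; exact: scalerA. Qed.
Lemma sscale1 : left_id 1 sscale.
Proof. by move=> x; apply: sv_inj; exact: scale1r. Qed.
Lemma sscaleDr : right_distributive sscale +%R.
Proof. by move=> k x y; apply: sv_inj; exact: scalerDr. Qed.
Lemma sscaleDl x : {morph sscale^~ x : k l / k + l}.
Proof. by move=> k l; apply: sv_inj; exact: scalerDl. Qed.
HB.instance Definition _ := GRing.Zmodule_isLmodule.Build R[i] scar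
  sscaleA sscale1 sscaleDr sscaleDl.

Lemma svN x : sv (- x) = - sv x. Proof. by rewrite -[RHS]scaleN1r. Qed.

Definition snorm x : R[i] := `|sv x|.
Lemma snormD x y : snorm (x + y) <= snorm x + snorm y. Proof. exact: ler_normD. Qed.
Lemma snormZ k x : snorm (k *: x) = `|k| * snorm x. Proof. exact: normrZ. Qed.
Lemma snorm0_eq0 x : snorm x = 0 -> x = 0.
Proof. by move=> /normr0_eq0 h; apply: sv_inj. Qed.
HB.instance Definition _ :=
  Lmodule_isNormed.Build R[i] scar snormD snormZ snorm0_eq0.

Lemma nm_sv x : nm (sv x) = nm x. Proof. by []. Qed.

Lemma scar_complete (F : set_system scar) : ProperFilter F -> cauchy F -> cvg F.
Proof.
apply: seq_complete => u hu; have r1 : (2^-1 : R) < 1 by rewrite invf_lt1// ltr1n.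
have [|//|n|l ul _] := @geo_complete R M (fun i : nat => sv (u i)) 2 2^-1.
- by rewrite invr_ge0.
- by rewrite nmBC -svN; apply: hu.
have Pl : P l.
  apply: cs_closed => e e0; have [N hN] := ul e e0; exists (sv (u N)); first exact: svP.
  by rewrite nmBC hN.
by exists (Scar Pl) => e e0; have [N hN] := ul e e0; exists N => n Nn; rewrite -nm_sv -[sv _]/(sv (u n) + sv (- Scar Pl)) svN; exact: hN.
Qed.
HB.instance Definition _ := Uniform_isComplete.Build scar scar_complete.

Lemma smul_P x y : P (sv x ** sv y). Proof. by apply: cs_mul; exact: svP. Qed.
Lemma sstar_P x : P (star (sv x)). Proof. by apply: cs_star; exact: svP. Qed.
Definition smul x y := Scar (smul_P x y).
Definition sstar x := Scar (sstar_P x).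

Lemma smulA x y z : smul x (smul y z) = smul (smul x y) z.
Proof. by apply: sv_inj; exact: cmulA. Qed.
Lemma smulDl (k : R[i]) x y z : smul (k *: x + y) z = k *: smul x z + smul y z.
Proof. by apply: sv_inj; exact: cmulDl. Qed.
Lemma smulDr (k : R[i]) x y z : smul z (k *: x + y) = k *: smul z x + smul z y.
Proof. by apply: sv_inj; exact: cmulDr. Qed.
Lemma smul_norm x y : `|smul x y| <= `|x| * `|y|. Proof. exact: cmul_norm. Qed.
Lemma sstarK x : sstar (sstar x) = x. Proof. by apply: sv_inj; exact: starK. Qed.
Lemma sstarD (k : R[i]) x y : sstar (k *: x + y) = k^* *: sstar x + sstar y.
Proof. by apply: sv_inj; exact: starD. Qed.
Lemma sstarM x y : sstar (smul x y) = smul (sstar y) (sstar x).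
Proof. by apply: sv_inj; exact: starM. Qed.
Lemma scstar x : `|smul (sstar x) x| = `|x| ^+ 2. Proof. exact: cstar_id. Qed.

Definition subalg : cstarAlg R := CstarAlg smulA smulDl smulDr smul_norm sstarK sstarD sstarM scstar.
End Carrier.

Lemma emb_closed (X : cstarAlg R) (m : mult X) :
  (forall e : R, 0 < e -> exists x, nm (m - emb x) < e) -> exists x, m = emb x.
Proof.
move=> h; have h2 : (0 : R) < 2^-1 by rewrite invr_gt0.
have [u uP] := choice (fun n : nat => h (2^-1 ^+ n) (exprn_gt0 n h2)).
have r1 : (2^-1 : R) < 1 by rewrite invf_lt1// ltr1n.
have small e : 0 < e -> exists N, forall n, (N <= n)%N -> nm (m - emb (u n)) < e.
  move=> e0; have [N hN] := expr_lt_eps (@ler01 R) (ltW h2) r1 e0; exists N => n Nn.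
  by have := hN n Nn; rewrite mul1r; exact: lt_trans.
have [|l ul] := @complete_seq R X u.
  move=> e e0; have e20 : 0 < e / 2 by rewrite divr_gt0.
  have [N hN] := small _ e20; exists N => i j Ni Nj.
  rewrite -nm_emb (islinB (@emb_lin R X)) (splitr e) (le_lt_trans (nm_tri m _ _))// ltrD ?hN//.
  by rewrite nmBC hN.
exists l; apply/eqP; rewrite -subr_eq0; apply/eqP; apply: (@nm_eps _ _ _ 2) => e e0.
have [N hN] := small _ e0; have [N' hN'] := ul _ e0; pose k := maxn N N'.
rewrite (le_trans (nm_tri (emb (u k)) _ _))// mulrDl mul1r lerD//.
  by rewrite ltW// hN// leq_maxl.
by rewrite -(islinB (@emb_lin R X)) nm_emb ltW// hN'// leq_maxr.
Qed.

Section MultSub.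
Variables (X : cstarAlg R) (P : cssub (multalg X)).
Local Notation B := (subalg P).
Definition sinc (b : B) : mult X := sv b.

Lemma sinc_hom : ismhom sinc.
Proof. by split. Qed.

Hypothesis ndP : cspan [set y | exists (p : mult X) x, P p /\ y = p x] = setT.

Lemma sinc_nondeg : nondeg sinc.
Proof.
split; first exact: sinc_hom.
by apply: (cspan_total ndP) => _ [p [x [pP ->]]]; apply: cspan_sub; exists (Scar pP), x.
Qed.

Lemma sub_mult (n : mult X) : (forall p : mult X, P p -> P (n * p)) ->
  (forall p : mult X, P p -> P (mstar n * p)) ->
  exists n' : mult B, (forall b, sinc (n' b) = n * sinc b) /\ mext sinc n' = n.
Proof.
move=> h h'; pose f (b : B) : B := Scar (h (sv b) (svP b)).
pose f' (b : B) : B := Scar (h' (sv b) (svP b)).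
have ff' (a b : B) : star (f a) ** b = star a ** f' b.
  by apply: sv_inj; rewrite /= -[LHS]/(mstar (n * sv a) * sv b) mstarM -mulrA.
exists (Mult ff'); split=> //; apply: (mext_uniq sinc_nondeg) => b x /=.
by [].
Qed.

Lemma sinc_act (m : mult B) b : sinc (m b) = mext sinc m * sinc b.
Proof.
by rewrite -(mext_emb sinc_nondeg b) -(mextM sinc_nondeg) -emb_mact (mext_emb sinc_nondeg).
Qed.

Variable h : X -> mult B.
Hypotheses (hn : nondeg h) (hE : forall x, mext sinc (h x) = emb x).

(** The multiplier h x of P acts on P as x does, so X maps P into P. *)
Lemma univ_absorb x (p : mult X) : P p -> P (emb x * p).
Proof.
move=> pP; have := svP (h x (Scar pP)).
by rewrite -[sv _]/(sinc _) sinc_act hE.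
Qed.

(* The composite of [h] with the inclusion of [P] is the identity of [X], so [h] has range [P]. *)
Lemma univ_range (p : mult X) : P p <-> exists x, p = emb x.
Proof.
split=> [pP|[x ->]].
- have : forall b : B, exists x, sinc b = emb x.
    have [_ dh] := hn; apply: (total_ind dh).
    + move=> b hb; apply: emb_closed => e e0; have [b' [x b'x] bb'] := hb e e0.
      by exists x; rewrite -b'x.
    + move=> k b b' [x bx] [x' bx']; exists (k *: x + x').
      by rewrite (@emb_lin R X) -bx -bx'.
    + by exists 0; rewrite (islin0 (@emb_lin R X)).
    + move=> _ [x [b ->]]; exists (rm x (sinc b)).
      by rewrite sinc_act hE rmE.
  by move=> /(_ (Scar pP)).
- have Pl : forall y : X, P (emb y).
    apply: (total_ind ndP).
    + move=> y hy; apply: cs_closed => e e0; have [z Pz yz] := hy e e0; exists (emb z) => //.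
      by rewrite -(islinB (@emb_lin R X)) nm_emb.
    + by move=> k y z Py Pz; rewrite (@emb_lin R X); exact: cs_lin.
    + by rewrite (islin0 (@emb_lin R X)); exact: cs_0.
    + move=> _ [q [y [qP ->]]]; rewrite emb_mact.
      have := cs_star (univ_absorb (star y) (cs_star qP)).
      by rewrite -[star _]/(mstar (emb (star y) * mstar q)) mstarM mstarK -emb_star starK.
  exact: Pl.
Qed.
End MultSub.
End Sub.

(** * Functions on a locally compact group *)

Section CptInd.
Variable T : topologicalType.

(** A property of sets that is hereditary, stable under finite unions and locally true holds for
    compact sets. The sets containing some set with P form the filter for the near-covering form of
    compactness. *)
Lemma compact_ind (P : set T -> Prop) (K : set T) : compact K ->
  (forall A B, A `<=` B -> P B -> P A) -> P set0 -> (forall A B, P A -> P B -> P (A `|` B)) ->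
  (forall x, K x -> exists2 U, nbhs x U & P U) -> P K.
Proof.
move=> cK mono P0 PU loc.
pose F : set_system (set T) := [set Q | exists2 A, P A & forall B, P B -> A `<=` B -> Q B].
have FF : Filter F.
  split; first by exists set0.
  - move=> Q Q' [A PA hA] [A' PA' hA']; exists (A `|` A'); first exact: PU.
    move=> B PB AB; split; [apply: hA => // x Ax; apply: AB; by left|apply: hA' => // x Ax; apply: AB; by right].
  - by move=> Q Q' QQ' [A PA hA]; exists A => // B PB AB; apply: QQ'; exact: hA.
have /compact_near_coveringP/(_ _ F (fun i x => i x) FF) [|A PA hA] := cK.
  move=> x Kx; have [U xU PU'] := loc x Kx; exists (U, [set B | P B /\ U `<=` B]).
    by split=> //=; exists U.
  by move=> [x' B] /= [Ux' [_ UB]]; exact: UB.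
by apply: (mono _ A) => //; exact: hA.
Qed.
End CptInd.

Section Bumps.
Context {R : realType} {G : lcGroupType}.
Implicit Types (s : G) (V K : set G) (b : G -> R).

Lemma ctsR b : continuous b <->
  forall s (e : R), 0 < e -> \forall s' \near s, `|b s - b s'| < e.
Proof.
split=> [h s e e0|h s]; last by apply/cvgrPdist_lt => e e0; exact: h.
by have /cvgrPdist_lt/(_ e e0) := h s.
Qed.

Lemma cts_real b : continuous b <-> continuous (fun s => (b s)%:C%C : R[i]^o).
Proof.
have e s s' : nm ((b s)%:C%C - (b s')%:C%C : R[i]^o) = `|b s - b s'|.
  by rewrite -rmorphB -[LHS]/(cabs _) cabs_real.
split=> [/ctsR h|/cts_nm h]; [apply/cts_nm|apply/ctsR] => s d d0.
  by apply: filterS (h s d d0) => s'; rewrite e.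
by apply: filterS (h s d d0) => s'; rewrite e.
Qed.

Definition csupp V b := [/\ continuous b, forall t, 0 <= b t
  & exists2 K, compact K & K `<=` V /\ forall t, ~ K t -> b t = 0].

(** An Urysohn function f vanishing at s is cut to max(0, 1 - 2 f). The support then lies in the
    closed set where f <= 1/2, inside a compact neighbourhood, and not merely in the closure of an
    open set. *)
Lemma bump_fun s V : nbhs s V -> exists2 b, csupp V b & b s = 1.
Proof.
move=> sV; have [U sU [cU clU]] := @lcg_locally_compact G s I.
have {}sU : nbhs s U by have h : nbhs s [set t | [set: G] t -> U t] := sU; apply: filterS h => t; apply.
have sW : nbhs s (V `&` U)° by apply: nbhs_interior; exact: filterI.
set W := (V `&` U)° in sW; have oW : open W by exact: open_interior.
have clW : closed (~` W) by exact: open_closedC.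
have nWs : ~ (~` W) s by move=> /(_ (nbhs_singleton sW)).
have us := @locally_compact_completely_regular G R (@lcg_locally_compact G) (@lcg_hausdorff G) s (~` W) clW nWs.
pose f : G -> R := Urysohn [set s] (~` W).
have fc : continuous f by exact: Urysohn_continuous.
have f0 : f s = 0 by apply: (Urysohn_sub0 us); exists s.
have f1 t : (~` W) t -> f t = 1 by move=> Wt; apply: (Urysohn_sub1 us); exists t.
have c1 : continuous (fun t => 1 - 2 * f t).
  by move=> t; apply: cvgB; [exact: cvg_cst|apply: cvgM; [exact: cvg_cst|exact: fc]].
exists (fun t => Num.max 0 (1 - 2 * f t)); last by rewrite f0 mulr0 subr0 max_r.
split=> [t|t|].
- by apply: (@continuous_max _ _ (fun=> 0) (fun t => 1 - 2 * f t)); [exact: cvg_cst|exact: c1].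
- by rewrite le_max lexx.
exists [set t | f t <= 2^-1].
  apply: (subclosed_compact _ cU); last first.
    move=> t /= ft; apply: contrapT => nU; have : f t = 1 by apply: f1 => /interior_subset[].
    by move=> h; move: ft; rewrite h; apply/negP; rewrite -ltNge invf_lt1// ltr1n.
  by apply: (@closed_comp _ _ f [set x | x <= 2^-1]) => //; exact: closed_le.
split.
  move=> t /= ft; apply: contrapT => nV; have : f t = 1 by apply: f1 => /interior_subset[].
  by move=> h; move: ft; rewrite h; apply/negP; rewrite -ltNge invf_lt1// ltr1n.
move=> t /negP; rewrite -ltNge => h; apply/max_idPl.
by rewrite subr_le0 mulrC -ler_pdivrMr// mul1r ltW.
Qed.

Lemma csuppD V b b' : csupp V b -> csupp V b' -> csupp V (fun t => b t + b' t).
Proof.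
move=> [c p [K cK [KV K0]]] [c' p' [K' cK' [KV' K0']]]; split=> [t|t|].
- by apply: cvgD; [exact: c|exact: c'].
- exact: addr_ge0.
exists (K `|` K'); first exact: compactU.
split; first by move=> t [/KV|/KV'].
by move=> t h; rewrite K0 ?K0' ?addr0//; move=> ?; apply: h; [right|left].
Qed.

Lemma csupp0 V : csupp V (fun=> 0).
Proof. split=> // [t|]; first exact: cvg_cst.
exists set0; last by split.
apply: (iffRL (compact_near_coveringP _)) => I F P FF _.
by apply: filterE => i x []. Qed.

Lemma csuppS V V' b : V `<=` V' -> csupp V b -> csupp V' b.
Proof. by move=> h [c p [K cK [KV K0]]]; split=> //; exists K => //; split=> // t /KV/h. Qed.

Lemma half_near b s : continuous b -> b s = 1 -> nbhs s [set t | 2^-1 <= b t].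
Proof.
move=> /ctsR bc bs; have e0 : 0 < (2^-1 : R) by rewrite invr_gt0.
apply: filterS (bc s _ e0) => t /=; rewrite bs ltr_norml => /andP[_].
have : (2^-1 : R) + 2^-1 = 1 by field.
by lra.
Qed.

(** Finitely many bumps have a sum bounded below by some be > 0 on K; dividing by be and truncating
    at 1 flattens it. *)
Lemma plateau K V : compact K -> open V -> K `<=` V ->
  exists2 b, csupp V b & (forall t, b t <= 1) /\ forall t, K t -> b t = 1.
Proof.
move=> cK oV KV.
have [b [bV [be be0 hb]]] : exists b, csupp V b /\ exists2 be : R, 0 < be & forall t, K t -> be <= b t.
  pose P (A : set G) := exists b, csupp V b /\ exists2 be : R, 0 < be & forall t, A t -> be <= b t.
  apply: (@compact_ind G P) => //.
  - by move=> A B AB [b [h [be be0 hb]]]; exists b; split=> //; exists be => // t /AB; exact: hb.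
  - by exists (fun=> 0); split; [exact: csupp0|exists 1].
  - move=> A B [b [h [be be0 hb]]] [b' [h' [be' be0' hb']]]; exists (fun t => b t + b' t).
    split; first exact: csuppD.
    have [_ p _] := h; have [_ p' _] := h'.
    exists (Num.min be be'); first by rewrite lt_min be0.
    move=> t [/hb|/hb'] ht; rewrite ge_min.
      by rewrite (le_trans ht)// lerDl.
    by rewrite (le_trans ht) ?orbT// lerDr.
  - move=> s Ks; have [|b bV bs] := @bump_fun s V.
      by apply: open_nbhs_nbhs; split=> //; exact: KV.
    have [bc _ _] := bV; exists [set t | 2^-1 <= b t]; first exact: half_near.
    by exists b; split=> //; exists 2^-1 => //; rewrite invr_gt0.
have [bc bp [K' cK' [K'V K'0]]] := bV.
exists (fun t => Num.min (be^-1 * b t) 1); last first.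
  split=> [t|t Kt]; first by rewrite ge_min lexx orbT.
  by rewrite min_r// ler_pdivlMl// mulr1 hb.
split=> [t|t|].
- apply: (@continuous_min _ _ (fun t => be^-1 * b t) (fun=> 1)); last exact: cvg_cst.
  by apply: cvgM; [exact: cvg_cst|exact: bc].
- by rewrite le_min ler01 mulr_ge0// invr_ge0 ltW.
exists K' => //; split=> // t /K'0 ->; by rewrite mulr0 min_l.
Qed.

Lemma compact_bound (W : normedModType R[i]) (f : G -> W) K : compact K -> continuous f ->
  exists2 M : R, 0 <= M & forall t, K t -> nm (f t) <= M.
Proof.
move=> cK /cts_nm fc; apply: (@compact_ind G (fun A => exists2 M : R, 0 <= M & forall t, A t -> nm (f t) <= M)) => //.
- by move=> A B AB [M M0 h]; exists M => // t /AB; exact: h.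
- by exists 0.
- move=> A B [M M0 h] [M' M'0 h']; exists (M + M'); first exact: addr_ge0.
  by move=> t [/h|/h'] ht; [exact: ler_wpDr|exact: ler_wpDl].
- move=> s Ks; exists [set t | nm (f s - f t) < 1]; first exact: fc.
  exists (nm (f s) + 1); first by rewrite addr_ge0 ?nm_ge0.
  move=> t /= st; have -> : f t = f s - (f s - f t) by rewrite opprB addrC subrK.
  by rewrite (le_trans (nmB _ _))// lerD2l ltW.
Qed.

(** A subordinate family of bumps that is not yet normalized: on K its sum is only bounded below.
    Beyond the length of the list, [nth] returns the zero function, which satisfies the clauses for
    all indices. *)
Lemma part_approx (W : normedModType R[i]) (f : G -> W) K (e : R) : compact K -> continuous f -> 0 < e ->
  exists (r : seq ((G -> R) * G)) (be : R), [/\ 0 < be,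
    (forall i, csupp setT (nth (fun=> 0, 1%g) r i).1),
    (forall i t, (nth (fun=> 0, 1%g) r i).1 t != 0 -> nm (f t - f (nth (fun=> 0, 1%g) r i).2) < e)
    & forall t, K t -> be <= \sum_(i < size r) (nth (fun=> 0, 1%g) r i).1 t].
Proof.
move=> cK fc e0; set d := (fun=> 0, 1%g).
pose P (A : set G) := exists (r : seq ((G -> R) * G)) (be : R), [/\ 0 < be,
    (forall i, csupp setT (nth d r i).1),
    (forall i t, (nth d r i).1 t != 0 -> nm (f t - f (nth d r i).2) < e)
    & forall t, A t -> be <= \sum_(i < size r) (nth d r i).1 t].
apply: (@compact_ind G P) => //.
- by move=> A B AB [r [be [h1 h2 h3 h4]]]; exists r, be; split=> // t /AB; exact: h4.
- exists [::], 1; split=> // [i|i t]; first by rewrite nth_nil; exact: csupp0.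
  by rewrite nth_nil eqxx.
- move=> A B [r [be [h1 h2 h3 h4]]] [r' [be' [h1' h2' h3' h4']]].
  exists (r ++ r'), (Num.min be be'); split=> [|i|i t|t].
  + by rewrite lt_min h1.
  + by rewrite nth_cat; case: ifP.
  + by rewrite nth_cat; case: ifP => _; [exact: h3|exact: h3'].
  have E : \sum_(i < size (r ++ r')) (nth d (r ++ r') i).1 t =
      \sum_(i < size r) (nth d r i).1 t + \sum_(i < size r') (nth d r' i).1 t.
    by rewrite -!(big_mkord xpredT (fun i => (nth d _ i).1 t)) -!(big_nth d xpredT (fun p => p.1 t)) big_cat.
  have pos q : (forall i, csupp setT (nth d q i).1) -> 0 <= \sum_(i < size q) (nth d q i).1 t.
    by move=> h; apply: sumr_ge0 => i _; have [_ + _] := h i; apply.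
  rewrite E => -[/h4|/h4'] ht; rewrite ge_min.
    by rewrite (le_trans ht)// lerDl pos.
  by rewrite (le_trans ht) ?orbT// lerDr pos.
- move=> s Ks; have fs := iffLR (cts_nm _) fc s e e0.
  have [b bV bs] := bump_fun fs; have [bc bp [K' cK' [K'V K'0]]] := bV.
  exists [set t | 2^-1 <= b t]; first exact: half_near.
  exists [:: (b, s)], 2^-1; split=> [|[|i]|[|i] t|t]; rewrite ?invr_gt0//=.
  + exact: csuppS bV.
  + by rewrite nth_nil; exact: csupp0.
  + move=> bt; rewrite nmBC; apply: K'V; apply: contrapT => /K'0 h.
    by rewrite h eqxx in bt.
  + by rewrite nth_nil eqxx.
  + by rewrite big_ord1.
Qed.
End Bumps.

Section C0.
Context {R : realType} {G : lcGroupType} {D : groupData R G}.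
Local Notation CZ := (gdZ D).
Local Notation "A \ox C" := (tp D A C) (at level 40, left associativity).
Local Notation tot A C := (tens_total (tensP D A C)).
Implicit Types C : cstarAlg R.

Definition zs (s : G) (d : CZ) : R[i]^o := zev d s.

Lemma zs_lin s : islin (zs s). Proof. exact: zev_lin. Qed.
Lemma zsM s d e : zs s (d ** e) = zs s d * zs s e :> R[i]. Proof. exact: zevM. Qed.
Lemma zs_star s d : zs s (star d) = (zs s d : R[i])^*. Proof. exact: zev_star. Qed.
Lemma zs_ext d e : (forall s, zs s d = zs s e) -> d = e.
Proof. by move=> h; apply: (@zev_inj _ _ CZ); apply/funext => s; exact: h. Qed.

(** The model of C_0(G) carries an abstract C*-norm. Evaluation is bounded because multiplying the
    identity by d(s) is a homomorphism in d. *)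
Lemma zs_bound s d : cabs (zs s d) <= 2 * nm d.
Proof.
pose p d : mult CZ := (zs s d : R[i]) *: (1 : mult CZ).
have ph : ismhom p.
  split=> [b k x y|x y|x].
  - by rewrite /p (zs_lin s) scalerDl -scalerA.
  - by apply: mult_ext => u; rewrite /p zsM /= scalerA.
  - by rewrite /p zs_star mstarZ mstar1.
have h := mhom_bound d ph; have [->|d0] := eqVneq (zs s d) 0; first by rewrite cabs0 mulr_ge0 ?nm_ge0.
have dn : 0 < nm d.
  rewrite lt_neqAle nm_ge0 andbT eq_sym; apply/eqP => /nm_eq0 e.
  by move: d0; rewrite e (islin0 (zs_lin s)) eqxx.
have n1 : 1 <= nm (1 : mult CZ) by rewrite -(ler_pM2r dn) mul1r -{1}(mact1 d) nm_mact.
by apply: le_trans h; rewrite nmZ ler_peMr ?cabs_ge0.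
Qed.

Lemma zs_bd s : bdlin (zs s).
Proof. by split; [exact: zs_lin|exists 2 => // d; exact: zs_bound]. Qed.

Lemma zex (f : G -> R[i]^o) : C0 f -> exists d : CZ, forall s, zs s d = f s.
Proof. by rewrite -(zev_range CZ) => -[d _ <-]; exists d. Qed.

Lemma zs_C0 d : C0 (fun s => zs s d).
Proof. by rewrite -(zev_range CZ); exists d. Qed.

Lemma csupp_C0 V (b : G -> R) : csupp V b -> C0 (fun s => (b s)%:C%C : R[i]^o).
Proof.
move=> [bc bp [K cK [_ K0]]]; split; first exact/cts_real.
by move=> e e0; exists K => // s /K0 ->; rewrite normr0.
Qed.

Lemma sqrt_eps (a b e : R) : 0 <= a -> 0 <= b -> 0 < e -> `|a - b| < e ^+ 2 ->
  `|Num.sqrt a - Num.sqrt b| < e.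
Proof.
move=> a0 b0 e0; have := sqrtr_ge0 a; have := sqrtr_ge0 b.
rewrite -{2}(sqr_sqrtr a0) -{2}(sqr_sqrtr b0); set x := Num.sqrt a; set y := Num.sqrt b => y0 x0.
rewrite !ltr_norml => /andP[h1 h2]; apply/andP; split; rewrite ltNge; apply/negP => h; nra.
Qed.

Lemma zs_sqrt (h : CZ) : (forall s, 0 <= zs s h :> R[i]) -> exists k, h = star k ** k.
Proof.
move=> h0; pose r s := complex.Re (zs s h).
have r0 s : 0 <= r s by have := h0 s; rewrite lecE => /andP[].
have rE s : zs s h = (r s)%:C%C.
  by have := h0 s; rewrite /r lecE; case: (zs s h) => a b /= /andP[/eqP-> _].
have [/cts_nm hc hv] := zs_C0 h.
have [|k kE] := @zex (fun s => (Num.sqrt (r s))%:C%C).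
  split.
    apply/cts_real/ctsR => s e e0; have e20 : 0 < e ^+ 2 by rewrite exprn_gt0.
    apply: filterS (hc s _ e20) => s' /=; rewrite !rE -rmorphB -[nm _]/(cabs _) cabs_real.
    exact: sqrt_eps.
  move=> e; case: e => e e'; rewrite ltcE/= => /andP[/eqP-> e0].
  have e20 : 0 < (e ^+ 2)%:C%C :> R[i] by rewrite ltcR exprn_gt0.
  have [K cK hK] := hv _ e20; exists K => // s /hK; rewrite rE !normc_def/= !expr0n/= !addr0.
  rewrite !sqrtr_sqr !ltcR ger0_norm// ger0_norm ?sqrtr_ge0//.
  by rewrite -{1}(sqr_sqrtr (r0 s)) ltr_pXn2r ?nnegrE ?sqrtr_ge0 ?(ltW e0).
exists k; apply: zs_ext => s; rewrite zsM zs_star kE rE.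
rewrite (_ : _^* = (Num.sqrt (r s))%:C%C); last exact: conjc_real.
by rewrite -rmorphM -expr2 sqr_sqrtr.
Qed.

Lemma zs_nonneg (f : CZ -> R[i]^o) h : posfun f -> (forall s, 0 <= zs s h :> R[i]) -> 0 <= f h :> R[i].
Proof. by move=> [_ fp] /zs_sqrt[k ->]. Qed.

Definition ev C (s : G) : CZ \ox C -> C := slicel (zs s).

Lemma ev_bd C s : bdlin (@ev C s). Proof. exact: (slicel_bd C (zs_bd s)). Qed.
Lemma ev_lin C s : islin (@ev C s). Proof. by case: (@ev_bd C s). Qed.
Lemma evE C s d c : ev s (tens d c : CZ \ox C) = zs s d *: c.
Proof. exact: slicelE (zs_bd s). Qed.

Lemma evM C s (x y : CZ \ox C) : ev s (x ** y) = ev s x ** ev s y.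
Proof.
move: x; apply: (dense_bdlin_eq (tot CZ C)).
- exact: (bdlin_comp (cmull_bd y) (@ev_bd C s)).
- exact: (bdlin_comp (@ev_bd C s) (cmull_bd (ev s y))).
move=> _ [d [c ->]] /=; move: y; apply: (dense_bdlin_eq (tot CZ C)).
- exact: (bdlin_comp (cmulr_bd _) (@ev_bd C s)).
- exact: (bdlin_comp (@ev_bd C s) (cmulr_bd _)).
move=> _ [d' [c' ->]] /=.
by rewrite (tensM (tensP D _ _)) !evE zsM cmulZl cmulZr scalerA.
Qed.

Lemma ev_star C s (x : CZ \ox C) : ev s (star x) = star (ev s x).
Proof.
rewrite -[LHS]starK; congr star; move: x; apply: (dense_bdlin_eq (tot CZ C)) (@ev_bd C s) _.
- have [el [K K0 eK]] := @ev_bd C s; split=> [k x y|].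
    by rewrite starDD starZ el starDD starZ conjCK.
  by exists K => // x; rewrite nm_star (le_trans (eK _))// nm_star.
by move=> _ [d [c ->]] /=; rewrite (tens_star (tensP D _ _)) !evE zs_star starZ conjCK starK.
Qed.

Lemma ev_hom C s : ishom (@ev C s).
Proof. by split=> [|x y|x]; [exact: ev_lin|exact: evM|exact: ev_star]. Qed.

Lemma ev_nm C s (x : CZ \ox C) : nm (ev s x) <= 2 * nm x.
Proof. by rewrite -nm_emb; exact: (mhom_bound x (ismhom_emb (@ev_hom C s))). Qed.

Local Notation zz := (zt (@tens R D CZ _)).

(** The product form of f and g at y is f applied to the function s -> g(y(s)^* y(s)). A positive f
    respects pointwise inequalities by [zs_nonneg], so the estimate may be made at each s. *)
Lemma C0norm_zt C (x : seq (CZ * C)) (M : R) : 0 <= M ->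
  (forall s, nm (ev s (zz x)) <= M) -> nm (zz x) <= M.
Proof.
move=> M0 h; apply/(tform_norm (tensP D _ _)) => // f g fp gp y.
have fl : islin f by case: fp. have gl : islin g by case: gp.
pose H (y : seq (CZ * C)) : CZ := \sum_(q <- y) \sum_(q' <- y) (g (star q.2 ** q'.2) : R[i]) *: (star q.1 ** q'.1).
have HE y' : tform f g y' y' = f (H y').
  rewrite /H (islin_sum fl); apply: eq_bigr => q _; rewrite (islin_sum fl); apply: eq_bigr => q' _.
  by rewrite (islinZ fl) -[RHS]/(_ * _ : R[i]) mulrC.
have Hs s y' : zs s (H y') = g (star (ev s (zz y')) ** ev s (zz y')).
  rewrite /H (islin_sum (zs_lin s)) /zt (islin_sum (@ev_lin C s)) star_sum cmul_suml (islin_sum gl).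
  apply: eq_bigr => q _; rewrite (islin_sum (zs_lin s)) cmul_sumr (islin_sum gl); apply: eq_bigr => q' _.
  rewrite (islinZ (zs_lin s)) zsM zs_star !evE starZ cmulZl cmulZr !(islinZ gl).
  by rewrite -![_ *: (_ : R[i]^o)]/(_ * _ : R[i]); ring.
rewrite !HE -subr_ge0 -[_ * f _]/(_ *: f _) -(islinZ fl) -(islinB fl); apply: zs_nonneg => // s.
rewrite (islinB (zs_lin s)) (islinZ (zs_lin s)) !Hs (zt_mul (tensP D _ _)) evM.
rewrite -[_ *: (_ : R[i]^o)]/(_ * _ : R[i]) subr_ge0 !(posfunE gp) -rmorphM lecR.
have := psq_bound gp (emb (ev s (zz x))) (ev s (zz y)); rewrite nm_emb => /le_trans; apply.
rewrite ler_wpM2r ?(psq_ge0 gp)// ler_pXn2r ?nnegrE ?nm_ge0//.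
Qed.

Lemma C0norm C (x : CZ \ox C) (M : R) : 0 <= M -> (forall s, nm (ev s x) <= M) -> nm x <= M.
Proof.
move=> M0 h; apply/ler_addgt0Pr => e e0; have e3 : 0 < e / 3 by rewrite divr_gt0.
have [y xy] := zt_dense (tensP D CZ C) x e3.
have : nm (zz y) <= M + 2 * (e / 3).
  apply: C0norm_zt => [|s]; first by rewrite addr_ge0// mulr_ge0// ltW.
  have -> : ev s (zz y) = ev s x - ev s (x - zz y) by rewrite (islinB (@ev_lin C s)) opprB addrC subrK.
  rewrite (le_trans (nmB _ _))// lerD// (le_trans (ev_nm _ _))// ler_wpM2l//.
  exact: ltW.
have := nmD (x - zz y) (zz y); rewrite subrK; lra.
Qed.

Lemma ev_ext C (x y : CZ \ox C) : (forall s, ev s x = ev s y) -> x = y.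
Proof.
move=> h; apply/eqP; rewrite -subr_eq0; apply/eqP/nm_le0/C0norm => // s.
by rewrite (islinB (@ev_lin C s)) h subrr nm0.
Qed.

Definition C0fun C (f : G -> C) := continuous f /\
  forall e : R, 0 < e -> exists2 K : set G, compact K & forall s, ~ K s -> nm (f s) < e.

(** The approximant is a combination of sampled values of f with weights b_i / M. The weights add up
    to 1 on K and to at most 1 elsewhere, where f is small. *)
Lemma C0fun_approx C (f : G -> C) (e : R) : C0fun f -> 0 < e ->
  exists x : CZ \ox C, forall s, nm (ev s x - f s) <= e.
Proof.
move=> [fc fv] e0; have e2 : 0 < e / 2 by rewrite divr_gt0.
have [K cK hK] := fv _ e2; have [r [be [be0 r1 r2 r3]]] := part_approx cK fc e2.
(* The maximum with be keeps the denominator M away from 0 without changing it on K. *)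
set d := (fun=> 0, 1%g) in r1 r2 r3; pose b i := (nth d r i).1; pose p i := (nth d r i).2.
pose B t := \sum_(i < size r) b i t; pose M t := Num.max (B t) be.
have b0 i t : 0 <= b i t by have [_ + _] := r1 i; apply.
have bc i : continuous (b i) by have [] := r1 i.
have B0 t : 0 <= B t by apply: sumr_ge0.
have Mp t : 0 < M t by rewrite lt_max be0 orbT.
have Bc : continuous B.
  rewrite /B; elim: (size r) => [|n IH].
    rewrite (_ : (fun t => _) = fun=> 0); first by move=> ?; exact: cvg_cst.
    by apply/funext => t; rewrite big_ord0.
  rewrite (_ : (fun t => _) = fun t => \sum_(i < n) b i t + b n t).
    by move=> t; apply: cvgD; [exact: IH|exact: bc].
  by apply/funext => t; rewrite big_ord_recr.
have Mc : continuous M.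
  by move=> t; apply: (@continuous_max _ _ B (fun=> be)); [exact: Bc|exact: cvg_cst].
pose ph i t := b i t / M t.
have ph0 i t : 0 <= ph i t by rewrite divr_ge0// ltW.
have phC i : csupp setT (ph i).
  have [_ _ [K' cK' [_ K'0]]] := r1 i; split=> //.
    move=> t; apply: cvgM; first exact: bc.
    by apply: cvgV; [rewrite gt_eqF|exact: Mc].
  by exists K' => //; split=> // t /K'0 h; rewrite /ph /b h mul0r.
have [z zE] : exists z : nat -> CZ, forall i s, zs s (z i) = (ph i s)%:C%C.
  have [z hz] := choice (P := fun i (z : CZ) => forall s, zs s z = (ph i s)%:C%C)
    (fun i => zex (csupp_C0 (phC i))).
  by exists z.
exists (\sum_(i < size r) tens (z i) (f (p i))) => s.
rewrite (islin_sum (@ev_lin C s)).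
have sph : \sum_(i < size r) ph i s = B s / M s by rewrite -mulr_suml.
have sph1 : B s / M s <= 1 by rewrite ler_pdivrMr// mul1r le_max lexx.
have -> : \sum_(i < size r) ev s (tens (z i) (f (p i))) - f s =
    - (\sum_(i < size r) (ph i s)%:C%C *: (f s - f (p i)) + (1 - B s / M s)%:C%C *: f s).
  have -> : \sum_(i < size r) (ph i s)%:C%C *: (f s - f (p i)) =
      (B s / M s)%:C%C *: f s - \sum_(i < size r) (ph i s)%:C%C *: f (p i).
    rewrite -sph rmorph_sum scaler_suml -sumrB; apply: eq_bigr => i _.
    by rewrite scalerBr.
  have -> : \sum_(i < size r) ev s (tens (z i) (f (p i))) =
      \sum_(i < size r) (ph i s)%:C%C *: f (p i).
    by apply: eq_bigr => i _; rewrite evE zE.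
  have -> : (1 - B s / M s)%:C%C = 1 - (B s / M s)%:C%C :> R[i] by rewrite rmorphB.
  rewrite scalerBl scale1r; zmod.
rewrite nmN (le_trans (nmD _ _))// (splitr e) lerD//.
  rewrite (le_trans (nm_sum _ _ _))//; apply: (le_trans (y := \sum_(i < size r) ph i s * (e / 2))).
    apply: ler_sum => i _; rewrite nmZ cabs_real ger0_norm//.
    have [h|h] := eqVneq (b i s) 0; first by rewrite /ph h !mul0r.
    by rewrite ler_wpM2l// ltW// r2.
  by rewrite -mulr_suml sph ler_piMl// ltW.
rewrite nmZ cabs_real ger0_norm ?subr_ge0//; have [Ks|nK] := pselect (K s).
  have Be : be <= B s by exact: r3.
  by rewrite /M max_l// divff ?subrr ?mul0r ?(ltW e2)// gt_eqF// (lt_le_trans be0).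
by apply: le_trans (ltW (hK s nK)); rewrite ler_piMl ?nm_ge0// lerBlDr lerDl divr_ge0// ltW.
Qed.

Lemma C0fun_ex C (f : G -> C) : C0fun f -> exists x : CZ \ox C, forall s, ev s x = f s.
Proof.
move=> fC; have h2 : (0 : R) < 2^-1 by rewrite invr_gt0.
have [u uP] := choice (fun n : nat => C0fun_approx fC (exprn_gt0 n h2)).
have r1 : (2^-1 : R) < 1 by rewrite invf_lt1// ltr1n.
have small e : 0 < e -> exists N, forall n, (N <= n)%N -> forall s, nm (ev s (u n) - f s) <= e.
  move=> e0; have [N hN] := expr_lt_eps (@ler01 R) (ltW h2) r1 e0; exists N => n Nn s.
  by rewrite (le_trans (uP n s))// -[leLHS]mul1r ltW// hN.
have [|l ul] := @complete_seq R _ u.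
  move=> e e0; have e30 : 0 < e / 3 by rewrite divr_gt0.
  have [N hN] := small _ e30; exists N => i j Ni Nj.
  apply: (@le_lt_trans _ _ (e / 3 + e / 3)); last by lra.
  apply: C0norm => [|s]; first by rewrite addr_ge0 ?(ltW e30).
  rewrite (islinB (@ev_lin C s)) (le_trans (nm_tri (f s) _ _))// lerD ?hN//.
  by rewrite nmBC hN.
exists l => s; apply/eqP; rewrite -subr_eq0; apply/eqP; apply: (@nm_eps _ _ _ 3) => e e0.
have [N hN] := small _ e0; have [N' hN'] := ul _ e0; pose k := maxn N N'.
have h1 : nm (ev s (u k) - f s) <= e by apply: hN; exact: leq_maxl.
have h3 : nm (u k - l) < e by apply: hN'; exact: leq_maxr.
have := ev_nm s (l - u k); rewrite (islinB (@ev_lin C s)) (nmBC l).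
by have := nm_tri (ev s (u k)) (ev s l) (f s); lra.
Qed.

Lemma ev_C0fun C (x : CZ \ox C) : C0fun (fun s => ev s x).
Proof.
have hz (z : seq (CZ * C)) : C0fun (fun s => ev s (zz z)).
  elim: z => [|p z [IHc IHv]].
    have e0 s : ev s (zz [::]) = 0 :> C by rewrite /zt big_nil (islin0 (@ev_lin C s)).
    split; first by rewrite (funext e0) => s; exact: cvg_cst.
    move=> e e0'; exists set0; last by move=> s _; rewrite e0 nm0.
    by apply: (iffRL (compact_near_coveringP _)) => I F P FF _; apply: filterE => i y [].
  have eE s : ev s (zz (p :: z)) = zs s p.1 *: p.2 + ev s (zz z).
    by rewrite /zt big_cons (islinD (@ev_lin C s)) evE.
  have [pc pv] := zs_C0 p.1; split.
    rewrite (funext eE) => s; apply: cvgD; last exact: IHc.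
    have kb : bdlin (fun k : R[i]^o => k *: p.2).
      split=> [k a b|]; first by rewrite scalerDl -scalerA.
      by exists (nm p.2) => [|k]; [exact: nm_ge0|rewrite nmZ mulrC].
    exact: (cts_bdlin kb pc).
  move=> e e0; have e2 : 0 < e / 2 by rewrite divr_gt0.
  have n1 : 0 < nm p.2 + 1 by rewrite ltr_wpDl ?nm_ge0.
  have [K cK hK] := IHv _ e2; have [|K' cK' hK'] := pv (e / 2 / (nm p.2 + 1))%:C%C.
    by rewrite ltcR divr_gt0.
  exists (K `|` K'); first exact: compactU.
  move=> s h; rewrite eE (le_lt_trans (nmD _ _))// addrC (splitr e) ltrD//.
    by apply: hK => ?; apply: h; left.
  have := hK' s (fun k => h (or_intror k)); rewrite cabsE ltcR ltr_pdivlMr// nmZ => /le_lt_trans; apply.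
  by rewrite ler_wpM2l ?cabs_ge0// lerDl.
split.
  apply: cts_unif => e e0; have e2 : 0 < e / 2 by rewrite divr_gt0.
  have [z xz] := zt_dense (tensP D CZ C) x e2; exists (fun s => ev s (zz z)); first by case: (hz z).
  move=> s; rewrite -(islinB (@ev_lin C s)) (le_lt_trans (ev_nm _ _))//; lra.
move=> e e0; have e4 : 0 < e / 4 by rewrite divr_gt0.
have [z xz] := zt_dense (tensP D CZ C) x e4; have [_ hv] := hz z.
have [K cK hK] := hv _ e4; exists K => // s /hK h.
have := ev_nm s (x - zz z); rewrite (islinB (@ev_lin C s)).
have := nmD (ev s x - ev s (zz z)) (ev s (zz z)); rewrite subrK; lra.
Qed.

Lemma C0fun_mact C (F : G -> mult C) (f : G -> C) (K : R) : (forall c, continuous (fun s => F s c)) ->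
  (forall s, nm (F s) <= K) -> C0fun f -> C0fun (fun s => F s (f s)).
Proof.
move=> Fc FK [/cts_nm fc fv].
have K0 : 0 <= K by apply: le_trans (FK 1%g); exact: nm_ge0.
have K1 : 0 < K + 1 by rewrite ltr_wpDl.
split.
  apply/cts_nm => s e e0; have e2 : 0 < e / 2 by rewrite divr_gt0.
  have := iffLR (cts_nm _) (Fc (f s)) s _ e2; have := fc s _ (divr_gt0 e2 K1).
  apply: filterS2 => s' h1 h2; rewrite (le_lt_trans (nm_tri (F s' (f s)) _ _))// (splitr e) ltrD//.
  rewrite -(islinB (mult_lin _)) (le_lt_trans (nm_mact _ _))//.
  rewrite (le_lt_trans (ler_wpM2r _ (FK s'))) ?nm_ge0//.
  move: h1; rewrite ltr_pdivlMr// mulrC => /(le_lt_trans _); apply.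
  by rewrite ler_wpM2r ?nm_ge0// lerDl.
move=> e e0; have [K' cK' hK'] := fv _ (divr_gt0 e0 K1); exists K' => // s /hK'.
rewrite ltr_pdivlMr// mulrC => /(le_lt_trans _); apply; rewrite (le_trans (nm_mact _ _))//.
by rewrite ler_wpM2r ?nm_ge0// (le_trans (FK s))// lerDl.
Qed.

Lemma z1 s : exists d : CZ, zs s d = 1.
Proof.
have [b bV bs] := @bump_fun R G s setT filterT.
by have [d dE] := zex (csupp_C0 bV); exists d; rewrite dE bs.
Qed.

Lemma ev_surj C s (c : C) : exists x : CZ \ox C, ev s x = c.
Proof. by have [d d1] := z1 s; exists (tens d c); rewrite evE d1 scale1r. Qed.

Definition fmult C (F : G -> mult C) (m : mult (CZ \ox C)) := forall s x, ev s (m x) = F s (ev s x).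

Lemma fmult_uniq C (F : G -> mult C) m n : fmult F m -> fmult F n -> m = n.
Proof. by move=> h h'; apply: mult_ext => x; apply: ev_ext => s; rewrite h h'. Qed.

Lemma fmult_star C (F : G -> mult C) m : fmult F m -> fmult (fun s => mstar (F s)) (mstar m).
Proof.
move=> h s x; apply: cmul_nondeg => c; have [y <-] := ev_surj s c.
by have := congr1 (@ev C s) (multP m y x); rewrite !evM !ev_star h multP => <-.
Qed.

Lemma fmultM C (F F' : G -> mult C) m m' : fmult F m -> fmult F' m' ->
  fmult (fun s => F s * F' s) (m * m').
Proof. by move=> h h' s x; rewrite mactM h h'. Qed.

Lemma fmult1 C : fmult (fun=> 1) (1 : mult (CZ \ox C)). Proof. by []. Qed.

Lemma fmult_ex C (F : G -> mult C) (K : R) : (forall c, continuous (fun s => F s c)) ->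
  (forall c, continuous (fun s => mstar (F s) c)) -> (forall s, nm (F s) <= K) ->
  exists m, fmult F m.
Proof.
move=> Fc Fsc FK; have FsK s : nm (mstar (F s)) <= K by rewrite nm_mstar.
have [f fE] := choice (P := fun x y => forall s, ev s y = F s (ev s x))
  (fun x => C0fun_ex (C0fun_mact Fc FK (@ev_C0fun C x))).
have [g gE] := choice (P := fun x y => forall s, ev s y = mstar (F s) (ev s x))
  (fun x => C0fun_ex (C0fun_mact Fsc FsK (@ev_C0fun C x))).
have fg a b : star (f a) ** b = star a ** g b.
  by apply: ev_ext => s; rewrite !evM !ev_star fE gE multP.
by exists (Mult fg).
Qed.

Local Notation CG := (gdA D).
Lemma wGP : fmult (@gin _ _ CG) (wG (D := D)).
Proof.
apply: (@the_spec (mult (CZ \ox CG)) (mone _) (fmult (@gin _ _ CG))).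
have [_ _ gv gc] := @gin_rep _ _ CG; apply: (fmult_ex (K := 1)) => // [c|s]; last first.
  exact: urep_nm (@gin_rep _ _ CG).
rewrite (_ : (fun s => _) = (fun s => gin s c) \o (fun s : G => s^-1%g)).
  by move=> s; apply: continuous_comp; [exact: invg_cts|exact: gc].
by apply/funext => s /=; rewrite gv.
Qed.

Lemma wG_unitary : mstar (wG (D := D)) * wG (D := D) = 1 /\ wG (D := D) * mstar (wG (D := D)) = 1.
Proof.
have gr := @gin_rep _ _ CG.
split; apply: (@fmult_uniq _ (fun=> 1)); try exact: fmult1.
  have := fmultM (fmult_star wGP) wGP; congr fmult; apply/funext => s.
  exact: urep_invl gr.
have := fmultM wGP (fmult_star wGP); congr fmult; apply/funext => s.
exact: urep_inv gr.
Qed.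
End C0.

Section CcF.
Context {R : realType} {G : lcGroupType}.
Implicit Types f g : G -> R[i]^o.

Lemma ctsM f g : continuous f -> continuous g -> continuous (fun s => f s * g s : R[i]^o).
Proof. by move=> fc gc s; apply: cvgM; [exact: fc|exact: gc]. Qed.

Lemma Cc_lin (k : R[i]) f g : Cc f -> Cc g -> Cc (fun s => k *: f s + g s).
Proof.
move=> [fc [K cK K0]] [gc [K' cK' K'0]]; split; first exact: (cts_lin (k := k) fc gc).
exists (K `|` K'); first exact: compactU.
by move=> s h; rewrite K0 ?K'0 ?scaler0 ?addr0// => ?; apply: h; [right|left].
Qed.

Lemma CcM f g : Cc f -> continuous g -> Cc (fun s => f s * g s).
Proof.
move=> [fc [K cK K0]] gc; split; first exact: ctsM.
by exists K => // s /K0 ->; rewrite mul0r.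
Qed.

Lemma csupp_Cc V (b : G -> R) : csupp V b -> Cc (fun s => (b s)%:C%C).
Proof.
move=> [bc _ [K cK [_ K0]]]; split; first exact/cts_real.
by exists K => // s /K0 ->.
Qed.

Lemma CcC0 f : Cc f -> C0 f.
Proof.
by move=> [fc [K cK K0]]; split=> // e e0; exists K => // s /K0 ->; rewrite normr0.
Qed.

Lemma Cc_comp f (r r' : G -> G) : continuous r -> continuous r' -> cancel r r' -> cancel r' r ->
  Cc f -> Cc (fun s => f (r s)).
Proof.
move=> rc r'c rK r'K [fc [K cK K0]]; split.
  by move=> s; apply: continuous_comp; [exact: rc|exact: fc].
exists (r' @` K); first exact: (continuous_compact (continuous_subspaceT r'c) cK).
by move=> s h; apply: K0 => Krs; apply: h; exists (r s).
Qed.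

Lemma lmul_cts (t : G) : continuous (fun s => t * s)%g.
Proof.
move=> s; have h : (fun s => (t, s)) @ s --> (t, s) by apply: cvg_pair; [exact: cvg_cst|exact: cvg_id].
exact: (@continuous_comp _ _ _ (fun s => (t, s)) (fun p : G * G => (p.1 * p.2)%g) s h (@mulg_cts G (t, s))).
Qed.

Lemma rmul_cts (t : G) : continuous (fun s => s * t)%g.
Proof.
move=> s; have h : (fun s => (s, t)) @ s --> (s, t) by apply: cvg_pair; [exact: cvg_id|exact: cvg_cst].
exact: (@continuous_comp _ _ _ (fun s => (s, t)) (fun p : G * G => (p.1 * p.2)%g) s h (@mulg_cts G (s, t))).
Qed.

Lemma lmulgK (t : G) : cancel (fun s => t * s)%g (fun s => t^-1 * s)%g.
Proof. by move=> s; rewrite mulgA mulVg mul1g. Qed.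
Lemma lmulgVK (t : G) : cancel (fun s => t^-1 * s)%g (fun s => t * s)%g.
Proof. by move=> s; rewrite mulgA mulgV mul1g. Qed.

Lemma Cc_ltrans f t : Cc f -> Cc (fun s => f (t * s)%g).
Proof. exact: (Cc_comp (@lmul_cts t) (@lmul_cts t^-1%g) (lmulgK t) (lmulgVK t)). Qed.
Lemma Cc_rtrans f t : Cc f -> Cc (fun s => f (s * t)%g).
Proof.
apply: (Cc_comp (@rmul_cts t) (@rmul_cts t^-1%g)) => s; first by rewrite -mulgA mulgV mulg1.
by rewrite -mulgA mulVg mulg1.
Qed.

Lemma cts_conj f : continuous f -> continuous (fun s => (f s : R[i])^* : R[i]^o).
Proof.
move=> /cts_nm h; apply/cts_nm => s e e0; apply: filterS (h s e e0) => t.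
by rewrite -[nm (_ - (f t : R[i])^*)]/(cabs _) -rmorphB -[cabs _]/(cabs (f s - f t)^*%C) cabsC.
Qed.

Lemma cts_Re f : continuous f -> continuous (fun s => (complex.Re (f s : R[i]))%:C%C : R[i]^o).
Proof.
move=> /cts_nm h; apply/cts_nm => s e e0; apply: filterS (h s e e0) => t; apply: le_lt_trans.
by rewrite -[nm _]/(cabs _) -rmorphB cabs_real -raddfB; exact: Re_le_cabs.
Qed.

Lemma Cc_plateau f : Cc f -> exists2 b : G -> R, csupp setT b & forall s, f s != 0 -> b s = 1.
Proof.
move=> [fc [K cK K0]]; have [//|b bT [_ b1]] := @plateau R G K setT cK openT.
by exists b => // s fs; apply: b1; apply: contrapT => /K0 h; rewrite h eqxx in fs.
Qed.
End CcF.

Section UC.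
Context {R : realType} {G : lcGroupType} {W : normedModType R[i]}.

Lemma unif_cts (f : G -> W) (K : set G) (e : R) : continuous f -> compact K -> (forall s, ~ K s -> f s = 0) ->
  0 < e -> \forall t \near (1%g : G), forall s, nm (f (t * s)%g - f s) < e.
Proof.
move=> fc cK K0 e0; have e2 : 0 < e / 2 by rewrite divr_gt0.
have h : \forall t \near (1%g : G), forall s, K s -> nm (f (t * s)%g - f s) < e.
  have FF : Filter (nbhs (1%g : G)) by exact: nbhs_filter.
  apply: (iffLR (compact_near_coveringP _) cK _ (nbhs (1%g : G)) (fun t s => nm (f (t * s)%g - f s) < e) FF) => s Ks.
  have hp : nbhs s [set s' | nm (f s - f s') < e / 2] by exact: (iffLR (cts_nm _) fc).
  have hm : nbhs ((1%g : G), s) [set p | nm (f s - f (p.1 * p.2)%g) < e / 2].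
    apply: (@mulg_cts G (1%g, s) [set s' | nm (f s - f s') < e / 2]).
    by rewrite /= mul1g.
  case: hm => -[U V] /= [U1 Vs] UV; exists ([set s' | nm (f s - f s') < e / 2] `&` V, U).
    by split=> //=; exact: filterI.
  move=> [s' t] /= [[h1 Vs'] Ut]; have := UV (t, s') (conj Ut Vs') => /= h2.
  by rewrite (le_lt_trans (nm_tri (f s) _ _))// (splitr e) ltrD// nmBC.
(* The inverse translation covers the points s outside K for which t s lies in K. *)
have h' : \forall t \near (1%g : G), forall s, K s -> nm (f (t^-1 * s)%g - f s) < e.
  have := @invg_cts G 1%g [set t | forall s, K s -> nm (f (t * s)%g - f s) < e].
  by rewrite /= invg1; apply.
apply: filterS2 h h' => t h1 h2 s; have [Ks|nK] := pselect (K s); first exact: h1.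
rewrite (K0 s nK) subr0; have [Kt|/K0->] := pselect (K (t * s)%g); last by rewrite nm0.
by have := h2 _ Kt; rewrite mulgA mulVg mul1g (K0 s nK) sub0r nmN.
Qed.
End UC.

(** * Integration and density of the group in its C*-algebra *)

Section Haar.
Context {R : realType} {G : lcGroupType} {D : groupData R G}.
Local Notation L2 := (gdL D).
Local Notation I := (haar L2).
Implicit Types f g : G -> R[i]^o.

Lemma haar_lin (k : R[i]) f g : Cc f -> Cc g -> I (fun s => k *: f s + g s) = k *: I f + I g.
Proof. by case: (@haarP _ _ L2) => h _ _ _ _; exact: h. Qed.
Lemma haar_ge0 f : Cc f -> (forall s, 0 <= f s :> R[i]) -> 0 <= I f :> R[i].
Proof. by case: (@haarP _ _ L2) => _ h _ _ _; exact: h. Qed.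
Lemma haar_inv f s : Cc f -> I (fun t => f (s * t)%g) = I f.
Proof. by case: (@haarP _ _ L2) => _ _ _ h _; exact: h. Qed.

Lemma haar_ext f g : (forall s, f s = g s) -> I f = I g.
Proof. by move=> h; congr I; apply/funext. Qed.

Lemma Cc0 : Cc (fun _ : G => 0 : R[i]^o).
Proof. exact: (csupp_Cc (@csupp0 R G setT)). Qed.

Lemma haar0 : I (fun=> 0) = 0.
Proof.
have h := haar_lin (-1) Cc0 Cc0; rewrite [in RHS]scaleN1r [in RHS]addNr in h.
by apply: etrans h; apply: haar_ext => s; rewrite scaler0 addr0.
Qed.

Lemma haarZ k f : Cc f -> I (fun s => k *: f s) = k *: I f.
Proof.
move=> fC; have := haar_lin k fC Cc0; rewrite haar0 addr0 => <-.
by apply: haar_ext => s; rewrite addr0.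
Qed.

Lemma haarD f g : Cc f -> Cc g -> I (fun s => f s + g s) = I f + I g.
Proof.
move=> fC gC; have := haar_lin 1 fC gC; rewrite scale1r => <-.
by apply: haar_ext => s; rewrite scale1r.
Qed.

Lemma CcZ k f : Cc f -> Cc (fun s => k *: f s).
Proof.
move=> fC; have := Cc_lin k fC Cc0; congr Cc; apply/funext => s; exact: addr0.
Qed.

(** The integral is only assumed positive. Polarization with a cut-off b equal to 1 on the support
    writes u = u b as a quarter of the difference of two squares, whose integrals are real. *)
Lemma haar_real (u : G -> R) : Cc (fun s => (u s)%:C%C) ->
  complex.Im (I (fun s => (u s)%:C%C)) = 0.
Proof.
move=> uC; have [b bT b1] := Cc_plateau uC; have bC := csupp_Cc bT.
have sq (v : G -> R) : Cc (fun s => (v s)%:C%C) -> Cc (fun s => (v s ^+ 2)%:C%C) /\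
    complex.Im (I (fun s => (v s ^+ 2)%:C%C)) = 0.
  move=> vC; have v2 : Cc (fun s => (v s ^+ 2)%:C%C).
    have := CcM vC (proj1 vC); congr Cc; apply/funext => s; by rewrite -rmorphM expr2.
  split=> //; have : 0 <= I (fun s => (v s ^+ 2)%:C%C) :> R[i].
    by apply: haar_ge0 => // s; rewrite lecR sqr_ge0.
  by rewrite lecE => /andP[/eqP ->].
have [p1 i1] : Cc (fun s => ((u s + b s) ^+ 2)%:C%C) /\ complex.Im (I (fun s => ((u s + b s) ^+ 2)%:C%C)) = 0.
  apply: sq; have := Cc_lin 1 uC bC; congr Cc; apply/funext => s; by rewrite scale1r rmorphD.
have [p2 i2] : Cc (fun s => ((b s - u s) ^+ 2)%:C%C) /\ complex.Im (I (fun s => ((b s - u s) ^+ 2)%:C%C)) = 0.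
  apply: sq; have := Cc_lin (-1) uC bC; congr Cc; apply/funext => s; by rewrite scaleN1r addrC rmorphB.
have e : I (fun s => (u s)%:C%C) = (4^-1)%:C%C * (I (fun s => ((u s + b s) ^+ 2)%:C%C) - I (fun s => ((b s - u s) ^+ 2)%:C%C)) :> R[i].
  have -> : I (fun s => ((u s + b s) ^+ 2)%:C%C) - I (fun s => ((b s - u s) ^+ 2)%:C%C) =
      I (fun s => (-1) *: ((b s - u s) ^+ 2)%:C%C + ((u s + b s) ^+ 2)%:C%C).
    by rewrite haar_lin// scaleN1r addrC.
  rewrite -[RHS]/(_ *: _ : R[i]^o) -haarZ; last exact: Cc_lin.
  apply: haar_ext => s; rewrite scaleN1r -![_ *: (_ : R[i]^o)]/(_ * _ : R[i]).
  have [->|us] := eqVneq (u s) 0; first by rewrite add0r subr0 addNr mulr0.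
  rewrite b1; last by apply/eqP => /(@complexI R)/eqP; rewrite (negbTE us).
  by rewrite [- _ + _]addrC -rmorphB -rmorphM; congr (_%:C%C); field.
rewrite e; case: (I _) i1 => a1 a2 /= ->; case: (I _) i2 => c1 c2 /= ->.
by rewrite subrr mulr0 mul0r addr0.
Qed.

Lemma haar_Re f : Cc f -> complex.Re (I f) = complex.Re (I (fun s => (complex.Re (f s : R[i]))%:C%C)).
Proof.
move=> fC; have rC (g : G -> R[i]^o) : Cc g -> Cc (fun s => (complex.Re (g s : R[i]))%:C%C).
  by move=> [gc [K cK K0]]; split; [exact: cts_Re|exists K => // s /K0 ->].
have jC : Cc (fun s => (- 'i%C : R[i]) *: f s) by exact: CcZ.
have -> : I f = 'i%C *: I (fun s => (complex.Re (- 'i%C * f s : R[i]))%:C%C) + I (fun s => (complex.Re (f s : R[i]))%:C%C).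
  rewrite -haar_lin; [|exact: (rC _ jC)|exact: rC].
  apply: haar_ext => s; case: (f s) => a b; rewrite -[_ *: _]/(_ * _ : R[i]).
  by apply/eqP; rewrite eq_complex /=; apply/andP; split; apply/eqP; ring.
rewrite raddfD /=; have := haar_real (rC _ jC); rewrite -[(fun s => _)]/(fun s => (complex.Re (- 'i%C * f s : R[i]))%:C%C).
by case: (I _) => a b /= ->; rewrite mul0r mul1r subrr add0r.
Qed.

Lemma haar_mono (u v : G -> R) : Cc (fun s => (u s)%:C%C) -> Cc (fun s => (v s)%:C%C) -> (forall s, u s <= v s) ->
  complex.Re (I (fun s => (u s)%:C%C)) <= complex.Re (I (fun s => (v s)%:C%C)).
Proof.
move=> uC vC uv; have h : 0 <= I (fun s => (-1) *: (u s)%:C%C + (v s)%:C%C) :> R[i].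
  by apply: haar_ge0 => [|s]; [exact: Cc_lin|rewrite scaleN1r addrC -rmorphB lecR subr_ge0].
move: h; rewrite haar_lin// scaleN1r lecE => /andP[_]; rewrite raddfD raddfN /=.
by rewrite addrC subr_ge0.
Qed.

Definition cr (b : G -> R) : G -> R[i]^o := fun s => (b s)%:C%C.
Definition rI (b : G -> R) := complex.Re (I (cr b)).

Lemma rI_ge0 V b : csupp V b -> 0 <= rI b.
Proof.
move=> bV; have [_ bp _] := bV; have : 0 <= I (cr b) :> R[i].
  by apply: haar_ge0 => [|s]; [exact: csupp_Cc bV|rewrite lecR].
by rewrite lecE => /andP[].
Qed.

Lemma haar_bound_Re V b f (M : R) : csupp V b -> continuous f ->
  (forall s, b s != 0 -> cabs (f s) <= M) -> `|complex.Re (I (fun s => cr b s * f s))| <= M * rI b.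
Proof.
move=> bV fc fM; have [_ bp _] := bV; have bC := csupp_Cc bV.
have bfC : Cc (fun s => cr b s * f s) by exact: CcM.
have E s : complex.Re (cr b s * f s : R[i]) = b s * complex.Re (f s : R[i]).
  by rewrite /cr; case: (f s) => x y /=; rewrite mul0r subr0.
rewrite haar_Re//; have rC : Cc (fun s => (complex.Re (cr b s * f s : R[i]))%:C%C).
  by have [c [K cK K0]] := bfC; split; [exact: cts_Re|exists K => // s /K0 ->].
have MC k : Cc (fun s => (k * b s)%:C%C).
  by have := CcZ k%:C%C bC; congr Cc; apply/funext => s; rewrite rmorphM.
have MI k : complex.Re (I (fun s => (k * b s)%:C%C)) = k * rI b.
  rewrite /rI -[I (fun s => _)](_ : k%:C%C *: I (cr b) = _).
    by case: (I _) => x y /=; rewrite mul0r subr0.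
  by rewrite -haarZ//; apply: haar_ext => s; rewrite rmorphM.
have key s : - (M * b s) <= complex.Re (cr b s * f s : R[i]) <= M * b s.
  rewrite E; have [->|h] := eqVneq (b s) 0; first by rewrite mulr0 mul0r oppr0 lexx.
  have := le_trans (Re_le_cabs (f s)) (fM s h); rewrite ler_norml => /andP[h1 h2].
  by rewrite -mulNr ![_ * b s]mulrC !ler_wpM2l.
rewrite ler_norml; apply/andP; split.
  rewrite -mulNr -MI; apply: haar_mono => // s; by have /andP[+ _] := key s; rewrite mulNr.
by rewrite -MI; apply: haar_mono => // s; have /andP[] := key s.
Qed.

Lemma haar_bound V b f (M : R) : csupp V b -> continuous f ->
  (forall s, b s != 0 -> cabs (f s) <= M) -> cabs (I (fun s => cr b s * f s)) <= 2 * (M * rI b).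
Proof.
move=> bV fc fM; have bC := csupp_Cc bV; have bfC : Cc (fun s => cr b s * f s) by exact: CcM.
have h1 := haar_bound_Re bV fc fM.
have ifc : continuous (fun s => - 'i%C * f s : R[i]^o).
  by move=> s; apply: cvgM; [exact: cvg_cst|exact: fc].
have := haar_bound_Re (M := M) bV ifc.
have ifM s : b s != 0 -> cabs (- 'i%C * f s) <= M by move=> h; rewrite cabsM cabsN cabs_i mul1r fM.
move=> /(_ ifM).
have -> : I (fun s => cr b s * (- 'i%C * f s)) = (- 'i%C : R[i]) *: I (fun s => cr b s * f s).
  by rewrite -haarZ//; apply: haar_ext => s; rewrite mulrCA.
case: (I _) h1 => x y /= h1 h2.
have -> : (x +i* y)%C = x%:C%C + 'i%C * y%:C%C by rewrite [LHS]complexE.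
rewrite (le_trans (cabsD _ _))// cabsM cabs_i mul1r !cabs_real mulr2n mulrDl mul1r lerD//.
by move: h2; rewrite oppr0 mul0r sub0r mulN1r opprK.
Qed.

(** If the integral of b vanished, so would that of a sum B of translates of b that is bounded below
    on the support of a given f. Writing f as B times a bounded function gives integral 0 for every
    f in C_c(G). *)
Lemma haar_pos V (b : G -> R) : csupp V b -> b 1%g = 1 -> 0 < rI b.
Proof.
move=> bV b1; rewrite lt_neqAle (rI_ge0 bV) andbT eq_sym; apply/eqP => I0.
have Ib0 : I (cr b) = 0.
  have := haar_real (csupp_Cc bV); rewrite -/(cr b); move: I0; rewrite /rI.
  by case: (I (cr b)) => x y /= -> ->.
have [_ _ [f fC If] _ _] := @haarP _ _ L2; apply: If.
have [fc [K cK K0]] := fC; have [bc bp [K1 cK1 [_ K10]]] := bV.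
have [B [BT [BI [be be0 hB]]]] : exists B, csupp setT B /\ (I (cr B) = 0 /\ exists2 be : R, 0 < be & forall t, K t -> be <= B t).
  pose P (A : set G) := exists B, csupp setT B /\ (I (cr B) = 0 /\ exists2 be : R, 0 < be & forall t, A t -> be <= B t).
  apply: (@compact_ind G P) => //.
  - by move=> A A' AA' [B [h [h1 [be be0 hB]]]]; exists B; split=> //; split=> //; exists be => // t /AA'; exact: hB.
  - by exists (fun=> 0); split; [exact: csupp0|split; [exact: haar0|exists 1]].
  - move=> A A' [B [h [h1 [be be0 hB]]]] [B' [h' [h1' [be' be0' hB']]]]; exists (fun t => B t + B' t).
    split; first exact: csuppD.
    split.
      have := haarD (csupp_Cc h) (csupp_Cc h'); rewrite -/(cr B) -/(cr B') h1 h1' addr0 => <-.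
      by apply: haar_ext => s; rewrite /cr rmorphD.
    have [_ p _] := h; have [_ p' _] := h'.
    exists (Num.min be be'); first by rewrite lt_min be0.
    move=> t [/hB|/hB'] ht; rewrite ge_min; first by rewrite (le_trans ht)// lerDl.
    by rewrite (le_trans ht) ?orbT// lerDr.
  - move=> s Ks; exists [set t | 2^-1 <= b (s^-1 * t)%g].
      apply: (@half_near R G (fun t => b (s^-1 * t)%g) s); last by rewrite mulVg.
      by move=> t; apply: continuous_comp; [exact: lmul_cts|exact: bc].
    exists (fun t => b (s^-1 * t)%g); split; last split; last by exists 2^-1 => //; rewrite invr_gt0.
      have /(Cc_ltrans s^-1%g)[c [K2 cK2 K20]] := csupp_Cc bV; split=> //; first exact/cts_real.
      by exists K2 => //; split=> // t /K20/(@complexI R).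
    by rewrite -Ib0 -(haar_inv s^-1%g (csupp_Cc bV)).
have [Bc Bp _] := BT; pose M t := Num.max (B t) be.
have Mp t : 0 < M t by rewrite lt_max be0 orbT.
have Mc : continuous (fun t => (M t)^-1).
  move=> t; apply: cvgV; first by rewrite gt_eqF.
  by apply: (@continuous_max _ _ B (fun=> be)); [exact: Bc|exact: cvg_cst].
have f'c : continuous (fun t => cr (fun t => (M t)^-1) t * f t : R[i]^o).
  have mc : continuous (cr (fun t => (M t)^-1)) by exact/cts_real.
  exact: (ctsM mc fc).
have [C C0 hC] := compact_bound cK f'c.
have h : cabs (I (fun s => cr B s * (cr (fun t => (M t)^-1) s * f s))) <= 2 * (C * rI B).
  apply: (haar_bound BT f'c) => s _; have [Ks|/K0->] := pselect (K s); first exact: hC.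
  by rewrite mulr0 cabs0.
have : cabs (I (fun s => cr B s * (cr (fun t => (M t)^-1) s * f s))) = 0.
  apply/eqP; rewrite eq_le cabs_ge0 andbT (le_trans h)// /rI BI /=.
  by rewrite mulr0 mulr0.
move=> /cabs_eq0 <-; apply: haar_ext => s; have [Ks|/K0->] := pselect (K s); last by rewrite !mulr0.
by rewrite mulrA /cr -rmorphM /M max_l ?hB// divff ?mul1r// gt_eqF// (lt_le_trans be0)// hB.
Qed.
End Haar.

Lemma cts_ext (R : realType) (T : topologicalType) (U : normedModType R[i]) (f g : T -> U) : continuous f -> f =1 g -> continuous g.
Proof. by move=> fc /funext <-. Qed.

Section Conj.
Context {R : realType}.
Implicit Types a b : R[i].
Lemma conj_mul a b : (a * b)^* = a^* * b^*. Proof. exact: rmorphM. Qed.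
Lemma conj_add a b : (a + b)^* = a^* + b^*. Proof. exact: rmorphD. Qed.
Lemma conj_inv a : (a^*)^* = a. Proof. exact: conjCK. Qed.
End Conj.

Section Vint.
Context {R : realType} {G : lcGroupType} {D : groupData R G}.
Local Notation L2 := (gdL D).
Local Notation I := (haar L2).
Local Notation CZ := (gdZ D).
Local Notation "A \ox C" := (tp D A C) (at level 40, left associativity).
Implicit Types C : cstarAlg R.

Lemma haar_cr V (b : G -> R) : csupp V b -> I (cr b) = (rI (D := D) b)%:C%C.
Proof.
move=> bV; have := haar_real (D := D) (csupp_Cc bV); rewrite -/(cr b) /rI.
by case: (I (cr b)) => x y /= ->.
Qed.

Lemma fun_sep C (v v' : C) : (forall e : C -> R[i]^o, bdlin e -> e v = e v') -> v = v'.
Proof.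
move=> h; apply/eqP; rewrite -subr_eq0; apply/eqP; set c := v - v'.
have [f [fp fb fc]] := exists_state c; have fl : islin f by case: fp.
have fbd : bdlin f by split=> //; exists 2.
have := h _ (bdlin_comp (cmulr_bd (star c)) fbd) => /= e.
apply: nm_le0; rewrite -(@ler_pXn2r _ 2) ?nnegrE ?nm_ge0// (le_trans fc)//.
by rewrite {2}/c cmulBr (islinB fl) e subrr expr0n.
Qed.

Definition is_vint (b : G -> R) C (h : G -> C) (v : C) :=
  forall e : C -> R[i]^o, bdlin e -> e v = I (fun s => cr b s * e (h s)).

(** Cut off to compact support, h is an element x of C_0(G) ⊗ C, and the vector integral is the
    slice of x by the functional d -> I(b d). *)
Lemma vint_ex V b C (h : G -> C) : csupp V b -> continuous h -> exists v, is_vint b h v.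
Proof.
move=> bV hc; have bC := csupp_Cc bV; have [chi chiT chi1] := Cc_plateau bC.
have [|x xE] := @C0fun_ex R G D C (fun s => cr chi s *: h s).
  split.
    have cc : continuous (cr chi) by case: (csupp_Cc chiT).
    by move=> s; apply: cvgZ; [exact: cc|exact: hc].
  move=> e e0; have [_ _ [K cK [_ K0]]] := chiT; exists K => // s /K0 h0.
  by rewrite /cr h0 scale0r nm0.
pose om (d : CZ) : R[i]^o := I (fun s => cr b s * zs s d).
have zc (d : CZ) : continuous (fun s => zs s d) by case: (zs_C0 d).
have omb : bdlin om.
  split=> [k d d'|].
    rewrite /om -haar_lin; [|exact: (CcM bC (zc d))|exact: (CcM bC (zc d'))].
    apply: haar_ext => s; rewrite (zs_lin s) -![_ *: (_ : R[i]^o)]/(_ * _ : R[i]); ring.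
  exists (4 * rI (D := D) b); first by rewrite mulr_ge0// (rI_ge0 bV).
  move=> d; apply: le_trans (haar_bound (M := 2 * nm d) bV (zc d) _) _.
    by move=> s _; exact: zs_bound.
  by rewrite le_eqVlt; apply/orP; left; apply/eqP; ring.
exists (slicel om x) => e eb; have el : islin e by case: eb.
have evc (y : CZ \ox C) : continuous (fun s => e (ev s y)).
  by apply: (cts_bdlin eb); case: (ev_C0fun y).
have key : forall y : CZ \ox C, e (slicel om y) = I (fun s => cr b s * e (ev s y)).
  apply: (dense_bdlin_eq (tens_total (tensP D CZ C)) (bdlin_comp (slicel_bd C omb) eb)).
    split=> [k y z|].
      rewrite -haar_lin; [|exact: (CcM bC (evc y))|exact: (CcM bC (evc z))].
      apply: haar_ext => s; rewrite (ev_lin s) el -![_ *: (_ : R[i]^o)]/(_ * _ : R[i]); ring.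
    have [_ [L L0 eL]] := eb; exists (4 * L * rI (D := D) b); first by rewrite !mulr_ge0// (rI_ge0 bV).
    move=> y; apply: le_trans (haar_bound (M := L * (2 * nm y)) bV (evc y) _) _.
      by move=> s _; rewrite (le_trans (eL _))// ler_wpM2l// ev_nm.
    by rewrite le_eqVlt; apply/orP; left; apply/eqP; ring.
  move=> _ [d [c ->]] /=; rewrite slicelE// (islinZ el) -[LHS]/(_ * _ : R[i]) mulrC -[LHS]/(_ *: om d : R[i]^o).
  rewrite /om -haarZ; last exact: (CcM bC (zc d)).
  apply: haar_ext => s; rewrite evE (islinZ el) -![_ *: (_ : R[i]^o)]/(_ * _ : R[i]); ring.
rewrite key; apply: haar_ext => s; rewrite xE (islinZ el) -[_ *: (_ : R[i]^o)]/(_ * _ : R[i]) mulrA.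
have [->|bs] := eqVneq (cr b s) 0; first by rewrite !mul0r.
by congr (_ * _); rewrite /cr chi1// mulr1.
Qed.

Lemma vint_nm V b C (h : G -> C) v w (M : R) : csupp V b -> continuous h -> is_vint b h v ->
  (forall s, b s != 0 -> nm (h s - w) <= M) -> nm (v - (rI (D := D) b)%:C%C *: w) <= 2 * (M * rI (D := D) b).
Proof.
move=> bV hc hv hM; have bC := csupp_Cc bV; set c := v - _.
have [f [fp fb fc]] := exists_state c; have fl : islin f by case: fp.
have fbd : bdlin f by split=> //; exists 2.
have gb := bdlin_comp (cmulr_bd (star c)) fbd; set g := _ \o _ in gb; have gl : islin g by case: gb.
have hwc : continuous (fun s => h s - w) by move=> s; apply: cvgB; [exact: hc|exact: cvg_cst].
have E : g c = I (fun s => cr b s * g (h s - w)).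
  have gc : continuous (fun s => g (h s)) by exact: (cts_bdlin gb).
  have := haar_lin (D := D) (- g w) (csupp_Cc bV) (CcM bC gc); rewrite -/(cr b) (haar_cr bV) -hv// => e.
  rewrite /c (islinB gl) (islinZ gl); transitivity (- g w *: (rI (D := D) b)%:C%C + g v : R[i]^o).
    by rewrite addrC scaleNr -![_ *: (_ : R[i]^o)]/(_ * _ : R[i]) mulrC.
  rewrite -e; apply: haar_ext => s; rewrite (islinB gl) -![_ *: (_ : R[i]^o)]/(_ * _ : R[i]); ring.
have gM s : b s != 0 -> cabs (g (h s - w)) <= 2 * nm c * M.
  move=> bs; rewrite /g /= (le_trans (fb _))// -mulrA ler_wpM2l// (le_trans (nm_mul _ _))//.
  by rewrite nm_star ler_wpM2l ?nm_ge0// hM.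
have h1 := haar_bound_Re (D := D) bV (cts_bdlin gb hwc) gM.
have [->|cn] := eqVneq (nm c) 0.
  have M0 : b =1 (fun=> 0) \/ 0 <= M.
    have [|/forallNP h0] := pselect (exists s, b s != 0); last first.
      by left => s; have := h0 s => /negP; rewrite negbK => /eqP.
    by move=> [s bs]; right; apply: le_trans (hM s bs); exact: nm_ge0.
  case: M0 => [b0|M0]; last by rewrite !mulr_ge0// (rI_ge0 bV).
  rewrite /rI (_ : I (cr b) = 0) ?mulr0//.
  by rewrite -(haar0 (D := D)); apply: haar_ext => s; rewrite /cr b0.
have c0 : 0 < nm c by rewrite lt_neqAle eq_sym cn nm_ge0.
rewrite -(ler_pM2l c0) -expr2 (le_trans fc)// (le_trans (ler_norm _))//.
rewrite -[f _]/(g c) E; apply: le_trans h1 _.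
by rewrite le_eqVlt; apply/orP; left; apply/eqP; ring.
Qed.

Lemma haar_conj f : Cc f -> I (fun s => (f s : R[i])^* : R[i]^o) = (I f : R[i])^*.
Proof.
move=> fC; have rC (g : G -> R[i]^o) : Cc g -> Cc (fun s => (complex.Re (g s : R[i]))%:C%C).
  by move=> [gc [K cK K0]]; split; [exact: cts_Re|exists K => // s /K0 ->].
have jC : Cc (fun s => (- 'i%C : R[i]) *: f s) by exact: CcZ.
pose u := I (fun s => (complex.Re (f s : R[i]))%:C%C); pose v := I (fun s => (complex.Re (- 'i%C * f s : R[i]))%:C%C).
have -> : I f = 'i%C *: v + u.
  rewrite -haar_lin; [|exact: (rC _ jC)|exact: rC].
  apply: haar_ext => s; case: (f s) => a b; rewrite -[_ *: _]/(_ * _ : R[i]).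
  by apply/eqP; rewrite eq_complex /=; apply/andP; split; apply/eqP; ring.
have -> : I (fun s => (f s : R[i])^*) = (- 'i%C) *: v + u.
  rewrite -haar_lin; [|exact: (rC _ jC)|exact: rC].
  apply: haar_ext => s; case: (f s) => a b; rewrite -[_ *: _]/(_ * _ : R[i]).
  by apply/eqP; rewrite /Num.conj /= eq_complex /=; apply/andP; split; apply/eqP; ring.
have := haar_real (D := D) (rC _ fC); have : complex.Im v = 0 := haar_real (D := D) (rC _ jC).
rewrite -/u.
case: v => a b; case: u => c d /= -> ->; rewrite -![_ *: _]/(_ * _ : R[i]) /Num.conj.
by apply/eqP; rewrite eq_complex /=; apply/andP; split; apply/eqP; ring.
Qed.

Lemma rep_int V b C (u : G -> mult C) : csupp V b -> unitary_rep u ->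
  exists m : mult C, (forall c, is_vint b (fun s => u s c) (m c)) /\
                     (forall c, is_vint b (fun s => mstar (u s) c) (mstar m c)).
Proof.
move=> bV uu; have [u1 um uv uc] := uu; have bC := csupp_Cc bV.
have usc c : continuous (fun s => mstar (u s) c).
  rewrite (_ : (fun s => _) = (fun s => u s c) \o (fun s : G => s^-1%g)).
    by move=> s; apply: continuous_comp; [exact: invg_cts|exact: uc].
  by apply/funext => s /=; rewrite uv.
have [f fE] := choice (P := fun c v => is_vint b (fun s => u s c) v) (fun c => vint_ex bV (uc c)).
have [g gE] := choice (P := fun c v => is_vint b (fun s => mstar (u s) c) v) (fun c => vint_ex bV (usc c)).
have fg (x y : C) : star (f x) ** y = star x ** g y.
  apply: fun_sep => e eb; have el : islin e by case: eb.
  pose e1 (z : C) : R[i]^o := (e (star z ** y) : R[i])^*.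
  have e1b : bdlin e1.
    split=> [k z w|].
      rewrite /e1 starD cmulDl el conj_add -[k^* *: _]/(k^* * e (star z ** y) : R[i]).
      by rewrite conj_mul conj_inv.
    have [_ [L L0 eL]] := eb; exists (L * nm y); first by rewrite mulr_ge0 ?nm_ge0.
    move=> z; rewrite -[nm _]/(cabs (e (star z ** y))^*%C) cabsC (le_trans (eL _))// -mulrA ler_wpM2l//.
    by rewrite (le_trans (nm_mul _ _))// nm_star mulrC.
  have -> : e (star (f x) ** y) = (e1 (f x) : R[i])^* by rewrite /e1 conj_inv.
  rewrite (fE x _ e1b) -haar_conj; last first.
    by apply: CcM => //; exact: (cts_bdlin e1b (uc x)).
  rewrite -[e (star x ** g y)]/((e \o (fun z => star x ** z)) (g y)) (gE y); last exact: (bdlin_comp (cmulr_bd _) eb).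
  apply: haar_ext => s; rewrite conj_mul /e1 conj_inv; congr (_ * _); first exact: conjc_real.
  by rewrite multP.
by exists (Mult fg).
Qed.
End Vint.

Section Dens.
Context {R : realType} {G : lcGroupType} {D : groupData R G}.
Local Notation L2 := (gdL D).
Local Notation I := (haar L2).
Local Notation CG := (gdA D).
Let gr := @gin_rep _ _ CG.

(** The functional e vanishes on the orbit of c under G. *)
Definition gann (e : CG -> R[i]^o) (c : CG) := bdlin e /\ forall s, e (gin s c) = 0.
Definition gabs (m : mult CG) := forall e c, gann e c -> e (m c) = 0.
(* These multipliers form a C*-algebra on which G acts by multiplication, and it contains the
   integrals of the group elements; universality of C*(G) then gives [dens]. *)
Definition gset (m : mult CG) := [/\ gabs m, gabs (mstar m),
  continuous (fun s => gin s * m) & continuous (fun s => gin s * mstar m)].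

Lemma gann_gin e c s : gann e c -> gann (fun x => e (gin s x)) c.
Proof.
move=> [eb h]; split; first exact: (bdlin_comp (mact_bdlin _) eb).
by move=> t; have [_ gm _ _] := gr; rewrite -mactM -[_ * _]gm h.
Qed.

Lemma gabsM m n : gabs m -> gabs n -> gabs (m * n).
Proof.
move=> hm hn e c h; rewrite mactM; apply: hm; split; first by case: h.
by move=> s; apply: (hn _ _ (gann_gin s h)).
Qed.

Lemma gabs_gin s : gabs (gin s). Proof. by move=> e c [_]; apply. Qed.

Lemma ctsMr (f : G -> mult CG) n : continuous f -> continuous (fun s => f s * n).
Proof.
move=> fc; have mb : bdlin (fun m : mult CG => m * n).
  split=> [k a b|]; first by rewrite mulrDl mscAl.
  by exists (nm n) => [|m]; [exact: nm_ge0|rewrite mulrC; exact: nmM].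
exact: (cts_bdlin mb fc).
Qed.

Lemma gset_closed (x : mult CG) : (forall e : R, 0 < e -> exists2 y, gset y & nm (x - y) < e) -> gset x.
Proof.
move=> h; have ab (f : mult CG -> mult CG) : (forall m n, nm (f m - f n) <= nm (m - n)) ->
    (forall m, gset m -> gabs (f m)) -> gabs (f x).
  move=> fl hf e c ec; have [eb e0] := ec; have [el [L L0 eL]] := eb.
  apply: (@nm_eps R R[i]^o _ (L * nm c)) => d d0; have [y ys xy] := h d d0.
  have -> : e (f x c) = e ((f x - f y) c) by rewrite multBE (islinB el) (hf y ys _ _ ec) subr0.
  rewrite (le_trans (eL _))// -mulrA ler_wpM2l// (le_trans (nm_mact _ _))// mulrC ler_wpM2l ?nm_ge0//.
  by rewrite (le_trans (fl _ _))// ltW.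
have ct (f : mult CG -> mult CG) : (forall m n, nm (f m - f n) <= nm (m - n)) ->
    (forall m, gset m -> continuous (fun s => gin s * f m)) -> continuous (fun s => gin s * f x).
  move=> fl hf; apply: cts_unif => e e0; have [y ys xy] := h e e0.
  exists (fun s => gin s * f y); first exact: hf.
  move=> s; rewrite -mulrBr (le_lt_trans (nmM _ _))// (le_lt_trans _ xy)//.
  rewrite (le_trans (ler_wpM2r (nm_ge0 _) (urep_nm s gr)))// mul1r; exact: fl.
have sl (m n : mult CG) : nm (mstar m - mstar n) <= nm (m - n) by rewrite -mstarB nm_mstar.
split; [apply: (ab id)|apply: (ab (@mstar R CG))|apply: (ct id)|apply: (ct (@mstar R CG))] => // m [] //.
Qed.

Lemma gset_lin k a b : gset a -> gset b -> gset (k *: a + b).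
Proof.
move=> [a1 a2 a3 a4] [b1 b2 b3 b4]; split.
- move=> e c ec; have [[el _] _] := ec.
  by rewrite multDE multZE el a1// b1// scaler0 addr0.
- move=> e c ec; have [[el _] _] := ec.
  by rewrite mstarD mstarZ multDE multZE el a2// b2// scaler0 addr0.
- refine (cts_ext (cts_lin (k := k) a3 b3) _); move=> s.
  by rewrite mulrDr mscAr.
- refine (cts_ext (cts_lin (k := k^*) a4 b4) _); move=> s.
  by rewrite mstarD mstarZ mulrDr mscAr.
Qed.

Lemma gset0 : gset 0.
Proof.
have ab : gabs 0 by move=> e c [[el _] _]; rewrite mult0E (islin0 el).
have ct : continuous (fun s : G => gin s * (0 : mult CG)).
  by rewrite (_ : (fun s => _) = fun=> 0); [move=> s; exact: cvg_cst|apply/funext => s; rewrite mulr0].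
by split; rewrite ?mstar0.
Qed.

Lemma gset_mul a b : gset a -> gset b -> gset (a * b).
Proof.
move=> [a1 a2 a3 a4] [b1 b2 b3 b4]; split; rewrite ?mstarM; try exact: gabsM.
- by refine (cts_ext (ctsMr (n := b) a3) _); move=> s; rewrite mulrA.
- by refine (cts_ext (ctsMr (n := mstar a) b4) _); move=> s; rewrite mulrA.
Qed.

Lemma gset_star a : gset a -> gset (mstar a).
Proof. by move=> [a1 a2 a3 a4]; split; rewrite ?mstarK. Qed.

Definition gsub : cssub (multalg CG) := @CsSub R (multalg CG) gset gset_closed gset_lin gset0 gset_mul gset_star.

Lemma gset_gin s m : gset m -> gset (gin s * m).
Proof.
have [g1 gm gv gc] := gr.
move=> [a1 a2 a3 a4]; split; rewrite ?mstarM -?gv.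
- exact: (gabsM (gabs_gin s) a1).
- exact: (gabsM a2 (gabs_gin _)).
- rewrite (_ : (fun t => _) = (fun t => gin t * m) \o (fun t => t * s)%g).
    by move=> t; apply: continuous_comp; [exact: rmul_cts|exact: a3].
  by apply/funext => t /=; rewrite mulrA gm.
- by refine (cts_ext (ctsMr (n := gin s^-1%g) a4) _); move=> t; rewrite mulrA.
Qed.

(** Left translation is norm continuous on J, but membership also needs it on the adjoint of J. The
    product J J^* is selfadjoint, so continuity on J suffices for both conditions. *)
Lemma gset_int V b (J : mult CG) : csupp V b -> 
  (forall c, is_vint (D := D) b (fun s => gin s c) (J c)) ->
  (forall c, is_vint (D := D) b (fun s => mstar (gin s) c) (mstar J c)) -> gset (J * mstar J).
Proof.
move=> bV hJ hJ'; have [g1 gm gv gc] := gr; have bC := csupp_Cc bV.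
have ab : gabs J.
  move=> e c [eb h]; rewrite (hJ c e eb) -(haar0 (D := D)); apply: haar_ext => s.
  by rewrite h mulr0.
have ab' : gabs (mstar J).
  move=> e c [eb h]; rewrite (hJ' c e eb) -(haar0 (D := D)); apply: haar_ext => s.
  by rewrite -gv h mulr0.
suff ct : continuous (fun s => gin s * J).
  split; rewrite ?mstarM ?mstarK; try exact: gabsM.
    by refine (cts_ext (ctsMr (n := mstar J) ct) _); move=> s; rewrite mulrA.
  by refine (cts_ext (ctsMr (n := mstar J) ct) _); move=> s; rewrite mulrA.
have [bc bp [K cK [_ K0]]] := bV.
have near1 e : 0 < e -> \forall t \near (1%g : G), nm (gin t * J - J) < e.
  move=> e0; have [U U1 [cU _]] := @lcg_locally_compact G 1%g Logic.I.
  have {}U1 : nbhs (1%g : G) U by have h : nbhs (1%g : G) [set t | [set: G] t -> U t] := U1; apply: filterS h => t; apply.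
  have U11 : U 1%g := nbhs_singleton U1.
  (* U K contains the supports of b and of its translates by t in U, so one cut-off chi serves for
     the difference of both integrals, uniformly in t. *)
  pose P : set G := (fun p : G * G => (p.1 * p.2)%g) @` (U `*` K).
  have cP : compact P.
    apply: continuous_compact; first by apply: continuous_subspaceT; exact: mulg_cts.
    exact: compact_setX.
  have [//|chi chiT [_ chi1]] := @plateau R G P setT cP openT.
  have chi0 := rI_ge0 (D := D) chiT.
  have e20 : 0 < e / 2 by rewrite divr_gt0.
  have c20 : 0 <= 2 * rI (D := D) chi by rewrite mulr_ge0.
  have [d [d0 d1 de]] := small_eps e20 c20.
  have fc : continuous (cr b) by exact/cts_real.
  have K0' s : ~ K s -> cr b s = 0 by move=> /K0 h; rewrite /cr h.
  have uc : \forall t \near (1%g : G), forall s, nm (cr b (t^-1 * s)%g - cr b s) < d.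
    have := @invg_cts G 1%g [set t | forall s, nm (cr b (t * s)%g - cr b s) < d].
    by rewrite /= invg1; apply; exact: (unif_cts fc cK K0' d0).
  have gc' (x : CG) : continuous (fun s : G => gin s x) := gc x.
  apply: filterS2 U1 uc => t Ut ht; apply: (@le_lt_trans _ _ (2 * rI (D := D) chi * d)); last by lra.
  apply: opn_le => [|c]; first by rewrite mulr_ge0 ?(ltW d0)// mulr_ge0.
  set v := (gin t * J - J) c.
  have [f [fp fb fv]] := exists_state v; have fl : islin f by case: fp.
  have fbd : bdlin f by split=> //; exists 2.
  have gb := bdlin_comp (cmulr_bd (star v)) fbd; set g := _ \o _ in gb; have gl : islin g by case: gb.
  have gtb := bdlin_comp (mact_bdlin (gin t)) gb.
  have ggc : continuous (fun s : G => g (gin s c)) by exact: (cts_bdlin gb (gc' c)).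
  have btC : Cc (fun s => cr b (t^-1 * s)%g) by exact: Cc_ltrans.
  have e1 : g (gin t (J c)) = I (fun s => cr b (t^-1 * s)%g * g (gin s c)).
    rewrite -[LHS]/((g \o gin t) (J c)) (hJ c _ gtb) -[RHS](haar_inv (D := D) t); last exact: (CcM btC ggc).
    by apply: haar_ext => s /=; rewrite mulgA mulVg mul1g gm.
  have E : g v = I (fun s => cr chi s * ((cr b (t^-1 * s)%g - cr b s) * g (gin s c))).
    rewrite /v multBE (islinB gl) mactM e1 (hJ c _ gb).
    transitivity (-1 *: I (fun s => cr b s * g (gin s c)) + I (fun s => cr b (t^-1 * s)%g * g (gin s c)) : R[i]^o).
      by rewrite scaleN1r addrC.
    rewrite -haar_lin; [|exact: (CcM bC ggc)|exact: (CcM btC ggc)].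
    apply: haar_ext => s; rewrite scaleN1r addrC -mulrBl.
    have [Ps|nP] := pselect (P s); first by rewrite /cr (chi1 s Ps) mul1r.
    rewrite /cr (K0 s); last first.
      by move=> Ks; apply: nP; exists (1%g, s); rewrite /= ?mul1g.
    rewrite (K0 (t^-1 * s)%g) ?subrr ?mul0r ?mulr0//.
    by move=> Ks; apply: nP; exists (t, (t^-1 * s)%g); [|rewrite /= mulgA mulgV mul1g].
  have Fc : continuous (fun s => (cr b (t^-1 * s)%g - cr b s) * g (gin s c) : R[i]^o).
    have c1 : continuous (fun s => cr b (t^-1 * s)%g) by case: btC.
    have c2 : continuous (fun s => cr b (t^-1 * s)%g - cr b s : R[i]^o).
      by refine (cts_ext (cts_lin (k := -1) fc c1) _); move=> s; rewrite scaleN1r addrC.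
    exact: (ctsM c2 ggc).
  have FM s : chi s != 0 -> cabs ((cr b (t^-1 * s)%g - cr b s) * g (gin s c)) <= d * (2 * (nm v * nm c)).
    move=> _; rewrite cabsM ler_pM ?cabs_ge0//; first exact: ltW (ht s).
    rewrite /g /= (le_trans (fb _))// ler_wpM2l// (le_trans (nm_mul _ _))// nm_star ler_wpM2l ?nm_ge0//.
    by rewrite (le_trans (nm_mact _ _))// ler_piMl ?nm_ge0// (urep_nm _ gr).
  have h1 := haar_bound_Re (D := D) chiT Fc FM.
  have [->|vn] := eqVneq (nm v) 0; first by rewrite mulr_ge0 ?nm_ge0// mulr_ge0 ?(ltW d0)// mulr_ge0.
  have v0 : 0 < nm v by rewrite lt_neqAle eq_sym vn nm_ge0.
  rewrite -(ler_pM2l v0) -expr2 (le_trans fv)// (le_trans (ler_norm _))//.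
  rewrite -[f _]/(g v) E; apply: le_trans h1 _.
  by rewrite le_eqVlt; apply/orP; left; apply/eqP; ring.
apply/cts_nm => s e e0.
have hc : nbhs s [set t | nm (gin (s^-1 * t)%g * J - J) < e].
  apply: (@lmul_cts G s^-1%g s [set t | nm (gin t * J - J) < e]).
  by rewrite /= mulVg; exact: near1.
apply: filterS hc => t /= h; rewrite nmBC.
have -> : gin t * J - gin s * J = gin s * (gin (s^-1 * t)%g * J - J).
  have ge : gin s * gin (s^-1 * t)%g = gin t :> mult CG.
    by apply: etrans (esym (gm _ _)) _; rewrite mulgA mulgV mul1g.
  by rewrite mulrBr mulrA ge.
rewrite (le_lt_trans (nmM _ _))// (le_lt_trans _ h)// ler_piMl ?nm_ge0//.
exact: urep_nm gr.
Qed.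

Lemma gset_approx (c : CG) (e : R) : 0 < e -> exists2 p, gset p & nm (p c - c) < e.
Proof.
move=> e0; have [g1 gm gv gc] := gr.
have gsc (x : CG) : continuous (fun s => mstar (gin s) x).
  refine (@cts_ext R _ _ ((fun s => gin s x) \o (fun s : G => s^-1%g)) _ _ _).
    by move=> s; apply: continuous_comp; [exact: invg_cts|exact: gc].
  by move=> s /=; rewrite gv.
(* J and its adjoint move c by at most 2 e / 16, and J has norm at most 2, so J J^* moves c by at
   most 6 e / 16. *)
have e8 : 0 < e / 16 by rewrite divr_gt0.
have V1 : nbhs (1%g : G) [set s | nm (gin s c - c) < e / 16].
  have := iffLR (cts_nm _) (gc c) 1%g _ e8; apply: filterS => s.
  by rewrite g1 nmBC.
have V2 : nbhs (1%g : G) [set s | nm (mstar (gin s) c - c) < e / 16].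
  have := iffLR (cts_nm _) (gsc c) 1%g _ e8; apply: filterS => s.
  by rewrite g1 (_ : mstar (mone CG) c = c)// nmBC.
have [b0 b0V b01] := bump_fun (R := R) (filterI V1 V2).
have rp := haar_pos (D := D) b0V b01.
pose b s := (rI (D := D) b0)^-1 * b0 s.
have bV : csupp ([set s | nm (gin s c - c) < e / 16] `&` [set s | nm (mstar (gin s) c - c) < e / 16]) b.
  have [bc bp [K cK [KV K0]]] := b0V; split=> [s|s|].
  - by apply: cvgM; [exact: cvg_cst|exact: bc].
  - by rewrite mulr_ge0// invr_ge0 ltW.
  - by exists K => //; split=> // s /K0 h; rewrite /b h mulr0.
have b1 : rI (D := D) b = 1.
  rewrite /rI (_ : I (cr b) = ((rI (D := D) b0)^-1)%:C%C *: I (cr b0)).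
    rewrite (haar_cr b0V) -[_ *: _]/(_ * _ : R[i]) -rmorphM /= mulVf// gt_eqF//.
  rewrite -haarZ; last exact: (csupp_Cc b0V).
  by apply: haar_ext => s; rewrite /cr /b rmorphM.
have [J [hJ hJ']] := rep_int (D := D) bV gr.
exists (J * mstar J); first exact: (gset_int bV).
have bsup s : b s != 0 -> nm (gin s c - c) < e / 16 /\ nm (mstar (gin s) c - c) < e / 16.
  have [_ _ [K cK [KV K0]]] := bV => bs; apply: KV; apply: contrapT => /K0 h.
  by rewrite h eqxx in bs.
have h1 : nm (mstar J c - c) <= 2 * (e / 16).
  have := vint_nm (w := c) (M := e / 16) bV (gsc c) (hJ' c); rewrite b1 mulr1 rmorph1 scale1r; apply.
  by move=> s /bsup[_ /ltW].
have h2 : nm (J c - c) <= 2 * (e / 16).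
  have := vint_nm (w := c) (M := e / 16) bV (gc c) (hJ c); rewrite b1 mulr1 rmorph1 scale1r; apply.
  by move=> s /bsup[/ltW].
have h3 (x : CG) : nm (J x) <= 2 * nm x.
  have := vint_nm (w := 0) (M := nm x) bV (gc x) (hJ x); rewrite b1 mulr1 scaler0 subr0; apply.
  move=> s _; rewrite subr0 (le_trans (nm_mact _ _))// ler_piMl ?nm_ge0//.
  exact: urep_nm gr.
have := h3 (mstar J c - c); rewrite (islinB (mult_lin J)) -mactM => h4.
have := nm_tri (J c) ((J * mstar J) c) c; lra.
Qed.

(** The span of G is dense enough in C*(G) for this, though only the universal property is given. G
    acts on [gsub] by strictly continuous unitaries, so C*(G) maps to its multipliers and
    [univ_absorb] yields x p in [gsub] for p in [gsub]. As c is close to p c, the value e(x c) is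
    close to e(x p c) = 0. *)
Lemma dens e c : gann e c -> forall x, e (x ** c) = 0.
Proof.
move=> ec x; have [g1 gm gv gc] := gr; have [eb _] := ec; have [el [L L0 eL]] := eb.
have nd : cspan [set y | exists (p : mult CG) (x : CG), gsub p /\ y = p x] = setT.
  rewrite -subTset => y _; apply/closure_nmP => d d0; have [p ps py] := gset_approx y d0.
  exists (p y); last by rewrite nmBC.
  exists 1%N, (fun=> 1), (fun=> p y); split; first by move=> _; exists p, y.
  by rewrite big_ord1 scale1r.
have [u uP] : exists u : G -> mult (subalg gsub), forall s, (forall b, sinc (u s b) = gin s * sinc b) /\
    mext (@sinc R CG gsub) (u s) = gin s.
  have [s|u uP] := choice (P := fun s (n : mult (subalg gsub)) => (forall b, sinc (n b) = gin s * sinc b) /\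
    mext (@sinc R CG gsub) n = gin s).
    apply: sub_mult => // p; first exact: gset_gin.
    by rewrite -gv; exact: gset_gin.
  by exists u.
have sinc_inj (a b : subalg gsub) : sinc a = sinc b -> a = b.
  exact: (@sv_inj R (multalg CG) gsub).
have uu : unitary_rep u.
  split.
  - apply: mult_ext => b; apply: sinc_inj; rewrite (proj1 (uP _)) g1; exact: mult_ext.
  - move=> s t; apply: mult_ext => b; apply: sinc_inj.
    rewrite (proj1 (uP _)) -[mmul _ _ _]/(u s (u t b)) !(proj1 (uP _)) gm; exact: mult_ext.
  - move=> s; apply: mult_ext => b; apply: cmul_nondeg => a; rewrite -multP.
    apply: sinc_inj; rewrite -[LHS]/(mstar (sinc a) * sinc (u s^-1%g b)).
    rewrite -[RHS]/(mstar (sinc (u s a)) * sinc b) !(proj1 (uP _)) mstarM -gv; exact: mulrA.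
  - move=> b; have [_ _ bc _] := svP b; apply/cts_nm => s d d0.
    apply: filterS (iffLR (cts_nm _) bc s d d0) => t /=; apply: le_lt_trans.
    rewrite -nm_sv -[sv _]/(sv (u s b) + sv (- u t b)) svN.
    by rewrite -[sv (u s b)]/(sinc (u s b)) -[sv (u t b)]/(sinc (u t b)) !(proj1 (uP _)).
have [h [[hn hu] _]] := @gin_univ _ _ CG _ u uu.
have kn : nondeg (fun x => mext (@sinc R CG gsub) (h x)) by apply: mext_nondeg => //; exact: sinc_nondeg.
have [k [_ kU]] := @gin_univ _ _ CG _ _ gr.
have e1 := kU (@emb R CG) (conj (@nondeg_emb R CG) (fun s => mext_emb_id _)).
have e2 := kU (fun x => mext (@sinc R CG gsub) (h x)).
have hE y : mext (@sinc R CG gsub) (h y) = emb y.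
  rewrite -[LHS]/((fun x => mext (@sinc R CG gsub) (h x)) y) -e2; last first.
    split=> // s; rewrite mext_comp ?hu//; last exact: sinc_nondeg.
    by case: (uP s).
  by rewrite e1.
apply: (@nm_eps R R[i]^o _ (L * nm x)) => d d0.
have [p ps pc] := gset_approx c d0.
have [xp _ _ _] := univ_absorb nd hE x ps.
have -> : e (x ** c) = e (x ** (c - p c)).
  by rewrite cmulBr (islinB el) -[x ** p c]/((emb x * p) c) (xp e c ec) subr0.
rewrite (le_trans (eL _))// -mulrA ler_wpM2l// (le_trans (nm_mul _ _))// ler_wpM2l ?nm_ge0//.
by rewrite nmBC ltW.
Qed.
End Dens.

(** * Large ideals *)

Section Interp.
Context {F : fieldType} {X : Type}.

(** Duality in F^n: a row vector annihilated by every relation among the restrictions of V lies in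
    their span. *)
Lemma interp (V : set (X -> F)) (h0 : X -> F) n (x : 'I_n -> X) : V (fun=> 0) ->
  (forall k g g', V g -> V g' -> V (fun y => k * g y + g' y)) ->
  (forall l : 'I_n -> F, (forall g, V g -> \sum_i l i * g (x i) = 0) -> \sum_i l i * h0 (x i) = 0) ->
  exists2 g, V g & forall i, g (x i) = h0 (x i).
Proof.
move=> V0 Vl h; pose r (g : X -> F) : 'rV[F]_n := \row_i g (x i).
pose P k := exists m (M : 'M[F]_(m, n)),
  (forall v : 'rV_n, (v <= M)%MS -> exists2 g, V g & v = r g) /\ \rank M = k.
have P0 : exists k, `[< P k >].
  exists 0%N; apply/asboolP; exists n, (0 : 'M[F]_n); split; last by rewrite mxrank0.
  by move=> v; rewrite submx0 => /eqP->; exists (fun=> 0) => //; apply/rowP => i; rewrite !mxE.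
have Pn k : `[< P k >] -> (k <= n)%N by move=> /asboolP[m [M [_ <-]]]; exact: rank_leq_col.
(* A matrix of maximal rank whose row space consists of restrictions of V contains all of them. The
   columns of its cokernel are then relations to which the hypothesis on h0 applies. *)
have [k /asboolP[m [M [MV Mk]]] kmax] := ex_maxnP P0 Pn.
have VM g : V g -> (r g <= M)%MS.
  move=> Vg; apply: contrapT => /negP nrM.
  have rk : (\rank M < \rank (M + r g)%MS)%N.
    have : (M < M + r g)%MS.
      rewrite /ltmx addsmxSl /=; apply: contra nrM => h1.
      exact: submx_trans (addsmxSr M (r g)) h1.
    by rewrite ltmxErank => /andP[].
  have : `[< P (\rank (M + r g)%MS) >].
    apply/asboolP; exists n, (M + r g)%MS; split=> // v /sub_addsmxP[[a b] /= ->].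
    have [|g1 Vg1 e1] := MV (a *m M); first exact: submxMl.
    exists (fun y => b 0 0 * g y + g1 y); first exact: Vl.
    rewrite e1; apply/rowP => i; rewrite !mxE big_ord1 !mxE addrC.
    exact: erefl.
  by move=> /kmax; rewrite leqNgt -Mk rk.
suff /MV[g Vg e] : (r h0 <= M)%MS.
  by exists g => // i; have := congr1 (fun v : 'rV_n => v 0 i) e; rewrite !mxE => ->.
rewrite submxE; apply/eqP/rowP => j; rewrite !mxE.
under eq_bigr => i _ do rewrite mxE mulrC.
apply: h => g /VM; rewrite submxE => /eqP/rowP/(_ j); rewrite mxE [in RHS]mxE => e0.
by rewrite -[RHS]e0; apply: eq_bigr => i _; rewrite mulrC [r g _ _]mxE.
Qed.
End Interp.

Lemma conj_0 (R : realType) : (0 : R[i])^* = 0.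
Proof. exact: rmorph0. Qed.

Section LargeIdeal.
Context {R : realType} {G : lcGroupType} {D : groupData R G}.
Local Notation CG := (gdA D).
Local Notation "A \ox C" := (tp D A C) (at level 40, left associativity).
Implicit Types e h : CG -> R[i]^o.

(** Two factorizations are compared at d c and d c' for a common approximate unit d: there m d lies
    in the algebra, and both sides are f(m d). *)
Lemma fextE (A : cstarAlg R) (f g : A -> R[i]^o) c m : bdlin g -> (forall x, f x = g (x ** c)) ->
  fext f m = g (m c).
Proof.
move=> gb fg; have [|g' [c' [/bdfunP g'b fg' e]]] := @the_spec _ (0 : R[i]) (fun z => exists g c,
   [/\ bounded_functional g, (forall x, f x = g (x ** c)) & z = g (m c)]).
  by exists (g (m c)), g, c; split=> //; exact/bdfunP.
rewrite /fext e; apply/eqP; rewrite -subr_eq0; apply/eqP.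
have [gl [L L0 gL]] := gb; have [g'l [L' L'0 g'L]] := g'b.
apply: (@nm_eps R R[i]^o _ ((L + L') * nm m)) => r r0.
have [d [_ _ hd]] := approx_unit [:: c; c'] r0.
have e1 : g (m (d ** c)) = g' (m (d ** c')) by rewrite !multM -fg -fg'.
have -> : g' (m c') - g (m c) = g' (m (c' - d ** c')) - g (m (c - d ** c)) :> R[i]^o.
  rewrite !(islinB (mult_lin m)) (islinB gl) (islinB g'l) e1; zmod.
have b x : x \in [:: c; c'] -> nm (m (x - d ** x)) <= nm m * r.
  by move=> /hd[h _]; rewrite (le_trans (nm_mact _ _))// ler_wpM2l ?nm_ge0.
rewrite (le_trans (nmB _ _))// (_ : (L + L') * nm m * r = L' * (nm m * r) + L * (nm m * r)); last by ring.
apply: lerD; first by rewrite (le_trans (g'L _))// ler_wpM2l// b// !inE eqxx orbT.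
by rewrite (le_trans (gL _))// ler_wpM2l// b// !inE eqxx.
Qed.

Lemma fext0 (A : cstarAlg R) (f : A -> R[i]^o) m :
  ~ (exists g c, bdlin g /\ forall x, f x = g (x ** c)) -> fext f m = 0.
Proof.
by move=> h; apply: the_none => -[z [g [c [/bdfunP gb fg _]]]]; apply: h; exists g, c.
Qed.

Let gr := @gin_rep _ _ CG.

(** Translation is invertible, so a functional factors exactly when its translate does; in the
    remaining case both values are the default 0. *)
Lemma BGval_l e t s : bdlin e -> BGval (fun x => e (gin t x)) s = BGval e (t * s)%g.
Proof.
have [g1 gm gv gc] := gr; move=> eb; rewrite /BGval.
have [[g [c [gb eg]]]|h] := pselect (exists g c, bdlin g /\ forall x, e x = g (x ** c)).
  rewrite (fextE _ gb eg) (@fextE _ _ (fun x => g (gin t x)) c).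
  - by rewrite gm.
  - exact: (bdlin_comp (mact_bdlin _) gb).
  - by move=> x; rewrite eg multM.
rewrite (fext0 _ h) fext0// => -[g [c [gb eg]]]; apply: h.
exists (fun x => g (gin t^-1%g x)), c; split; first exact: (bdlin_comp (mact_bdlin _) gb).
move=> x; rewrite multM -eg -[gin t (gin _ x)]/(mmul (gin t) (gin t^-1%g) x) -gm mulgV g1.
by [].
Qed.

Lemma rm_mul (x : CG) m c : rm x m ** c = x ** m c.
Proof. by rewrite -[LHS]/(emb (rm x m) c) -rmE. Qed.

Lemma BGval_r e t s : bdlin e -> BGval (fun x => e (rm x (gin t))) s = BGval e (s * t)%g.
Proof.
have [g1 gm gv gc] := gr; move=> eb; rewrite /BGval.
have [[g [c [gb eg]]]|h] := pselect (exists g c, bdlin g /\ forall x, e x = g (x ** c)).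
  rewrite (fextE _ gb eg) (@fextE _ _ g (gin t c))//; first by rewrite gm.
  by move=> x; rewrite eg rm_mul.
rewrite (fext0 _ h) fext0// => -[g [c [gb eg]]]; apply: h.
exists g, (gin t^-1%g c); split=> // x.
rewrite -rm_mul -eg; congr e; apply: emb_inj; rewrite -!rmE -mulrA.
by rewrite -[gin t^-1%g * _]gm mulVg g1 mulr1.
Qed.

Variable E : set (CG -> R[i]^o).
Hypothesis hE : large_ideal E.

Lemma E_bdlin e : E e -> bdlin e.
Proof. by move=> Ee; apply/bdfunP; case: hE => /(_ e Ee). Qed.

Lemma E_trans e s t : E e -> E (fun x => e (gin s (rm x (gin t)))).
Proof.
have [_ _ _ _ [tr _]] := hE; move=> Ee; have eb := E_bdlin Ee.
have b1 : bdlin (fun x => e (gin s x)) by exact: (bdlin_comp (mact_bdlin _) eb).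
have E1 : E (fun x => e (gin s x)).
  by apply: (tr e _ s) => //; [exact/bdfunP|left => u; exact: BGval_l].
apply: (tr (fun x => e (gin s x)) _ t) => //.
  by apply/bdfunP; exact: (bdlin_comp (rm_bdlin _) b1).
by right => u; exact: (@BGval_r (fun x => e (gin s x))).
Qed.

(** The functionals of E that agree with h on a finite set form a filter base, which converges to h
    pointwise. *)
Lemma E_closed h : bdlin h ->
  (forall n (x : 'I_n -> CG), exists2 g, E g & forall i, g (x i) = h (x i)) -> E h.
Proof.
have [_ _ _ _ [_ [F cF EF]]] := hE; move=> hb hx.
rewrite EF; split; first exact/bdfunP.
pose S (s : seq CG) : set {ptws CG -> R[i]^o} := [set g | E g /\ forall x, x \in s -> g x = h x].
pose FF : set_system {ptws CG -> R[i]^o} := [set Q | exists s, S s `<=` Q].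
have Fp : ProperFilter FF.
  split.
    move=> [s sQ]; have [g Eg gh] := hx (size s) (fun i => nth 0 s i).
    apply: (sQ g); split=> // x /(nthP 0)[i il <-]; exact: (gh (Ordinal il)).
  split.
  - by exists [::].
  - move=> Q Q' [s sQ] [s' sQ']; exists (s ++ s') => g [Eg gh]; split.
      by apply: sQ; split=> // x xs; apply: gh; rewrite mem_cat xs.
    by apply: sQ'; split=> // x xs; apply: gh; rewrite mem_cat xs orbT.
  - by move=> Q Q' QQ' [s sQ]; exists s => g /sQ/QQ'.
have cv : {ptws, FF --> (h : CG -> R[i]^o)}.
  apply/pointwise_cvgP => x B /nbhs_singleton Bx; exists [:: x] => g [_ gh] /=.
  by rewrite gh ?mem_seq1// eqxx.
apply: (@closed_cvg _ _ FF _ id F cF _ h cv).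
by exists [::] => g [Eg _]; move: Eg; rewrite EF => -[].
Qed.

Lemma E_bimod e c1 c2 : E e -> E (fun x => e (c1 ** x ** c2)).
Proof.
move=> Ee; have eb := E_bdlin Ee; have el : islin e by case: eb.
have [_ [E0 Elin] _ _ _] := hE.
have hb : bdlin (fun x => e (c1 ** x ** c2)).
  exact: (bdlin_comp (bdlin_comp (cmulr_bd c1) (cmull_bd c2)) eb).
apply: E_closed => // n x.
apply: (@interp R[i] CG E (fun x => e (c1 ** x ** c2)) n x E0) => [k g g' Eg Eg'|l hl].
  exact: (Elin k g g').
set y := \sum_i l i *: x i.
have ly g : E g -> \sum_i l i * g (x i) = g y :> R[i].
  by move=> /E_bdlin[gl _]; rewrite /y (islin_sum gl); apply: eq_bigr => i _; rewrite (islinZ gl).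
have -> : \sum_i l i * e (c1 ** x i ** c2) = e (c1 ** y ** c2) :> R[i].
  rewrite /y cmul_sumr cmul_suml (islin_sum el); apply: eq_bigr => i _.
  by rewrite cmulZr cmulZl (islinZ el).
have gy g : E g -> g y = 0 by move=> Eg; rewrite -ly// hl.
have [g1 gm gv gc] := gr.
(* All two-sided translates of e lie in E and hence vanish at y; [dens] replaces the left translate
   by multiplication with z. *)
have k1 t z : e (z ** rm y (gin t)) = 0.
  by apply: (@dens R G D); split=> // s; exact: (gy _ (E_trans s t Ee)).
have sw z t : z ** rm y (gin t) = rm (z ** y) (gin t).
  by apply: emb_inj; rewrite -rmE !embM -rmE mulrA.
(* Since [dens] concerns left multiplication only, the right factor c2 is handled by passing to the
   adjoint functional. *)
pose e' z : R[i]^o := (e (star z) : R[i])^*.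
have e'b : bdlin e'.
  split=> [k z w|].
    rewrite /e' starD el conj_add -[k^* *: _]/(k^* * e (star z) : R[i]).
    by rewrite conj_mul conj_inv.
  have [_ [L L0 eL]] := eb; exists L => // z.
  by rewrite -[nm _]/(cabs (e (star z))^*%C) cabsC (le_trans (eL _))// nm_star.
have k2 : gann e' (star (c1 ** y)).
  split=> // s; rewrite /e'; have -> : star (gin s (star (c1 ** y))) = rm (c1 ** y) (gin s^-1%g).
    by rewrite /rm gv.
  by rewrite -sw k1 conj_0.
have := dens k2 (star c2); rewrite /e' starM !starK => /(congr1 (fun z : R[i] => z^*)).
by rewrite conj_inv conj_0.
Qed.

Lemma E_pair : exists e c1 c2, E e /\ e (c1 ** c2) != 0.
Proof.
have [_ _ _ [e Ee [x ex]] _] := hE; have [el [L L0 eL]] := E_bdlin Ee.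
apply: contrapT => h; apply: ex.
have e0 : forall x, e x = 0.
  apply: (dense_bdlin_eq (cmul_total CG) (E_bdlin Ee)).
    by split=> [k a b|]; [rewrite scaler0 addr0|exists 0 => // z; rewrite nm0 mul0r].
  move=> _ [a [b ->]]; apply: contrapT => /eqP n0; apply: h; by exists e, a, b.
exact: e0.
Qed.

Lemma slicer_cmul A (g : CG -> R[i]^o) x c (y : A \ox CG) : bdlin g ->
  slicer g (tens x c ** y) = x ** slicer (fun z => g (c ** z)) y.
Proof.
by move=> gb; rewrite -[tens x c ** y]/(emb (tens x c) y) -tensm_emb slicer_tensm.
Qed.

Lemma idealE_ker (X : crossedProducts D) (S : coaction D) (a : S) : idealE E (S := S) a -> jA (cox X S) a = 0.
Proof.
move=> aE; have [jAn jGn cov] := @jcov _ _ _ _ (cox X S); have := cov a.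
set W := mext _ wG; set T := jA _ a => /= covE.
have WW : mstar W * W = 1.
  rewrite /W -(mext_star (tensmhL_nondeg CG jGn)) -(mextM (tensmhL_nondeg CG jGn)).
  by rewrite (proj1 (wG_unitary (D := D))) (mext1 (tensmhL_nondeg CG jGn)).
have dt := @codelta_tilde _ _ _ S a.
pose k := tensmh (jA (cox X S)) (@emb R CG) : S \ox CG -> mult (cox X S \ox CG).
have kn : nondeg k by exact: tensmhL_nondeg.
have [kh kE] := tensmhL (D := D) CG (proj1 jAn).
pose m := mext k (codelta a).
have mE : m = W * tensm T 1 * mstar W by [].
(* Pulled through j_A, this is the slice of the coaction of a by the functional y -> e(c1 y c2 c'),
   which lies in E by [E_bimod]. *)
have step1 e c1 c2 x c' : E e ->
    slicer (fun z => e (c1 ** z)) (m (tens x (c2 ** c') : cox X S \ox CG)) = 0.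
  move=> Ee; have eb := E_bdlin Ee.
  have gb : bdlin (fun z => e (c1 ** z)) by exact: (bdlin_comp (cmulr_bd c1) eb).
  have g'b : bdlin (fun z => e (c1 ** (z ** c'))).
    exact: (bdlin_comp (bdlin_comp (cmull_bd c') (cmulr_bd c1)) eb).
  have [t tE] := tilde_ex c2 dt.
  have -> : tens x (c2 ** c') = tensm 1 (emb c2) (tens x c' : cox X S \ox CG) by rewrite tensmE.
  have mk : m * tensm 1 (emb c2) = k t.
    by rewrite -(mext_emb kn t) -tE (mextM kn) {1}/k (mext_tensmL jAn) (mext1 jAn).
  rewrite -mactM mk.
  have -> : slicer (fun z => e (c1 ** z)) (k t (tens x c')) =
      jA (cox X S) (slicer (fun z => e (c1 ** (z ** c'))) t) x.
    move: (t); apply: (dense_bdlin_eq (tens_total (tensP D S CG))).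
    - exact: (bdlin_comp (evh_bdlin _ kh) (slicer_bd _ gb)).
    - exact: (bdlin_comp (slicer_bd _ g'b) (evh_bdlin x (proj1 jAn))).
    move=> _ [b [c ->]] /=; rewrite /k kE tensmE !slicerE// (islinZ (ismhom_lin (proj1 jAn))).
    by [].
  rewrite -(tslicerE dt g'b (f := fun y => e (c1 ** y ** (c2 ** c'))) _ tE); last first.
    by move=> y; rewrite !cmulA.
  rewrite aE; last exact: (E_bimod c1 (c2 ** c') Ee).
  by rewrite (islin0 (ismhom_lin (proj1 jAn))).
have dC : cspan [set y : cox X S \ox CG | exists x c c', y = tens x (c ** c')] = setT.
  apply: (tens_total2 (tensP D (cox X S) CG) (S1 := setT) _ (cmul_total CG)).
    by rewrite -subTset => x _; apply: cspan_sub.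
  by move=> x _ _ [c [c' ->]]; apply: cspan_sub; exists x, c, c'.
have step2 e c1 xi : E e -> slicer (fun z => e (c1 ** z)) (m xi) = 0.
  move=> Ee; have gb : bdlin (fun z => e (c1 ** z)) by exact: (bdlin_comp (cmulr_bd c1) (E_bdlin Ee)).
  move: xi; apply: (dense_bdlin_eq dC (bdlin_comp (mact_bdlin m) (slicer_bd _ gb))).
    by split=> [l u v|]; [rewrite scaler0 addr0|exists 0 => // z; rewrite nm0 mul0r].
  by move=> _ [x [c [c' ->]]] /=; exact: step1.
have step3 e z xi : E e -> slicer e ((z : cox X S \ox CG) ** m xi) = 0.
  move=> Ee; have eb := E_bdlin Ee; move: z.
  apply: (dense_bdlin_eq (tens_total (tensP D _ _)) (bdlin_comp (cmull_bd _) (slicer_bd _ eb))).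
    by split=> [l u v|]; [rewrite scaler0 addr0|exists 0 => // z; rewrite nm0 mul0r].
  by move=> _ [x [c ->]] /=; rewrite slicer_cmul// step2// cmul0r.
(* The vanishing holds for all factors on both sides of m = W (j_A(a) ⊗ 1) W^*, so z W^* and W xi
   may be inserted, which removes W. *)
have step4 e z xi : E e -> slicer e ((z : cox X S \ox CG) ** tensm T 1 xi) = 0.
  move=> Ee; rewrite -(step3 e (rm z (mstar W)) (W xi) Ee); congr slicer.
  have ee : emb (rm z (mstar W)) * m * W = emb z * tensm T 1.
    by rewrite -rmE mE !mulrA -(mulrA (emb z)) WW mulr1 -!mulrA WW mulr1.
  exact: (esym (congr1 (fun n => mact n xi) ee)).
have [e [c1 [c2 [Ee ne]]]] := E_pair.
apply: mult_ext => x; apply: cmul_nondeg => x'.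
have := step4 e (tens (star x') c1) (tens x c2) Ee.
rewrite tensmE slicer_cmul; last exact: E_bdlin.
rewrite slicerE; last exact: (bdlin_comp (cmulr_bd c1) (E_bdlin Ee)).
rewrite mact1 cmulZr => /(congr1 (fun y => (e (c1 ** c2) : R[i])^-1 *: y)).
by rewrite scalerA mulVf// scale1r scaler0 mult0E cmul0r.
Qed.
End LargeIdeal.

(** * The modular function *)

Section Fubini.
Context {R : realType} {G : lcGroupType} {D : groupData R G}.
Local Notation CZ := (gdZ D).
Local Notation L2 := (gdL D).
Local Notation I := (haar L2).
Implicit Types f g : G -> R[i]^o.

(** The sharp counterpart of [zs_bound]: for q = d^* d the function M^2 q - q^2 is nonnegative,
    hence of the form k^* k, so |q|^2 <= M^2 |q|. *)
Lemma CZ_norm (d : CZ) (M : R) : 0 <= M -> (forall s, cabs (zs s d) <= M) -> nm d <= M.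
Proof.
move=> M0 h; pose q := star d ** d.
have qs s : zs s q = (cabs (zs s d) ^+ 2)%:C%C.
  by rewrite zsM zs_star cabs_sqr mulrC.
have [k kE] : exists k, ((M ^+ 2)%:C%C *: q - q ** q) = star k ** k.
  apply: zs_sqrt => s; rewrite (islinB (zs_lin s)) (islinZ (zs_lin s)) zsM qs.
  rewrite -[_ *: _]/(_ * _ : R[i]) -!rmorphM -rmorphB lecR -mulrBl mulr_ge0 ?sqr_ge0//.
  by rewrite subr_ge0 ler_pXn2r ?nnegrE ?cabs_ge0.
have qq : star q = q by rewrite /q starM starK.
have h1 : pos1 (emb (q ** q)).
  by rewrite -{1}qq embM emb_star; exact: pos1_starmul.
have h2 : pos1 (emb ((M ^+ 2)%:C%C *: q) - emb (q ** q)).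
  by rewrite -(islinB (@emb_lin R CZ)) kE embM emb_star; exact: pos1_starmul.
have := pos1_mono h1 h2; rewrite !nm_emb nmZ cabs_real ger0_norm ?sqr_ge0//.
rewrite -{1}qq nm_starmul => h3.
have h4 : nm q <= M ^+ 2.
  have [->|qn] := eqVneq (nm q) 0; first exact: sqr_ge0.
  have q0 : 0 < nm q by rewrite lt_neqAle eq_sym qn nm_ge0.
  by rewrite -(ler_pM2r q0) -expr2.
by rewrite -(@ler_pXn2r _ 2) ?nnegrE ?nm_ge0// -nm_starmul.
Qed.

(** The sections of F form a norm continuous function of s with values in C_0(G). Its vector
    integral v gives the inner integrals by evaluation, and applying to it the functional d -> I(b1
    d) gives both iterated integrals. That v lies in C_0(G) also provides their continuity. *)
Lemma fubini_v (F : G * G -> R[i]^o) (K1 K2 : set G) : continuous F -> compact K1 -> compact K2 ->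
  (forall t s, F (t, s) != 0 -> K1 t /\ K2 s) ->
  (exists v : CZ, forall t, zs t v = I (fun s => F (t, s))) /\
  I (fun t => I (fun s => F (t, s))) = I (fun s => I (fun t => F (t, s))).
Proof.
move=> Fc cK1 cK2 F0.
have sl1 s : continuous (fun t => F (t, s)).
  move=> t; apply: (@continuous_comp _ _ _ (fun t => (t, s)) F); last exact: Fc.
  by apply: cvg_pair; [exact: cvg_id|exact: cvg_cst].
have sl2 t : continuous (fun s => F (t, s)).
  move=> s; apply: (@continuous_comp _ _ _ (fun s => (t, s)) F); last exact: Fc.
  by apply: cvg_pair; [exact: cvg_cst|exact: cvg_id].
have [//|b1 b1T [_ b11]] := @plateau R G K1 setT cK1 openT.
have [//|b2 b2T [_ b21]] := @plateau R G K2 setT cK2 openT.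
have [h hE] : exists h : G -> CZ, forall s t, zs t (h s) = F (t, s).
  have [|h hE] := choice (P := fun s (d : CZ) => forall t, zs t d = F (t, s)); last by exists h.
  move=> s; apply: zex; apply: CcC0; split => //; exists K1 => // t nK.
  by apply/eqP; apply: contrapT => /negP /F0[].
have hc : continuous h.
  apply/cts_nm => s e e0; have e2 : 0 < e / 2 by rewrite divr_gt0.
  have e4 : 0 < e / 4 by rewrite divr_gt0.
  have FF : Filter (nbhs s) by exact: nbhs_filter.
  have := iffLR (compact_near_coveringP _) cK1 _ (nbhs s) (fun s' t => nm (F (t, s') - F (t, s)) < e / 2) FF.
  have nr : forall t, K1 t -> \forall t' \near t & s' \near nbhs s, nm (F (t', s') - F (t', s)) < e / 2.
    move=> t _.
    have hp : nbhs (t, s) [set p | nm (F (t, s) - F p) < e / 4] by exact: (iffLR (cts_nm _) Fc).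
    case: hp => -[U V] /= [Ut Vs] UV; exists (U, V); first by [].
    move=> [t' s'] /= [Ut' Vs'].
    have h1 := UV (t', s') (conj Ut' Vs'); have h2 := UV (t', s) (conj Ut' (nbhs_singleton Vs)).
    have := nm_tri (F (t, s)) (F (t', s')) (F (t', s)); rewrite /= in h1 h2.
    have h3 := nmBC (F (t, s)) (F (t', s')).
    have h4 : nm (F (t', s') - F (t', s)) <= nm (F (t, s) - F (t', s')) + nm (F (t, s) - F (t', s)).
      rewrite h3 (_ : _ - F (t', s) = (F (t', s') - F (t, s)) + (F (t, s) - F (t', s))); first exact: nmD.
      by zmod.
    by lra.
  move=> /(_ nr); apply: filterS => s' hs'.
  apply: (@le_lt_trans _ _ (e / 2)); last by lra.
  apply: CZ_norm => [|t]; first exact: ltW.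
  rewrite (islinB (zs_lin t)) !hE -[cabs _]/(nm (F (t, s) - F (t, s'))) nmBC.
  have [Kt|nK] := pselect (K1 t); first by exact: (ltW (hs' t Kt)).
  have z s0 : F (t, s0) = 0 by apply/eqP; apply: contrapT => /negP /F0[].
  by rewrite !z subrr nm0 ltW.
have [v vE] := vint_ex (D := D) b2T hc.
pose om (d : CZ) : R[i]^o := I (fun t => cr b1 t * zs t d).
have zc (d : CZ) : continuous (fun t => zs t d) by case: (zs_C0 d).
have omb : bdlin om.
  split=> [k d d'|].
    rewrite /om -haar_lin; [|exact: (CcM (csupp_Cc b1T) (zc d))|exact: (CcM (csupp_Cc b1T) (zc d'))].
    apply: haar_ext => s; rewrite (zs_lin s) -![_ *: (_ : R[i]^o)]/(_ * _ : R[i]); ring.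
  exists (4 * rI (D := D) b1); first by rewrite mulr_ge0// (rI_ge0 b1T).
  move=> d; apply: le_trans (haar_bound (M := 2 * nm d) b1T (zc d) _) _.
    by move=> s _; exact: zs_bound.
  by rewrite le_eqVlt; apply/orP; left; apply/eqP; ring.
have b1F t s : cr b1 t * F (t, s) = F (t, s) :> R[i].
  have [->|/F0[Kt _]] := eqVneq (F (t, s)) 0; first by rewrite mulr0.
  by rewrite /cr b11// mul1r.
have b2F t s : cr b2 s * F (t, s) = F (t, s) :> R[i].
  have [->|/F0[_ Ks]] := eqVneq (F (t, s)) 0; first by rewrite mulr0.
  by rewrite /cr b21// mul1r.
have vt t : zs t v = I (fun s => F (t, s)).
  by rewrite (vE _ (zs_bd t)); apply: haar_ext => s; rewrite hE b2F.
have o1 : om v = I (fun t => I (fun s => F (t, s))).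
  apply: haar_ext => t; rewrite vt.
  have [Kt|nK] := pselect (K1 t); first by rewrite /cr b11// mul1r.
  rewrite (_ : I _ = 0) ?mulr0// -(haar0 (D := D)); apply: haar_ext => s.
  by apply/eqP; apply: contrapT => /negP /F0[].
split; first by exists v.
rewrite -o1 (vE _ omb); apply: haar_ext => s.
rewrite /om; have [Ks|nK] := pselect (K2 s).
  by rewrite /cr (b21 s)// mul1r; apply: haar_ext => t; rewrite hE b1F.
have z t : F (t, s) = 0 by apply/eqP; apply: contrapT => /negP /F0[].
rewrite (_ : I (fun t => F (t, s)) = 0); last by rewrite -(haar0 (D := D)); apply: haar_ext.
rewrite (_ : I _ = 0) ?mulr0// -(haar0 (D := D)); apply: haar_ext => t.
by rewrite hE z mulr0.
Qed.

Local Notation Del := (modular L2).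

Lemma mod_gt0 s : 0 < Del s.
Proof. by case: (@haarP _ _ L2) => _ _ _ _ /(_ s)[]. Qed.
Lemma mod_haar f s : Cc f -> I (fun t => f (t * s)%g) = ((Del s)^-1)%:C%C * I f :> R[i].
Proof. by case: (@haarP _ _ L2) => _ _ _ _ /(_ s)[_]; apply. Qed.

Lemma ex_unit (V : set G) : nbhs (1%g : G) V -> exists b, csupp V b /\ I (cr b) = 1.
Proof.
move=> V1; have [b0 b0V b01] := bump_fun (R := R) V1; have rp := haar_pos (D := D) b0V b01.
exists (fun s => (rI (D := D) b0)^-1 * b0 s); split.
  have [bc bp [K cK [KV K0]]] := b0V; split=> [s|s|].
  - by apply: cvgM; [exact: cvg_cst|exact: bc].
  - by rewrite mulr_ge0// invr_ge0 ltW.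
  - by exists K => //; split=> // s /K0 h; rewrite h mulr0.
rewrite (_ : I _ = ((rI (D := D) b0)^-1)%:C%C *: I (cr b0)).
  by rewrite (haar_cr b0V) -[_ *: _]/(_ * _ : R[i]) -rmorphM /= mulVf// gt_eqF.
rewrite -haarZ; last exact: (csupp_Cc b0V).
by apply: haar_ext => s; rewrite /cr rmorphM.
Qed.

Lemma modM t s : Del (t * s)%g = Del t * Del s.
Proof.
have [b [bT b1]] := ex_unit filterT; have bC := csupp_Cc bT.
have h1 := mod_haar (t * s)%g bC; have h2 := mod_haar t (Cc_rtrans s bC); have h3 := mod_haar s bC.
rewrite b1 mulr1 in h3; rewrite h3 in h2; rewrite b1 mulr1 in h1.
have e : ((Del (t * s)%g)^-1)%:C%C = ((Del t)^-1 * (Del s)^-1)%:C%C :> R[i].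
  rewrite -h1; apply: etrans (_ : ((Del t)^-1)%:C%C * ((Del s)^-1)%:C%C = _); last by rewrite -rmorphM.
  by rewrite -h2; apply: haar_ext => u; rewrite mulgA.
by apply: invr_inj; rewrite invfM; exact: (complexI e).
Qed.

Lemma mod1 : Del 1%g = 1.
Proof.
have := modM 1 1; rewrite mulg1 => h; have p := mod_gt0 1%g.
by apply: (mulfI (lt0r_neq0 p)); rewrite -h mulr1.
Qed.

Lemma modV s : Del s^-1%g = (Del s)^-1.
Proof.
have p := mod_gt0 s; have e : Del s * Del s^-1%g = 1 by rewrite -modM mulgV mod1.
by apply: (mulfI (lt0r_neq0 p)); rewrite e divff// lt0r_neq0.
Qed.

Lemma mulV_compact (K1 K2 : set G) : compact K1 -> compact K2 ->
  compact [set x | exists s t, [/\ K1 s, K2 t & x = (s * t^-1)%g]].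
Proof.
move=> c1 c2; have c := compact_setX c1 c2.
have fc : continuous (fun p : G * G => (p.1 * p.2^-1)%g).
  move=> p; apply: (@continuous_comp _ _ _ (fun p : G * G => (p.1, p.2^-1)%g) (fun p : G * G => (p.1 * p.2)%g)).
    apply: cvg_pair; first exact: cvg_fst.
    by apply: (@continuous_comp _ _ _ snd (fun x : G => x^-1)%g); [exact: cvg_snd|exact: invg_cts].
  exact: mulg_cts.
rewrite (_ : [set x | _] = (fun p : G * G => (p.1 * p.2^-1)%g) @` (K1 `*` K2)).
  by apply: continuous_compact => //; exact: continuous_subspaceT.
apply/seteqP; split=> [x [s [t [? ? ->]]]|x [[s t] /= [? ?] <-]]; first by exists (s, t).
by exists s, t.
Qed.

Lemma mul2_cts (f : G -> R[i]^o) (r : G * G -> G) : continuous f -> continuous r -> continuous (fun p => f (r p)).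
Proof. by move=> fc rc p; apply: (@continuous_comp _ _ _ r f); [exact: rc|exact: fc]. Qed.
Lemma fst_cts : continuous (fun p : G * G => p.1). Proof. by move=> p; exact: cvg_fst. Qed.
Lemma snd_cts : continuous (fun p : G * G => p.2). Proof. by move=> p; exact: cvg_snd. Qed.
Lemma mulp_cts (a b : G * G -> G) : continuous a -> continuous b -> continuous (fun p => (a p * b p)%g).
Proof.
move=> ac bc p; apply: (@continuous_comp _ _ _ (fun p => (a p, b p)) (fun q : G * G => (q.1 * q.2)%g)).
  by apply: cvg_pair; [exact: ac|exact: bc].
exact: mulg_cts.
Qed.
Lemma invp_cts (a : G * G -> G) : continuous a -> continuous (fun p => (a p)^-1)%g.
Proof. by move=> ac p; apply: (@continuous_comp _ _ _ a (fun x : G => x^-1)%g); [exact: ac|exact: invg_cts]. Qed.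
Lemma ctsM2 (f g : G * G -> R[i]^o) : continuous f -> continuous g -> continuous (fun p => f p * g p : R[i]^o).
Proof. by move=> fc gc p; apply: (@cvgM R[i] _ (nbhs p)); [exact: fc|exact: gc]. Qed.

(** The integral of b(s t) c(t) over s is c(t) divided by the modular function, and it is continuous
    in t by [fubini_v]; c is nonzero near the point in question. *)
Lemma mod_cts : continuous (fun s => ((Del s)%:C%C : R[i]^o)).
Proof.
have [b [bT b1]] := ex_unit filterT; have bC := csupp_Cc bT.
have ci : continuous (fun s => (((Del s)^-1)%:C%C : R[i]^o)).
  move=> s0; have [c cT c1] := bump_fun (R := R) (filterT : nbhs s0 setT); have cC := csupp_Cc cT.
  have [bc [Kb cKb Kb0]] := bC; have [cc [Kc cKc Kc0]] := cC.
  pose F (p : G * G) : R[i]^o := cr b (p.2 * p.1)%g * cr c p.1.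
  have Fc : continuous F.
    by apply: ctsM2; [apply: (mul2_cts bc (mulp_cts snd_cts fst_cts))|apply: (mul2_cts cc fst_cts)].
  have [//|[v vE] _] := fubini_v Fc cKc (mulV_compact cKb cKc).
    move=> t s; rewrite /F /= mulf_eq0 negb_or => /andP[h1 h2].
    have Kt : Kc t by apply: contrapT => /Kc0 e; rewrite /cr e eqxx in h2.
    have Kst : Kb (s * t)%g by apply: contrapT => /Kb0 e; rewrite /cr e eqxx in h1.
    by split => //; exists (s * t)%g, t; split => //; rewrite mulgK.
  have e t : zs t v = ((Del t)^-1)%:C%C * cr c t.
    rewrite vE; apply: etrans (_ : cr c t * I (fun s => cr b (s * t)%g) = _).
      by rewrite -[_ * I _]/(_ *: (I _ : R[i]^o)) -haarZ; [apply: haar_ext => s; rewrite /F/= mulrC|exact: Cc_rtrans].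
    by rewrite (mod_haar t bC) b1 mulr1 mulrC.
  have vc : continuous (fun t => zs t v) by case: (zs_C0 v).
  have c0 : cr c s0 != 0 :> R[i] by rewrite /cr c1 oner_eq0.
  have q : (fun t => zs t v / cr c t : R[i]^o) @ s0 --> (zs s0 v / cr c s0 : R[i]^o).
    by apply: cvgM; [exact: vc|apply: cvgV => //; exact: cc].
  have e0 : zs s0 v / cr c s0 = ((Del s0)^-1)%:C%C by rewrite e mulfK.
  rewrite e0 in q; apply: cvg_trans q; apply: near_eq_cvg.
  have hb : nbhs s0 [set t | 2^-1 <= c t] by apply: half_near => //; case: cT.
  near=> t.
  rewrite e mulfK// /cr.
  have : 2^-1 <= c t by near: t; exact: hb.
  by move=> h; rewrite -(rmorph0 (real_complex R)) (inj_eq (@complexI R)) gt_eqF// (lt_le_trans _ h)// invr_gt0.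
apply: (@cts_ext R G R[i]^o (fun s => ((Del s^-1%g)^-1)%:C%C)) => [s|s]; last by rewrite modV invrK.
exact: (@continuous_comp G G R[i]^o (fun s : G => s^-1%g) (fun s => ((Del s)^-1)%:C%C) s (@invg_cts G s) (ci _)).
Unshelve. all: by end_near. Qed.

(** Both orders of integration of b(s) g(t^-1 s), where b has integral 1, compare the integral of
    g(t^-1) with that of g divided by the modular function. *)
Lemma haar_V f : Cc f -> I (fun t => f t^-1%g * ((Del t)^-1)%:C%C) = I f.
Proof.
move=> fC.
have main g : Cc g -> I (fun t => g t^-1%g) = I (fun t => g t * ((Del t)^-1)%:C%C).
  move=> gC; have [b [bT b1]] := ex_unit filterT; have bC := csupp_Cc bT.
  have [bc [Kb cKb Kb0]] := bC; have [gc [Kg cKg Kg0]] := gC.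
  pose F1 (p : G * G) : R[i]^o := cr b p.2 * g (p.1^-1 * p.2)%g.
  have F1c : continuous F1.
    apply: ctsM2; [apply: (mul2_cts bc snd_cts)|].
    by apply: (mul2_cts gc); apply: mulp_cts; [exact: (invp_cts fst_cts)|exact: snd_cts].
  pose F2 (p : G * G) : R[i]^o := cr b (p.1 * p.2)%g * g p.2.
  have F2c : continuous F2.
    by apply: ctsM2; [apply: (mul2_cts bc (mulp_cts fst_cts snd_cts))|apply: (mul2_cts gc snd_cts)].
  have [|_ f1] := fubini_v F1c (mulV_compact cKb cKg) cKb.
    move=> t s; rewrite /F1 /= mulf_eq0 negb_or => /andP[h1 h2].
    have Ks : Kb s by apply: contrapT => /Kb0 e; rewrite /cr e eqxx in h1.
    have Kt : Kg (t^-1 * s)%g by apply: contrapT => /Kg0 e; rewrite e eqxx in h2.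
    by split => //; exists s, (t^-1 * s)%g; split => //; rewrite invgM invgK mulgA mulgV mul1g.
  have [|_ f2] := fubini_v F2c (mulV_compact cKb cKg) cKg.
    move=> t s; rewrite /F2 /= mulf_eq0 negb_or => /andP[h1 h2].
    have Ks : Kg s by apply: contrapT => /Kg0 e; rewrite e eqxx in h2.
    have Kt : Kb (t * s)%g by apply: contrapT => /Kb0 e; rewrite /cr e eqxx in h1.
    by split => //; exists (t * s)%g, s; split => //; rewrite mulgK.
  have gV : Cc (fun t => g t^-1%g) by apply: (Cc_comp (r := fun t : G => t^-1%g) (r' := fun t : G => t^-1%g) (@invg_cts G) (@invg_cts G) (@invgK _) (@invgK _) gC).
  have e1 : I (fun s => I (fun t => F1 (t, s))) = I (fun t => g t^-1%g).
    transitivity (I (fun s => I (fun t => g t^-1%g) *: cr b s)); last first.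
      by rewrite haarZ// b1 -[_ *: _]/(_ * _ : R[i]) mulr1.
    apply: haar_ext => s; rewrite [RHS]mulrC -[RHS]/(cr b s *: I _) -(haar_inv s^-1%g gV) -haarZ.
      by apply: haar_ext => t; rewrite /F1 /= invgM invgK.
    exact: Cc_ltrans gV.
  have e2 : I (fun t => I (fun s => F1 (t, s))) = I (fun t => I (fun s => F2 (t, s))).
    apply: haar_ext => t; rewrite -(haar_inv t (f := fun s => F1 (t, s))).
      by apply: haar_ext => s; rewrite /F1 /F2 /= mulKg.
    have [gtc _] := Cc_ltrans t^-1%g gC; exact: (CcM bC gtc).
  rewrite -e1 -f1 e2 f2; apply: haar_ext => s.
  transitivity (g s *: I (fun t => cr b (t * s)%g)).
    by rewrite -haarZ; [apply: haar_ext => t; rewrite /F2/= mulrC|exact: Cc_rtrans].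
  by rewrite (mod_haar s bC) b1 mulr1.
have dC : Cc (fun t => f t * (Del t)%:C%C) by apply: (CcM fC); exact: mod_cts.
transitivity (I (fun t => f t^-1%g * (Del t^-1%g)%:C%C)).
  by apply: haar_ext => t; rewrite modV.
rewrite (main _ dC); apply: haar_ext => t; rewrite -mulrA -rmorphM /= divff ?mulr1//.
by rewrite gt_eqF// mod_gt0.
Qed.
End Fubini.

(** * Representations on L^2(G) *)

Section Hilb.
Context {R : realType} {H : hilbert R} {K : compactAlg H}.
Implicit Types (x y z : H) (k l : K).

Lemma hdotZl c x y : hdot (c *: x) y = c * hdot x y.
Proof. exact: (islinZ (hdot_lin y)). Qed.
Lemma hdotDl x x' y : hdot (x + x') y = hdot x y + hdot x' y.
Proof. exact: (islinD (hdot_lin y)). Qed.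
Lemma hdotBl x x' y : hdot (x - x') y = hdot x y - hdot x' y.
Proof. exact: (islinB (hdot_lin y)). Qed.
Lemma hdotZr c x y : hdot x (c *: y) = c^* * hdot x y.
Proof. by rewrite hdotC hdotZl conj_mul -hdotC. Qed.
Lemma hdotBr x y y' : hdot x (y - y') = hdot x y - hdot x y'.
Proof. by rewrite hdotC hdotBl rmorphB /= -!hdotC. Qed.

Lemma hdot_nm x : hdot x x = (nm x ^+ 2)%:C%C.
Proof. by rewrite -hdot_norm nmE rmorphXn. Qed.

Lemma hdot_CS x y : cabs (hdot x y) <= nm x * nm y.
Proof.
have [->|y0] := eqVneq y 0.
  by rewrite nm0 mulr0 -[0 : H](scale0r (0 : H)) hdotZr rmorph0 mul0r cabs0.
have n0 : 0 < nm y by rewrite lt_neqAle nm_ge0 andbT eq_sym; apply: contra_neq y0; exact: nm_eq0.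
have n2 : 0 < nm y ^+ 2 by rewrite exprn_gt0.
pose c := hdot x y / (nm y ^+ 2)%:C%C.
have cn : c * (nm y ^+ 2)%:C%C = hdot x y.
  by rewrite /c mulfVK// -(rmorph0 (real_complex R)) (inj_eq (@complexI R)) gt_eqF.
have e : hdot (x - c *: y) (x - c *: y) = (nm x ^+ 2)%:C%C - (cabs c ^+ 2 * nm y ^+ 2)%:C%C.
  rewrite hdotBl !hdotBr !hdotZl !hdotZr !hdot_nm (hdotC x y) -cn.
  have -> : (c * (nm y ^+ 2)%:C%C)^* = c^* * (nm y ^+ 2)%:C%C by rewrite conj_mul; congr (_ * _); exact: conjc_real.
  have -> : (cabs c ^+ 2 * nm y ^+ 2)%:C%C = c * c^* * (nm y ^+ 2)%:C%C by rewrite rmorphM /= cabs_sqr.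
  ring.
have : nm (x - c *: y) ^+ 2 = nm x ^+ 2 - cabs c ^+ 2 * nm y ^+ 2.
  by apply: (@complexI R); rewrite -hdot_nm e rmorphB.
move=> h; have h2 : (cabs c * nm y) ^+ 2 <= nm x ^+ 2.
  by rewrite exprMn -subr_ge0 -h sqr_ge0.
rewrite ler_pXn2r ?nnegrE ?mulr_ge0 ?cabs_ge0 ?nm_ge0// in h2.
rewrite -cn cabsM cabs_real ger0_norm ?sqr_ge0// expr2 mulrA ler_wpM2r ?nm_ge0//.
Qed.

Lemma hdot_bdl y : bdlin (fun x => hdot x y : R[i]^o).
Proof.
split; first exact: hdot_lin.
by exists (nm y); rewrite ?nm_ge0// => x; rewrite [nm _]/(cabs _) mulrC hdot_CS.
Qed.

Lemma hdot_eq x x' : (forall y, hdot x y = hdot x' y) -> x = x'.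
Proof.
move=> h; apply/eqP; rewrite -subr_eq0; apply/eqP; apply: nm_eq0; apply/eqP.
rewrite -sqrf_eq0; apply/eqP; apply: (@complexI R); rewrite -hdot_nm hdotBl !hdotBr !h.
by rewrite subrr.
Qed.

Lemma kact_ext k l : (forall x, kact k x = kact l x) -> k = l.
Proof. by move=> h; apply: kact_inj; apply/funext. Qed.

Definition th x y : K := projT1 (cid (@kact_rank1 _ _ K x y)).
Lemma thE x y z : kact (th x y) z = hdot z y *: x.
Proof. by rewrite /th; case: cid. Qed.

Lemma th_linl y : islin (fun x => th x y).
Proof. by move=> c x x'; apply: kact_ext => z; rewrite kact_linl !thE scalerDr !scalerA mulrC. Qed.

Lemma th_star x y : star (th x y) = th y x.
Proof.
apply: kact_ext => z; apply: hdot_eq => w; rewrite kact_star starK !thE hdotZr hdotZl.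
by rewrite -hdotC mulrC.
Qed.

Lemma nm_th x y : nm (th x y) <= nm x * nm y.
Proof.
have e u v : nm (th u v) ^+ 2 = nm u ^+ 2 * nm (th v v).
  rewrite -nm_starmul th_star (_ : _ ** _ = (nm u ^+ 2)%:C%C *: th v v).
    by rewrite nmZ cabs_real ger0_norm// sqr_ge0.
  apply: kact_ext => z; rewrite kactM !thE (islinZ (f := fun k => kact k z)); last exact: kact_linl.
  by rewrite hdotZl thE hdot_nm scalerA mulrC.
have h v : nm (th v v) <= nm v ^+ 2.
  have [->|n0] := eqVneq (nm (th v v)) 0; first exact: sqr_ge0.
  have p : 0 < nm (th v v) by rewrite lt_neqAle eq_sym n0 nm_ge0.
  by rewrite -(ler_pM2r p) -expr2 e.
rewrite -(@ler_pXn2r _ 2) ?nnegrE ?mulr_ge0 ?nm_ge0// e exprMn.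
by rewrite ler_wpM2l ?sqr_ge0.
Qed.

(** The bound of a positive functional under left multiplication, applied to l -> <l x, x> at the
    rank one projection onto x. *)
Lemma kact_nm k x : nm (kact k x) <= nm k * nm x.
Proof.
have [->|x0] := eqVneq x 0; first by rewrite (islin0 (@kact_linr _ _ K k)) nm0 mulr_ge0 ?nm_ge0.
have n0 : 0 < nm x by rewrite lt_neqAle nm_ge0 andbT eq_sym; apply: contra_neq x0; exact: nm_eq0.
pose f (l : K) : R[i]^o := hdot (kact l x) x.
have fpos : posfun f.
  split=> [c a b|a].
    by rewrite /f kact_linl hdotDl hdotZl.
  by rewrite /f kactM kact_star starK hdot_nm lecR sqr_ge0.
have pE a : psq f a = nm (kact a x) ^+ 2.
  by rewrite /psq /f kactM kact_star starK hdot_nm.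
pose a := ((nm x ^+ 2)^-1)%:C%C *: th x x.
have aE : kact a x = x.
  rewrite /a (islinZ (f := fun k => kact k x)) ?thE; last exact: kact_linl.
  by rewrite hdot_nm scalerA -rmorphM /= mulVf ?scale1r// gt_eqF// exprn_gt0.
have := psq_bound fpos (emb k) a; rewrite !pE nm_emb -[emb k a]/(k ** a) kactM aE -exprMn.
by rewrite ler_pXn2r ?nnegrE ?mulr_ge0 ?nm_ge0.
Qed.

Lemma kact_bdl x : bdlin (fun k => kact k x).
Proof.
split; first by move=> c a b; rewrite kact_linl.
by exists (nm x); rewrite ?nm_ge0// => k; rewrite mulrC kact_nm.
Qed.

Lemma th_total : cspan [set k : K | exists x y, k = th x y] = setT.
Proof.
apply: (cspan_total (@kact_dense _ _ K)) => k [x [y kE]]; apply: cspan_sub; exists x, y.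
by apply: kact_ext => z; rewrite kE thE.
Qed.

Definition impl (m : mult K) (v : H -> H) := forall k x, kact (m k) x = v (kact k x).

Lemma impl_uniq m n v : impl m v -> impl n v -> m = n.
Proof. by move=> h h'; apply: mult_ext => k; apply: kact_ext => x; rewrite h h'. Qed.

Lemma impl_fun m v w : impl m v -> impl m w -> v =1 w.
Proof.
move=> h h' x; have [->|x0] := eqVneq x 0.
  have e (u : H -> H) : impl m u -> u 0 = 0.
    move=> hu; have := hu 0 0; rewrite (islin0 (mult_lin m)).
    by rewrite !(islin0 (f := fun k => kact k 0))//; exact: kact_linl.
  by rewrite (e v h) (e w h').
have n0 : 0 < nm x by rewrite lt_neqAle nm_ge0 andbT eq_sym; apply: contra_neq x0; exact: nm_eq0.
have := h (th x x) (((nm x ^+ 2)^-1)%:C%C *: x); rewrite h' thE hdotZl hdot_nm -rmorphM /= mulVf ?scale1r//.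
by rewrite gt_eqF// exprn_gt0.
Qed.

(** Left multiplication by an isometry v is defined on combinations of rank one operators and does
    not change a^* a, so it extends to K(H); v' provides the adjoint. *)
Lemma impl_ex (v v' : H -> H) : bdlin v -> bdlin v' ->
  (forall x y, hdot (v x) (v y) = hdot x y) -> (forall x y, hdot (v' x) (v' y) = hdot x y) ->
  (forall x y, hdot (v x) y = hdot x (v' y)) -> exists m, impl m v.
Proof.
have ex (w : H -> H) : bdlin w -> (forall x y, hdot (w x) (w y) = hdot x y) ->
    exists f : K -> K, forall k x, kact (f k) x = w (kact k x).
  move=> wb wi; have wl : islin w by case: wb.
  have Kl x : islin (fun k : K => kact k x) by move=> c a b; rewrite kact_linl.
  have [||s|f [fl fb fE]] := @ext_total R K K (H * H)%type (fun p => th p.1 p.2) (fun p => th (w p.1) p.2)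
    [set k : K | exists x y, k = th x y] 1 ler01.
  - by move=> k; split=> [[x [y ->]]|[[x y] ->]]; [exists (x, y)|exists x, y].
  - exact: th_total.
  - rewrite mul1r; set a := \sum_(p <- s) _; set b := \sum_(p <- s) _.
    have ab x : kact a x = w (kact b x).
      rewrite (islin_sum (Kl x)) (islin_sum (Kl x)) (islin_sum wl); apply: eq_bigr => p _.
      by rewrite !(islinZ (Kl x)) (islinZ wl) !thE (islinZ wl).
    rewrite -(@ler_pXn2r _ 2) ?nnegrE ?nm_ge0// -!nm_starmul (_ : star a ** a = star b ** b)//.
    apply: kact_ext => x; apply: hdot_eq => y; rewrite !kactM [LHS]kact_star [RHS]kact_star !starK.
    by rewrite !ab wi.
  exists f => k x; move: k; apply: (dense_bdlin_eq th_total).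
  - by apply: (bdlin_comp (g := fun k => kact k x)) (kact_bdl x); split => //; exists 1.
  - exact: (bdlin_comp (kact_bdl x) wb).
  - by move=> _ [y [z ->]]; rewrite (fE (y, z)) !thE (islinZ wl).
move=> vb v'b vi v'i vv'; have [f fE] := ex v vb vi; have [f' f'E] := ex v' v'b v'i.
have ad a b : star (f a) ** b = star a ** f' b.
  apply: kact_ext => x; apply: hdot_eq => y; rewrite !kactM [LHS]kact_star [RHS]kact_star !starK fE f'E.
  by rewrite hdotC vv' -hdotC.
by exists (Mult ad).
Qed.
End Hilb.

Section L2ops.
Context {R : realType} {G : lcGroupType} {D : groupData R G}.
Local Notation CZ := (gdZ D).
Local Notation L2 := (gdL D).
Local Notation K := (gdK D).
Local Notation I := (haar L2).
Implicit Types f g : G -> R[i]^o.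
Implicit Types u w : (G -> R[i]^o) -> G -> R[i]^o.

Definition ip f g : R[i] := I (fun s => f s * (g s : R[i])^*).

Lemma ip_dot f g : Cc f -> Cc g -> hdot (l2in f : L2) (l2in g) = ip f g.
Proof. exact: l2in_dot. Qed.

Lemma l2_total : cspan [set x : L2 | exists f, Cc f /\ x = l2in f] = setT.
Proof.
rewrite -subTset => x _; apply: cspan_eps => e e0.
have : (setT : set L2) x by [].
rewrite -(@l2in_dense _ _ L2) => /closure_nmP/(_ e e0)[_ [f fC <-] xf].
by exists (l2in f) => //; apply: cspan_sub; exists f.
Qed.

Lemma l2in0 : l2in (fun=> 0) = 0 :> L2.
Proof.
have h := @l2in_lin _ _ L2 (-1) _ _ (@Cc0 R G) (@Cc0 R G).
rewrite [RHS](_ : 0 = -1 *: l2in (fun=> 0) + l2in (fun=> 0) :> L2); last by rewrite scaleN1r addNr.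
by rewrite -h; congr l2in; apply/funext => s; rewrite scaler0 addr0.
Qed.

(** Operators on L^2(G) are recorded by what they do to functions in C_c(G). By density this
    determines them, so operator identities become identities of functions. *)
Definition cimpl (m : mult K) u := (forall f, Cc f -> Cc (u f)) /\
  exists v : L2 -> L2, [/\ bdlin v, impl m v & forall f, Cc f -> v (l2in f) = l2in (u f)].

Lemma cimpl_uniq m n u w : cimpl m u -> cimpl n w -> (forall f, Cc f -> u f = w f) -> m = n.
Proof.
move=> [_ [v [vb mv vE]]] [_ [v' [v'b nv v'E]]] e; apply: (impl_uniq mv).
suff -> : v = v' by [].
apply/funext => x; apply: (dense_bdlin_eq l2_total vb v'b) => _ [f [fC ->]].
by rewrite vE// v'E// e.
Qed.

Lemma cimpl_op m u : cimpl m u -> opmult (l2op u) = m.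
Proof.
move=> [uC [v [vb mv vE]]]; have h : l2op u = v.
  have ex : exists v : L2 -> L2, [/\ islin v, continuous v & forall f, Cc f -> v (l2in f) = l2in (u f)].
    by exists v; split => //; [case: vb|exact: bdlin_cont].
  have [wl wc wE] := @the_spec _ (fun=> 0 : L2) _ ex.
  apply/funext => x; apply: (dense_bdlin_eq l2_total _ vb) => [|_ [f [fC ->]]].
    exact: (iffLR (bdlinP wl)).
  by rewrite /l2op wE// vE.
rewrite h; apply: (impl_uniq (v := v)) => //.
exact: (@the_spec _ (mone K) (fun m => forall (k : K) x, kact (m k) x = v (kact k x)) (ex_intro _ m mv)).
Qed.

Lemma cimplM m n u w : cimpl m u -> cimpl n w -> cimpl (m * n) (fun f => u (w f)).
Proof.
move=> [uC [v [vb mv vE]]] [wC [v' [v'b nv v'E]]]; split=> [f fC|]; first exact/uC/wC.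
exists (fun x => v (v' x)); split=> [|k x|f fC]; first exact: bdlin_comp v'b vb.
  by rewrite mactM mv nv.
by rewrite v'E// vE//; exact: wC.
Qed.

Lemma cimpl1 : cimpl 1 id.
Proof. by split => //; exists id; split=> //; exact: id_bdlin. Qed.

Lemma bdlin_lin (V W : normedModType R[i]) c (a b : V -> W) : bdlin a -> bdlin b -> bdlin (fun x => c *: a x + b x).
Proof.
move=> [al [A A0 aA]] [bl [B B0 bB]]; split=> [d x y|].
  by rewrite al bl !scalerDr !scalerA [c * d]mulrC !addrA; congr (_ + _); rewrite -!addrA; congr (_ + _); rewrite addrC.
exists (cabs c * A + B); first by rewrite addr_ge0// mulr_ge0// cabs_ge0.
move=> x; rewrite (le_trans (nmD _ _))// nmZ mulrDl lerD// -mulrA ler_wpM2l ?cabs_ge0//.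
Qed.

Lemma cimpl_lin c m n u w : cimpl m u -> cimpl n w -> cimpl (c *: m + n) (fun f s => c *: u f s + w f s).
Proof.
move=> [uC [v [vb mv vE]]] [wC [v' [v'b nv v'E]]]; split=> [f fC|].
  by apply: Cc_lin; [exact: uC|exact: wC].
exists (fun x => c *: v x + v' x); split=> [|k x|f fC]; first exact: bdlin_lin.
  by rewrite -mv -nv -kact_linl.
by rewrite vE// v'E// -l2in_lin//; [exact: uC|exact: wC].
Qed.

Lemma hdot_total (v v' : L2 -> L2) u u' : bdlin v -> bdlin v' ->
  (forall f, Cc f -> v (l2in f) = l2in (u f)) -> (forall f, Cc f -> v' (l2in f) = l2in (u' f)) ->
  (forall f, Cc f -> Cc (u f)) -> (forall f, Cc f -> Cc (u' f)) ->
  (forall f g, Cc f -> Cc g -> ip (u f) g = ip f (u' g)) ->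
  forall x y, hdot (v x) y = hdot x (v' y).
Proof.
move=> vb v'b vE v'E uC u'C e x y.
move: x; apply: (dense_bdlin_eq l2_total (f := fun x => hdot (v x) y : R[i]^o) (g := fun x => hdot x (v' y) : R[i]^o)).
- exact: (bdlin_comp vb (hdot_bdl y)).
- exact: hdot_bdl.
move=> _ [f [fC ->]]; rewrite [LHS]hdotC [RHS]hdotC; congr (_^*).
move: y; apply: (dense_bdlin_eq l2_total (f := fun y => hdot y (v (l2in f)) : R[i]^o) (g := fun y => hdot (v' y) (l2in f) : R[i]^o)).
- exact: hdot_bdl.
- exact: (bdlin_comp v'b (hdot_bdl _)).
move=> _ [g [gC ->]]; rewrite [LHS]hdotC [RHS]hdotC vE// v'E// !ip_dot//; first by rewrite e.
- exact: u'C.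
- exact: uC.
Qed.

Lemma cimpl_star m n u w : cimpl m u -> cimpl n w ->
  (forall f g, Cc f -> Cc g -> ip (u f) g = ip f (w g)) -> mstar m = n.
Proof.
move=> [uC [v [vb mv vE]]] [wC [v' [v'b nv v'E]]] e.
have h := hdot_total vb v'b vE v'E uC wC e.
apply: mult_ext => b; apply: cmul_nondeg => a; rewrite -multP.
apply: kact_ext => x; apply: hdot_eq => y; rewrite !kactM [LHS]kact_star [RHS]kact_star !starK mv nv.
by rewrite hdotC h -hdotC.
Qed.

Lemma cimpl_ex u w :
  (forall c f g, Cc f -> Cc g -> u (fun s => c *: f s + g s) = (fun s => c *: u f s + u g s)) ->
  (forall c f g, Cc f -> Cc g -> w (fun s => c *: f s + g s) = (fun s => c *: w f s + w g s)) ->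
  (forall f, Cc f -> Cc (u f)) -> (forall f, Cc f -> Cc (w f)) ->
  (forall f, Cc f -> w (u f) = f) -> (forall f, Cc f -> u (w f) = f) ->
  (forall f g, Cc f -> Cc g -> ip (u f) (u g) = ip f g) ->
  exists m, [/\ cimpl m u, cimpl (mstar m) w, mstar m * m = 1 & m * mstar m = 1].
Proof.
move=> ul wl uC wC wu uw ui.
have wi f g : Cc f -> Cc g -> ip (w f) (w g) = ip f g.
  by move=> fC gC; rewrite -{2}(uw f)// -{2}(uw g)// ui//; exact: wC.
have uwi f g : Cc f -> Cc g -> ip (u f) g = ip f (w g).
  by move=> fC gC; rewrite -{1}(uw g)// ui//; exact: wC.
have wui f g : Cc f -> Cc g -> ip (w f) g = ip f (u g).
  by move=> fC gC; rewrite -{1}(wu g)// wi//; exact: uC.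
have ex z : (forall c f g, Cc f -> Cc g -> z (fun s => c *: f s + g s) = (fun s => c *: z f s + z g s)) ->
    (forall f, Cc f -> Cc (z f)) -> (forall f g, Cc f -> Cc g -> ip (z f) (z g) = ip f g) ->
    exists2 v : L2 -> L2, bdlin v & forall f, Cc f -> v (l2in f) = l2in (z f).
  move=> zl zC zi.
  have [||s|v [vl vb vE]] := @ext_total R L2 L2 {f : G -> R[i]^o | Cc f} (fun i => l2in (sval i))
      (fun i => l2in (z (sval i))) [set x : L2 | exists f, Cc f /\ x = l2in f] 1 ler01.
  - by move=> x; split=> [[f [fC ->]]|[[f fC] ->]]; [exists (exist _ f fC)|exists f].
  - exact: l2_total.
  - rewrite mul1r.
    have [F [FC -> ->]] : exists F, [/\ Cc F, \sum_(p <- s) p.1 *: l2in (z (sval p.2)) = l2in (z F) :> L2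
        & \sum_(p <- s) p.1 *: l2in (sval p.2) = l2in F :> L2].
      elim: s => [|[c [f fC]] s [F [FC e1 e2]]].
        exists (fun=> 0); split; [exact: Cc0| |by rewrite big_nil l2in0].
        have h := zl (-1) _ _ (@Cc0 R G) (@Cc0 R G).
        rewrite big_nil (_ : z _ = fun=> 0) ?l2in0//.
        rewrite (_ : (fun=> 0) = fun _ : G => (-1) *: (0 : R[i]^o) + 0); last by apply/funext => t; rewrite scaler0 addr0.
        by rewrite h; apply/funext => t; rewrite scaleN1r addNr scaler0 addr0.
      exists (fun t => c *: f t + F t); split; first exact: Cc_lin.
      + by rewrite big_cons /= e1 zl// l2in_lin//; exact: zC.
      + by rewrite big_cons /= e2 l2in_lin.
    rewrite -(@ler_pXn2r _ 2) ?nnegrE ?nm_ge0// -lecR -!hdot_nm !ip_dot ?zi//; exact: zC.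
  exists v; first by split => //; exists 1.
  by move=> f fC; exact: (vE (exist _ f fC)).
have [v vb vE] := ex u ul uC ui; have [v' v'b v'E] := ex w wl wC wi.
have vv' := hdot_total vb v'b vE v'E uC wC uwi.
have v'v := hdot_total v'b vb v'E vE wC uC wui.
have vK x : v' (v x) = x.
  apply: (dense_bdlin_eq l2_total (bdlin_comp vb v'b) (id_bdlin _)) => _ [f [fC ->]].
  by rewrite /= vE// v'E ?wu//; exact: uC.
have v'K x : v (v' x) = x.
  apply: (dense_bdlin_eq l2_total (bdlin_comp v'b vb) (id_bdlin _)) => _ [f [fC ->]].
  by rewrite /= v'E// vE ?uw//; exact: wC.
have vi x y : hdot (v x) (v y) = hdot x y by rewrite vv' vK.
have v'i x y : hdot (v' x) (v' y) = hdot x y by rewrite v'v v'K.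
have [m mv] := impl_ex (K := K) vb v'b vi v'i vv'.
have [n nv] := impl_ex (K := K) v'b vb v'i vi v'v.
have mc : cimpl m u by split => //; exists v.
have nc : cimpl n w by split => //; exists v'.
have e := cimpl_star mc nc uwi.
exists m; rewrite e; split => //.
- by apply: (cimpl_uniq (cimplM nc mc) cimpl1).
- by apply: (cimpl_uniq (cimplM mc nc) cimpl1).
Qed.
End L2ops.

Section Reps.
Context {R : realType} {G : lcGroupType} {D : groupData R G}.
Local Notation CZ := (gdZ D).
Local Notation CG := (gdA D).
Local Notation L2 := (gdL D).
Local Notation K := (gdK D).
Local Notation I := (haar L2).
Local Notation Del := (modular L2).
Local Notation ip := (ip (D := D)).
Implicit Types f g : G -> R[i]^o.
Implicit Types u w : (G -> R[i]^o) -> G -> R[i]^o.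

Definition lfun (s : G) f : G -> R[i]^o := fun t => f (s^-1 * t)%g.
Definition rfun (s : G) f : G -> R[i]^o := fun t => (Num.sqrt (Del s))%:C%C * f (t * s)%g.
Definition Ufun f : G -> R[i]^o := fun t => (Num.sqrt (Del t^-1%g))%:C%C * f t^-1%g.

Lemma Cc_lfun s f : Cc f -> Cc (lfun s f). Proof. exact: Cc_ltrans. Qed.
Lemma Cc_rfun s f : Cc f -> Cc (rfun s f).
Proof. by move=> fC; exact: (CcZ _ (Cc_rtrans s fC)). Qed.
Lemma sqrtDel_cts : continuous (fun t : G => (Num.sqrt (Del t))%:C%C : R[i]^o).
Proof.
have /cts_real dc := mod_cts (D := D); apply/cts_real => s.
by apply: (@continuous_comp _ _ _ (fun t => Del t) Num.sqrt); [exact: dc|exact: sqrt_continuous].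
Qed.
Lemma Cc_V f : Cc f -> Cc (fun t => f t^-1%g).
Proof. exact: (Cc_comp (r := fun t : G => t^-1%g) (r' := fun t : G => t^-1%g) (@invg_cts G) (@invg_cts G) (@invgK _) (@invgK _)). Qed.
Lemma Cc_Ufun f : Cc f -> Cc (Ufun f).
Proof.
move=> fC; have := Cc_V (CcM fC sqrtDel_cts); congr Cc.
by apply/funext => t; rewrite /Ufun mulrC.
Qed.

Lemma sqrtDelM s : Num.sqrt (Del s) * Num.sqrt (Del s^-1%g) = 1.
Proof. by rewrite -sqrtrM ?(ltW (mod_gt0 _))// -modM mulgV mod1 sqrtr1. Qed.

Lemma ip_lfun s f g : Cc f -> Cc g -> ip (lfun s f) (lfun s g) = ip f g.
Proof.
move=> fC gC; have fg : Cc (fun t => f t * (g t : R[i])^* : R[i]^o) by apply: (CcM fC); apply: cts_conj; case: gC.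
by rewrite /ip -(haar_inv s^-1%g fg).
Qed.

Lemma ip_rfun s f g : Cc f -> Cc g -> ip (rfun s f) (rfun s g) = ip f g.
Proof.
move=> fC gC; have fg : Cc (fun t => f t * (g t : R[i])^* : R[i]^o) by apply: (CcM fC); apply: cts_conj; case: gC.
transitivity (I (fun t => (Del s)%:C%C *: (f (t * s)%g * (g (t * s)%g : R[i])^* : R[i]^o))).
  apply: haar_ext => t; rewrite /rfun conj_mul (_ : ((Num.sqrt (Del s))%:C%C)^* = (Num.sqrt (Del s))%:C%C); last exact: conjc_real.
  rewrite mulrACA -rmorphM /= -expr2 sqr_sqrtr//; exact/ltW/mod_gt0.
rewrite haarZ; last exact: (Cc_rtrans s fg).
rewrite (mod_haar s fg) -[_ *: _]/(_ * _ : R[i]) mulrA -rmorphM /= mulfV ?mul1r//.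
by rewrite gt_eqF// mod_gt0.
Qed.

Lemma ip_Ufun f g : Cc f -> Cc g -> ip (Ufun f) (Ufun g) = ip f g.
Proof.
move=> fC gC; have fg : Cc (fun t => f t * (g t : R[i])^* : R[i]^o) by apply: (CcM fC); apply: cts_conj; case: gC.
rewrite /ip -(haar_V fg); apply: haar_ext => t.
rewrite /Ufun conj_mul (_ : ((Num.sqrt (Del t^-1%g))%:C%C)^* = (Num.sqrt (Del t^-1%g))%:C%C); last exact: conjc_real.
rewrite mulrACA -rmorphM /= -expr2 sqr_sqrtr; last exact/ltW/mod_gt0.
by rewrite modV mulrC.
Qed.

Lemma UfunK f : Ufun (Ufun f) = f.
Proof.
apply/funext => t; rewrite /Ufun invgK mulrA -rmorphM /= mulrC; apply: etrans (mulr1 _); congr (_ * _).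
by rewrite mulrC sqrtDelM.
Qed.
Lemma rfunK s f : rfun s (rfun s^-1%g f) = f.
Proof.
apply/funext => t; rewrite /rfun mulrA -rmorphM /= -mulgA mulgV mulg1; apply: etrans (mul1r _); congr (_ * _).
by rewrite sqrtDelM.
Qed.
Lemma lfunM s t f : lfun s (lfun t f) = lfun (s * t)%g f.
Proof. by apply/funext => x; rewrite /lfun invgM mulgA. Qed.
Lemma lfun1 f : lfun 1%g f = f.
Proof. by apply/funext => x; rewrite /lfun invg1 mul1g. Qed.

Lemma scal_lin (a : G -> R[i]) (r : G -> G) c f g :
  (fun t => a t * (c *: f (r t) + g (r t)) : R[i]^o) = fun t => c *: (a t * f (r t)) + a t * g (r t).
Proof. by apply/funext => t; rewrite mulrDr -![_ *: (_ : R[i]^o)]/(_ * _ : R[i]) mulrCA. Qed.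

Lemma lamG_c s : cimpl (lamG (D := D) s) (lfun s) /\ mstar (lamG (D := D) s) = lamG s^-1%g.
Proof.
have ex t : exists m, [/\ cimpl (D := D) m (lfun t), cimpl (mstar m) (lfun t^-1%g), mstar m * m = 1 & m * mstar m = 1].
  apply: cimpl_ex => //; try by move=> f /Cc_lfun.
  - by move=> f _; rewrite lfunM mulVg lfun1.
  - by move=> f _; rewrite lfunM mulgV lfun1.
  - exact: ip_lfun.
have [m [mc mc' _ _]] := ex s; rewrite [lamG s](cimpl_op mc); split => //.
by rewrite [lamG s^-1%g](cimpl_op mc').
Qed.

Lemma rhoG_c s : [/\ cimpl (rhoG (D := D) s) (rfun s), mstar (rhoG (D := D) s) * rhoG s = 1 & rhoG (D := D) s * mstar (rhoG s) = 1].
Proof.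
have [m [mc mc' h1 h2]] : exists m, [/\ cimpl (D := D) m (rfun s), cimpl (mstar m) (rfun s^-1%g), mstar m * m = 1 & m * mstar m = 1].
  apply: cimpl_ex => [c f g _ _|c f g _ _|f|f|f _|f _|].
  - exact: (scal_lin (fun=> _)).
  - exact: (scal_lin (fun=> _)).
  - exact: Cc_rfun.
  - exact: Cc_rfun.
  - by rewrite -{2}(invgK s) rfunK.
  - exact: rfunK.
  - exact: ip_rfun.
by rewrite [rhoG s](cimpl_op mc).
Qed.

Lemma Uop_ex : exists m, [/\ cimpl (D := D) m Ufun, mstar m = m & m * m = 1].
Proof.
have [m [mc mc' h1 h2]] : exists m, [/\ cimpl (D := D) m Ufun, cimpl (mstar m) Ufun, mstar m * m = 1 & m * mstar m = 1].
  apply: cimpl_ex => [c f g _ _|c f g _ _|f|f|f _|f _|]; try exact: (scal_lin _ (fun t => t^-1%g)); try exact: UfunK.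
  - exact: Cc_Ufun.
  - exact: Cc_Ufun.
  - exact: ip_Ufun.
have e : mstar m = m by exact: (cimpl_uniq mc' mc).
by exists m; rewrite e in h2.
Qed.

Lemma cimpl_ext m u w : (forall f, Cc f -> u f = w f) -> cimpl (D := D) m u -> cimpl m w.
Proof.
move=> e [uC [v [vb mv vE]]]; split=> [f fC|]; first by rewrite -e//; exact: uC.
by exists v; split => // f fC; rewrite -e//; exact: vE.
Qed.

Lemma cimpl0 : cimpl (D := D) 0 (fun f => fun=> 0).
Proof.
have := cimpl_lin (-1) (@cimpl1 R G D) (@cimpl1 R G D); rewrite scaleN1r addNr.
by apply: cimpl_ext => f _; apply/funext => t; rewrite scaleN1r addNr.
Qed.

Definition mfun (p : G -> R[i]^o) f : G -> R[i]^o := fun t => p t * f t.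

(** [cimpl_ex] only produces unitaries. Multiplication by a real r of modulus at most 1 is the mean
    of the unitary p = r + i (1 - r^2)^(1/2) and its adjoint. *)
Lemma Mop_real (r : G -> R) : continuous r -> (forall t, `|r t| <= 1) ->
  exists m, cimpl (D := D) m (mfun (cr r)).
Proof.
move=> rc r1; pose p t : R[i]^o := (r t)%:C%C + 'i%C * (Num.sqrt (1 - r t ^+ 2))%:C%C.
have pc : continuous p.
  have c1 : continuous (cr r) by exact/cts_real.
  have c2 : continuous (fun t => (Num.sqrt (1 - r t ^+ 2))%:C%C : R[i]^o).
    apply/cts_real => s.
    apply: (@continuous_comp _ _ _ (fun t => 1 - r t ^+ 2) Num.sqrt); last exact: sqrt_continuous.
    apply: cvgB; first exact: cvg_cst.
    rewrite (_ : (fun x => r x ^+ 2) = fun x => r x * r x); last by apply/funext => x; rewrite expr2.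
    by rewrite expr2; apply: cvgM; exact: rc.
  by apply: cts_ext (cts_lin (k := 'i%C) c2 c1) _ => t; rewrite addrC.
have pp t : (p t : R[i])^* = (r t)%:C%C - 'i%C * (Num.sqrt (1 - r t ^+ 2))%:C%C.
  rewrite /p conj_add conj_mul (_ : ((r t)%:C%C)^* = (r t)%:C%C); last exact: conjc_real.
  rewrite (_ : ((Num.sqrt (1 - r t ^+ 2))%:C%C)^* = (Num.sqrt (1 - r t ^+ 2))%:C%C); last exact: conjc_real.
  by rewrite (_ : ('i%C : R[i])^* = - 'i%C) ?mulNr//; apply/eqP; rewrite eq_complex /= oppr0 !eqxx.
have p1 t : p t * (p t : R[i])^* = 1 :> R[i].
  rewrite pp /p mulrC -subr_sqr exprMn sqr_i mulN1r opprK -!rmorphXn /= sqr_sqrtr.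
    by rewrite -rmorphD /= addrC subrK.
  rewrite subr_ge0 -real_normK ?num_real// -(expr1n _ 2) ler_pXn2r ?nnegrE//.
have pcc : continuous (fun t => (p t : R[i])^* : R[i]^o) by exact: cts_conj.
have mC q f : continuous q -> Cc f -> Cc (mfun q f).
  by move=> qc fC; have := CcM fC qc; congr Cc; apply/funext => t; rewrite /mfun mulrC.
have [m [mc mc' _ _]] : exists m, [/\ cimpl (D := D) m (mfun p), cimpl (mstar m) (mfun (fun t => (p t : R[i])^*)), mstar m * m = 1 & m * mstar m = 1].
  apply: cimpl_ex => [c f g _ _|c f g _ _|f|f|f _|f _|f g fC gC].
  - exact: (scal_lin p id).
  - exact: (scal_lin (fun t => (p t)^*) id).
  - exact: mC.
  - exact: mC.
  - by apply/funext => t; rewrite /mfun mulrA [_ * p t]mulrC p1 mul1r.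
  - by apply/funext => t; rewrite /mfun mulrA p1 mul1r.
  - by apply: haar_ext => t; rewrite /mfun conj_mul mulrACA p1 mul1r.
exists ((2^-1) *: m + ((2^-1) *: mstar m + 0)).
apply: cimpl_ext (cimpl_lin _ mc (cimpl_lin _ mc' cimpl0)) => f _; apply/funext => t.
rewrite addr0 /mfun -scalerDr -mulrDl pp /p /cr (_ : _ + _ + _ = (r t)%:C%C + (r t)%:C%C); last by ring.
by rewrite mulrDl half_addv.
Qed.

Lemma Mrep_c (d : CZ) : cimpl (Mrep (D := D) d) (mfun (fun t => zs t d)).
Proof.
suff [m mc] : exists m, cimpl (D := D) m (mfun (fun t => zs t d)).
  by rewrite [Mrep d](cimpl_op mc).
(* N bounds all values of d by [zs_bound]; the added 1 keeps it positive when d = 0. *)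
pose N := 2 * nm d + 1; have N0 : 0 < N by rewrite ltr_wpDl// mulr_ge0// nm_ge0.
have [dc _] := zs_C0 d.
pose r1 t := complex.Re (zs t d : R[i]) / N; pose r2 t := complex.Re (- 'i%C * zs t d : R[i]) / N.
have bnd (z : R[i]) : cabs z <= N -> `|complex.Re z / N| <= 1.
  by move=> h; rewrite normrM normfV (gtr0_norm N0) ler_pdivrMr// mul1r (le_trans (Re_le_cabs _)).
have zN t : cabs (zs t d) <= N by rewrite (le_trans (zs_bound t d))// /N lerDl.
have c1 : continuous r1.
  by move=> t; apply: cvgM; [have /cts_real h := cts_Re dc; exact: h|exact: cvg_cst].
have dci : continuous (fun t => - 'i%C * zs t d : R[i]^o).
  by move=> s; apply: cvgM; [exact: cvg_cst|exact: dc].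
have c2 : continuous r2.
  by move=> t; apply: cvgM; [have /cts_real h := cts_Re dci; exact: h|exact: cvg_cst].
have [|m1 m1c] := Mop_real c1 => [t|]; first exact/bnd/zN.
have [|m2 m2c] := Mop_real c2 => [t|].
  by apply: bnd; rewrite cabsM cabsN cabs_i mul1r.
exists (N%:C%C *: m1 + ((N%:C%C * 'i%C) *: m2 + 0)).
apply: cimpl_ext (cimpl_lin _ m1c (cimpl_lin _ m2c cimpl0)) => f _; apply/funext => t.
rewrite addr0 /mfun /cr /r1 /r2 -![_ *: (_ : R[i]^o)]/(_ * _ : R[i]) !mulrA -mulrDl; congr (_ * _).
have e (x : R) : N%:C%C * (x / N)%:C%C = x%:C%C :> R[i] by rewrite -rmorphM /= mulrCA divff ?mulr1// gt_eqF.
rewrite e mulrAC e; case: (zs t d) => x y /=; rewrite [RHS]complexE /=.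
by rewrite oppr0 mul0r mulN1r sub0r opprK mulrC.
Qed.

Lemma Mrep_uniq (d : CZ) m u : cimpl (D := D) m u -> (forall f, Cc f -> u f = mfun (fun t => zs t d) f) -> m = Mrep d.
Proof. by move=> h e; exact: (cimpl_uniq h (Mrep_c d) e). Qed.

Lemma impl_th (m : mult K) (v : L2 -> L2) x y : bdlin v -> impl m v -> m (th x y) = th (v x) y.
Proof. by move=> [vl _] h; apply: kact_ext => z; rewrite h !thE (islinZ vl). Qed.

Lemma cimpl_th m u f y : cimpl (D := D) m u -> Cc f -> m (th (l2in f) y) = th (l2in (u f)) y.
Proof. by move=> [_ [v [vb mv vE]]] fC; rewrite (impl_th _ _ vb mv) vE. Qed.

Lemma th_l2_total : cspan [set k : K | exists f y, Cc f /\ k = th (l2in f) y] = setT.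
Proof.
apply: (cspan_total (@th_total _ _ K)) => _ [x [y ->]].
move: x; apply: (cspan_bdlin (@l2_total _ _ D) (f := fun x => th x y)).
  split; first exact: th_linl.
  by exists (nm y); rewrite ?nm_ge0// => x; rewrite mulrC nm_th.
by move=> _ [f [fC ->]]; apply: cspan_sub; exists f, y.
Qed.

Lemma Mrep_nondeg : nondeg (Mrep (D := D)).
Proof.
split; first split.
- have h : islin (Mrep (D := D)).
    move=> k d e; symmetry; apply: (Mrep_uniq (cimpl_lin k (Mrep_c d) (Mrep_c e))) => f fC.
    by apply/funext => t; rewrite /mfun (zs_lin t) mulrDl scalerAl.
  by move=> b k d e; rewrite h.
- move=> d e; symmetry; apply: (Mrep_uniq (cimplM (Mrep_c d) (Mrep_c e))) => f fC.
  by apply/funext => t; rewrite /mfun zsM mulrA.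
- move=> d; symmetry; apply: (cimpl_star (Mrep_c d) (Mrep_c (star d))) => f g fC gC.
  by apply: haar_ext => t; rewrite /mfun zs_star conj_mul conj_inv mulrCA mulrA.
apply: (cspan_total th_l2_total) => _ [f [y [fC ->]]]; apply: cspan_sub.
have [chi chiT chi1] := Cc_plateau fC; have [d dE] := zex (D := D) (csupp_C0 chiT).
exists d, (th (l2in f) y); rewrite (cimpl_th y (Mrep_c d) fC); congr (th (l2in _) _).
apply/funext => t; rewrite /mfun dE; have [->|/chi1->] := eqVneq (f t) 0; first by rewrite mulr0.
by rewrite mul1r.
Qed.

Lemma coef_C0 f g : Cc f -> Cc g -> exists d : CZ, forall s, zs s d = ip (lfun s f) g.
Proof.
move=> [fc [Kf cKf Kf0]] [gc [Kg cKg Kg0]].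
pose F (p : G * G) : R[i]^o := f (p.1^-1 * p.2)%g * (g p.2 : R[i])^*.
have Fc : continuous F.
  apply: (@ctsM2 _ _ (fun p => f (p.1^-1 * p.2)%g) (fun p => (g p.2 : R[i])^*)).
    by apply: (mul2_cts fc); apply: mulp_cts; [exact: (invp_cts (@fst_cts G))|exact: snd_cts].
  exact: (mul2_cts (cts_conj gc) (@snd_cts G)).
have [|[v vE] _] := fubini_v (D := D) Fc (mulV_compact cKg cKf) cKg; last by exists v.
move=> t s; rewrite /F /= mulf_eq0 negb_or => /andP[h1 h2].
have Ks : Kg s by apply: contrapT => /Kg0 e; rewrite e rmorph0 eqxx in h2.
have Kt : Kf (t^-1 * s)%g by apply: contrapT => /Kf0 e; rewrite e eqxx in h1.
by split => //; exists s, (t^-1 * s)%g; split => //; rewrite invgM invgK mulgA mulgV mul1g.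
Qed.

Lemma coef_cts f g : Cc f -> Cc g -> continuous (fun s => ip (lfun s f) g : R[i]^o).
Proof.
move=> fC gC; have [d dE] := coef_C0 fC gC; have [dc _] := zs_C0 d.
by apply: cts_ext dc _ => s; rewrite dE.
Qed.

Lemma lamG_rep : unitary_rep (lamG (D := D)).
Proof.
have lc s := (lamG_c s).1; have ls s := (lamG_c s).2.
have lM s t : lamG (s * t)%g = mmul (lamG (D := D) s) (lamG t).
  by apply: (cimpl_uniq (lc _) (cimplM (lc s) (lc t))) => f _; rewrite lfunM.
split => //.
- by apply: (cimpl_uniq (lc _) (@cimpl1 R G D)) => f _; rewrite lfun1.
have lu s : mstar (lamG (D := D) s) * lamG s = 1.
  rewrite ls -[LHS]lM mulVg.
  by apply: (cimpl_uniq (lc _) (@cimpl1 R G D)) => f _; rewrite lfun1.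
apply: (cts_total th_l2_total (K := 1)) => // [s|_ [f [y [fC ->]]]].
  rewrite -(@ler_pXn2r _ 2) ?nnegrE ?nm_ge0// expr1n -nm_mstarM lu; exact: nm1_le.
apply: (@cts_ext R G _ (fun s => th (l2in (lfun s f)) y)) => [|s]; last by rewrite (cimpl_th y (lc s) fC).
apply/cts_nm => s e e0; have y0 : 0 < nm y + 1 by rewrite ltr_wpDl ?nm_ge0.
pose e' := e / (nm y + 1); have e'0 : 0 < e' by rewrite divr_gt0.
have e2 : 0 < e' ^+ 2 / 2 by rewrite divr_gt0// exprn_gt0.
have /cts_nm/(_ s _ e2) := coef_cts fC (Cc_lfun s fC); apply: filterS => s' hs.
(* Both translates have the norm of f, so the squared distance is twice the real part of a
   difference of coefficients. *)
have n2 : nm (l2in (lfun s f) - l2in (lfun s' f) : L2) ^+ 2 < e' ^+ 2.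
  have c0 := ip_lfun s fC fC; have c1 := ip_lfun s' fC fC.
  have : (nm (l2in (lfun s f) - l2in (lfun s' f) : L2) ^+ 2)%:C%C
    = (ip (lfun s f) (lfun s f) - ip (lfun s' f) (lfun s f)) + (ip (lfun s f) (lfun s f) - ip (lfun s' f) (lfun s f))^*.
    rewrite -hdot_nm hdotBl !hdotBr !ip_dot; try exact: Cc_lfun.
    have -> : ip (lfun s f) (lfun s' f) = (ip (lfun s' f) (lfun s f))^*.
      by rewrite -!ip_dot; try exact: Cc_lfun; rewrite -hdotC.
    have -> : ip (lfun s' f) (lfun s' f) = (ip (lfun s f) (lfun s f))^*.
      by rewrite c1 c0 -ip_dot// -hdotC.
    rewrite rmorphB /=; ring.
  move=> /(congr1 (@cabs R)); rewrite cabs_real ger0_norm ?sqr_ge0// => ->.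
  rewrite (le_lt_trans (cabsD _ _))// cabsC.
  by move: hs; rewrite -[nm _]/(cabs _); lra.
rewrite -(islinB (th_linl y)) (le_lt_trans (nm_th _ _))//.
have n1 : nm (l2in (lfun s f) - l2in (lfun s' f) : L2) < e'.
  by rewrite -(@ltr_pXn2r _ 2) ?nnegrE ?nm_ge0// ltW.
apply: (@le_lt_trans _ _ (e' * nm y)); first by rewrite ler_wpM2r ?nm_ge0// ltW.
by rewrite /e' mulrAC ltr_pdivrMr// ltr_pM2l// ltrDl.
Qed.

Lemma lamP : nondeg (lam (D := D)) /\ forall s, mext (lam (D := D)) (gin s) = lamG s.
Proof.
have [h [[hn hE] _]] := @gin_univ _ _ CG _ _ lamG_rep.
exact: (@the_spec _ (fun=> mone _) (fun h => nondeg h /\ forall s, mext h (gin s) = lamG s) (ex_intro _ h (conj hn hE))).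
Qed.

(** For f a bump of integral 1 near the identity and g the conjugate of p, the coefficient at s is
    the mean of p(s t) over small t, which is uniformly close to p. *)
Lemma coef_dense (d : CZ) (e : R) : 0 < e -> exists f g (d' : CZ),
  [/\ Cc f, Cc g, forall s, zs s d' = ip (lfun s f) g & nm (d - d') < e].
Proof.
move=> e0; have e4 : 0 < e / 8 by rewrite divr_gt0.
have [dc dv] := zs_C0 d; have e4' : 0 < (e / 8)%:C%C :> R[i] by rewrite ltcR.
have [K cK hK] := dv _ e4'; have [//|b bT [b1 bK]] := @plateau R G K setT cK openT.
pose p t : R[i]^o := cr b t * zs t d.
have pC : Cc p by exact: (CcM (csupp_Cc bT) dc).
have pd s : cabs (p s - zs s d) <= e / 8.
  rewrite /p; have [Ks|nK] := pselect (K s); first by rewrite /cr bK// mul1r subrr cabs0 ltW.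
  rewrite -{2}[zs s d]mul1r -mulrBl cabsM -rmorphB cabs_real.
  have [_ b0 _] := bT; have hb : `|b s - 1| <= 1 by rewrite ler_norml; have := b0 s; have := b1 s; lra.
  have h2 : cabs (zs s d) < e / 8 by rewrite -ltcR' -cabsE hK.
  rewrite (le_trans (ler_wpM2r (cabs_ge0 _) hb))// mul1r ltW//.
have pVC := Cc_V pC; have [pVc [KV cKV KV0]] := pVC.
have un := unif_cts pVc cKV KV0 e4.
have un' : nbhs (1%g : G) [set t | forall s, cabs (p (s * t)%g - p s) < e / 8].
  have h1 : nbhs (1^-1%g : G) [set t | forall s, nm (p (t * s)^-1%g - p s^-1%g) < e / 8] by rewrite invg1.
  apply: (@filterS _ _ (nbhs_filter (1%g : G)) _ _ _ (@invg_cts G 1%g _ h1)) => t /= h s.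
  by have := h s^-1%g; rewrite invgM !invgK.
have [c [cV c1]] := ex_unit (D := D) un'; have cC := csupp_Cc cV.
pose g t : R[i]^o := (p t : R[i])^*; have gC : Cc g.
  by have [pc [Kp cKp Kp0]] := pC; split; [exact: cts_conj|exists Kp => // t /Kp0 h; rewrite /g h rmorph0].
have [d' d'E] := coef_C0 cC gC; exists (cr c), g, d'; split => //.
apply: (@le_lt_trans _ _ (3 * (e / 8))); last by lra.
apply: CZ_norm => [|s]; first by rewrite mulr_ge0// ltW.
rewrite (islinB (zs_lin s)) (_ : _ - _ = (zs s d - p s) + (p s - zs s d')); last by rewrite addrA subrK.
rewrite (le_trans (cabsD _ _))// (_ : 3 * _ = e / 8 + 2 * (e / 8)); last by ring.
apply: lerD; first by rewrite -cabsN opprB.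
have pT : Cc (fun t => p (s * t)%g) by exact: Cc_ltrans.
have pTc : continuous (fun t => p (s * t)%g) by case: pT.
have cpC : Cc (fun t => cr c t * p (s * t)%g) by exact: CcM.
have e1 : zs s d' = I (fun t => cr c t * p (s * t)%g).
  rewrite d'E /ip -(haar_inv s (f := fun t => lfun s (cr c) t * (g t : R[i])^*)).
    by apply: haar_ext => t; rewrite /lfun mulgA mulVg mul1g /g conj_inv.
  by apply: (CcM (Cc_lfun s cC)); apply: cts_conj; case: gC.
have rc : rI (D := D) c = 1 by apply: (@complexI R); rewrite -(haar_cr cV).
have e2 : zs s d' - p s = I (fun t => cr c t * (p (s * t)%g - p s)).
  have q : p s = I (fun t => p s *: cr c t) by rewrite haarZ// c1 -[_ *: _]/(_ * _ : R[i]) mulr1.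
  apply: etrans (_ : -1 *: I (fun t => p s *: cr c t) + I (fun t => cr c t * p (s * t)%g) = _).
    by rewrite -q e1 scaleN1r addrC.
  rewrite -(haar_lin (-1) (CcZ (p s) cC) cpC).
  by apply: haar_ext => t; rewrite scaleN1r addrC -[_ *: _]/(_ * _ : R[i]) mulrBr [p s * _]mulrC.
rewrite -cabsN opprB e2.
have := haar_bound (D := D) (f := fun t => p (s * t)%g - p s) (M := e / 8) cV; rewrite rc mulr1; apply.
  by move=> t; apply: cvgB; [exact: pTc|exact: cvg_cst].
move=> t ct; have [_ _ [Kc cKc [KcV Kc0]]] := cV.
by apply: ltW; apply: (KcV t); apply: contrapT => /Kc0 h; rewrite h eqxx in ct.
Qed.

Lemma lam_M (d d' : CZ) r : (forall t, zs t d' = zs (r * t)%g d) ->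
  mstar (lamG (D := D) r) * Mrep d * lamG r = Mrep d'.
Proof.
move=> e; rewrite (lamG_c r).2; have [c _] := lamG_c r; have [c' _] := lamG_c r^-1%g.
apply: (Mrep_uniq (cimplM (cimplM c' (Mrep_c d)) c)) => f _; apply/funext => t.
by rewrite /lfun /mfun invgK e mulgA mulVg mul1g.
Qed.

Lemma lam_rho r s : lamG (D := D) r * rhoG s = rhoG s * lamG r.
Proof.
have [c _] := lamG_c r; have [c' _ _] := rhoG_c s.
by apply: (cimpl_uniq (cimplM c c') (cimplM c' c)) => f _; apply/funext => t; rewrite /lfun /rfun mulgA.
Qed.

Lemma rho_M (d d' : CZ) s : (forall t, zs t d' = zs (t * s)%g d) ->
  rhoG (D := D) s * Mrep d = Mrep d' * rhoG s.
Proof.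
move=> e; have [c _ _] := rhoG_c s.
apply: (cimpl_uniq (cimplM c (Mrep_c d)) (cimplM (Mrep_c d') c)) => f _; apply/funext => t.
by rewrite /rfun /mfun e mulrCA.
Qed.

Lemma Uop : exists U : mult K, [/\ mstar U = U, U * U = 1,
  (forall d d', (forall t, zs t d' = zs t^-1%g d) -> U * Mrep d * U = Mrep d')
  & forall s, U * rhoG (D := D) s * U = lamG s].
Proof.
have [U [c Us UU]] := Uop_ex; exists U; split => // [d d' e|s].
  apply: (Mrep_uniq (cimplM (cimplM c (Mrep_c d)) c)) => f _; apply/funext => t.
  rewrite /Ufun /mfun e invgK mulrCA; congr (_ * _); rewrite mulrA -rmorphM /= [X in X%:C%C]mulrC sqrtDelM.
  exact: mul1r.
have [cr _ _] := rhoG_c s; have [cl _] := lamG_c s.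
apply: (cimpl_uniq (cimplM (cimplM c cr) c) cl) => f _; apply/funext => t.
rewrite /Ufun /rfun /lfun !invgM invgK !mulrA -!rmorphM /= -[RHS]mul1r; congr (_ * _).
rewrite modM sqrtrM ?(ltW (mod_gt0 _))//.
rewrite (_ : _ * _ * _ = (Num.sqrt (Del s) * Num.sqrt (Del s^-1%g)) * (Num.sqrt (Del t) * Num.sqrt (Del t^-1%g))); last by ring.
by rewrite !sqrtDelM mulr1.
Qed.

Lemma Mrep_inj (d d' : CZ) : Mrep (D := D) d = Mrep d' -> d = d'.
Proof.
move=> e; apply: zs_ext => s; have [b [bc b0 [K cK [KV K0]]] b1] := bump_fun (R := R) (filterT : nbhs s setT).
have bC : Cc (cr b) by split; [exact/cts_real|exists K => // t /K0 h; rewrite /cr h].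
have hc := Mrep_c d; have [c1 [v [vb mv vE]]] := Mrep_c d; have [c2 [v' [v'b mv' v'E]]] := Mrep_c d'.
rewrite -e in mv'; have vv := impl_fun mv mv'.
have h : l2in (mfun (fun t => zs t (d - d')) (cr b)) = 0 :> L2.
  have := @l2in_lin _ _ L2 (-1) _ _ (c2 _ bC) (c1 _ bC).
  rewrite -vE// -v'E// vv scaleN1r addNr => <-; congr l2in; apply/funext => t.
  by rewrite /mfun (islinB (zs_lin t)) scaleN1r [RHS]addrC; exact: mulrBl.
have qC : Cc (mfun (fun t => zs t (d - d')) (cr b)) by case: (Mrep_c (d - d')) => + _; apply.
have ip0 : ip (mfun (fun t => zs t (d - d')) (cr b)) (mfun (fun t => zs t (d - d')) (cr b)) = 0.
  by rewrite -ip_dot// h hdot_nm nm0 expr0n.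
have [q0|q1] := eqVneq (zs s (d - d')) 0.
  by apply/eqP; rewrite -subr_eq0 -(islinB (zs_lin s)) q0.
(* [haar_pos] requires the value 1 at the identity, so the squared modulus is translated by s and
   divided by its value there. *)
exfalso; pose a t := cabs (mfun (fun t => zs t (d - d')) (cr b) t) ^+ 2.
have as0 : 0 < a s.
  rewrite exprn_gt0// lt_neqAle cabs_ge0 andbT eq_sym; apply: contra_neq q1 => /cabs_eq0.
  by rewrite /mfun /cr b1 mulr1.
have [qc [Kq cKq Kq0]] := qC.
have aE t : (a t)%:C%C = mfun (fun t => zs t (d - d')) (cr b) t * (mfun (fun t => zs t (d - d')) (cr b) t)^* by rewrite cabs_sqr.
have aS : csupp setT (fun t => (a s)^-1 * a (s * t)%g).
  have aC : Cc (cr a).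
    have := CcM qC (cts_conj qc); congr Cc; by apply/funext => t; rewrite /cr aE.
  have [ac [Ka cKa Ka0]] := Cc_ltrans s aC; split.
  - move=> t; apply: cvgM; first exact: cvg_cst.
    by have /cts_real := ac; apply.
  - by move=> t; rewrite mulr_ge0 ?invr_ge0 ?(ltW as0)// sqr_ge0.
  - by exists Ka => //; split => // t /Ka0/(@complexI R) ->; rewrite mulr0.
have := haar_pos (D := D) aS; rewrite mulg1 mulVf ?gt_eqF// => /(_ erefl).
suff -> : rI (D := D) (fun t => (a s)^-1 * a (s * t)%g) = 0 by rewrite ltxx.
apply: (@complexI R); rewrite -(haar_cr aS).
have aC : Cc (cr a) by have := CcM qC (cts_conj qc); congr Cc; apply/funext => t; rewrite /cr aE.
transitivity (I (fun t => ((a s)^-1)%:C%C *: cr a (s * t)%g)).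
  by apply: haar_ext => t; rewrite /cr rmorphM.
rewrite haarZ; last exact: Cc_ltrans. 
rewrite (haar_inv s aC) (_ : I (cr a) = ip (mfun (fun t => zs t (d - d')) (cr b)) (mfun (fun t => zs t (d - d')) (cr b))).
  by rewrite ip0 scaler0.
by apply: haar_ext => t; rewrite /cr aE.
Qed.

(** Were K zero, all multiplication operators would coincide, against their injectivity and a
    nonzero bump. *)
Lemma K_nontrivial : exists k : K, k <> 0.
Proof.
have [b bT b1] := bump_fun (R := R) (filterT : nbhs (1%g : G) setT); have [d dE] := zex (D := D) (csupp_C0 bT).
apply: contrapT => h; have e : d = 0.
  apply: Mrep_inj; apply: mult_ext => k; have k0 (l : K) : l = 0 by apply: contrapT => l0; apply: h; exists l.
  by rewrite (k0 (Mrep d k)) (k0 (Mrep 0 k)).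
have := dE 1%g; rewrite e (islin0 (zs_lin _)) b1 => /eqP; rewrite eq_sym.
by rewrite -[1%:C%C]/(1 : R[i]) oner_eq0.
Qed.
End Reps.

(** * The crossed product as a closed span *)

Section Aux.
Context {R : realType}.
Implicit Types A B : cstarAlg R.

Lemma cspan_map (V W : normedModType R[i]) (S : set V) (T : set W) (f : V -> W) x : cspan S x -> bdlin f ->
  (forall x, S x -> cspan T (f x)) -> cspan T (f x).
Proof.
move=> /closure_nmP hx [fl [K K0 fK]] h; apply: cspan_eps => e e0; have K1 : 0 < K + 1 by rewrite ltr_wpDl.
have [y [n [k [v [Sv ->]]]] xy] := hx _ (divr_gt0 e0 K1); exists (f (\sum_(i < n) k i *: v i)).
  rewrite (islin_sum fl); elim/big_ind: _ => [|a b ha hb|i _]; first exact: cspan0.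
    by rewrite -[a]scale1r; exact: cspan_lin.
  rewrite (islinZ fl) -[_ *: _]addr0; apply: cspan_lin; last exact: cspan0.
  exact/h/Sv.
rewrite -(islinB fl) (le_lt_trans (fK _))//; move: xy; rewrite ltr_pdivlMr// => xy.
by apply: le_lt_trans xy; rewrite mulrC ler_wpM2l ?nm_ge0// lerDl.
Qed.

Lemma mull_bd A (n : mult A) : bdlin (fun m : mult A => m * n).
Proof. exact: (@cmull_bd R (multalg A) n). Qed.
Lemma mulr_bd A (n : mult A) : bdlin (fun m : mult A => n * m).
Proof. exact: (@cmulr_bd R (multalg A) n). Qed.
Lemma emb_bd A : bdlin (@emb R A).
Proof. by split; [exact: emb_lin|exists 1 => // x; rewrite mul1r nm_emb]. Qed.
Lemma mext_bd A B (p : A -> mult B) : nondeg p -> bdlin (mext p).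
Proof. by move=> pn; split; [exact: mext_lin|exists 2 => // m; exact: mext_bound2]. Qed.
Lemma star_total A (S : set A) : cspan S = setT -> cspan [set x | exists2 y, S y & x = star y] = setT.
Proof.
move=> dS; rewrite -subTset => x _; rewrite -[x]starK; move: (star x).
apply: (total_ind (K := fun x => cspan [set x | exists2 y, S y & x = star y] (star x)) dS).
- move=> y hy; apply: cspan_eps => e e0; have [z hz yz] := hy e e0; exists (star z) => //.
  by rewrite -starB nm_star.
- by move=> k y z hy hz; rewrite starDD starZ; exact: cspan_lin.
- by rewrite star0; exact: cspan0.
- by move=> y Sy; apply: cspan_sub; exists y.
Qed.
End Aux.

Section Comm.
Context {R : realType} {G : lcGroupType} {D : groupData R G}.
Implicit Types A C : cstarAlg R.
Local Notation CZ := (gdZ D).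
Local Notation CG := (gdA D).
Local Notation K := (gdK D).
Local Notation "A \ox C" := (tp D A C) (at level 40, left associativity).
Local Notation tot A C := (tens_total (tensP D A C)).

Lemma tensmh_comm A A' C C' (p : A -> mult A') (q : C -> mult C') (m : mult (A \ox C)) : nondeg p -> nondeg q ->
  mext (tensmh (@emb R A') q) (mext (tensmh p (@emb R C)) m) = mext (tensmh p (@emb R C')) (mext (tensmh (@emb R A) q) m).
Proof.
move=> pn qn; have [ph _] := pn; have [qh _] := qn.
have n1 := tensmhL_nondeg (D := D) C pn; have n2 := tensmhR_nondeg (D := D) A' qn.
have n3 := tensmhL_nondeg (D := D) C' pn; have n4 := tensmhR_nondeg (D := D) A qn.
rewrite -!mext_comp//; congr (mext _ m); apply: tens_mhom_eq; try by apply: mext_mhom => //; case: n1; case: n4.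
move=> a c; rewrite (tensmhL C ph).2 (tensmhR A qh).2 (mext_tensmR qn) (mext_tensmL pn).
by rewrite (mext_emb pn) (mext_emb qn).
Qed.

Lemma ev_tensmh C C' (q : C -> mult C') s (z : CZ \ox C) (y : CZ \ox C') : ismhom q ->
  ev s (tensmh (@emb R CZ) q z y) = q (ev s z) (ev s y).
Proof.
move=> qh; have [hh hE] := tensmhR (D := D) CZ qh.
move: z; apply: (dense_bdlin_eq (tot CZ C)).
- exact: (bdlin_comp (evh_bdlin y hh) (@ev_bd _ _ _ C' s)).
- exact: (bdlin_comp (@ev_bd _ _ _ C s) (evh_bdlin _ qh)).
move=> _ [d [c ->]]; rewrite hE evE; move: y; apply: (dense_bdlin_eq (tot CZ C')).
- exact: (bdlin_comp (mact_bdlin _) (@ev_bd _ _ _ C' s)).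
- exact: (bdlin_comp (@ev_bd _ _ _ C' s) (mact_bdlin _)).
move=> _ [d' [c' ->]]; rewrite tensmE !evE (islinZ (ismhom_lin qh)) zsM.
by rewrite (islinZ (mult_lin _)) -scalerA scalerA mulrC -scalerA.
Qed.

Lemma fmult_mext C C' (q : C -> mult C') (F : G -> mult C) (m : mult (CZ \ox C)) : nondeg q -> fmult F m ->
  fmult (fun s => mext q (F s)) (mext (tensmh (@emb R CZ) q) m).
Proof.
move=> qn fm s; have [qh _] := qn; have n := tensmhR_nondeg (D := D) CZ qn.
apply: (dense_bdlin_eq (proj2 n)).
- exact: (bdlin_comp (mact_bdlin _) (@ev_bd _ _ _ C' s)).
- exact: (bdlin_comp (@ev_bd _ _ _ C' s) (mact_bdlin _)).
by move=> _ [z [y ->]]; rewrite (mextP n) !(ev_tensmh _ _ _ qh) fm (mextP qn).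
Qed.

Lemma fmult_tensm1 C (n : mult C) : fmult (fun=> n) (tensm 1 n : mult (CZ \ox C)).
Proof. by move=> s x; rewrite /ev slicel_tensm//; exact: zs_bd. Qed.

Lemma fmult_emb C (z : CZ \ox C) : fmult (fun s => emb (ev s z)) (emb z).
Proof. by move=> s x; rewrite /= evM. Qed.

Definition wl : mult (CZ \ox K) := mext (tensmh (@emb R CZ) (lam (D := D))) (wG (D := D)).

Lemma wlP : fmult (lamG (D := D)) wl.
Proof.
have [ln lE] := @lamP R G D; have := fmult_mext ln (@wGP R G D); congr fmult.
by apply/funext => s; exact: lE.
Qed.

Lemma th_mul (x y u v : gdL D) : (th x y : K) ** th u v = hdot u y *: th x v.
Proof.
apply: kact_ext => z; rewrite kactM !thE (islinZ (f := fun k => kact k z)); last exact: kact_linl.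
by rewrite thE hdotZl scalerA mulrC.
Qed.

(** Rank one operators on both sides cut the function s -> lambda_s down to one of its
    coefficients. *)
Lemma coefw x x0 f g (d : CZ) : Cc f -> Cc g -> (forall s, zs s d = ip (D := D) (lfun s f) g) ->
  tensm 1 (emb (th x (l2in g))) * wl * tensm 1 (emb (th (l2in f) x0)) = emb (tens d (th x x0) : CZ \ox K).
Proof.
move=> fC gC dE; apply: (fmult_uniq (fmultM (fmultM (fmult_tensm1 _) wlP) (fmult_tensm1 _))).
have := fmult_emb (tens d (th x x0) : CZ \ox K); congr fmult; apply/funext => s.
have [c _] := lamG_c (D := D) s.
rewrite -mulrA -emb_mact (cimpl_th _ c fC) -embM th_mul evE dE ip_dot//.
exact: Cc_lfun.
Qed.
End Comm.

Section Sep.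
Context {R : realType} {G : lcGroupType} {D : groupData R G}.
Implicit Types A C : cstarAlg R.
Local Notation "A \ox C" := (tp D A C) (at level 40, left associativity).

(** Let x be within e of z, and let Q and S be the forms of x y and of y. The functional u -> <x y,
    u y> vanishes at z because it is built from slices. So Q is approximated by its values at x -
    x', where x' is close to z, and Cauchy-Schwarz gives Q <= Q^(1/2) e S^(1/2) in the limit. *)
Lemma slice_sep A C (z : A \ox C) : (forall g : C -> R[i]^o, bdlin g -> slicer g z = 0) -> z = 0.
Proof.
move=> h; have tP := tensP D A C.
suff hx e x : 0 < e -> nm (z - zt (@tens R D A C) x) < e -> nm (zt (@tens R D A C) x) <= e.
  apply: (@nm_eps _ _ _ 2) => e e0; have [x xz] := zt_dense tP z e0.
  have := hx e x e0 xz; have := nm_tri (zt (@tens R D A C) x) z 0; rewrite !subr0; lra.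
move=> e0 xz; apply/(tform_norm tP); first exact: ltW.
move=> f g fp gp y; have fl : islin f by case: fp.
pose Y := tlmul x y; pose Ph (u : A \ox C) : R[i]^o := \sum_(q <- Y) \sum_(q' <- y)
  f (star q.1 ** (slicer (fun c => g (star q.2 ** (c ** q'.2))) u ** q'.1)).
have gb (q q' : A * C) : bdlin (fun c => g (star q.2 ** (c ** q'.2))).
  exact: (bdlin_comp (@emb_bd R C) (pos_coef_bdlin q.2 q'.2 gp)).
have PhE x' : Ph (zt (@tens R D A C) x') = tform f g Y (tlmul x' y).
  rewrite /Ph /tform; apply: eq_bigr => q _; rewrite big_allpairs_dep /= exchange_big /=.
  apply: eq_bigr => q' _; rewrite /zt; have sl := (slicer_bd (D := D) A (gb q q')).1.
  rewrite (islin_sum sl) cmul_suml cmul_sumr (islin_sum fl); apply: eq_bigr => p _.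
  by rewrite (slicerE _ _ (gb q q')) cmulZl cmulZr (islinZ fl) mulrC.
have Phb : bdlin Ph.
  apply: bdlin_sum => q; apply: bdlin_sum => q'.
  exact: (bdlin_comp (bdlin_comp (slicer_bd A (gb q q')) (@emb_bd R A)) (pos_coef_bdlin q.1 q'.1 fp)).
have Phz : Ph z = 0.
  rewrite /Ph big1// => q _; rewrite big1// => q' _.
  by rewrite (h _ (gb q q')) cmul0l cmul0r (islin0 fl).
have qE := tform_ge0 tP Y fp gp; have tE := tform_ge0 tP y fp gp.
set q := tform f g Y Y in qE *; set T := tform f g y y in tE *.
have reE (w : R[i]) : 0 <= w -> w = (complex.Re w)%:C%C.
  by rewrite lecE /=; case: w => a b /= /andP[/eqP-> _].
rewrite (reE q qE) (reE T tE) -rmorphM lecR.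
have q0 : 0 <= complex.Re q by rewrite -lecR -reE.
have T0 : 0 <= complex.Re T by rewrite -lecR -reE.
set Q := complex.Re q in q0 *; set S := complex.Re T in T0 *.
have key d : 0 < d -> Q <= Num.sqrt Q * (e * Num.sqrt S) + d.
  move=> d0; have [Phl [L L0 LP]] := Phb; have L1 : 0 < L + 1 by rewrite ltr_wpDl.
  have e1 : 0 < e - nm (z - zt (@tens R D A C) x) by rewrite subr_gt0.
  pose d' := Num.min (d / (L + 1)) (e - nm (z - zt (@tens R D A C) x)).
  have d'0 : 0 < d' by rewrite lt_min e1 divr_gt0.
  have [x' x'z] := zt_dense tP z d'0.
  pose xx := x ++ tscale (-1) x'.
  have ztE : zt (@tens R D A C) xx = zt (@tens R D A C) x - zt (@tens R D A C) x'.
    by rewrite /xx zt_cat (zt_scale tP) scaleN1r.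
  have nxx : nm (zt (@tens R D A C) xx) <= e.
    rewrite ztE (le_trans (nm_tri z _ _))// nmBC.
    have : d' <= e - nm (z - zt (@tens R D A C) x) by rewrite ge_min lexx orbT.
    by move: x'z; lra.
  have qsum : q = tform f g Y (tlmul xx y) + Ph (zt (@tens R D A C) x').
    by rewrite -PhE ztE (islinB Phl) subrK PhE.
  have b2 : cabs (Ph (zt (@tens R D A C) x')) <= d.
    have := LP (zt (@tens R D A C) x' - z); rewrite (islinB Phl) Phz subr0 -[nm (Ph _)]/(cabs _) => hb.
    rewrite (le_trans hb)// nmBC (le_trans (ler_wpM2l L0 (ltW x'z)))//.
    have : d' <= d / (L + 1) by rewrite ge_min lexx.
    rewrite ler_pdivlMr// => h1; apply: le_trans h1; rewrite mulrC ler_wpM2l ?(ltW d'0)//.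
    by rewrite lerDl.
  have b1 : cabs (tform f g Y (tlmul xx y)) <= Num.sqrt Q * (e * Num.sqrt S).
    rewrite -(@ler_pXn2r _ 2) ?nnegrE ?cabs_ge0 ?mulr_ge0 ?sqrtr_ge0 ?(ltW e0)//.
    rewrite (le_trans (tform_cs tP Y (tlmul xx y) fp gp))// !exprMn !sqr_sqrtr//.
    rewrite ler_wpM2l//; have := (iffLR (tform_norm tP xx (ltW e0)) nxx) f g fp gp y.
    by rewrite (reE _ (tform_ge0 tP _ fp gp)) -/T (reE T tE) -rmorphM lecR.
  have : cabs q <= Num.sqrt Q * (e * Num.sqrt S) + d by rewrite {1}qsum (le_trans (cabsD _ _))// lerD.
  by rewrite {1}(reE q qE) cabs_real ger0_norm.
have hQ : Q <= Num.sqrt Q * (e * Num.sqrt S) by apply/ler_addgt0Pr => d d0; exact: key.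
have sQ := sqr_sqrtr q0; have sS := sqr_sqrtr T0.
have [Q0|Qn] := eqVneq (Num.sqrt Q) 0.
  by rewrite -sQ Q0 expr0n /= mulr_ge0// sqr_ge0.
have Qp : 0 < Num.sqrt Q by rewrite lt_neqAle eq_sym Qn sqrtr_ge0.
rewrite -{1}sQ expr2 ler_pM2l// in hQ.
by rewrite -sQ -sS -exprMn ler_pXn2r ?nnegrE ?mulr_ge0 ?sqrtr_ge0 ?(ltW e0).
Qed.

Lemma slicer_tensmhL A A' C (p : A -> mult A') (g : C -> R[i]^o) (u : A \ox C) x c : ismhom p -> bdlin g ->
  slicer g (tensmh p (@emb R C) u (tens x c : A' \ox C)) = p (slicer (fun c' => g (c' ** c)) u) x.
Proof.
move=> ph gb; have [hh hE] := tensmhL (D := D) C ph.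
have gc : bdlin (fun c' => g (c' ** c)) by exact: (bdlin_comp (cmull_bd c) gb).
move: u; apply: (dense_bdlin_eq (tens_total (tensP D A C))).
- exact: (bdlin_comp (evh_bdlin _ hh) (slicer_bd A' gb)).
- exact: (bdlin_comp (slicer_bd A gc) (evh_bdlin x ph)).
move=> _ [a [c' ->]]; rewrite hE tensmE (slicerE _ _ gb) (slicerE _ _ gc) /=.
by rewrite (islinZ (ismhom_lin ph)).
Qed.

Lemma slice_swap A C (f : A -> R[i]^o) (g : C -> R[i]^o) (z : A \ox C) : bdlin f -> bdlin g ->
  f (slicer g z) = g (slicel f z).
Proof.
move=> fb gb; move: z; apply: (dense_bdlin_eq (tens_total (tensP D A C))).
- exact: (bdlin_comp (slicer_bd A gb) fb).
- exact: (bdlin_comp (slicel_bd C fb) gb).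
move=> _ [a [c ->]]; rewrite (slicerE _ _ gb) (slicelE _ _ fb) (islinZ fb.1) (islinZ gb.1).
exact: mulrC.
Qed.

Lemma zs_sep A (z z' : A \ox gdZ D) : (forall s, slicer (zs s) z = slicer (zs s) z') -> z = z'.
Proof.
move=> h; apply/eqP; rewrite -subr_eq0; apply/eqP; apply: slice_sep => g gb; apply: fun_sep => f fb.
rewrite (slice_swap _ fb gb) (islin0 fb.1) (_ : slicel f (z - z') = 0); first exact: islin0 gb.1.
apply: zs_ext => s; rewrite -(slice_swap _ fb (zs_bd s)) (islinB (slicer_bd A (zs_bd s)).1) h subrr.
by rewrite (islin0 fb.1) (islin0 (zs_lin s)).
Qed.

(** Slices in the second leg commute with p and separate the points of the tensor product. *)
Lemma tensmhL_inj A A' C (p : A -> mult A') : ismhom p -> injective p ->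
  injective (tensmh p (@emb R C) : A \ox C -> mult (A' \ox C)).
Proof.
move=> ph pi z z' e; apply/eqP; rewrite -subr_eq0; apply/eqP.
have [hh hE] := tensmhL (D := D) C ph.
have {}e : tensmh p (@emb R C) (z - z') = 0 :> mult (A' \ox C) by rewrite (islinB (ismhom_lin hh)) e subrr.
apply: emb_inj; rewrite (islin0 (@emb_lin R _)); apply: tens1c_eq => c; rewrite mul0r rmE.
rewrite -(islin0 (@emb_lin R (A \ox C))); congr emb; apply: slice_sep => g gb.
rewrite (slicer_rm _ _ _ gb) rm1; apply: pi; apply: mult_ext => x.
have := slicer_tensmhL (z - z') x c ph gb; rewrite e (islin0 (slicer_bd A' gb).1) => h.
rewrite (islin0 (ismhom_lin ph)); apply: etrans (esym h); congr (p (slicer _ _) x).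
by apply/funext => c'; rewrite rm_emb.
Qed.

Lemma mext_inj A B (p : A -> mult B) : nondeg p -> injective p -> injective (mext p).
Proof.
move=> pn pi m m' e; apply: mult_ext => a; apply: pi; apply: mult_ext => b.
by rewrite -!(mextP pn) e.
Qed.
End Sep.

Section Member.
Context {R : realType} {G : lcGroupType} {D : groupData R G}.
Local Notation CZ := (gdZ D).
Local Notation CG := (gdA D).
Local Notation K := (gdK D).
Local Notation L2 := (gdL D).
Local Notation "A \ox C" := (tp D A C) (at level 40, left associativity).
Local Notation tot A C := (tens_total (tensP D A C)).

(** Slicing the second leg at c0 l0 recovers m0 up to the nonzero scalar g(c0 l0), and the slices
    are bounded in operator norm. *)
Lemma span_slice (A C : cstarAlg R) (S : set (mult A)) m0 (c0 l0 : C) (g : C -> R[i]^o) : bdlin g -> g (c0 ** l0) != 0 ->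
  cspan [set x : mult (A \ox C) | exists m c, S m /\ x = tensm m (emb c)] (tensm m0 (emb c0)) -> cspan S m0.
Proof.
move=> gb g0 h; have [gl [L L0 gL]] := gb.
have sb := slicer_bd (D := D) A gb; have [sl [N N0 sN]] := sb.
suff : cspan S (g (c0 ** l0) *: m0).
  move=> h'; have := cspan_lin (k := (g (c0 ** l0) : R[i])^-1) h' (cspan0 S).
  by rewrite addr0 scalerA mulVf// scale1r.
apply: cspan_eps => e e0.
have M1 : 0 < N * nm l0 + 1 by rewrite ltr_wpDl// mulr_ge0// nm_ge0.
have /closure_nmP/(_ _ (divr_gt0 e0 M1))[_ [n [k [v [Sv ->]]]] xy] := h.
have [w wP] := choice (P := fun i (q : mult A * C) => S q.1 /\ v i = tensm q.1 (emb q.2)) (fun i => let: ex_intro m (ex_intro c h) := Sv i in ex_intro _ (m, c) h).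
pose m1 := \sum_(i < n) (k i * g ((w i).2 ** l0)) *: (w i).1.
exists m1.
  rewrite /m1; elim/big_ind: _ => [|a b ha hb|i _]; first exact: cspan0.
    by rewrite -[a]scale1r; exact: cspan_lin.
  rewrite -[_ *: _]addr0; apply: cspan_lin (cspan0 S); apply: cspan_sub.
  by case: (wP i).
rewrite ltr_pdivlMr// in xy; apply: le_lt_trans xy.
have hop x : (g (c0 ** l0) *: m0 - m1) x = slicer g ((tensm m0 (emb c0) - \sum_(i < n) k i *: v i) (tens x l0)).
  rewrite (islinB (ev_bdlin x).1) (islinB (ev_bdlin (tens x l0)).1) (islinB sl) multZE tensmE (slicerE _ _ gb) /=.
  congr (_ - _); rewrite (islin_sum (ev_bdlin x).1) (islin_sum (ev_bdlin (tens x l0)).1) (islin_sum sl).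
  apply: eq_bigr => i _; have [_ ->] := wP i.
  rewrite !multZE (islinZ sl) tensmE (slicerE _ _ gb) /= scalerA //.
set y := \sum_(i < n) _ in hop *; set z := tensm m0 (emb c0) - y in hop *.
apply: (@le_trans _ _ (N * nm l0 * nm z)); last first.
  by rewrite mulrC ler_wpM2l ?nm_ge0// lerDl.
apply: opn_le => [|x]; first by rewrite !mulr_ge0 ?nm_ge0.
rewrite hop (le_trans (sN _))// -!mulrA ler_wpM2l// (le_trans (nm_mact _ _))//.
rewrite [nm l0 * _]mulrCA ler_wpM2l ?nm_ge0// mulrC; exact: nm_tens (tensP D A C) _ _.
Qed.

Lemma tensm1M (A C : cstarAlg R) (m n : mult C) : tensm 1 (m * n) = tensm 1 m * tensm 1 n :> mult (A \ox C).
Proof. by rewrite tensmM mulr1. Qed.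

Lemma tensmh_comp (A B B' C : cstarAlg R) (p : A -> mult B) (r : B -> mult B') (m : mult (A \ox C)) :
  nondeg p -> nondeg r ->
  mext (tensmh r (@emb R C)) (mext (tensmh p (@emb R C)) m) = mext (tensmh (fun a => mext r (p a)) (@emb R C)) m.
Proof.
move=> pn rn; have [ph _] := pn; have n1 := tensmhL_nondeg (D := D) C pn; have n2 := tensmhL_nondeg (D := D) C rn.
have rpn := mext_nondeg rn pn; have [rph _] := rpn.
rewrite -mext_comp//; congr (mext _ m); apply: tens_mhom_eq.
- by apply: mext_mhom => //; case: n1.
- by case: (tensmhL (D := D) C rph).
by move=> a c; rewrite (tensmhL C ph).2 (tensmhL C rph).2 (mext_tensmL rn).
Qed.

Variables (S : coaction D) (X : cocrossed S).
Local Notation jA := (jA X).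
Local Notation jG := (jG X).
Let jAn : nondeg jA. Proof. by case: (jcov X). Qed.
Let jGn : nondeg jG. Proof. by case: (jcov X). Qed.
Let jAh : ismhom jA. Proof. by case: jAn. Qed.
Let jGh : ismhom jG. Proof. by case: jGn. Qed.
Let lamn : nondeg (lam (D := D)). Proof. by case: (@lamP R G D). Qed.

Definition Wl : mult (X \ox K) := mext (tensmh jG (@emb R K)) (wl (D := D)).
Definition Dl a : mult (X \ox K) :=
  mext (tensmh (@emb R X) (lam (D := D))) (mext (tensmh jA (@emb R CG)) (codelta a)).

Lemma wl_unitary : mstar (wl (D := D)) * wl (D := D) = 1 /\ wl (D := D) * mstar (wl (D := D)) = 1.
Proof.
have n := tensmhR_nondeg (D := D) CZ lamn; have [h1 h2] := @wG_unitary R G D.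
by rewrite /wl -(mext_star n) -!(mextM n) h1 h2 (mext1 n).
Qed.

Lemma Wl_unitary : mstar Wl * Wl = 1 /\ Wl * mstar Wl = 1.
Proof.
have n := tensmhL_nondeg (D := D) K jGn; have [h1 h2] := wl_unitary.
by rewrite /Wl -(mext_star n) -!(mextM n) h1 h2 (mext1 n).
Qed.

Lemma Dl_cov a : Dl a = Wl * tensm (jA a) 1 * mstar Wl.
Proof.
have n := tensmhR_nondeg (D := D) X lamn; have [_ _ /(_ a) /= h] := jcov X.
rewrite /Dl h !(mextM n) (mext_star n) (tensmh_comm _ jGn lamn) -/Wl.
by congr (_ * _ * _); rewrite (mext_tensmR lamn) (mext1 lamn).
Qed.

Lemma Dl_Wl a : Dl a * Wl = Wl * tensm (jA a) 1.
Proof. by rewrite Dl_cov -mulrA (proj1 Wl_unitary) mulr1. Qed.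

Lemma coefW x x0 f g (d : CZ) : Cc f -> Cc g -> (forall s, zs s d = ip (D := D) (lfun s f) g) ->
  tensm 1 (emb (th x (l2in g))) * Wl * tensm 1 (emb (th (l2in f) x0)) = tensm (jG d) (emb (th x x0)).
Proof.
move=> fC gC dE; have n := tensmhL_nondeg (D := D) K jGn.
have h (k : K) : tensm 1 (emb k) = mext (tensmh jG (@emb R K)) (tensm 1 (emb k)).
  by rewrite (mext_tensmL jGn) (mext1 jGn).
rewrite !h -!(mextM n) (coefw x x0 fC gC dE) (mext_emb n).
by rewrite (proj2 (tensmhL (D := D) K jGh)).
Qed.

Definition ZA : set (mult (X \ox K)) := [set m | exists a (k : K), m = tensm (jA a) (emb k)].
Definition BX : set (mult X) := [set m | exists a d, m = jA a * jG d].
Definition ZX : set (mult (X \ox K)) := [set x | exists m (c : K), BX m /\ x = tensm m (emb c)].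

Lemma tensm1_bd (A C : cstarAlg R) (m : mult A) : bdlin (fun c : C => tensm m (emb c) : mult (A \ox C)).
Proof.
split=> [k a b|]; first by rewrite (@emb_lin R C) (tensm_linr m).
exists (nm m); rewrite ?nm_ge0// => c; by rewrite -(nm_emb c) nm_tensm.
Qed.

Lemma Dl_span a (k : K) : cspan ZA (tensm 1 (emb k) * Dl a).
Proof.
have n1 := tensmhR_nondeg (D := D) X lamn; have n2 := tensmhL_nondeg (D := D) CG jAn.
have [hh hE] := tensmhL (D := D) CG jAh.
apply: (cspan_bdlin (star_total (proj2 lamn)) (f := fun k : K => tensm 1 (emb k) * Dl a)).
  exact: (bdlin_comp (tensm1_bd K 1) (mull_bd (Dl a))).
move=> _ [_ [c [k0 ->]] ->].
have -> : emb (star (lam c k0)) = emb (star k0) * lam (star c).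
  by rewrite emb_star emb_mact mstarM -emb_star (ismhomS _ (proj1 lamn)).
have [_ [t tE]] := @codelta_tilde _ _ _ S a (star c).
rewrite tensm1M -mulrA.
have -> : tensm 1 (lam (star c)) * Dl a = mext (tensmh (@emb R X) (lam (D := D))) (tensmh jA (@emb R CG) t).
  rewrite -(mext_emb n2) -tE (mextM n2) (mextM n1) -/(Dl a); congr (_ * _).
  by rewrite (mext_tensmL jAn) (mext1 jAn) (mext_tensmR lamn) (mext_emb lamn).
move: t {tE}; apply: (cspan_bdlin (tot S CG)
  (f := fun t => tensm 1 (emb (star k0)) * mext (tensmh (@emb R X) (lam (D := D))) (tensmh jA (@emb R CG) t))).
  exact: (bdlin_comp (bdlin_comp (mhom_bdlin hh) (mext_bd n1)) (mulr_bd _)).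
move=> _ [a' [c' ->]]; rewrite hE (mext_tensmR lamn) (mext_emb lamn) tensmM mul1r rmE.
by apply: cspan_sub; exists a', (rm (star k0) (lam c')).
Qed.

Lemma WZ_span f x0 M : Cc f -> cspan ZA M -> cspan ZX (M * Wl * tensm 1 (emb (th (l2in f) x0))).
Proof.
move=> fC hM; have := cspan_map (T := ZX) hM (bdlin_comp (mull_bd Wl) (mull_bd (tensm 1 (emb (th (l2in f) x0))))).
apply=> _ [a [k ->]]; move: k.
apply: (cspan_bdlin (star_total (@th_l2_total R G D)) (f := fun k => tensm (jA a) (emb k) * Wl * tensm 1 (emb (th (l2in f) x0)))).
  exact: (bdlin_comp (tensm1_bd K (jA a)) (bdlin_comp (mull_bd _) (mull_bd _))).
move=> _ [_ [g [x [gC ->]]] ->]; rewrite th_star.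
have [d dE] := coef_C0 (D := D) fC gC.
rewrite -[jA a]mulr1 -[emb (th x _)]mul1r -tensmM -!mulrA [_ * (Wl * _)]mulrA (coefW x x0 fC gC dE) tensmM mul1r.
by apply: cspan_sub; exists (jA a * jG d), (th x x0); split => //; exists a, d.
Qed.

(** The order of j_G and j_A can be exchanged up to closed span. For d a coefficient function,
    j_G(d) is a corner of W_lambda, and covariance moves j_A(a) across W_lambda; general d follow by
    [coef_dense]. *)
Lemma jGjA_span d a : cspan BX (jG d * jA a).
Proof.
have [x0 x0n] : exists x0 : L2, x0 <> 0.
  apply: contrapT => h; have [k] := @K_nontrivial R G D; apply; apply: kact_ext => x.
  have z (y : L2) : y = 0 by apply: contrapT => y0; apply: h; exists y.
  by rewrite [LHS]z [RHS]z.
have n0 : hdot x0 x0 != 0.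
  rewrite hdot_nm -(rmorph0 (real_complex R)) (inj_eq (@complexI R)) expf_neq0//.
  by apply/eqP => /nm_eq0.
apply: cspan_eps => e e0.
have N0 : 0 < 2 * nm (jA a) + 1 by rewrite ltr_wpDl// mulr_ge0// nm_ge0.
have [f [g [d' [fC gC d'E dd']]]] := coef_dense d (divr_gt0 e0 N0).
exists (jG d' * jA a); last first.
  rewrite -mulrBl -(islinB (ismhom_lin jGh)) (le_lt_trans (nmM _ _))//.
  have := mhom_bound (d - d') jGh; have := nm_ge0 (jA a); move: dd'; rewrite ltr_pdivlMr//.
  have := nm_ge0 (d - d'); have := nm_ge0 (jG (d - d')); nra.
pose kap (l : K) : R[i]^o := hdot (kact l x0) x0.
have kb : bdlin kap by exact: (bdlin_comp (kact_bdl x0) (hdot_bdl x0)).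
apply: (span_slice (c0 := th x0 x0) (l0 := th x0 x0) kb).
  by rewrite /kap th_mul (islinZ (f := fun k => kact k x0)) ?thE ?hdotZl ?mulf_neq0//; exact: kact_linl.
(* Covariance in the form Dl(a) W = W (j_A(a) ⊗ 1), compressed by rank one operators on both
   sides. *)
have -> : tensm (jG d' * jA a) (emb (th x0 x0)) = tensm 1 (emb (th x0 (l2in g))) * Dl a * Wl * tensm 1 (emb (th (l2in f) x0)).
  rewrite -(mulrA _ (Dl a)) Dl_Wl !mulrA -(mulrA _ (tensm (jA a) 1)) tensmM mulr1 mul1r.
  rewrite -[jA a in RHS]mul1r -[emb (th (l2in f) _)]mulr1 -tensmM mulrA (coefW x0 x0 fC gC d'E).
  by rewrite tensmM mulr1.
apply: WZ_span fC _; exact: Dl_span.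
Qed.

Lemma BX_mull m p : (forall b, BX b -> cspan BX (m * b)) -> cspan BX p -> cspan BX (m * p).
Proof. by move=> h hp; exact: (cspan_map hp (mulr_bd m) h). Qed.

Lemma jA_BX a p : cspan BX p -> cspan BX (jA a * p).
Proof.
apply: BX_mull => _ [a' [d ->]]; apply: cspan_sub; exists (a ** a'), d.
by rewrite (ismhomM _ _ jAh) mulrA.
Qed.

Lemma jG_BX d p : cspan BX p -> cspan BX (jG d * p).
Proof.
apply: BX_mull => _ [a' [d' ->]]; rewrite mulrA.
have := cspan_map (T := BX) (@jGjA_span d a') (mull_bd (jG d')); apply=> _ [a [d'' ->]].
by apply: cspan_sub; exists a, (d'' ** d'); rewrite (ismhomM _ _ jGh) mulrA.
Qed.

Lemma BX_closed x : (forall e : R, 0 < e -> exists2 y, cspan BX y & nm (x - y) < e) -> cspan BX x.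
Proof. exact: cspan_eps. Qed.
Lemma BX_mul p q : cspan BX p -> cspan BX q -> cspan BX (p * q).
Proof.
move=> hp hq; apply: (cspan_map hp (mull_bd q)) => _ [a [d ->]].
by rewrite -mulrA; apply: jA_BX; exact: jG_BX.
Qed.
Lemma BX_star p : cspan BX p -> cspan BX (mstar p).
Proof.
move=> /closure_nmP hp; apply: cspan_eps => e e0; have [y [n [k [v [Bv ->]]]] xy] := hp e e0.
exists (mstar (\sum_(i < n) k i *: v i)); last by rewrite -mstarB nm_mstar.
elim/big_ind: _ => [|a b ha hb|i _].
- by rewrite mstar0; exact: cspan0.
- by rewrite mstarD -[mstar a]scale1r; exact: cspan_lin.
- rewrite mstarZ -[_ *: _]addr0; apply: cspan_lin (cspan0 _); have [a [d ->]] := Bv i.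
  by rewrite mstarM -(ismhomS _ jAh) -(ismhomS _ jGh); exact: jGjA_span.
Qed.

Definition PX : cssub (multalg X) := @CsSub R (multalg X) (cspan BX) BX_closed (@cspan_lin R _ BX) (cspan0 BX) BX_mul BX_star.

Lemma PX_nd : cspan [set y | exists (p : mult X) x, PX p /\ y = p x] = setT.
Proof.
apply: (cspan_total (proj2 jAn)) => _ [a [x ->]].
move: x; apply: (cspan_bdlin (proj2 jGn) (mact_bdlin (jA a))) => _ [d [x ->]].
apply: cspan_sub; exists (jA a * jG d), x; split => //; apply: cspan_sub; by exists a, d.
Qed.

Lemma jA_mult a : exists n : mult (subalg PX), mext (sinc (P := PX)) n = jA a.
Proof.
have [|q hq|n [_ nE]] := @sub_mult _ _ PX PX_nd (jA a); last by exists n.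
  by move=> q hq; exact: jA_BX.
by rewrite -(ismhomS _ jAh); exact: jA_BX.
Qed.
Lemma jG_mult d : exists n : mult (subalg PX), mext (sinc (P := PX)) n = jG d.
Proof.
have [|q hq|n [_ nE]] := @sub_mult _ _ PX PX_nd (jG d); last by exists n.
  by move=> q hq; exact: jG_BX.
by rewrite -(ismhomS _ jGh); exact: jG_BX.
Qed.

Lemma sinc_inj : injective (sinc (P := PX)).
Proof. exact: sv_inj. Qed.

Lemma sub_hom (A : cstarAlg R) (j : A -> mult X) : ismhom j ->
  (forall a, exists n : mult (subalg PX), mext (sinc (P := PX)) n = j a) ->
  exists p : A -> mult (subalg PX), ismhom p /\ forall a, mext (sinc (P := PX)) (p a) = j a.
Proof.
move=> jh ex; have [p pE] := choice (P := fun a (n : mult (subalg PX)) => mext (sinc (P := PX)) n = j a) ex.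
have sn := sinc_nondeg PX_nd; have si := mext_inj sn sinc_inj.
exists p; split => //; split.
- have pl : islin p by move=> k a b; apply: si; rewrite (mext_lin sn) !pE (ismhom_lin jh).
  by move=> b k a a'; rewrite pl.
- by move=> a b; apply: si; rewrite (mextM sn) !pE (ismhomM _ _ jh).
- by move=> a; apply: si; rewrite (mext_star sn) !pE (ismhomS _ jh).
Qed.

Lemma sub_act (p : mult (subalg PX)) (b : subalg PX) : sinc (P := PX) (p b) = mext (sinc (P := PX)) p * sinc b.
Proof. exact: sinc_act PX_nd _ _. Qed.

(** An element j(a1 a2) m is p(a1) applied to j(a2) m, and products are total in A. *)
Lemma nondeg_of_span (A : cstarAlg R) (j : A -> mult X) (p : A -> mult (subalg PX)) m : ismhom j ->
  (forall a, mext (sinc (P := PX)) (p a) = j a) -> (forall a, cspan BX (j a * m)) ->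
  forall a (b : subalg PX), sinc b = j a * m -> cspan [set y | exists a b', y = p a b'] b.
Proof.
move=> jh pE hm a b bE; have [sh _] := sinc_nondeg PX_nd.
have hb a1 : exists b : subalg PX, sinc b = j a1 * m by exists (Scar (hm a1 : PX _)).
have [F FE] := choice (P := fun a1 (b : subalg PX) => sinc b = j a1 * m) hb.
have Fb : bdlin F.
  split=> [k a1 a2|]; first by apply: sinc_inj; rewrite (ismhom_lin sh) !FE (ismhom_lin jh) mulrDl mscAl.
  have [_ [N N0 hN]] := mhom_bdlin jh; exists (N * nm m); first by rewrite mulr_ge0 ?nm_ge0.
  by move=> a1; rewrite -nm_sv -[sv _]/(sinc _) FE (le_trans (nmM _ _))// mulrAC ler_wpM2r ?nm_ge0.
have -> : b = F a by apply: sinc_inj; rewrite FE.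
move: a {b bE}; apply: (cspan_bdlin (@cmul_total R A) Fb) => _ [a1 [a2 ->]]; apply: cspan_sub.
by exists a1, (F a2); apply: sinc_inj; rewrite sub_act pE !FE (ismhomM _ _ jh) mulrA.
Qed.

(** Both j_A and j_G act as multipliers on the closed span, where they form a covariant
    nondegenerate pair. The map which the universal property assigns to this pair satisfies the
    hypotheses of [univ_range]. *)
Lemma emb_range_crossed (m : mult X) : cspan BX m <-> exists x, m = emb x.
Proof.
have sn := sinc_nondeg PX_nd; have si := mext_inj sn sinc_inj; have [sh _] := sn.
have [p [ph pE]] := sub_hom jAh jA_mult; have [q [qh qE]] := sub_hom jGh jG_mult.
have dense (T : set (subalg PX)) : (forall m : mult X, BX m -> exists2 b, cspan T b & sinc b = m) -> cspan T = setT.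
  move=> hT; rewrite -subTset => b _; apply: cspan_eps => e e0.
  have /closure_nmP/(_ e e0)[y [n [k [v [Bv ->]]]] xy] : cspan BX (sv (b : scar PX)) := svP (b : scar PX).
  have [w wP] := choice (P := fun i b => cspan T b /\ sinc b = v i) (fun i => let: ex_intro2 b h h' := hT _ (Bv i) in ex_intro _ b (conj h h')).
  exists (\sum_(i < n) k i *: w i).
    elim/big_ind: _ => [|a c ha hc|i _]; first exact: cspan0.
      by rewrite -[a]scale1r; exact: cspan_lin.
    by rewrite -[_ *: _]addr0; apply: cspan_lin (cspan0 _); case: (wP i).
  apply: le_lt_trans xy; rewrite -nm_sv -[sv _]/(sinc _) (islinB (ismhom_lin sh)) (islin_sum (ismhom_lin sh)).
  rewrite le_eqVlt; apply/orP; left; apply/eqP; congr (nm (_ - _)); apply: eq_bigr => i _.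
  by rewrite (islinZ (ismhom_lin sh)); case: (wP i) => _ ->.
have T0 : cspan [set b : subalg PX | exists a d, sinc b = jA a * jG d] = setT.
  apply: dense => _ [a [d ->]].
  have h : cspan BX (jA a * jG d) by apply: cspan_sub; exists a, d.
  by exists (Scar (h : PX _)) => //; apply: cspan_sub; exists a, d.
have pn : nondeg p.
  split => //; apply: (cspan_total T0) => b [a [d bE]].
  apply: (nondeg_of_span (m := jG d) jAh pE _ bE) => a1; apply: cspan_sub; by exists a1, d.
have qn : nondeg q.
  split => //; apply: (cspan_total (star_total T0)) => _ [b [a [d bE]] ->].
  apply: (@nondeg_of_span CZ _ _ (jA (star a)) jGh qE _ (star d)) => [d1|]; first exact: jGjA_span.
  by rewrite -[sinc _]/(mstar (sinc b)) bE mstarM -(ismhomS _ jAh) -(ismhomS _ jGh).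
have pE' : (fun a => mext (sinc (P := PX)) (p a)) = jA by apply/funext.
have qE' : (fun a => mext (sinc (P := PX)) (q a)) = jG by apply/funext.
(* The covariance relation holds after the inclusion into M(X) and is pulled back along its
   extension, which is injective by [tensmhL_inj] and [mext_inj]. *)
have cov : covariant (D := D) p q.
  split => // a; have n := tensmhL_nondeg (D := D) CG sn.
  apply: (mext_inj n (tensmhL_inj sh sinc_inj)).
  have [_ _ /(_ a) /= h] := jcov X.
  rewrite !(mextM n) (mext_star n) (tensmh_comp _ pn sn) (tensmh_comp _ qn sn) pE' qE' h.
  by rewrite (mext_tensmL sn) pE.
have [hm [[hn hA hG] _]] := @juniv _ _ _ _ X _ p q cov.
have hE x : mext (sinc (P := PX)) (hm x) = emb x.
  have [h0 [_ u0]] := @juniv _ _ _ _ X _ jA jG (jcov X).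
  have e1 : h0 = @emb R X.
    by apply: u0; split => [|a|d]; [exact: nondeg_emb|exact: mext_emb_id|exact: mext_emb_id].
  have e2 : h0 = fun x => mext (sinc (P := PX)) (hm x).
    apply: u0; split => [|a|d]; first exact: mext_nondeg.
      by rewrite mext_comp// hA.
    by rewrite mext_comp// hG.
  by rewrite -e1 e2.
exact: (univ_range PX_nd hn hE m).
Qed.

Lemma mhom_eqX (B : cstarAlg R) (h k : X -> mult B) : nondeg h -> nondeg k ->
  (forall a, mext h (jA a) = mext k (jA a)) -> (forall d, mext h (jG d) = mext k (jG d)) -> h = k.
Proof.
move=> hn kn hA hG; apply/funext => x.
have : cspan BX (emb x) by apply/emb_range_crossed; exists x.
move=> /closure_nmP hx; apply/eqP; rewrite -subr_eq0; apply/eqP.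
apply: (@nm_eps _ _ _ 4) => e e0; have [_ [n [c [v [Bv ->]]]] xy] := hx e e0.
set y := \sum_(i < n) _ in xy.
have yE : mext h y = mext k y.
  rewrite (islin_sum (mext_lin hn)) (islin_sum (mext_lin kn)); apply: eq_bigr => i _.
  rewrite (islinZ (mext_lin hn)) (islinZ (mext_lin kn)); have [a [d ->]] := Bv i.
  by rewrite (mextM hn) (mextM kn) hA hG.
have -> : h x - k x = mext h (emb x - y) - mext k (emb x - y).
  by rewrite (islinB (mext_lin hn)) (islinB (mext_lin kn)) (mext_emb hn) (mext_emb kn) yE opprB addrA subrK.
have h1 := mext_bound2 (emb x - y) hn; have h2 := mext_bound2 (emb x - y) kn.
rewrite (le_trans (nmB _ _))//; lra.
Qed.
End Member.

(** * Normal coactions *)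

Section Translates.
Context {R : realType} {G : lcGroupType} {D : groupData R G}.
Local Notation CZ := (gdZ D).
Local Notation K := (gdK D).
Local Notation "A \ox C" := (tp D A C) (at level 40, left associativity).

Lemma Cc_dense (d : CZ) (e : R) : 0 < e -> exists2 p : G -> R[i]^o, Cc p & forall s, cabs (p s - zs s d) <= e.
Proof.
move=> e0; have [dc dv] := zs_C0 d; have e0' : 0 < e%:C%C :> R[i] by rewrite ltcR.
have [K cK hK] := dv _ e0'; have [//|b bT [b1 bK]] := @plateau R G K setT cK openT.
exists (fun t => cr b t * zs t d); first exact: (CcM (csupp_Cc bT) dc).
move=> s; have [Ks|nK] := pselect (K s); first by rewrite /cr bK// mul1r subrr cabs0 ltW.
rewrite -{2}[zs s d]mul1r -mulrBl cabsM -rmorphB cabs_real.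
have [_ b0 _] := bT; have hb : `|b s - 1| <= 1 by rewrite ler_norml; have := b0 s; have := b1 s; lra.
have h2 : cabs (zs s d) < e by rewrite -ltcR' -cabsE hK.
by rewrite (le_trans (ler_wpM2r (cabs_ge0 _) hb))// mul1r ltW.
Qed.

Lemma C0_unif (d : CZ) (e : R) : 0 < e -> \forall h \near (1%g : G), forall u, cabs (zs (h * u)%g d - zs u d) < e.
Proof.
move=> e0; have e3 : 0 < e / 3 by rewrite divr_gt0.
have [p [pc [K cK K0]] pd] := Cc_dense d e3.
apply: filterS (unif_cts pc cK K0 e3) => h hu u; have := hu u; rewrite -[nm _]/(cabs _) => h1.
have h2 := pd u; have h3 := pd (h * u)%g.
rewrite (_ : _ - _ = - (p (h * u)%g - zs (h * u)%g d) + ((p (h * u)%g - p u) + (p u - zs u d))); last by zmod.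
rewrite (le_lt_trans (cabsD _ _))// cabsN.
have h4 := cabsD (p (h * u)%g - p u) (p u - zs u d); lra.
Qed.

Lemma trV_ex (d : CZ) (r : G) : exists d' : CZ, forall t, zs t d' = zs (r * t^-1)%g d.
Proof.
apply: zex; have [dc dv] := zs_C0 d; split.
  move=> t; apply: (@continuous_comp _ _ _ (fun t => r * t^-1)%g (fun t => zs t d)); last exact: dc.
  by apply: (@continuous_comp _ _ _ (fun t : G => t^-1)%g (fun t => r * t)%g); [exact: invg_cts|exact: lmul_cts].
move=> e e0; have [K cK hK] := dv e e0.
exists [set x | exists s t, [/\ K s, [set r] t & x = (s^-1 * t)%g]].
  rewrite (_ : [set x | _] = (fun s => s^-1 * r)%g @` K).
    apply: continuous_compact => //; apply: continuous_subspaceT => s.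
    by apply: (@continuous_comp _ _ _ (fun t : G => t^-1)%g (fun t => t * r)%g); [exact: invg_cts|exact: rmul_cts].
  by apply/seteqP; split=> [x [s [t [Ks -> ->]]]|x [s Ks <-]]; [exists s|exists s, r].
move=> t nK; apply: hK => Kr; apply: nK; exists (r * t^-1)%g, r; split => //.
by rewrite invgM invgK -mulgA mulVg mulg1.
Qed.

Lemma rtr_ex (d : CZ) (r : G) : exists d' : CZ, forall t, zs t d' = zs (t * r)%g d.
Proof.
apply: zex; have [dc dv] := zs_C0 d; split.
  by move=> t; apply: (@continuous_comp _ _ _ (fun t => t * r)%g (fun t => zs t d)); [exact: rmul_cts|exact: dc].
move=> e e0; have [K cK hK] := dv e e0; exists ((fun s => s * r^-1)%g @` K).
  by apply: continuous_compact => //; apply: continuous_subspaceT; exact: rmul_cts.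
move=> t nK; apply: hK => Kr; apply: nK; exists (t * r)%g => //.
by rewrite -mulgA mulgV mulg1.
Qed.

Lemma trV_fun (d : CZ) : exists F : G -> CZ, (forall r t, zs t (F r) = zs (r * t^-1)%g d) /\ continuous F.
Proof.
have [F FE] := choice (P := fun r (d' : CZ) => forall t, zs t d' = zs (r * t^-1)%g d) (trV_ex d).
exists F; split => //; apply/cts_nm => r e e0; have e2 : 0 < e / 2 by rewrite divr_gt0.
have h1 : nbhs (r * r^-1)%g [set h : G | forall u, cabs (zs (h * u)%g d - zs u d) < e / 2].
  by rewrite mulgV; exact: C0_unif.
apply: (@filterS _ _ (nbhs_filter r) _ _ _ (@rmul_cts G r^-1%g r _ h1)) => s /= hs.
rewrite nmBC; apply: (@le_lt_trans _ _ (e / 2)); last by lra.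
apply: CZ_norm => [|t]; first exact: ltW.
rewrite (islinB (zs_lin t)) !FE; have := hs (r * t^-1)%g.
by rewrite mulgA -(mulgA s) mulVg mulg1 => /ltW.
Qed.

(** In the second variable s, the function d(r s^-1) is the right translate of d by s^-1, so
    applying j_G to the first leg gives what [actfun] attaches to j_G(d). As a function of r it is
    norm continuous, which yields the multiplier. *)
Lemma trV_mult (d : CZ) : exists (F : G -> CZ) (m : mult (CZ \ox CZ)),
  (forall r t, zs t (F r) = zs (r * t^-1)%g d) /\ fmult (fun r => emb (F r)) m.
Proof.
have [F [FE Fc]] := trV_fun d; have [F' [F'E F'c]] := trV_fun (star d).
have FF r : F' r = star (F r) by apply: zs_ext => t; rewrite F'E zs_star [in RHS]zs_star FE.
exists F; have [|||m mE] := @fmult_ex R G D CZ (fun r => emb (F r)) (2 * nm d).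
- by move=> c; exact: (cts_bdlin (cmull_bd c) Fc).
- move=> c; apply: (cts_ext (cts_bdlin (cmull_bd c) F'c)) => r /=.
  by rewrite FF.
- move=> r; rewrite nm_emb; apply: CZ_norm => [|t]; first by rewrite mulr_ge0// nm_ge0.
  by rewrite FE zs_bound.
by exists m.
Qed.

Lemma sep_point (s : G) : s <> 1%g -> exists d : CZ, zs s d <> zs 1%g d.
Proof.
move=> s1; have op : open (~` [set s]).
  by apply: closed_openC; apply: accessible_closed_set1; apply: hausdorff_accessible; exact: (@lcg_hausdorff G).
have n1 : nbhs (1%g : G) (~` [set s]) by apply: open_nbhs_nbhs; split => //= h; apply: s1.
have [b bV b1] := bump_fun (R := R) n1; have [d dE] := zex (D := D) (csupp_C0 bV).
exists d; rewrite !dE b1; have [_ _ [K cK [KV K0]]] := bV.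
by rewrite K0 => [|/KV/(_ erefl)//]; move/eqP; rewrite eq_sym -[1%:C%C]/(1 : R[i]) oner_eq0.
Qed.

Lemma slice_trV A (jG : CZ -> mult A) (F : G -> CZ) (m : mult (CZ \ox CZ)) (s : G) (e : CZ) y : nondeg jG ->
  fmult (fun r => emb (F r)) m -> (forall r, zs r e = zs s (F r)) ->
  slicer (zs s) (mext (tensmh jG (@emb R CZ)) m y : A \ox CZ) = jG e (slicer (zs s) y).
Proof.
move=> jn mE eE; have [jh _] := jn; have n := tensmhL_nondeg (D := D) CZ jn.
have sb := slicer_bd (D := D) A (@zs_bd R G D s).
move: y; apply: (dense_bdlin_eq (proj2 n)).
- exact: (bdlin_comp (mact_bdlin _) sb).
- exact: (bdlin_comp sb (mact_bdlin _)).
move=> _ [z [y ->]]; rewrite (mextP n); have [hh hE] := tensmhL (D := D) CZ jh.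
move: y; apply: (dense_bdlin_eq (tens_total (tensP D A CZ))).
- exact: (bdlin_comp (mact_bdlin _) sb).
- exact: (bdlin_comp (bdlin_comp (mact_bdlin _) sb) (mact_bdlin _)).
move=> _ [x [c ->]]; rewrite !(slicer_tensmhL _ _ _ jh (zs_bd s)).
have fE : (fun c' => zs s (c' ** c)) = fun c' => zs s c *: zs s c'.
  by apply/funext => c'; rewrite zsM mulrC.
have sc (w : CZ \ox CZ) : slicer (fun c' => zs s (c' ** c)) w = zs s c *: slicer (zs s) w.
  have gc : bdlin (fun c' => zs s (c' ** c)) by exact: (bdlin_comp (cmull_bd c) (zs_bd s)).
  move: w; apply: (dense_bdlin_eq (tens_total (tensP D CZ CZ))).
  - exact: (slicer_bd CZ gc).
  - have [l [N N0 hN]] := slicer_bd (D := D) CZ (@zs_bd R G D s); split=> [k u v|].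
      by rewrite l scalerDr !scalerA mulrC.
    exists (cabs (zs s c) * N); first by rewrite mulr_ge0 ?cabs_ge0.
    by move=> u; rewrite nmZ -mulrA ler_wpM2l ?cabs_ge0.
  by move=> _ [u [v ->]]; rewrite (slicerE _ _ gc) (slicerE _ _ (zs_bd s)) zsM scalerA mulrC.
rewrite !sc !(islinZ (ismhom_lin jh)) !multZE (islinZ (mult_lin _)); congr (_ *: _).
rewrite -mactM -(ismhomM _ _ jh); congr (jG _ x); apply: zs_ext => r.
rewrite zsM !(slice_swap _ (zs_bd r) (zs_bd s)) -!/(ev r _) mE /= zsM eE.
by [].
Qed.
End Translates.

Section AdV.
Context {R : realType}.
Implicit Types A B : cstarAlg R.

Lemma Ad_nondeg A B (p : A -> mult B) (V : mult B) : nondeg p -> mstar V * V = 1 -> V * mstar V = 1 ->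
  nondeg (fun a => V * p a * mstar V) /\ forall m, mext (fun a => V * p a * mstar V) m = V * mext p m * mstar V.
Proof.
move=> pn V1 V2; have [ph pd] := pn.
have hn : nondeg (fun a => V * p a * mstar V).
  split; first split.
  - have l : islin (fun a => V * p a * mstar V).
      exact: (bdlin_comp (bdlin_comp (mhom_bdlin ph) (mulr_bd V)) (mull_bd (mstar V))).1.
    by move=> b k x y; rewrite l.
  - move=> a b; rewrite (ismhomM _ _ ph) -[mmul _ _]/(V * p a * mstar V * (V * p b * mstar V)).
    by rewrite !mulrA -(mulrA _ (mstar V) V) V1 mulr1.
  - by move=> a; rewrite (ismhomS _ ph) !mstarM mstarK mulrA.
  have Vs b : b = V (mstar V b) by rewrite -mactM V2.
  rewrite -subTset => b _; rewrite (Vs b).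
  move: (mstar V b); apply: (cspan_bdlin pd (mact_bdlin V)) => _ [a [c ->]].
  apply: cspan_sub; exists a, (V c); rewrite !mactM; congr (V (p a _)).
  by rewrite -mactM V1.
split => // m; apply: (mext_uniq hn) => a b; rewrite -!mactM !mulrA -(mulrA _ (mstar V) V) V1 mulr1.
rewrite -(mulrA V) -[p (m a)](mext_emb pn) emb_mact (mextM pn) (mext_emb pn) //.
Qed.
End AdV.

Section Normal.
Context {R : realType} {G : lcGroupType} {D : groupData R G}.
Local Notation CZ := (gdZ D).
Local Notation CG := (gdA D).
Local Notation K := (gdK D).
Local Notation "A \ox C" := (tp D A C) (at level 40, left associativity).

Lemma tens_neq0 (A C : cstarAlg R) (a : A) (c : C) : a <> 0 -> c <> 0 -> tens a c <> 0 :> A \ox C.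
Proof.
move=> a0 c0 h; apply: c0; apply: fun_sep => g gb; rewrite (islin0 gb.1).
apply: contrapT => gc; apply: a0; have := slicerE (D := D) a c gb.
rewrite h (islin0 (slicer_bd (D := D) A gb).1) => e.
have : (g c : R[i])^-1 *: (g c *: a) = a by rewrite scalerA mulVf ?scale1r//; exact/eqP.
by rewrite -e scaler0.
Qed.

Lemma tensm1_inj (A C : cstarAlg R) (a : A) (m n : mult C) : a <> 0 ->
  tensm 1 m = tensm 1 n :> mult (A \ox C) -> m = n.
Proof.
move=> a0 h; apply: mult_ext => c; apply: contrapT => mn.
apply: (@tens_neq0 A C a (m c - n c) a0); first by move=> /eqP; rewrite subr_eq0 => /eqP.
rewrite (islinB (tens_linr (tensP D A C) a)).
have := congr1 (fun u : mult (A \ox C) => u (tens a c)) h.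
by rewrite !tensmE !mact1 => ->; rewrite subrr.
Qed.

Context (X : crossedProducts D) (S : coaction D).
Local Notation XS := (cox X S).
Local Notation Y := (coxx X S).
Local Notation al := (dual_action (X := cox X S)).
Local Notation jA := (jA XS).
Local Notation jG := (jG XS).
Let jAn : nondeg jA. Proof. by case: (jcov XS). Qed.
Let jGn : nondeg jG. Proof. by case: (jcov XS). Qed.
Let jAh : ismhom jA. Proof. by case: jAn. Qed.
Let jGh : ismhom jG. Proof. by case: jGn. Qed.
Let lamn : nondeg (lam (D := D)). Proof. by case: (@lamP R G D). Qed.
Let iAn : nondeg (iA Y). Proof. by case: (icov Y). Qed.
Let iAh : ismhom (iA Y). Proof. by case: iAn. Qed.

Definition cop : XS -> mult (S \ox K) :=
  cointegrated XS (fun a => mext (tensmh (@emb _ S) (lam (D := D))) (codelta a))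
       (fun d => tensm (mone S) (Mrep d)).
Definition reg1 (x : XS) : mult (XS \ox K) := mext (tensmh (@emb _ XS) (Mrep (D := D))) (actfun (D := D) al x).

(* In the remaining steps, a default value taken by one of the definite descriptions
   would make [Phi] or [regular] constant, hence [S \ox K] trivial. *)
Variables (F : mult (XS \ox K) -> S \ox K) (b : S).
Hypothesis Fbij : set_bij (range (regular (D := D) (Y := Y))) setT F.
Hypothesis FE : forall x : Y, Phi x = emb (F (regular (D := D) (Y := Y) x)).
Hypothesis b0 : b <> 0.

Lemma SK_neq10 : 1 <> 0 :> mult (S \ox K).
Proof.
move=> h; have [k k0] := @K_nontrivial R G D; apply: (tens_neq0 b0 k0).
by apply: emb_inj; exact: mult_trivial.
Qed.

Lemma F_surj t : exists y : Y, Phi y = emb t.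
Proof.
have [_ _ h] := Fbij; have [m [y _ <-] e] := h t I.
by exists y; rewrite FE e.
Qed.

Lemma PhiP : [/\ nondeg (Phi (X := X) (S := S)), (forall x, mext (Phi (X := X) (S := S)) (iA Y x) = cop x)
  & forall s, mext (Phi (X := X) (S := S)) (iG Y s) = tensm (mone S) (rhoG s)].
Proof.
have [ex|nex] := pselect (exists h : Y -> mult (S \ox K), [/\ nondeg h, (forall x, mext h (iA Y x) = cop x)
  & forall s, mext h (iG Y s) = tensm (mone S) (rhoG s)]).
  exact: (@the_spec _ (fun=> mone _) _ ex).
exfalso; apply: SK_neq10; have [y yE] := F_surj 0.
have := the_none (fun=> mone (S \ox K)) nex => h.
have : Phi y = 1 by rewrite -[LHS]/(the _ _ y) h.
by rewrite yE (islin0 (@emb_lin R _)).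
Qed.

Lemma copP : [/\ nondeg cop, (forall a, mext cop (jA a) = mext (tensmh (@emb _ S) (lam (D := D))) (codelta a))
  & forall d, mext cop (jG d) = tensm (mone S) (Mrep d)].
Proof.
have [ex|nex] := pselect (exists h : XS -> mult (S \ox K), [/\ nondeg h,
  (forall a, mext h (jA a) = mext (tensmh (@emb _ S) (lam (D := D))) (codelta a))
  & forall d, mext h (jG d) = tensm (mone S) (Mrep d)]).
  exact: (@the_spec _ (fun=> mone _) _ ex).
exfalso; apply: SK_neq10; have := the_none (fun=> mone (S \ox K)) nex => h.
have [pn pA _] := PhiP; have := pA 0; rewrite (islin0 (ismhom_lin iAh)) (islin0 (mext_lin pn)) => ->.
by rewrite -[cop]/(the _ _) h.
Qed.

Lemma cop_al s x : cop (al s x) = tensm 1 (rhoG s) * cop x * mstar (tensm 1 (rhoG s)).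
Proof.
have [pn pA pG] := PhiP; have [_ _ h] := icov Y.
rewrite -!pA h -[mmul _ _]/(iG Y s * iA Y x * mstar (iG Y s)) !(mextM pn) (mext_star pn) pG.
by [].
Qed.

Definition dual_spec s (h : XS -> XS) := [/\ ishom h, bijective h,
      (forall a, mext (fun x => emb (h x)) (jA a) = jA a)
    & (forall d e : CZ, rtrans s d e -> mext (fun x => emb (h x)) (jG d) = jG e)].

(* The dual action is not constructed: were the description void, covariance of [Phi] would make
   [Mrep d] commute with [rhoG s], forcing [s = 1], where the identity qualifies. *)
Lemma dualP s : dual_spec s (al s).
Proof.
have [ex|nex] := pselect (exists h, dual_spec s h); first exact: (@the_spec _ id _ ex).
have alE : al s = id by exact: (the_none id nex).
exfalso; apply: nex; exists id.
have [cn _ cG] := copP; have [ch _] := cn; have [_ r1 r2] := rhoG_c (D := D) s.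
set r := rhoG (D := D) s in r1 r2; set V : mult (S \ox K) := tensm 1 r.
have V1 : mstar V * V = 1 by rewrite /V tensm_star mstar1 -tensm1M r1 tensm11.
have V2 : V * mstar V = 1 by rewrite /V tensm_star mstar1 -tensm1M r2 tensm11.
have cE : cop = fun x => V * cop x * mstar V by apply/funext => x; rewrite -cop_al alE.
have mE m : mext cop m = V * mext cop m * mstar V.
  by have [_ h] := Ad_nondeg cn V1 V2; rewrite -h -cE.
have dE (d e : CZ) : (forall t, zs t e = zs (t * s)%g d) -> d = e.
  move=> h; apply: Mrep_inj; apply: (tensm1_inj b0).
  have := mE (jG d); rewrite cG -/V -[mone S]/(1 : mult S) -tensm1M (rho_M h) -/r tensm1M -mulrA V2 mulr1.
  by [].
have s1 : s = 1%g.
  apply: contrapT => /(@sep_point R G D)[d]; apply; have [e eE] := rtr_ex d s.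
  by rewrite {2}(dE d e eE) eE mul1g.
split => //.
- by exists id.
- by move=> a; exact: mext_emb_id.
- move=> d e h; rewrite -(dE d e) => [|t]; first exact: mext_emb_id.
  exact: h.
Qed.

(** Phi factors through the regular representation and takes both the values b ⊗ k and 0. This
    excludes the defaults in the two descriptions that follow. *)
Lemma regular_not_const c : ~ (forall y, regular (D := D) (Y := Y) y = c).
Proof.
move=> h; apply: SK_neq10; have [k k0] := @K_nontrivial R G D.
exfalso; apply: (tens_neq0 b0 k0); have [y yE] := F_surj (tens b k); have [y' y'E] := F_surj 0.
by apply: emb_inj; rewrite -yE -y'E !FE !h.
Qed.

Lemma regP : [/\ nondeg (regular (D := D) (Y := Y)), (forall x, mext (regular (D := D) (Y := Y)) (iA Y x) = reg1 x)
  & forall s, mext (regular (D := D) (Y := Y)) (iG Y s) = tensm (mone XS) (lamG s)].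
Proof.
have [ex|nex] := pselect (exists h : Y -> mult (XS \ox K), [/\ nondeg h, (forall x, mext h (iA Y x) = reg1 x)
  & forall s, mext h (iG Y s) = tensm (mone XS) (lamG s)]).
  exact: (@the_spec _ (fun=> mone _) _ ex).
exfalso; apply: (@regular_not_const 1) => y.
have := the_none (fun=> mone (XS \ox K)) nex => h.
by rewrite -[LHS]/(the _ _ y) h.
Qed.

Lemma reg1_nondeg : nondeg reg1.
Proof.
have [rn rA _] := regP; have := mext_nondeg rn iAn.
by rewrite (_ : (fun a => _) = reg1)//; apply/funext.
Qed.

(** A void description at x would be void at 2 x as well, since the dual action is linear. Then
    [reg1] would take the value 1 at both, and linearity would make its target zero. *)
Lemma actP x s z : slicer (zs s) (actfun (D := D) al x z) = al (s^-1)%g x ** slicer (zs s) z.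
Proof.
pose good x := exists m : mult (XS \ox CZ), forall s z, slicer (zs s) (m z) = al (s^-1)%g x ** slicer (zs s) z.
suff gx : good x by exact: (@the_spec _ (mone _) (fun m : mult (XS \ox CZ) => forall s z, slicer (zs s) (m z) = al (s^-1)%g x ** slicer (zs s) z) gx).
apply: contrapT => bad; have mn := tensmhR_nondeg (D := D) XS (@Mrep_nondeg R G D).
have bad1 x' : ~ good x' -> reg1 x' = 1.
  by move=> bx; rewrite /reg1 /actfun (the_none (mone (XS \ox CZ)) bx) (mext1 mn).
have bad2 : ~ good (2 *: x).
  move=> [m mE]; apply: bad; exists (2^-1 *: m) => s' z'.
  have [[hl _ _] _ _ _] := dualP s'^-1%g.
  rewrite multZE (islinZ (slicer_bd (D := D) XS (@zs_bd R G D s')).1) mE (islinZ hl) cmulZl scalerA mulVf ?scale1r//.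
have [rh _] := reg1_nondeg; have := bad1 _ bad2; rewrite (islinZ (ismhom_lin rh)) (bad1 _ bad) => e.
have e0 : 1 = 0 :> mult (XS \ox K).
  by have := congr1 (fun u => u - 1) e; rewrite subrr scaler_nat mulr2n addrK.
by apply: (@regular_not_const 0) => y; exact: mult_trivial.
Qed.

Lemma al_nondeg s : nondeg (fun x => emb (al s x)).
Proof.
have [hh [g gK Kg] _ _] := dualP s; split; first exact: ismhom_emb.
have [_ e] := @nondeg_emb R XS; apply: (cspan_total e) => _ [a [c ->]]; apply: cspan_sub.
by exists (g a), c; rewrite Kg.
Qed.

Lemma actfun_mul (m : mult XS) (M : mult (XS \ox CZ)) (N : G -> mult XS) x :
  (forall s, mext (fun x => emb (al s^-1%g x)) m = N s) ->
  (forall s z, slicer (zs s) (M z) = N s (slicer (zs s) z)) ->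
  actfun (D := D) al (m x) = M * actfun (D := D) al x.
Proof.
move=> mN MN; apply: mult_ext => z; apply: zs_sep => s.
rewrite mactM MN !actP multM; congr (_ ** _).
apply: emb_inj; rewrite -(mext_emb (al_nondeg _)) emb_mact (mextM (al_nondeg _)) mN (mext_emb (al_nondeg _)).
by rewrite emb_mact.
Qed.

Lemma reg1_mext (m : mult XS) (M : mult (XS \ox CZ)) (N : G -> mult XS) :
  (forall s, mext (fun x => emb (al s^-1%g x)) m = N s) ->
  (forall s z, slicer (zs s) (M z) = N s (slicer (zs s) z)) ->
  mext reg1 m = mext (tensmh (@emb _ XS) (Mrep (D := D))) M.
Proof.
move=> mN MN; have mn := tensmhR_nondeg (D := D) XS (@Mrep_nondeg R G D).
apply: (mext_uniq reg1_nondeg) => x z; rewrite [in RHS]/reg1 (actfun_mul _ mN MN) (mextM mn).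
by [].
Qed.

Lemma reg1_jA a : mext reg1 (jA a) = tensm (jA a) 1.
Proof.
have := reg1_mext (m := jA a) (M := tensm (jA a) 1) (N := fun=> jA a).
move=> -> => [|s|s z].
- by rewrite (mext_tensmR (@Mrep_nondeg R G D)) (mext1 (@Mrep_nondeg R G D)).
- by case: (dualP s^-1%g).
- by rewrite slicer_tensm//; exact: zs_bd.
Qed.

Lemma reg1_jG d : exists (E : G -> CZ) (m : mult (CZ \ox K)), [/\ forall r t, zs t (E r) = zs (r * t^-1)%g d,
  fmult (fun r => Mrep (E r)) m & mext reg1 (jG d) = mext (tensmh jG (@emb _ K)) m].
Proof.
have [E [m [EE mE]]] := trV_mult d; have Mn := @Mrep_nondeg R G D.
exists E, (mext (tensmh (@emb _ CZ) (Mrep (D := D))) m); split => //.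
  have := fmult_mext Mn mE; congr fmult; apply/funext => r; exact: mext_emb.
rewrite -(tensmh_comm m jGn Mn).
have [T TE] := choice (P := fun s (e : CZ) => forall t, zs t e = zs (t * s^-1)%g d) (fun s => rtr_ex d s^-1%g).
apply: (reg1_mext (N := fun s => jG (T s))) => [s|s z].
  by have [_ _ _ h] := dualP s^-1%g; apply: h => t; exact: TE.
by apply: (slice_trV z jGn mE) => r; rewrite TE EE.
Qed.

Section Conj.
Variable U : mult K.
Hypotheses (Us : mstar U = U) (UU : U * U = 1)
  (UM : forall d d' : CZ, (forall t, zs t d' = zs t^-1%g d) -> U * Mrep (D := D) d * U = Mrep d')
  (Ur : forall s, U * rhoG (D := D) s * U = lamG s).

Definition Vop : mult (XS \ox K) := tensm 1 U * mstar (Wl XS).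

Lemma Vs : mstar Vop = Wl XS * tensm 1 U.
Proof. by rewrite /Vop mstarM mstarK tensm_star mstar1 Us. Qed.
Lemma V_unitary : mstar Vop * Vop = 1 /\ Vop * mstar Vop = 1.
Proof.
have [W1 W2] := Wl_unitary XS; rewrite Vs /Vop; split.
  by rewrite mulrA -(mulrA (Wl XS)) -tensm1M UU tensm11 mulr1.
by rewrite mulrA -(mulrA (tensm 1 U)) W1 mulr1 -tensm1M UU tensm11.
Qed.

Let th := tensmh jA (@emb R K) : S \ox K -> mult (XS \ox K).
Let thn : nondeg th. Proof. exact: tensmhL_nondeg. Qed.
Local Notation J := (mext (tensmh jG (@emb R K))).

(** The conjugation takes place in the image of M(C_0(G) ⊗ K) under j_G, where W_lambda is the
    function r -> lambda_r, so it can be computed at each r. *)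
Lemma Vconj (n : mult K) (m : mult (CZ \ox K)) :
  fmult (fun r => U * (mstar (lamG (D := D) r) * n * lamG r) * U) m ->
  Vop * mext th (tensm 1 n) * mstar Vop = J m.
Proof.
move=> mE; have Jn := tensmhL_nondeg (D := D) K jGn.
have J1 (k : mult K) : J (tensm 1 k) = tensm 1 k by rewrite (mext_tensmL jGn) (mext1 jGn).
have -> : m = tensm 1 U * (mstar (wl (D := D)) * tensm 1 n * wl (D := D)) * tensm 1 U.
  apply: (fmult_uniq mE); apply: fmultM; last exact: fmult_tensm1.
  apply: fmultM; first exact: fmult_tensm1.
  apply: fmultM; last exact: wlP.
  by apply: fmultM; [exact: fmult_star (@wlP R G D)|exact: fmult_tensm1].
rewrite !(mextM Jn) (mext_star Jn) !J1 -/(Wl XS) (mext_tensmL jAn) (mext1 jAn) Vs /Vop.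
by rewrite !mulrA.
Qed.

Definition reg2 (y : Y) := Vop * mext th (Phi y) * mstar Vop.

Lemma reg2P : nondeg reg2 /\ forall m, mext reg2 m = Vop * mext th (mext (Phi (X := X) (S := S)) m) * mstar Vop.
Proof.
have [V1 V2] := V_unitary; have [pn _ _] := PhiP.
have [n h] := Ad_nondeg (mext_nondeg thn pn) V1 V2; split => // m.
by rewrite /reg2 h mext_comp.
Qed.

Lemma reg2_iA x : mext reg2 (iA Y x) = reg1 x.
Proof.
have [V1 V2] := V_unitary; have [_ pA _] := PhiP; have [_ h2] := reg2P; have [cn cA cG] := copP.
rewrite h2 pA; have [n h] := Ad_nondeg (mext_nondeg thn cn) V1 V2.
suff : (fun x => Vop * mext th (cop x) * mstar Vop) = reg1 by move=> /(congr1 (fun f => f x)).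
apply: (mhom_eqX n reg1_nondeg) => [a|d]; rewrite h mext_comp//.
  rewrite cA -(tensmh_comm _ jAn lamn) -/(Dl XS a) Dl_cov reg1_jA Vs /Vop.
  have [W1 W2] := Wl_unitary XS.
  rewrite !mulrA -(mulrA (tensm 1 U) (mstar _)) W1 mulr1 -(mulrA _ (mstar _) (Wl _)) W1 mulr1.
  by rewrite !tensmM !mul1r !mulr1 UU.
(* Conjugation by lambda_r turns d(t) into d(r t) and U inverts t. The result d(r t^-1) is the
   function found for the regular representation in [reg1_jG]. *)
rewrite cG; have [E [m [EE mE ->]]] := reg1_jG d; apply: Vconj.
move: mE; congr fmult; apply/funext => r.
have [T TE] : exists T : CZ, forall t, zs t T = zs (r * t)%g d.
  have [d1 d1E] := trV_ex d r; have [T TE] : exists T : CZ, forall t, zs t T = zs t^-1%g d1.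
    have [d2 d2E] := trV_ex d1 1%g; exists d2 => t; by rewrite d2E mul1g.
  by exists T => t; rewrite TE d1E invgK.
by rewrite (lam_M TE); symmetry; apply: UM => t; rewrite EE TE.
Qed.

Lemma reg2_iG s : mext reg2 (iG Y s) = tensm 1 (lamG s).
Proof.
have [_ _ pG] := PhiP; have [_ h2] := reg2P; rewrite h2 pG.
rewrite (Vconj (m := tensm 1 (lamG s))) ?(mext_tensmL jGn) ?(mext1 jGn)//.
rewrite (_ : (fun r => _) = fun=> lamG s); first exact: fmult_tensm1.
apply/funext => r; rewrite -(Ur s); congr (_ * _ * _); have lr := @lamG_rep R G D.
by rewrite -mulrA -lam_rho mulrA (urep_invl _ lr) mul1r.
Qed.

(** Both maps solve the universal problem of the double crossed product for the same covariant
    pair. *)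
Lemma reg_eq : regular (D := D) (Y := Y) = reg2.
Proof.
have [rn rA rG] := regP; have [n2 _] := reg2P.
have cov : act_covariant al reg1 (fun s => tensm (mone XS) (lamG (D := D) s) : mult (XS \ox K)).
  split; first exact: reg1_nondeg.
    have [_ iu _] := icov Y; have := urep_mext rn iu.
    by rewrite (_ : (fun s => _) = fun s => tensm (mone XS) (lamG s))//; apply/funext.
  move=> s x; have [_ _ h] := icov Y; rewrite -!rA h.
  by rewrite -[mmul _ _]/(iG Y s * iA Y x * mstar (iG Y s)) !(mextM rn) (mext_star rn) rG.
have [h [_ hu]] := iuniv Y cov.
have e1 : h = regular (D := D) (Y := Y) by apply: hu.
have e2 : h = reg2 by apply: hu; split => //; [exact: reg2_iA|exact: reg2_iG].
by rewrite -e1 e2.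
Qed.
End Conj.

Lemma jA_neq0 : jA b <> 0.
Proof.
move=> jb; have [U [Us UU UM Ur]] := @Uop R G D; have [k k0] := @K_nontrivial R G D.
have [y yE] := F_surj (tens b k); have e := reg_eq Us UU UM Ur.
have [pn _ _] := PhiP; have [ph _] := pn; have [rn _ _] := regP; have [rh _] := rn.
have r0 : regular (D := D) (Y := Y) y = regular (D := D) (Y := Y) 0.
  rewrite (islin0 (ismhom_lin rh)) e /reg2 yE (mext_emb (tensmhL_nondeg K jAn)).
  rewrite (proj2 (tensmhL K jAh)) jb (islin0 (tensm_linl (emb k))).
  by rewrite mulr0 mul0r.
apply: (tens_neq0 b0 k0); apply: emb_inj.
by rewrite -yE FE r0 -FE (islin0 (ismhom_lin ph)) (islin0 (@emb_lin R _)).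
Qed.
End Normal.

Lemma normal_inj (R : realType) (G : lcGroupType) (D : groupData R G) (X : crossedProducts D) (S : coaction D) (b : S) :
  normal_coaction (X := X) S -> jA (cox X S) b = 0 -> b = 0.
Proof.
move=> [F Fb FE] jb; apply: contrapT => b0; exact: (jA_neq0 Fb FE b0 jb).
Qed.

(** * Kernels under crossed product isomorphisms, and the functor *)

Section Iso.
Context {R : realType} {G : lcGroupType} {D : groupData R G} {X : crossedProducts D}.
Implicit Types S T : coaction D.

Lemma jG_cancel S (m : mult (cox X S)) : (forall d, m * jG (cox X S) d = 0) -> m = 0.
Proof.
move=> h; have [_ [_ jd] _] := jcov (cox X S); apply: (mult_eq_total jd) => _ [d [x ->]].
by rewrite -mactM h.
Qed.

(** The isomorphism is described only on products j_A(a) j_G(d), and j_A(a) vanishes if all of these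
    do. For the converse direction [emb_range_crossed] is essential: such a product is an element of
    the crossed product, to which injectivity can be applied. *)
Lemma crossed_iso_ker S T (f : comor S T) a : crossed_iso (X := X) f ->
  jA (cox X S) a = 0 <-> jA (cox X T) (f a) = 0.
Proof.
move=> [h [hh hE] [g gK Kg]]; have h0 := islin0 (ishom_lin hh).
have emb0 (B : cstarAlg R) := islin0 (@emb_lin R B).
split=> ja; apply: jG_cancel => d.
- have : emb 0 = mmul (jA (cox X S) a) (jG (cox X S) d) by rewrite ja emb0; symmetry; exact: mul0r.
  by move=> /hE; rewrite h0 emb0.
- have [x xE] : exists x, jA (cox X S) a * jG (cox X S) d = emb x.
    by apply/emb_range_crossed; apply: cspan_sub; exists a, d.
  have := hE _ _ _ (esym xE); rewrite ja xE => e.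
  have : h x = h 0 by apply: emb_inj; rewrite h0 emb0 e; exact: mul0r.
  by move=> /(can_inj gK) ->; rewrite emb0.
Qed.
End Iso.

Theorem proposition6p2 (R : realType) (G : lcGroupType) (D : groupData R G)
  (X : crossedProducts D) (Mx : maximalization X) (Nm : normalization X)
  (E : set (gdA D -> R[i]^o)) (hE : large_ideal E)
  (tauE : coaction D -> coaction D) (QE : forall S, comor S (tauE S))
  (hQ : is_quotientE E tauE QE) :
  is_decreasing_coaction_functor Mx Nm tauE QE.
Proof.
have Qs S : Defs.surj (QE S) by have [h _] := hQ S.
have jLam S x : jA (cox X (Nm S)) (Lam Nm S x) = 0 -> Lam Nm S x = 0.
  exact: normal_inj (Lam_normal Nm S).
have [Fm FmE] : exists Fm : forall S T, comor S T -> comor (tauE S) (tauE T),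
    forall S T (f : comor S T), Fm S T f \o QE S =1 QE T \o f.
  exists (fun S T f => projT1 (cid (induced_comor hQ f))) => S T f.
  by case: cid.
have [q qE] : exists q : forall S, comor (Mx S) (tauE S), forall S, q S =1 QE S \o qm Mx S.
  exists (fun S => projT1 (cid (comor_comp (qm Mx S) (QE S)))) => S.
  by case: cid.
split => //.
- move=> S T f x /(Q_ker hQ) ax; apply/(Q_ker hQ); exact: idealE_comor.
- move=> S x /(Q_ker hQ) ax; apply: jLam; apply: (idealE_ker hE); exact: idealE_comor.
exists Fm, q; split => //; split.
- have FmE' S T (f : comor S T) x : Fm S T f (QE S x) = QE T (f x) := FmE S T f x.
  split=> [S i ii y|S T U f g h hfg y].
    by have [x <-] := Qs S y; rewrite FmE' ii.
  by have [x <-] := Qs S y; rewrite /= !FmE' hfg.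
- move=> S T f x; have FmE' y : Fm S T f (QE S y) = QE T (f y) := FmE S T f y.
  rewrite /= !qE /= FmE'; congr (QE T _); exact: qm_nat.
- move=> S y; have [x <-] := Qs S y; have [z <-] := qm_surj Mx x.
  by exists z; rewrite qE.
(* Vanishing of q at x puts the image of x under [qm] into A_E, where j_A is zero. This is carried
   back along [qm] to j of x itself, and then forward along [Lam] to the normal coaction. *)
- move=> S x; rewrite /ker /= qE /= => /(Q_ker hQ)/(idealE_ker hE) h.
  apply: jLam; apply/(crossed_iso_ker x (Lam_iso Nm (Mx S))).
  exact/(crossed_iso_ker x (qm_iso Mx S)).
Qed.
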